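(* Let $\mathcal G$ be a connected noncompact metric graph with finitely many edges, let $k\in\mathbb N$, $2<q<4k+2$, $\mu>0$, and let $V\in L^2(\mathcal G)+L^\infty(\mathcal G)$ be real-valued. For $u\in H^k(\mathcal G)$ and $t\ge 0$ let $$E^{(k)}(u)=\frac12\int_{\mathcal G}|u^{(k)}|^2+V|u|^2\,\mathrm dx-\frac{\mu}{q}\int_{\mathcal G}|u|^q\,\mathrm dx,\qquad E^{(k)}_t=\inf_{u\in H^k(\mathcal G),\ \|u\|_{L^2}^2=t}E^{(k)}(u),\qquad E^{(k)}:=E^{(k)}_1 .$$ Assume that either (i) $V=V_2+V_\infty$ with $V_2\in L^2(\mathcal G)$, $V_\infty\in L^\infty(\mathcal G)$ and $V_\infty(x)\to 0$ as $x\to\infty$ on all edges of infinite length, or (ii) the operator $A=(-\Delta)^k+V$ admits a ground state, i.e. $\inf\sigma(A)$ is an eigenvalue of $A$. Then $t\mapsto E^{(k)}_t$ is strictly subadditive, i.e. $E^{(k)}_{t_1+t_2}<E^{(k)}_{t_1}+E^{(k)}_{t_2}$ for all $t_1,t_2>0$. If additionally $$E^{(k)}<\widetilde{E^{(k)}}:=\lim_{n\to\infty}\ \inf_{\substack{u\in H^k(\mathcal G),\ \|u\|_{L^2}^2=1\\ \operatorname{supp}u\subset\mathcal G\setminus K_n}}E^{(k)}(u),$$ then $E^{(k)}$ admits a minimizer, i.e. there is $u\in H^k(\mathcal G)$ with $\|u\|_{L^2}^2=1$ and $E^{(k)}(u)=E^{(k)}$.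
   Context: A metric graph $\mathcal G=(\mathcal V,\mathcal E)$ is obtained from edges $e\in\mathcal E$, each identified with an interval $I_e=[0,l_e]$ ($0<l_e<\infty$) or $I_e=[0,\infty)$ (if $l_e=\infty$; such an edge is called a ray), by gluing finite endpoints of the intervals at vertices $\mathsf v\in\mathcal V$ (each of degree at least one). Vertices at infinity (ends of rays) are not points of $\mathcal G$ and carry no conditions. $\mathcal G$ carries the shortest-path metric and Lebesgue measure. $u_e:=u|_e$, and $e\succ\mathsf v$ means that $e$ is adjacent to $\mathsf v$. $C(\mathcal G)$ is the set of continuous complex-valued functions; $L^p(\mathcal G)$ is the edgewise-defined $L^p$ space. Sobolev spaces: $\widetilde{H^k}(\mathcal G)=\{u\in C(\mathcal G): u_e\in H^k(I_e)\ \forall e,\ \sum_e\|u_e\|_{H^k(I_e)}^2<\infty\}$, and $$H^k(\mathcal G)=\Big\{u\in\widetilde{H^k}(\mathcal G): u^{(j)}\in C(\mathcal G)\ \forall j\le k-1\text{ even},\ \sum_{e\succ\mathsf v}\tfrac{\partial^j}{\partial\nu^j}u_e(\mathsf v)=0\ \forall j\le k-1\text{ odd},\ \forall\mathsf v\in\mathcal V\Big\},$$ where $\frac{\partial}{\partial\nu}$ at $\mathsf v$ is the derivative in the direction from $\mathsf v$ into the interior of the edge. The operator $A=(-\Delta)^k+V$ on $L^2(\mathcal G)$ acts edgewise as $(Au)_e=(-1)^ku_e^{(2k)}+Vu_e$ with domain $D(A)=H^{2k}(\mathcal G)$. $K$ denotes the (compact) core of $\mathcal G$, i.e. the complement of the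 rays, and $K_n=\{x\in\mathcal G:\operatorname{dist}(x,K)<n\}$. *)

(* Defs.v *)
From HB Require Import structures.
From mathcomp Require Import all_boot all_order all_algebra.
From mathcomp Require Import complex.
From mathcomp Require Import all_classical all_reals all_analysis.
Set Implicit Arguments.
Unset Strict Implicit.
Unset Printing Implicit Defensive.
Import Order.TTheory GRing.Theory Num.Theory.
Import numFieldNormedType.Exports.
Import ComplexField.Normc.

Local Open Scope classical_set_scope.
Local Open Scope ring_scope.

(* Function spaces on an interval I.  An L^p class is represented by a Borel
   function on R whose values outside I are irrelevant.  Complex-valued
   functions are handled through complex.Re, complex.Im and the real-valued
   modulus normc. *)
Section Interval.
Context {R : realType}.
Local Notation leb := (@lebesgue_measure R).
Implicit Types (I : set R) (f g : R -> R[i]).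

Definition real_L2 I (f : R -> R) : Prop :=
  measurable_fun I f /\ ((\int[leb]_(x in I) ((f x ^+ 2)%:E)) < +oo)%E.

Definition real_Linfty I (f : R -> R) : Prop :=
  measurable_fun I f /\
  exists M : R, {ae leb, forall x, I x -> `|f x| <= M}.

Definition normsq I f : \bar R :=
  (\int[leb]_(x in I) ((normc (f x) ^+ 2)%:E))%E.

Definition L2 I f : Prop :=
  [/\ measurable_fun I (fun x => complex.Re (f x)),
      measurable_fun I (fun x => complex.Im (f x))
    & (normsq I f < +oo)%E].

Definition cont_on I f : Prop :=
  {within I, continuous (fun x => complex.Re (f x))} /\
  {within I, continuous (fun x => complex.Im (f x))}.

Definition ae_eq_on I f g : Prop := {ae leb, forall x, I x -> f x = g x}.

Definition test_fun I (phi : R -> R) : Prop :=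
  [/\ forall x, derivable phi x 1,
      continuous (derive1 phi)
    & exists a b : R, `[a, b] `<=` I° /\ forall x, ~ `[a, b]%classic x -> phi x = 0].

(* g is a weak derivative of f on the interior of I *)
Definition is_wderiv I f g : Prop :=
  forall phi, test_fun I phi ->
    (\int[leb]_(x in I) (complex.Re (f x) * derive1 phi x)) =
      - (\int[leb]_(x in I) (complex.Re (g x) * phi x)) /\
    (\int[leb]_(x in I) (complex.Im (f x) * derive1 phi x)) =
      - (\int[leb]_(x in I) (complex.Im (g x) * phi x)).

Fixpoint Sobolev I (m : nat) f : Prop :=
  if m is m'.+1 then L2 I f /\ exists g, is_wderiv I f g /\ Sobolev I m' g
  else L2 I f.

(* A representative of the weak derivative class (unique up to null sets),
   and the constant function 0 if there is no weak derivative in L^2. *)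
Definition wderiv I f : R -> R[i] :=
  xget (fun=> 0) [set g | L2 I g /\ is_wderiv I f g].

Definition wderivn I (j : nat) f : R -> R[i] := iter j (wderiv I) f.

(* The continuous representative of the class of f on I, used to evaluate
   at points the derivatives u^(j), j < m, of a function u of H^m(I). *)
Definition cont_rep I f : R -> R[i] :=
  xget (fun=> 0) [set g | cont_on I g /\ ae_eq_on I g f].

End Interval.

(* A metric graph with finitely many edges.  The edge e is [0, len e] or
   [0, +oo[; its end 0 is glued at the vertex org e, and its other end, if
   finite, at the vertex given by trg e. *)
Record metric_graph (R : realType) := MetricGraph {
  vertex : finType;
  edge : finType;
  len : edge -> \bar R;
  org : edge -> vertex;
  trg : edge -> option vertex;
  len_gt0 : forall e, (0 < len e)%E;
  trg_ray : forall e, trg e = None <-> len e = +oo%E;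
  degree_gt0 : forall v, exists e, org e = v \/ trg e = Some v
}.

Section Graph.
Context {R : realType} (G : metric_graph R).
Local Notation leb := (@lebesgue_measure R).

Definition edge_dom (e : edge G) : set R := [set x | 0 <= x /\ (x%:E <= len e)%E].

(* The two ends of an edge are indexed by booleans: false is the end 0,
   true is the end len e, which is at no vertex if e is a ray. *)
Definition end_vertex (e : edge G) (b : bool) : option (vertex G) :=
  if b then trg e else Some (org e).

Definition end_coord (e : edge G) (b : bool) : R :=
  if b then fine (len e) else 0.

(* Points of G are given by an edge and a coordinate on it; the same point
   of G has several such names exactly when it is a vertex. *)
Definition gpoint : Type := (edge G * R)%type.
Definition is_point (p : gpoint) : Prop := edge_dom p.1 p.2.

Definition at_vertex (v : vertex G) (p : gpoint) : Prop :=
  exists b, end_vertex p.1 b = Some v /\ p.2 = end_coord p.1 b.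

(* graph_path p q s: some piecewise linear path of length s joins p to q in G *)
Inductive graph_path : gpoint -> gpoint -> R -> Prop :=
| graph_path_nil p : is_point p -> graph_path p p 0
| graph_path_move e x y q s : edge_dom e x -> edge_dom e y -> graph_path (e, y) q s ->
    graph_path (e, x) q (`|x - y| + s)
| graph_path_glue v p p' q s : at_vertex v p -> at_vertex v p' -> graph_path p' q s ->
    graph_path p q s.

Definition graph_dist (p q : gpoint) : \bar R :=
  ereal_inf [set s%:E | s in [set s | graph_path p q s]].

Definition connected_graph : Prop :=
  forall p q, is_point p -> is_point q -> exists s, graph_path p q s.

Definition open_in_graph (U : set gpoint) : Prop :=
  forall p, is_point p -> U p ->
  exists eps : R, 0 < eps /\
    forall q, is_point q -> (graph_dist p q < eps%:E)%E -> U q.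

Definition compact_graph : Prop :=
  forall F : set (set gpoint),
    (forall U, F U -> open_in_graph U) ->
    (forall p, is_point p -> exists U, F U /\ U p) ->
    exists F' : set (set gpoint), [/\ finite_set F', F' `<=` F
      & forall p, is_point p -> exists U, F' U /\ U p].

(* What remains after removing the open rays: the bounded edges and all the
   vertices.  Vertices are kept, so that the core is closed and nonempty. *)
Definition core : set gpoint :=
  [set p | is_point p /\ (len p.1 <> +oo%E \/ exists v, at_vertex v p)].

Definition core_nbhd (n : nat) : set gpoint :=
  [set p | is_point p /\
           (ereal_inf [set graph_dist p q | q in core] < (n%:R : R)%:E)%E].

(* Complex-valued functions on G, edge by edge.  The number of edges being
   finite, the sums over the edges of the squared norms are finite as soon
   as each term is. *)
Definition gfun : Type := edge G -> R -> R[i].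
Implicit Types u f : gfun.

Definition graph_normsq u : \bar R := (\sum_(e : edge G) normsq (edge_dom e) (u e))%E.

Definition graph_L2 u : Prop := forall e, L2 (edge_dom e) (u e).

Definition graph_ae_eq u f : Prop := forall e, ae_eq_on (edge_dom e) (u e) (f e).

Definition graph_cont u : Prop :=
  (forall e, cont_on (edge_dom e) (u e)) /\
  (forall p p' v, at_vertex v p -> at_vertex v p' -> u p.1 p.2 = u p'.1 p'.2).

Definition graph_deriv (j : nat) u : gfun :=
  fun e => wderivn (edge_dom e) j (u e).

Definition graph_deriv_cont (j : nat) u : gfun :=
  fun e => cont_rep (edge_dom e) (graph_deriv j u e).

(* The j-th derivative of u_e at the end b of e, in the direction from that
   end into the interior of e. *)
Definition inward_deriv (j : nat) u (e : edge G) (b : bool) : R[i] :=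
  (if b then -1 else 1) ^+ j * graph_deriv_cont j u e (end_coord e b).

Definition Sobolev_tilde (m : nat) u : Prop :=
  graph_cont u /\ forall e, Sobolev (edge_dom e) m (u e).

(* H^m(G).  A loop at v contributes both its ends to the Kirchhoff sum. *)
Definition graph_Sobolev (m : nat) u : Prop :=
  [/\ Sobolev_tilde m u,
      forall j, (j < m)%N -> ~~ odd j -> graph_cont (graph_deriv_cont j u)
    & forall j, (j < m)%N -> odd j -> forall v : vertex G,
        \sum_(c : edge G * bool | end_vertex c.1 c.2 == Some v)
          inward_deriv j u c.1 c.2 = 0].

Definition graph_support u : set gpoint :=
  [set p | is_point p /\ forall eps : R, 0 < eps ->
     exists q, [/\ is_point q, (graph_dist p q < eps%:E)%E & u q.1 q.2 <> 0]].

Section Energy.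
Variables (k : nat) (V : edge G -> R -> R).

(* A decomposition of the class of V into L^2 and L^oo classes can be taken
   pointwise, by changing the L^2 part on a null set. *)
Definition L2_plus_Linfty (V2 Vinf : edge G -> R -> R) : Prop :=
  forall e, [/\ real_L2 (edge_dom e) (V2 e), real_Linfty (edge_dom e) (Vinf e)
    & forall x, edge_dom e x -> V e x = V2 e x + Vinf e x].

Definition schrodinger u : gfun := fun e x =>
  (-1) ^+ k * graph_deriv (2 * k) u e x + ((V e x)%:C)%C * u e x.

Definition schrodinger_sub (z : R[i]) u : gfun := fun e x =>
  schrodinger u e x - z * u e x.

(* A - z is a bijection from D(A) = H^(2k)(G) onto L^2(G), with a bounded
   inverse; the estimate contains the injectivity. *)
Definition resolvent_set : set R[i] := [set z |
  (forall f, graph_L2 f -> exists u, graph_Sobolev (2 * k) u /\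
     graph_ae_eq (schrodinger_sub z u) f) /\
  (exists c : R, forall u, graph_Sobolev (2 * k) u ->
     (graph_normsq u <= c%:E * graph_normsq (schrodinger_sub z u))%E)].

Definition spectrum : set R[i] := ~` resolvent_set.

Definition eigenvalue_of_schrodinger (z : R[i]) : Prop :=
  exists u, [/\ graph_Sobolev (2 * k) u, graph_normsq u <> 0%E
    & graph_ae_eq (schrodinger u) (fun e x => z * u e x)].

(* A is self-adjoint, so its spectrum is a set of real numbers. *)
Definition has_ground_state : Prop :=
  exists lambda : R,
    ereal_inf [set x%:E | x in [set x : R | spectrum (x%:C)%C]] = lambda%:E /\
    eigenvalue_of_schrodinger (lambda%:C)%C.

Variables (mu q : R).

Definition energy u : R :=
  2^-1 * (\sum_(e : edge G) \int[leb]_(x in edge_dom e)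
            (normc (graph_deriv k u e x) ^+ 2 + V e x * normc (u e x) ^+ 2))
  - mu / q * (\sum_(e : edge G) \int[leb]_(x in edge_dom e) (normc (u e x) `^ q)).

Definition ground_energy (t : R) : \bar R :=
  ereal_inf [set (energy u)%:E | u in
    [set u | graph_Sobolev k u /\ graph_normsq u = t%:E]].

Definition energy_outside (n : nat) : \bar R :=
  ereal_inf [set (energy u)%:E | u in
    [set u | [/\ graph_Sobolev k u, graph_normsq u = 1%:E
               & graph_support u `<=` ~` core_nbhd n]]].

Definition energy_at_infinity : \bar R := limn energy_outside.

End Energy.
End Graph.

(* Main.v *)
(* Complex functions are split into real and imaginary parts, and u in H^m is replaced by the
   family of its derivatives, each one a primitive of the next (du Bois-Reymond).

   Subadditivity.  If the power term of nearly minimizing functions of mass t stays away from 0,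
   scaling such a function by a factor greater than 1 gives E_(c t) < c E_t for c > 1, hence strict
   subadditivity.  In case (i), a wide polynomial bump far out on a ray gives E_t < 0 since
   q < 4k + 2, whereas a function with small power term has nearly nonnegative energy because V
   is small in L^2 + L^oo far away.  In case (ii), the infimum of the quadratic form is in the
   spectrum, so the ground state minimizes it, and E_t lies strictly below its value.

   Minimizer.  A minimizing sequence is bounded in H^k by interpolation; along an ultrafilter it
   converges locally uniformly, with its derivatives of order less than k, and weakly, to some u.
   The energy splits (Brezis-Lieb) between u and the remainder, so strict subadditivity leaves
   only the masses 0 and 1 for u.  Mass 0 contradicts E < E~: cutting the sequence off near the
   core, by Hermite interpolation on the rays, changes the energy by o(1).  If u has mass 1, the
   remainder tends to 0 in L^2, hence so do its potential and power terms, and u is a minimizer. *)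
Require Import Defs.
From HB Require Import structures.
From mathcomp Require Import all_boot all_order all_algebra.
From mathcomp Require Import complex finmap.
From mathcomp Require Import all_classical all_reals all_analysis.
From mathcomp Require Import measurable_realfun.
From mathcomp Require Import ring lra zify.
Import Order.TTheory GRing.Theory Num.Theory.
Import numFieldNormedType.Exports.
Import ComplexField.Normc.
Local Open Scope classical_set_scope.
Local Open Scope ring_scope.
Set Implicit Arguments.
Unset Strict Implicit.
Unset Printing Implicit Defensive.

(** * Lebesgue integrals of real functions *)

(** The derivatives in the definition of H^m are chosen representatives of classes, so the analysis
    is done on a [jet], which carries explicit functions, and [represents] translates. All
    embeddings come from one interpolation inequality with a free length scale [h]: a small [h]
    makes the top-order term relatively small, and an [h] that depends on the value of the function
    gives the subcritical bound, one of the two places where q < 4k + 2 enters. The ultrafilter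
    yields limits at all points at once, in place of a diagonal extraction, and the weak limit comes
    from minimizing over convex sets, by completeness of L^2 and the parallelogram law. The two
    cases of the hypothesis meet in a single property, [concentrated], after which only the L^2 +
    L^oo splitting of the potential is used. In case (ii) the spectrum is defined through
    resolvents, so Green's formula on the graph, with the vertex conditions cancelling the boundary
    terms, has to link the operator to its quadratic form. *)

Section Integral.
Context {R : realType}.
Local Notation leb := (@lebesgue_measure R).
Implicit Types (D E I : set R) (f g h : R -> R) (a b c x y z : R).

Lemma aeS (P Q : R -> Prop) : (forall x, P x -> Q x) ->
  {ae leb, forall x, P x} -> {ae leb, forall x, Q x}.
Proof. exact: (@filterS _ _ (ae_filter_ringOfSetsType leb) P Q). Qed.

Lemma aeS2 (P Q S : R -> Prop) : (forall x, P x -> Q x -> S x) ->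
  {ae leb, forall x, P x} -> {ae leb, forall x, Q x} -> {ae leb, forall x, S x}.
Proof. exact: (@filterS2 _ _ (ae_filter_ringOfSetsType leb) P Q S). Qed.

Definition Rintegrable D f : Prop := leb.-integrable D (EFin \o f).

Lemma Rintegrable_measurable D f : Rintegrable D f -> measurable_fun D f.
Proof. by move=> /(measurable_int leb) /measurable_EFinP. Qed.

Lemma eq_Rint D f g : (forall x, D x -> f x = g x) ->
  \int[leb]_(x in D) f x = \int[leb]_(x in D) g x.
Proof. by move=> fg; apply: eq_Rintegral => x /set_mem Dx; rewrite fg. Qed.

Section Fixed_domain.
Variable D : set R.
Hypothesis mD : measurable D.

Lemma eq_Rintegrable f g : (forall x, D x -> f x = g x) ->
  Rintegrable D f -> Rintegrable D g.
Proof. by move=> fg; apply: eq_integrable => // x /set_mem Dx /=; rewrite fg. Qed.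

Lemma Rintegrable_le f g : measurable_fun D f ->
  (forall x, D x -> `|f x| <= g x) -> Rintegrable D g -> Rintegrable D f.
Proof.
move=> mf fg; apply: le_integrable => //; first exact/measurable_EFinP.
move=> x Dx /=; rewrite lee_fin; apply: (le_trans (fg x Dx)).
exact: ler_norm.
Qed.

Lemma RintegrableD f g : Rintegrable D f -> Rintegrable D g ->
  Rintegrable D (fun x => f x + g x).
Proof. by move=> ? ?; apply: (@integrableD _ _ _ leb D mD (EFin \o f) (EFin \o g)). Qed.

Lemma RintegrableB f g : Rintegrable D f -> Rintegrable D g ->
  Rintegrable D (fun x => f x - g x).
Proof. by move=> ? ?; apply: (@integrableB _ _ _ leb D mD (EFin \o f) (EFin \o g)). Qed.

Lemma RintegrableZ c f : Rintegrable D f -> Rintegrable D (fun x => c * f x).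
Proof. by move=> ?; apply: (@integrableZl _ _ _ leb D mD c (EFin \o f)). Qed.

Lemma Rintegrable_norm f : Rintegrable D f -> Rintegrable D (fun x => `|f x|).
Proof. by move=> ?; apply: (@integrable_norm _ _ _ leb D f). Qed.

Lemma RintD f g : Rintegrable D f -> Rintegrable D g ->
  \int[leb]_(x in D) (f x + g x) = \int[leb]_(x in D) f x + \int[leb]_(x in D) g x.
Proof. exact: RintegralD. Qed.

Lemma RintB f g : Rintegrable D f -> Rintegrable D g ->
  \int[leb]_(x in D) (f x - g x) = \int[leb]_(x in D) f x - \int[leb]_(x in D) g x.
Proof. exact: RintegralB. Qed.

Lemma RintZ c f : Rintegrable D f ->
  \int[leb]_(x in D) (c * f x) = c * \int[leb]_(x in D) f x.
Proof. by move=> ?; apply: RintegralZl. Qed.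

Lemma Rint_le f g : Rintegrable D f -> Rintegrable D g ->
  (forall x, D x -> f x <= g x) ->
  \int[leb]_(x in D) f x <= \int[leb]_(x in D) g x.
Proof. exact: le_Rintegral. Qed.

Lemma Rint_abs f : Rintegrable D f ->
  `|\int[leb]_(x in D) f x| <= \int[leb]_(x in D) `|f x|.
Proof. exact: le_normr_Rintegral. Qed.

Lemma Rint_abs_le f g : Rintegrable D f -> Rintegrable D g ->
  (forall x, D x -> `|f x| <= g x) ->
  `|\int[leb]_(x in D) f x| <= \int[leb]_(x in D) g x.
Proof.
move=> sf sg fg; apply: (le_trans (Rint_abs sf)).
by apply: Rint_le => //; exact: Rintegrable_norm.
Qed.

Lemma integral_Rintegrable f : Rintegrable D f ->
  (\int[leb]_(x in D) (f x)%:E)%E = (\int[leb]_(x in D) f x)%:E.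
Proof. by move=> sf; rewrite /Rintegral fineK//; exact: integrable_fin_num. Qed.

Lemma RintegrableS E f : measurable E -> E `<=` D -> Rintegrable D f -> Rintegrable E f.
Proof. by move=> mE ED sf; apply: (@integrableS _ _ _ leb D E (EFin \o f)). Qed.

Lemma Rint_subset E f : measurable E -> E `<=` D -> Rintegrable D f ->
  (forall x, D x -> 0 <= f x) ->
  \int[leb]_(x in E) f x <= \int[leb]_(x in D) f x.
Proof.
move=> mE ED sf f0; have sE : Rintegrable E f by apply: (@integrableS _ _ _ leb D E (EFin \o f)).
rewrite -lee_fin /Rintegral !fineK; [|exact: integrable_fin_num..].
apply: ge0_subset_integral => //.
by apply/measurable_EFinP; exact: Rintegrable_measurable.
Qed.

Lemma Rintegrable_bounded f B : (leb D < +oo)%E -> measurable_fun D f ->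
  (forall x, D x -> `|f x| <= B) -> Rintegrable D f.
Proof.
move=> Dfin mf fB; apply: measurable_bounded_integrable => //.
exists B; split; first exact: num_real.
by move=> t Bt x Dx /=; apply: (le_trans (fB x Dx)); exact: ltW.
Qed.

Lemma ae_Rintegrable f g : measurable_fun D g ->
  {ae leb, forall x, D x -> f x = g x} -> Rintegrable D f -> Rintegrable D g.
Proof.
move=> mg fg /integrableP[mf foo]; apply/integrableP; split.
  exact/measurable_EFinP.
rewrite -(_ : (\int[leb]_(x in D) `|(EFin \o f) x| = \int[leb]_(x in D) `|(EFin \o g) x|)%E)//.
apply: ae_eq_integral => //.
- exact: measurableT_comp.
- by apply: measurableT_comp => //; exact/measurable_EFinP.
by apply: aeS fg => x h Dx /=; rewrite h.
Qed.

Lemma ae_Rint f g : measurable_fun D f -> measurable_fun D g ->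
  {ae leb, forall x, D x -> f x = g x} ->
  \int[leb]_(x in D) f x = \int[leb]_(x in D) g x.
Proof.
move=> mf mg fg; congr fine; apply: ae_eq_integral => //; try exact/measurable_EFinP.
by apply: aeS fg => x h Dx /=; rewrite h.
Qed.

End Fixed_domain.

Lemma measurable_itvcc a b : measurable (`[a, b]%classic : set R).
Proof. exact: measurable_itv. Qed.
#[local] Hint Resolve measurable_itvcc : core.

Lemma leb_itvcc a b : a <= b -> leb `[a, b]%classic = (b - a)%:E.
Proof.
by move=> ab; rewrite lebesgue_measure_itv/= lte_fin; case: ltgtP ab => // -> _; rewrite subrr.
Qed.

Lemma leb_itvcc_fin a b : (leb `[a, b]%classic < +oo)%E.
Proof. by rewrite lebesgue_measure_itv/=; case: ifP => _; rewrite ltry. Qed.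

Lemma Rint_cst a b c : a <= b -> \int[leb]_(x in `[a, b]) c = c * (b - a).
Proof.
move=> ab; rewrite Rintegral_cst// -[(b - a)%R]/(fine (b - a)%:E) -leb_itvcc//.
Qed.

Lemma Rintegrable_cst a b c : Rintegrable `[a, b] (fun=> c).
Proof. by apply: (@Rintegrable_bounded _ _ _ `|c|); [|exact: leb_itvcc_fin|exact: measurable_cst|]. Qed.

Lemma Rintegrable_continuous a b f : {within `[a, b], continuous f} -> Rintegrable `[a, b] f.
Proof. by apply: continuous_compact_integrable; exact: segment_compact. Qed.

Lemma Rint_itv_nil a f : \int[leb]_(x in `[a, a]) f x = 0.
Proof. by rewrite set_itv1 Rintegral_set1. Qed.

Lemma Rint_itv_cat a b c f : a <= b -> b <= c -> Rintegrable `[a, c] f ->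
  \int[leb]_(x in `[a, c]) f x =
  \int[leb]_(x in `[a, b]) f x + \int[leb]_(x in `[b, c]) f x.
Proof.
move=> ab bc sf; apply/eqP; rewrite addrC -subr_eq; apply/eqP.
have := @Rintegral_itvB _ f (BLeft a) (BRight c) b sf.
rewrite !bnd_simp => /(_ ab bc) ->.
apply: Rintegral_itv_obnd_cbnd.
apply: (@RintegrableS `[a, c]%classic) => //.
by apply: subset_itvr; rewrite bnd_simp.
Qed.

Lemma subset_itvcc a b c d : a <= c -> d <= b -> `[c, d]%classic `<=` (`[a, b]%classic : set R).
Proof. by move=> ac db; apply: subset_itv; rewrite bnd_simp. Qed.

Lemma Rintegrable_itv_sub a b c d f : Rintegrable `[a, b] f -> a <= c -> d <= b -> Rintegrable `[c, d] f.
Proof. by move=> sf ac db; apply: RintegrableS sf => //; exact: subset_itvcc. Qed.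

End Integral.
#[global] Hint Resolve measurable_itvcc : core.

(** * Real L^2 spaces and the Cauchy-Schwarz inequality *)

Section Square_integrable.
Context {R : realType}.
Local Notation leb := (@lebesgue_measure R).
Implicit Types (D E : set R) (f g h : R -> R) (a b c x y z : R).

Definition ip D f g : R := \int[leb]_(x in D) (f x * g x).
Definition nsq D f : R := \int[leb]_(x in D) (f x ^+ 2).

(** The sign of the discriminant. It is kept free of integrals because it gives Cauchy-Schwarz three
    times: for [ip], for [bil] and for the shifted form of the operator. *)
Lemma quadratic_ge0 (A B C : R) : 0 <= C ->
  (forall t, 0 <= A + 2 * t * B + t ^+ 2 * C) -> B ^+ 2 <= A * C.
Proof.
move=> C0 h; have [C00|Cn0] := eqVneq C 0.
  have [->|Bn0] := eqVneq B 0; first by rewrite C00 mulr0 expr0n.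
  have := h (- (A + 1) / (2 * B)); rewrite C00 mulr0 addr0.
  have -> : 2 * (- (A + 1) / (2 * B)) * B = - (A + 1).
    by field; rewrite Bn0.
  by lra.
have {}C0 : 0 < C by rewrite lt_neqAle eq_sym Cn0.
have := h (- B / C).
have -> : A + 2 * (- B / C) * B + (- B / C) ^+ 2 * C = (A * C - B ^+ 2) / C.
  by field.
by rewrite pmulr_lge0 ?invr_gt0// subr_ge0.
Qed.

Lemma nsq_ge0 D f : 0 <= nsq D f.
Proof. by apply: Rintegral_ge0 => x _; exact: sqr_ge0. Qed.
Hint Resolve nsq_ge0 : core.

Lemma ipC D f g : ip D f g = ip D g f.
Proof. by apply: eq_Rint => x _; rewrite mulrC. Qed.

Lemma ip_nsq D f : ip D f f = nsq D f.
Proof. by apply: eq_Rint => x _; rewrite expr2. Qed.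

Lemma eq_nsq D f g : (forall x, D x -> f x = g x) -> nsq D f = nsq D g.
Proof. by move=> fg; apply: eq_Rint => x /fg ->. Qed.

Section Fixed_domain.
Variable D : set R.
Hypothesis mD : measurable D.

Lemma real_L2P f :
  real_L2 D f <-> measurable_fun D f /\ Rintegrable D (fun x => f x ^+ 2).
Proof.
split=> -[mf h]; split=> //.
  apply/integrableP; split; first by apply/measurable_EFinP/measurable_funX.
  by under eq_integral do rewrite /= ger0_norm ?sqr_ge0//.
by move: h => /(integral_Rintegrable mD) ->; rewrite ltry.
Qed.

Lemma L2_measurable f : real_L2 D f -> measurable_fun D f.
Proof. by case. Qed.

Lemma L2_sqr f : real_L2 D f -> Rintegrable D (fun x => f x ^+ 2).
Proof. by move=> /real_L2P[]. Qed.

Lemma L2_le f g c : measurable_fun D f ->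
  (forall x, D x -> `|f x| <= c * `|g x|) -> real_L2 D g -> real_L2 D f.
Proof.
move=> mf fg /real_L2P[mg sg]; apply/real_L2P; split => //.
apply: (Rintegrable_le mD _ _ (RintegrableZ mD (c ^+ 2) sg)); first exact: measurable_funX.
move=> x Dx; rewrite -(real_normK (num_real (g x))) normrX -exprMn.
have h := fg x Dx.
by rewrite lerXn2r// nnegrE ?(le_trans _ h).
Qed.

Lemma Rintegrable_mul f g : real_L2 D f -> real_L2 D g -> Rintegrable D (fun x => f x * g x).
Proof.
move=> /real_L2P[mf sf] /real_L2P[mg sg].
apply: (Rintegrable_le mD _ _ (RintegrableD mD sf sg)); first exact: measurable_funM.
move=> x _; rewrite normrM -(real_normK (num_real (f x))) -(real_normK (num_real (g x))).
have := sqr_ge0 (`|f x| - `|g x|); have := sqr_ge0 (`|f x| + `|g x|).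
by rewrite sqrrB sqrrD; lra.
Qed.

Lemma L2Z c f : real_L2 D f -> real_L2 D (fun x => c * f x).
Proof.
move=> [mf hf]; apply: (@L2_le _ f `|c|) => //; first exact: measurable_funM.
by move=> x _; rewrite normrM.
Qed.

Lemma L2D f g : real_L2 D f -> real_L2 D g -> real_L2 D (fun x => f x + g x).
Proof.
move=> Lf Lg; have /real_L2P[mf sf] := Lf; have /real_L2P[mg sg] := Lg.
apply/real_L2P; split; first exact: measurable_funD.
have := RintegrableD mD (RintegrableD mD sf sg) (RintegrableZ mD 2 (Rintegrable_mul Lf Lg)).
by apply: (eq_Rintegrable mD) => x _; rewrite sqrrD; ring.
Qed.

Lemma L2B f g : real_L2 D f -> real_L2 D g -> real_L2 D (fun x => f x - g x).
Proof.
move=> Lf Lg; have := L2D Lf (L2Z (-1) Lg).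
by under eq_fun do rewrite mulN1r.
Qed.

Lemma L2_0 : real_L2 D (fun=> 0).
Proof.
split; first exact: measurable_cst.
by under eq_integral do rewrite expr0n/=; rewrite integral0 ltry.
Qed.

Lemma L2_norm f : real_L2 D f -> real_L2 D (fun x => `|f x|).
Proof.
move=> Lf; apply: (@L2_le _ f 1) => //; last by move=> x _; rewrite normr_id mul1r.
by have [mf _] := Lf; apply: measurableT_comp => //; exact: normr_measurable.
Qed.

Lemma L2S E f : measurable E -> E `<=` D -> real_L2 D f -> real_L2 E f.
Proof.
move=> mE ED /real_L2P[mf sf]; split; first exact: measurable_funS mf.
rewrite (integral_Rintegrable mE) ?ltry//; exact: (RintegrableS mD).
Qed.

Lemma eq_L2 f g : (forall x, D x -> f x = g x) -> real_L2 D f -> real_L2 D g.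
Proof.
move=> fg Lf; apply: (@L2_le _ f 1) => //; last by move=> x /fg ->; rewrite mul1r.
by have [mf _] := Lf; apply: eq_measurable_fun mf => x /set_mem /fg.
Qed.

Lemma nsqZ c f : real_L2 D f -> nsq D (fun x => c * f x) = c ^+ 2 * nsq D f.
Proof.
move=> /L2_sqr sf; rewrite /nsq -(RintZ mD)//.
by apply: eq_Rint => x _; rewrite exprMn.
Qed.

Lemma nsqD f g : real_L2 D f -> real_L2 D g ->
  nsq D (fun x => f x + g x) = nsq D f + 2 * ip D f g + nsq D g.
Proof.
move=> Lf Lg; have sf := L2_sqr Lf; have sg := L2_sqr Lg; have sfg := Rintegrable_mul Lf Lg.
rewrite /nsq /ip -(RintZ mD)// -!(RintD mD)//; last exact: RintegrableZ.
- by apply: eq_Rint => x _; rewrite sqrrD; ring.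
- by apply: RintegrableD => //; exact: RintegrableZ.
Qed.

Lemma ipDl f g h : real_L2 D f -> real_L2 D g -> real_L2 D h ->
  ip D (fun x => f x + g x) h = ip D f h + ip D g h.
Proof.
move=> Lf Lg Lh; rewrite /ip -(RintD mD) ?Rintegrable_mul//.
- by apply: eq_Rint => x _; rewrite mulrDl.
- exact: Rintegrable_mul.
- exact: Rintegrable_mul.
Qed.

Lemma ipZl c f h : real_L2 D f -> real_L2 D h ->
  ip D (fun x => c * f x) h = c * ip D f h.
Proof.
move=> Lf Lh; rewrite /ip -(RintZ mD); last exact: Rintegrable_mul.
by apply: eq_Rint => x _; rewrite mulrA.
Qed.

Lemma nsqB f g : real_L2 D f -> real_L2 D g ->
  nsq D (fun x => f x - g x) = nsq D f - 2 * ip D f g + nsq D g.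
Proof.
move=> Lf Lg; rewrite (_ : nsq _ _ = nsq D (fun x => f x + (-1) * g x)); last first.
  by apply: eq_nsq => x _; rewrite mulN1r.
rewrite nsqD ?nsqZ//; last exact: L2Z.
by rewrite (ipC D f) ipZl// (ipC D g); ring.
Qed.

Lemma cauchy_schwarz f g : real_L2 D f -> real_L2 D g ->
  ip D f g ^+ 2 <= nsq D f * nsq D g.
Proof.
move=> Lf Lg; apply: quadratic_ge0 => // t.
rewrite -(mulrA 2) -nsqZ// (ipC D f g) -(ipZl t)// ipC -nsqD//; exact: L2Z.
Qed.

Lemma nsqD_le f g : real_L2 D f -> real_L2 D g ->
  nsq D (fun x => f x + g x) <= 2 * nsq D f + 2 * nsq D g.
Proof.
move=> Lf Lg; have h := nsq_ge0 D (fun x => f x - g x).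
by rewrite nsqD//; rewrite nsqB// in h; lra.
Qed.

Lemma nsqS E f : measurable E -> E `<=` D -> real_L2 D f -> nsq E f <= nsq D f.
Proof.
move=> mE ED Lf; apply: Rint_subset => //; first exact: L2_sqr.
by move=> x _; exact: sqr_ge0.
Qed.

Lemma nsq_le f g : real_L2 D f -> real_L2 D g ->
  (forall x, D x -> `|f x| <= `|g x|) -> nsq D f <= nsq D g.
Proof.
move=> Lf Lg fg; apply: Rint_le => //; [exact: L2_sqr..|].
move=> x Dx; rewrite -(real_normK (num_real (f x))) -(real_normK (num_real (g x))).
by rewrite lerXn2r// ?nnegrE// fg.
Qed.

End Fixed_domain.

Lemma L2_continuous a b f : {within `[a, b], continuous f} -> real_L2 `[a, b] f.
Proof.
move=> cf; apply/real_L2P => //; split.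
  exact: subspace_continuous_measurable_fun.
have cff : {within `[a, b], continuous (f \* f)}.
  by move=> x; apply: continuousM; exact: cf.
by apply: (eq_Rintegrable _ _ (Rintegrable_continuous cff)) => // x _; rewrite expr2.
Qed.

Lemma L2_cst a b c : real_L2 `[a, b] (fun=> c).
Proof. by apply: L2_continuous => x; exact: cst_continuous. Qed.

Lemma nsq_cst a b c : a <= b -> nsq `[a, b] (fun=> c) = c ^+ 2 * (b - a).
Proof. by move=> ab; rewrite /nsq Rint_cst. Qed.

Lemma L2_Rintegrable a b f : real_L2 `[a, b] f -> Rintegrable `[a, b] f.
Proof.
move=> Lf; have := Rintegrable_mul (@measurable_itvcc _ a b) Lf (L2_cst a b 1).
by apply: eq_Rintegrable => // x _; rewrite mulr1.
Qed.

Lemma L2_sub a b c d f : real_L2 `[a, b] f -> a <= c -> d <= b -> real_L2 `[c, d] f.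
Proof. by move=> Lf ac db; apply: L2S Lf => //; exact: subset_itvcc. Qed.

Lemma sqr_Rint_le a b f : a <= b -> real_L2 `[a, b] f ->
  (\int[leb]_(x in `[a, b]) f x) ^+ 2 <= (b - a) * nsq `[a, b] f.
Proof.
move=> ab Lf; have := cauchy_schwarz (@measurable_itvcc _ a b) (L2_cst a b 1) Lf.
rewrite nsq_cst// expr1n mul1r; congr (_ ^+ 2 <= _).
by apply: eq_Rint => x _; rewrite mul1r.
Qed.

Lemma nsq_cat a b c f : a <= b -> b <= c -> real_L2 `[a, c] f ->
  nsq `[a, c] f = nsq `[a, b] f + nsq `[b, c] f.
Proof. by move=> ab bc Lf; apply: Rint_itv_cat => //; exact: L2_sqr. Qed.

End Square_integrable.
#[global] Hint Resolve nsq_ge0 : core.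

(** * Absolutely continuous functions and their product rule *)

Section Primitive.
Context {R : realType}.
Local Notation leb := (@lebesgue_measure R).
Implicit Types (f g h F H : R -> R) (a b c x y z : R).

(** Absolute continuity in integrated form: no pointwise derivative is mentioned, and changing [f]
    on a null set changes nothing. *)
Definition primitive a b F f : Prop := forall x y, a <= x -> x <= y -> y <= b ->
  F y - F x = \int[leb]_(t in `[x, y]) f t.

Lemma primitive_sub a b c d F f : a <= c -> d <= b ->
  primitive a b F f -> primitive c d F f.
Proof. by move=> ac db h x y cx xy yd; apply: h => //; lra. Qed.

Lemma Rint_primitive a b f : Rintegrable `[a, b] f ->
  primitive a b (fun x => \int[leb]_(t in `[a, x]) f t) f.
Proof.
move=> sf x y ax xy yb; rewrite (@Rint_itv_cat _ a x y)//; first by ring.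
by apply: (Rintegrable_itv_sub sf).
Qed.

Lemma primitive_continuous a b F f : Rintegrable `[a, b] f -> primitive a b F f ->
  {within `[a, b], continuous F}.
Proof.
move=> sf hF; have [ab|ba] := leP a b; last first.
  by rewrite set_itv_ge ?bnd_simp -?ltNge//; exact: continuous_subspace0.
have : {within `[a, b], continuous (fun x => F a + \int[leb]_(t in `[a, x]) f t)}.
  move=> x; apply: (@continuousD _ R^o (subspace `[a, b]) (fun=> F a)).
    exact: cst_continuous.
  exact: (parameterized_integral_continuous ab sf).
apply: subspace_eq_continuous => x /set_mem /=; rewrite in_itv/= => /andP[ax xb].
by rewrite /from_subspace/= -hF//; ring.
Qed.

Lemma primitive_L2 a b F f : Rintegrable `[a, b] f -> primitive a b F f ->
  real_L2 `[a, b] F.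
Proof. by move=> sf hF; apply: L2_continuous; exact: primitive_continuous hF. Qed.

Lemma primitive_dist a b F f x y : Rintegrable `[a, b] f -> primitive a b F f ->
  `[a, b]%classic x -> `[a, b]%classic y ->
  `|F x - F y| <= \int[leb]_(t in `[a, b]) `|f t|.
Proof.
move=> sf hF /=; rewrite !in_itv/= => /andP[ax xb] /andP[ay yb].
wlog xy : x y ax xb ay yb / y <= x.
  move=> h; have [xy|/ltW xy] := leP y x; first exact: h.
  by rewrite distrC; exact: h.
rewrite hF//; apply: (le_trans (Rint_abs _ _)) => //; first by apply: (Rintegrable_itv_sub sf).
apply: Rint_subset => //; first exact: subset_itvcc.
exact: Rintegrable_norm.
Qed.

Lemma primitive_bounded a b F f : Rintegrable `[a, b] f -> primitive a b F f ->
  exists B, forall x, `[a, b]%classic x -> `|F x| <= B.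
Proof.
move=> sf hF; exists (`|F a| + \int[leb]_(t in `[a, b]) `|f t|) => x xab.
have aab : `[a, b]%classic a.
  by move: xab; rewrite /= !in_itv/= => /andP[ax xb]; rewrite lexx (le_trans ax).
have := primitive_dist sf hF xab aab.
by have := ler_normD (F x - F a) (F a); rewrite subrK; lra.
Qed.

Lemma Rintegrable_mul_primitive a b F f g : Rintegrable `[a, b] f -> primitive a b F f ->
  Rintegrable `[a, b] g -> Rintegrable `[a, b] (fun x => g x * F x).
Proof.
move=> sf hF sg; have [B hB] := primitive_bounded sf hF.
have /= := RintegrableZ (@measurable_itvcc R a b) `|B| (Rintegrable_norm sg).
apply: Rintegrable_le => //.
  apply: measurable_funM; first exact: Rintegrable_measurable.
  by apply: subspace_continuous_measurable_fun => //; exact: primitive_continuous hF.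
move=> x xab; rewrite normrM mulrC ler_wpM2r//.
by apply: (le_trans (hB x xab)); exact: ler_norm.
Qed.

(* Bisecting the variation [P] at its middle value halves the quadratic bound. *)
Lemma quadratic_bound_constant a b H (P : R -> R) :
  {within `[a, b], continuous P} ->
  (forall x y, a <= x -> x <= y -> y <= b ->
     `|H y - H x| <= (P y - P x) ^+ 2) ->
  forall x y, a <= x -> x <= y -> y <= b -> P x <= P y -> H y = H x.
Proof.
move=> cP h.
have halve n : forall x y, a <= x -> x <= y -> y <= b -> P x <= P y ->
    `|H y - H x| * 2 ^+ n <= (P y - P x) ^+ 2.
  elim: n => [|n IH] x y ax xy yb Pxy; first by rewrite mulr1 h.
  have cxy : {within `[x, y], continuous P}.
    by apply: continuous_subspaceW cP; exact: subset_itvcc.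
  have [] := @IVT R P x y ((P x + P y) / 2) xy cxy.
    by rewrite min_l// max_r//; lra.
  move=> z; rewrite in_itv/= => /andP[xz zy] Pz.
  have := IH x z ax xz (le_trans zy yb); have := IH z y (le_trans ax xz) zy yb.
  rewrite Pz => h1 h2.
  have {}h1 := h1 ltac:(lra); have {}h2 := h2 ltac:(lra).
  have tri : `|H y - H x| <= `|H y - H z| + `|H z - H x|.
    by rewrite (_ : H y - H x = (H y - H z) + (H z - H x)) ?ler_normD//; ring.
  rewrite exprS mulrCA; apply: (@le_trans _ _ (2 * ((`|H y - H z| + `|H z - H x|) * 2 ^+ n))).
    by rewrite ler_pM2l// ler_wpM2r ?exprn_ge0.
  have e : (P y - P x) ^+ 2 = 2 * ((P y - (P x + P y) / 2) ^+ 2 + ((P x + P y) / 2 - P x) ^+ 2).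
    by field.
  by rewrite e ler_pM2l// mulrDl lerD.
move=> x y ax xy yb Pxy; apply/eqP; rewrite -subr_eq0 -normr_le0; apply/ler_addgt0Pr => e e0.
rewrite add0r; set c := `|_|; set K := (P y - P x) ^+ 2.
have [n hn] : exists n : nat, K / e < n%:R.
  by exists (Num.bound (K / e)); apply: archi_boundP; rewrite divr_ge0 ?sqr_ge0// ltW.
have hn2 : (n%:R : R) <= 2 ^+ n by rewrite -natrX ler_nat ltnW// ltn_expl.
have := halve n x y ax xy yb Pxy; rewrite -/c -/K => hK.
rewrite -(@ler_pM2r _ (2 ^+ n)) ?exprn_gt0//; apply: (le_trans hK).
rewrite ltr_pdivrMr// in hn.
have : n%:R * e <= 2 ^+ n * e by rewrite ler_pM2r.
by rewrite mulrC (mulrC e); lra.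
Qed.

(** The product minus its candidate primitive [L] has increments at most the square of those of [P],
    the total variation of both factors, so it is constant by [quadratic_bound_constant]. *)
Lemma primitive_mul a b F f G g : Rintegrable `[a, b] f -> Rintegrable `[a, b] g ->
  primitive a b F f -> primitive a b G g ->
  primitive a b (fun x => F x * G x) (fun x => f x * G x + F x * g x).
Proof.
move=> sf sg hF hG x0 y0 ax0 xy0 yb0.
have sfG : Rintegrable `[a, b] (fun x => f x * G x) := Rintegrable_mul_primitive sg hG sf.
have sFg : Rintegrable `[a, b] (fun x => F x * g x).
  by apply: (eq_Rintegrable _ _ (Rintegrable_mul_primitive sf hF sg)) => // x _; rewrite mulrC.
have sfg : Rintegrable `[a, b] (fun x => `|f x| + `|g x|).
  by apply: RintegrableD => //; exact: Rintegrable_norm.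
pose P x := \int[leb]_(t in `[a, x]) (`|f t| + `|g t|).
pose L x := \int[leb]_(t in `[a, x]) (f t * G t + F t * g t).
have hP : primitive a b P _ := Rint_primitive sfg.
have hL : primitive a b L _ := Rint_primitive (RintegrableD (@measurable_itvcc R a b) sfG sFg).
suff : F y0 * G y0 - L y0 = F x0 * G x0 - L x0.
  by have := hL x0 y0 ax0 xy0 yb0; lra.
have Pmono x y : a <= x -> x <= y -> y <= b -> P x <= P y.
  move=> ax xy yb; rewrite -subr_ge0 hP//; apply: Rintegral_ge0 => t _.
  by rewrite addr_ge0.
apply: (@quadratic_bound_constant a b (fun x => F x * G x - L x) P) => //; last exact: Pmono.
  exact: primitive_continuous hP.
move=> x y ax xy yb.
have mxy := @measurable_itvcc R x y.
have sub h : Rintegrable `[a, b] h -> Rintegrable `[x, y] h by move=> sh; apply: (Rintegrable_itv_sub sh).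
have s1 : Rintegrable `[x, y] (fun t => f t * G y + F x * g t).
  apply: RintegrableD => //; last by apply: RintegrableZ => //; exact: sub.
  by apply: (eq_Rintegrable _ _ (RintegrableZ mxy (G y) (sub _ sf))) => // t _; rewrite mulrC.
(* The increment of the product over [x, y] is the integral of f G(y) + F(x) g, so what remains
   carries increments of [G] and [F], each at most P(y) - P(x). *)
have -> : F y * G y - L y - (F x * G x - L x) =
    \int[leb]_(t in `[x, y]) (f t * (G y - G t) + g t * (F x - F t)).
  transitivity (\int[leb]_(t in `[x, y]) ((f t * G y + F x * g t) - (f t * G t + F t * g t))).
    rewrite RintB//; last exact/sub/RintegrableD.
    rewrite -hL// RintD//; last 2 first.
    - by apply: (eq_Rintegrable _ _ (RintegrableZ mxy (G y) (sub _ sf))) => // t _; rewrite mulrC.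
    - by apply: RintegrableZ => //; exact: sub.
    rewrite RintZ//; last exact: sub.
    under eq_Rint do rewrite mulrC.
    rewrite RintZ//; last exact: sub.
    by rewrite -hF// -hG//; ring.
  by apply: eq_Rint => t _; ring.
rewrite expr2 {2}hP// -RintZ//; last exact: sub.
apply: Rint_abs_le => //.
- apply: eq_Rintegrable (RintegrableB mxy s1 (sub _ (RintegrableD (@measurable_itvcc R a b) sfG sFg))) => //.
  by move=> t _; ring.
- by apply: RintegrableZ => //; exact: sub.
move=> t txy; have /= := txy; rewrite in_itv/= => /andP[xt ty].
have yxy : `[x, y]%classic y by rewrite /= in_itv/= xy lexx.
have xxy : `[x, y]%classic x by rewrite /= in_itv/= xy lexx.
have b1 : `|G y - G t| <= P y - P x.
  rewrite hP//; apply: (le_trans (primitive_dist (sub _ sg) (primitive_sub ax yb hG) yxy txy)).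
  apply: Rint_le => //; [by apply: Rintegrable_norm; exact: sub|exact: sub|].
  by move=> s _; rewrite lerDr.
have b2 : `|F x - F t| <= P y - P x.
  rewrite hP//; apply: (le_trans (primitive_dist (sub _ sf) (primitive_sub ax yb hF) xxy txy)).
  apply: Rint_le => //; [by apply: Rintegrable_norm; exact: sub|exact: sub|].
  by move=> s _; rewrite lerDl.
apply: (le_trans (ler_normD _ _)); rewrite !normrM mulrDr ![(P y - P x) * _]mulrC.
by rewrite lerD// ler_wpM2l.
Qed.

Lemma primitive_C1 a b F f : (forall x, derivable F x 1) -> continuous f ->
  (forall x, derive1 F x = f x) -> primitive a b F f.
Proof.
move=> dF cf Ff x y ax; rewrite le_eqVlt => /predU1P[<-|xy] yb.
  by rewrite subrr Rint_itv_nil.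
have cF : continuous F by move=> z; apply: differentiable_continuous; exact/derivable1_diffP.
rewrite /Rintegral (@continuous_FTC2 _ f F x y xy)//.
- exact: continuous_subspaceT.
- split => //; first exact: cvg_at_right_filter (cF x).
  exact: cvg_at_left_filter (cF y).
Qed.

End Primitive.

(** * Weak derivatives on an interval *)

Section Edge_interval.
Context {R : realType}.
Local Notation leb := (@lebesgue_measure R).
Implicit Types (f g h F H phi : R -> R) (a b c x y z : R).

Lemma Rint_support (D E : set R) f : measurable D -> measurable E -> E `<=` D ->
  (forall x, D x -> ~ E x -> f x = 0) ->
  \int[leb]_(x in D) f x = \int[leb]_(x in E) f x.
Proof.
move=> mD mE ED f0; have -> : E = D `&` E by rewrite setIC; apply/esym/setIidPl.
rewrite Rintegral_mkcondr; apply: eq_Rint => x Dx; rewrite patchE.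
by case: ifPn => // /negP xE; apply: f0 => // Ex; apply: xE; exact/mem_set.
Qed.

(** Lebesgue differentiation for the extension of [h] by 0, whose integral over every half-line
    []-oo, x]] vanishes. *)
Lemma primitive0_ae a b h : Rintegrable `[a, b] h ->
  (forall y, a <= y -> y <= b -> \int[leb]_(t in `[a, y]) h t = 0) ->
  {ae leb, forall x, `[a, b]%classic x -> h x = 0}.
Proof.
move=> sh h0; set f := h \_ `[a, b].
have sf : leb.-integrable setT (EFin \o f).
  have := (@integrable_mkcond _ _ _ leb _ (EFin \o h) (measurable_itvcc a b)).1 sh.
  by rewrite restrict_EFin.
have lf : locally_integrable setT f by apply: integrable_locally.
have F0 x : \int[leb]_(t in `]-oo, x]) f t = 0.
  rewrite /f -Rintegral_mkcondr.
  have [xa|ax] := ltP x a.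
    rewrite (_ : _ `&` _ = set0) ?Rintegral_set0//.
    rewrite -subset0 => t [] /=; rewrite !in_itv/= => tx /andP[at_ _].
    by have := lt_le_trans xa at_; rewrite ltNge tx.
  have [ab|ba] := leP a b; last first.
    by rewrite [X in _ `&` X]set_itv_ge ?bnd_simp -?ltNge// setI0 Rintegral_set0.
  rewrite (_ : _ `&` _ = `[a, Num.min x b]%classic); last first.
    apply/seteqP; split => t /=; rewrite !in_itv/= le_min.
      by move=> [-> /andP[-> ->]].
    by move=> /andP[-> /andP[-> ->]].
  by apply: h0; rewrite ?le_min ?ax// ge_min lexx orbT.
have sfy y : leb.-integrable `]-oo, y] (EFin \o f).
  by apply: integrableS sf.
have := FTC1Ny sfy lf.
apply: aeS => x [_ +] xab.
rewrite (_ : (fun _ => _) = cst 0); last by apply/funext => y; rewrite F0.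
by rewrite derive1_cst /f patchE mem_set.
Qed.

(** [edge_dom e] unfolds to [edge_itv (len e)]; the analysis on one edge depends only on its
    length. *)
Definition edge_itv (l : \bar R) : set R := [set x | 0 <= x /\ (x%:E <= l)%E].

Lemma measurable_edge_itv l : measurable (edge_itv l).
Proof.
case: l => [r| |].
- rewrite (_ : edge_itv _ = `[0, r]%classic)//.
  apply/seteqP; split => x; rewrite /edge_itv/= in_itv/= lee_fin; first by case=> -> ->.
  by move=> /andP[].
- rewrite (_ : edge_itv _ = `[0, +oo[%classic); first exact: measurable_itv.
  apply/seteqP; split => x; rewrite /edge_itv/= in_itv/= leey andbT; first by case.
  by move=> ->.
- rewrite (_ : edge_itv _ = set0)//.
  by rewrite -subset0 => x /= [_].
Qed.

Lemma edge_itv_sub l a b : edge_itv l a -> edge_itv l b -> `[a, b] `<=` edge_itv l.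
Proof.
move=> [a0 _] [_ bl] x /=; rewrite in_itv/= => /andP[ax xb]; split.
  exact: le_trans ax.
by apply: le_trans bl; rewrite lee_fin.
Qed.

Lemma edge_itv_lt l a : 0 < a -> (a%:E < l)%E -> edge_itv l a.
Proof. by move=> a0 al; split; apply: ltW. Qed.

Lemma edge_itv_interior l a b : 0 < a -> (b%:E < l)%E -> `[a, b] `<=` (edge_itv l)°.
Proof.
move=> a0 bl x /=; rewrite in_itv/= => /andP[ax xb].
have xl : (x%:E < l)%E by apply: le_lt_trans bl; rewrite lee_fin.
have x0 : 0 < x by exact: lt_le_trans ax.
have [r [xr rl]] : exists r, x < r /\ (r%:E <= l)%E.
  case: l xl {bl} => [r xr|_|//]; first by exists r.
  by exists (x + 1); rewrite leey; split => //; rewrite ltrDl.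
have : nbhs x (`]0, r[%classic : set R).
  by apply: near_in_itvoo; rewrite in_itv/= x0 xr.
apply: filterS => t /=; rewrite in_itv/= => /andP[t0 tr]; split; first exact: ltW.
by apply: le_trans rl; rewrite lee_fin ltW.
Qed.

(* Off a null set the edge is exhausted by compact intervals avoiding its ends. *)
Lemma edge_itv_ae l (P : R -> Prop) : (0 < l)%E ->
  (forall a b, 0 < a -> a < b -> (b%:E < l)%E ->
     {ae leb, forall x, `[a, b]%classic x -> P x}) ->
  {ae leb, forall x, edge_itv l x -> P x}.
Proof.
move=> l0 h.
pose a n : R := n.+1%:R^-1.
pose b n : R := if l is r%:E then r - n.+1%:R^-1 else n.+1%:R.
have a0 n : 0 < a n by rewrite invr_gt0.
have bl n : ((b n)%:E < l)%E.
  rewrite /b; case: l {h b} l0 => [r _|_|//]; last exact: ltry.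
  by rewrite lte_fin ltrBlDr ltrDl.
have hn n : {ae leb, forall x, `[a n, b n]%classic x -> P x}.
  have [ba|ab] := leP (b n) (a n); last exact: h.
  have [<-|ne] := eqVneq (a n) (b n).
    exists [set a n]; split => //; first exact: lebesgue_measure_set1.
    move=> x /= /not_implyP[+ _]; rewrite in_itv/= => /andP[h1 h2].
    by apply/eqP; rewrite eq_le h1 h2.
  apply: aeW => x /=; rewrite in_itv/= => /andP[ax xb].
  by have := le_trans ax xb; rewrite leNgt lt_neqAle eq_sym ne ba.
have ends : {ae leb, forall x, ~ (x = 0 \/ x = fine l)}.
  exists [set 0; fine l]; split => //.
  - exact: measurableU.
  - apply: countable_lebesgue_measure0; apply: finite_set_countable.
    by rewrite finite_setU; split; exact: finite_set1.
  - by move=> x /= /contrapT.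
have := ae_foralln hn; move: ends; apply: aeS2 => x /not_orP[x0 xl] hx [x0' xl'].
have {x0 x0'} x0 : 0 < x by rewrite lt_neqAle x0' andbT eq_sym; exact/eqP.
have {xl xl'} xl : (x%:E < l)%E.
  rewrite lt_neqAle xl' andbT; apply/eqP => e; apply: xl; by rewrite -e.
have [n [h1 h2]] : exists n, a n <= x /\ x <= b n.
  have small c : 0 < c -> exists n, forall m, (n <= m)%N -> (m.+1%:R^-1 : R) <= c.
    move=> c0; exists (Num.bound (c^-1)) => m nm.
    rewrite -[leRHS]invrK lef_pV2 ?posrE ?invr_gt0//.
    have := archi_boundP (ltW (_ : 0 < c^-1)); rewrite invr_gt0 => /(_ c0) /ltW /le_trans; apply.
    by rewrite ler_nat (leq_trans nm).
  have [n1 hn1] := small x x0.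
  have [n2 hn2] : exists n, forall m, (n <= m)%N -> x <= b m.
    move: l0 xl; rewrite /b; clear -small x0; case: l => [r _ xr|_ _|//].
      have [|n2 hn2] := small (r - x); first by rewrite subr_gt0 -lte_fin.
      by exists n2 => m /hn2; rewrite lerBrDl -lerBrDr.
    exists (Num.bound x) => m nm; apply: ltW.
    have := archi_boundP (ltW x0) => /lt_le_trans; apply.
    by rewrite ler_nat (leq_trans nm).
  by exists (maxn n1 n2); rewrite hn1 ?leq_maxl// hn2// leq_maxr.
by apply: (hx n); rewrite /= in_itv/= h1 h2.
Qed.

Section Weak_derivative.
Variable l : \bar R.
Hypothesis l_gt0 : (0 < l)%E.
Local Notation I := (edge_itv l).

Definition weak_derivative f g : Prop := forall phi, test_fun I phi ->
  \int[leb]_(x in I) (f x * derive1 phi x) = - \int[leb]_(x in I) (g x * phi x).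

(** The ends of the edge are allowed as [a] and [b]. On a ray, a primitive of an L^2 function is in
    general square integrable only in this sense. *)
Definition locally_L2 f : Prop := forall a b, I a -> I b -> real_L2 `[a, b] f.

Definition primitive_on F f : Prop := forall x y, I x -> I y -> x <= y ->
  F y - F x = \int[leb]_(t in `[x, y]) f t.

Lemma primitive_on_itv F f a b : primitive_on F f -> I a -> I b -> primitive a b F f.
Proof.
move=> hF Ia Ib x y ax xy yb; have sub := edge_itv_sub Ia Ib.
by apply: hF => //; apply: sub; rewrite /= in_itv/=; lra.
Qed.

Lemma L2_locally f : real_L2 I f -> locally_L2 f.
Proof.
move=> Lf a b Ia Ib; apply: L2S Lf => //; first exact: measurable_edge_itv.
exact: edge_itv_sub.
Qed.

Lemma locally_L2_Rintegrable f a b : locally_L2 f -> I a -> I b -> Rintegrable `[a, b] f.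
Proof. by move=> Lf Ia Ib; apply: L2_Rintegrable; exact: Lf. Qed.

Lemma edge_itv0 : I 0.
Proof. by split => //; exact: ltW. Qed.

Lemma locally_L2_primitive F f : locally_L2 f -> primitive_on F f -> locally_L2 F.
Proof.
move=> Lf hF a b Ia Ib; apply: (@primitive_L2 _ a b F f).
  exact: locally_L2_Rintegrable.
exact: primitive_on_itv.
Qed.

Lemma continuous_zero phi c : {for c, continuous phi} ->
  (forall e, 0 < e -> exists x, `|x - c| < e /\ phi x = 0) -> phi c = 0.
Proof.
move=> cphi h; apply/eqP; rewrite -normr_le0; apply/ler_addgt0Pr => e e0.
have /cvgrPdist_lt /(_ e e0) /nbhs_ballP [d /= d0 hd] := cphi.
have [x [xc px]] := h d d0.
have := hd x; rewrite /ball/= distrC px subr0 => /(_ xc) /ltW.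
by rewrite add0r.
Qed.

Lemma test_fun_support phi : test_fun I phi -> exists a b,
  [/\ I a, I b, a <= b, phi a = 0 /\ phi b = 0 &
    forall x, ~ `[a, b]%classic x -> phi x = 0 /\ derive1 phi x = 0].
Proof.
move=> [dphi cphi [a [b [abI out]]]].
have phi_cont : continuous phi.
  by move=> z; apply: differentiable_continuous; exact/derivable1_diffP.
have out' x : ~ `[a, b]%classic x -> derive1 phi x = 0.
  move=> xab; rewrite derive1E (@near_eq_derive _ _ _ phi (cst 0)) ?derive_cst//.
  have : nbhs x (~` `[a, b]%classic).
    by apply: open_nbhs_nbhs; split => //; apply: closed_openC; exact: itv_closed.
  by apply: filterS => t /out.
(* For b < a the interval is empty and [phi] is 0; the interval [0, 0] then serves. *)
have [ab|ba] := leP a b; last first.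
  have E x : ~ `[a, b]%classic x by rewrite /= in_itv/= => /andP[ax xb]; lra.
  exists 0, 0; split; [exact: edge_itv0|exact: edge_itv0|by []|by split; exact: out|].
  by move=> x _; split; [exact: out|exact: out'].
have Iab x : `[a, b]%classic x -> I x by move=> /abI /interior_subset.
have aab : `[a, b]%classic a by rewrite /= in_itv/= lexx ab.
have bab : `[a, b]%classic b by rewrite /= in_itv/= lexx ab.
exists a, b; split => //; [exact: Iab|exact: Iab|split|].
- apply: (continuous_zero (phi_cont a)) => e e0; exists (a - e / 2); split.
    by rewrite addrAC subrr sub0r normrN gtr0_norm ?divr_gt0//; lra.
  by apply: out; rewrite /= in_itv/=; lra.
- apply: (continuous_zero (phi_cont b)) => e e0; exists (b + e / 2); split.
    by rewrite addrAC subrr add0r gtr0_norm ?divr_gt0//; lra.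
  by apply: out; rewrite /= in_itv/=; lra.
- by move=> x xab; rewrite out// out'.
Qed.

Lemma test_fun_primitive phi a b : test_fun I phi -> primitive a b phi (derive1 phi).
Proof. by move=> [dphi cphi _]; exact: (primitive_C1 dphi cphi (fun=> erefl)). Qed.

Lemma continuous_Rintegrable phi a b : continuous phi -> Rintegrable `[a, b] phi.
Proof. by move=> cphi; apply: Rintegrable_continuous; exact: continuous_subspaceT. Qed.

Lemma weak_derivative_primitive F f : locally_L2 f -> primitive_on F f ->
  weak_derivative F f.
Proof.
move=> Lf hF phi tphi; have [dphi cphi' _] := tphi.
have [a [b [Ia Ib ab [pa pb] out]]] := test_fun_support tphi.
have abI := edge_itv_sub Ia Ib.
have mI := measurable_edge_itv l.
have sf := locally_L2_Rintegrable Lf Ia Ib.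
have hFab := primitive_on_itv hF Ia Ib.
have sphi' := continuous_Rintegrable a b cphi'.
have hphi := @test_fun_primitive phi a b tphi.
have /(_ a b (lexx _) ab (lexx _)) := primitive_mul sf sphi' hFab hphi.
have s1 := Rintegrable_mul_primitive sphi' hphi sf.
have s2 := Rintegrable_mul_primitive sf hFab sphi'.
have s2' : Rintegrable `[a, b] (fun x => F x * derive1 phi x).
  by apply: (eq_Rintegrable _ _ s2) => // x _; rewrite mulrC.
rewrite RintD// pa pb !mulr0 subrr => /esym/eqP; rewrite addrC addr_eq0 => /eqP.
rewrite -!(@Rint_support I `[a, b]%classic)//.
- by move=> x _ xab; rewrite (out x xab).1 mulr0.
- by move=> x _ xab; rewrite (out x xab).2 mulr0.
Qed.

(** The primitive of [psi] from 0 vanishes left of [a], and right of [b] because of the zero mean.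
    This identifies the densities against which a weak derivative can be tested. *)
Lemma test_fun_of_density psi a b : continuous psi -> 0 < a -> a <= b -> (b%:E < l)%E ->
  (forall x, ~ `[a, b]%classic x -> psi x = 0) ->
  \int[leb]_(t in `[a, b]) psi t = 0 ->
  exists2 phi, test_fun I phi & forall x, derive1 phi x = psi x.
Proof.
move=> cpsi a0 ab bl out int0.
pose phi x := \int[leb]_(t in `[0, x]) psi t.
have phi0 x : x < a -> phi x = 0.
  move=> xa; rewrite /phi (_ : \int[leb]_(t in `[0, x]) psi t = \int[leb]_(t in `[0, x]) (fun=> 0) t); last first.
    apply: eq_Rint => t /=; rewrite in_itv/= => /andP[_ tx]; apply: out => /=.
    by rewrite in_itv/= => /andP[at_ _]; lra.
  by rewrite Rintegral_cst// mul0r.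
have phi1 x : b < x -> phi x = 0.
  move=> bx; rewrite /phi (@Rint_support _ `[a, b]%classic)//.
  - by apply: subset_itvcc; lra.
  - by move=> t _; exact: out.
have dphi x : derivable phi x 1 /\ derive1 phi x = psi x.
  (* The fundamental theorem on [0, x + 1] needs 0 < x, which a <= x provides; left of [a] the
     primitive is locally 0. *)
  have [xa|ax] := ltP x a; last first.
    apply: (@continuous_FTC1_closed _ psi 0 x (x + 1)) => //.
    - by rewrite ltrDl.
    - exact: continuous_Rintegrable.
    - exact: lt_le_trans ax.
    - exact: cpsi.
  have nphi : \near x, phi x = cst 0 x.
    have : nbhs x (`]-oo, a[%classic : set R).
      by apply: open_nbhs_nbhs; split; [exact: interval_open|rewrite /= in_itv].
    by apply: filterS => t /=; rewrite in_itv/= => /phi0.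
  have nphi' : \near x, cst 0 x = phi x by move: nphi; apply: filterS => t ->.
  have [h1 h2] := near_eq_is_derive nphi' (is_derive_cst (0 : R) x 1).
  split => //; rewrite derive1E h2 out//= in_itv/=; lra.
exists phi; last by move=> x; have [] := dphi x.
split; first by move=> x; have [] := dphi x.
  by rewrite (_ : derive1 phi = psi)//; apply/funext => x; have [] := dphi x.
exists a, b; split; first exact: edge_itv_interior.
move=> x /=; rewrite in_itv/= => /negP; rewrite negb_and -!ltNge => /orP[/phi0//|/phi1//].
Qed.

(** Truncation to [0, 1], through absolute values so that its continuity is that of the norm. *)
Definition clamp x : R := (1 + `|x| - `|x - 1|) / 2.

Lemma clamp_continuous : continuous clamp.
Proof.
move=> x; apply: cvgMl; apply: cvgB; last first.
  by apply: cvg_norm; apply: cvgB; [exact: cvg_id|exact: cvg_cst].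
by apply: cvgD; [exact: cvg_cst|apply: cvg_norm; exact: cvg_id].
Qed.

Lemma clamp0 x : x <= 0 -> clamp x = 0.
Proof. by move=> x0; rewrite /clamp ler0_norm// ler0_norm; lra. Qed.

Lemma clamp1 x : 1 <= x -> clamp x = 1.
Proof. by move=> x0; rewrite /clamp ger0_norm ?ger0_norm; lra. Qed.

Lemma clamp_itv x : 0 <= clamp x <= 1.
Proof.
have [/clamp0 ->|x0] := leP x 0; first by lra.
have [/clamp1 ->|x1] := leP 1 x; first by lra.
by rewrite /clamp gtr0_norm// ler0_norm; lra.
Qed.

(** A continuous substitute for the indicator of [a, b], with ramps of width [e] inside the
    interval. *)
Definition trapezoid a b e x := clamp ((x - a) / e) * clamp ((b - x) / e).

Lemma trapezoid_continuous a b e : continuous (trapezoid a b e).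
Proof.
move=> x; apply: cvgM.
  apply: (@cvg_comp _ _ _ (fun x => (x - a) / e) clamp); last exact: clamp_continuous.
  by apply: cvgMl; apply: cvgB; [exact: cvg_id|exact: cvg_cst].
apply: (@cvg_comp _ _ _ (fun x => (b - x) / e) clamp); last exact: clamp_continuous.
by apply: cvgMl; apply: cvgB; [exact: cvg_cst|exact: cvg_id].
Qed.

Lemma trapezoid_out a b e x : 0 < e -> ~ `[a, b]%classic x -> trapezoid a b e x = 0.
Proof.
move=> e0; rewrite /= in_itv/= => /negP; rewrite negb_and -!ltNge /trapezoid.
move=> /orP[h|h]; first rewrite clamp0 ?mul0r//; last rewrite (@clamp0 ((b - x) / e)) ?mulr0//.
- by rewrite pmulr_lle0 ?invr_gt0//; lra.
- by rewrite pmulr_lle0 ?invr_gt0//; lra.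
Qed.

Lemma trapezoid_in a b e x : 0 < e -> a + e <= x -> x <= b - e -> trapezoid a b e x = 1.
Proof.
move=> e0 ax xb; rewrite /trapezoid !clamp1 ?mulr1// ler_pdivlMr//; lra.
Qed.

Lemma trapezoid_itv a b e x : 0 <= trapezoid a b e x <= 1.
Proof.
have /andP[h1 h2] := clamp_itv ((x - a) / e); have /andP[h3 h4] := clamp_itv ((b - x) / e).
by rewrite /trapezoid mulr_ge0//= mulr_ile1.
Qed.

(** Cauchy-Schwarz: the trapezoid differs from 1 only on two ramps of width [e], and there by at
    most 1. *)
Lemma trapezoid_approx a b e h : real_L2 `[a, b] h -> 0 < e -> 2 * e < b - a ->
  (\int[leb]_(t in `[a, b]) (h t * trapezoid a b e t) - \int[leb]_(t in `[a, b]) h t) ^+ 2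
    <= nsq `[a, b] h * (2 * e).
Proof.
move=> Lh e0 eab; have mab := @measurable_itvcc R a b.
have ct : {within `[a, b], continuous (trapezoid a b e)}.
  by apply: continuous_subspaceT; exact: trapezoid_continuous.
have Lt := L2_continuous ct.
have Lt1 : real_L2 `[a, b] (fun t => trapezoid a b e t - 1).
  by apply: L2B => //; exact: L2_cst.
rewrite -RintB//; [|exact: Rintegrable_mul|exact: L2_Rintegrable].
rewrite (_ : \int[leb]_(t in _) _ = ip `[a, b] h (fun t => trapezoid a b e t - 1)); last first.
  by apply: eq_Rint => t _; rewrite mulrBr mulr1.
apply: (le_trans (cauchy_schwarz mab Lh Lt1)); apply: ler_wpM2l; first exact: nsq_ge0.
rewrite (@nsq_cat _ a (a + e) b)//; [|lra..].
rewrite (@nsq_cat _ (a + e) (b - e) b); [|lra|lra|apply: (@L2_sub _ a b) => //; lra].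
have piece c d : a <= c -> d <= b -> c <= d ->
    nsq `[c, d] (fun t => trapezoid a b e t - 1) <= d - c.
  move=> ac db cd; rewrite -[leRHS]mul1r -[X in X * _](expr1n _ 2) -nsq_cst//.
  apply: nsq_le => //; [exact: (@L2_sub _ a b)|exact: L2_cst|].
  by move=> t _; have := trapezoid_itv a b e t; rewrite normr1 ler_norml; lra.
have -> : nsq `[a + e, b - e] (fun t => trapezoid a b e t - 1) = 0.
  rewrite (@eq_nsq _ _ _ (fun=> 0)) ?nsq_cst ?expr0n ?mul0r//; first lra.
  by move=> t /=; rewrite in_itv/= => /andP[h1 h2]; rewrite trapezoid_in// subrr.
have := piece a (a + e); have := piece (b - e) b.
by move=> h1 h2; have := h1 ltac:(lra) ltac:(lra) ltac:(lra); have := h2 ltac:(lra) ltac:(lra) ltac:(lra); lra.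
Qed.

Lemma orthogonal_continuous_itv h a b : locally_L2 h ->
  (forall psi c d, 0 < c -> c <= d -> (d%:E < l)%E -> continuous psi ->
     (forall x, ~ `[c, d]%classic x -> psi x = 0) ->
     \int[leb]_(x in I) (h x * psi x) = 0) ->
  0 < a -> a < b -> (b%:E < l)%E -> \int[leb]_(x in `[a, b]) h x = 0.
Proof.
move=> Lh orth a0 ab bl.
have Ib : I b by apply: edge_itv_lt => //; exact: lt_trans ab.
have Ia : I a by apply: edge_itv_lt => //; apply: lt_trans bl; rewrite lte_fin.
have Lab := Lh a b Ia Ib.
apply/eqP; rewrite -sqrf_eq0 eq_le sqr_ge0 andbT; apply/ler_addgt0Pr => e e0.
rewrite add0r; set N := nsq `[a, b] h.
pose d := Num.min (e / (2 * (N + 1))) ((b - a) / 4).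
have N0 : 0 <= N by exact: nsq_ge0.
have d0 : 0 < d by rewrite lt_min !divr_gt0//; lra.
have dab : 2 * d < b - a.
  have : d <= (b - a) / 4 by rewrite ge_min lexx orbT.
  lra.
have de : d * (2 * (N + 1)) <= e.
  by rewrite -ler_pdivlMr ?ge_min ?lexx//; lra.
have := trapezoid_approx Lab d0 dab; rewrite -/N.
have -> : \int[leb]_(t in `[a, b]) (h t * trapezoid a b d t) = 0.
  rewrite -(@Rint_support I); [|exact: measurable_edge_itv|by []|exact: edge_itv_sub|].
  - apply: (orth _ a b) => //; [exact: ltW|exact: trapezoid_continuous|].
    by move=> x; exact: trapezoid_out.
  - by move=> x _ xab; rewrite trapezoid_out ?mulr0.
rewrite sub0r sqrrN => /le_trans; apply.
by apply: le_trans de; nra.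
Qed.

Lemma orthogonal_continuous_ae h : locally_L2 h ->
  (forall psi c d, 0 < c -> c <= d -> (d%:E < l)%E -> continuous psi ->
     (forall x, ~ `[c, d]%classic x -> psi x = 0) ->
     \int[leb]_(x in I) (h x * psi x) = 0) ->
  {ae leb, forall x, I x -> h x = 0}.
Proof.
move=> Lh orth; apply: edge_itv_ae => // a b a0 ab bl.
apply: primitive0_ae.
  apply: locally_L2_Rintegrable => //; apply: edge_itv_lt => //; last exact: lt_trans ab.
  by apply: lt_trans bl; rewrite lte_fin.
move=> y; rewrite le_eqVlt => /predU1P[<- _|ay yb]; first by rewrite Rint_itv_nil.
by apply: orthogonal_continuous_itv => //; apply: le_lt_trans bl; rewrite lee_fin.
Qed.

Lemma locally_L2B f g : locally_L2 f -> locally_L2 g -> locally_L2 (fun x => f x - g x).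
Proof. by move=> Lf Lg a b Ia Ib; apply: L2B => //; [exact: Lf|exact: Lg]. Qed.

Lemma primitive_on_unique F f g : locally_L2 f -> locally_L2 g ->
  primitive_on F f -> primitive_on F g -> {ae leb, forall x, I x -> f x = g x}.
Proof.
move=> Lf Lg hf hg.
have : {ae leb, forall x, I x -> (fun x => f x - g x) x = 0}.
  apply: edge_itv_ae => // a b a0 ab bl.
  have Ib : I b by apply: edge_itv_lt => //; exact: lt_trans ab.
  have Ia : I a by apply: edge_itv_lt => //; apply: lt_trans bl; rewrite lte_fin.
  apply: primitive0_ae.
    by apply: locally_L2_Rintegrable => //; exact: locally_L2B.
  move=> y ay yb; have Iy : I y by apply: (edge_itv_sub Ia Ib); rewrite /= in_itv/= ay.
  rewrite RintB//; try exact: locally_L2_Rintegrable.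
  by rewrite -hf// -hg// subrr.
by apply: aeS => x h /h /eqP; rewrite subr_eq0 => /eqP.
Qed.

(** With [F0] a primitive of [g], the difference [h] of [f] and [F0] is orthogonal to all continuous
    densities of mean zero supported inside the edge. Any density becomes one after subtraction of a
    multiple of a fixed [psi0] of nonzero mean, so [h] is the constant [k], its [psi0]-average. *)
Lemma weak_derivativeP f g : locally_L2 f -> locally_L2 g -> weak_derivative f g ->
  exists2 F, primitive_on F g & {ae leb, forall x, I x -> f x = F x}.
Proof.
move=> Lf Lg wd; pose F0 x := \int[leb]_(t in `[0, x]) g t.
have hF0 : primitive_on F0 g.
  move=> x y Ix Iy xy; have I0 := edge_itv0.
  by apply: (@Rint_primitive _ 0 y) => //; [exact: locally_L2_Rintegrable|case: Ix].
have LF0 := locally_L2_primitive Lg hF0.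
have wd0 := weak_derivative_primitive Lg hF0.
pose h x := f x - F0 x; have Lh : locally_L2 h by exact: locally_L2B.
have mI := measurable_edge_itv l.
have supp (psi u : R -> R) c d : 0 < c -> c <= d -> (d%:E < l)%E -> continuous psi ->
    (forall x, ~ `[c, d]%classic x -> psi x = 0) ->
    \int[leb]_(x in I) (u x * psi x) = \int[leb]_(x in `[c, d]) (u x * psi x).
  move=> c0 cd dl cpsi out; apply: Rint_support => //.
    apply: edge_itv_sub; apply: edge_itv_lt => //; last exact: lt_le_trans cd.
    by apply: le_lt_trans dl; rewrite lee_fin.
  by move=> x _ /out ->; rewrite mulr0.
have orth0 (psi : R -> R) c d : 0 < c -> c <= d -> (d%:E < l)%E -> continuous psi ->
    (forall x, ~ `[c, d]%classic x -> psi x = 0) ->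
    \int[leb]_(x in `[c, d]) psi x = 0 ->
    \int[leb]_(x in `[c, d]) (h x * psi x) = 0.
  move=> c0 cd dl cpsi out int0.
  have [phi tphi dphi] := test_fun_of_density cpsi c0 cd dl out int0.
  have := wd0 phi tphi; rewrite -(wd phi tphi).
  under eq_Rint do rewrite dphi.
  under [in RHS]eq_Rint do rewrite dphi.
  rewrite !(supp psi _ c d)// => e.
  have Id : I d by apply: edge_itv_lt => //; exact: lt_le_trans cd.
  have Ic : I c by apply: edge_itv_lt => //; apply: le_lt_trans dl; rewrite lee_fin.
  have Lpsi : real_L2 `[c, d] psi by apply: L2_continuous; exact: continuous_subspaceT.
  transitivity (\int[leb]_(x in `[c, d]) (f x * psi x) - \int[leb]_(x in `[c, d]) (F0 x * psi x)).
    rewrite -RintB//; last 2 first.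
    - by apply: Rintegrable_mul => //; exact: Lf.
    - by apply: Rintegrable_mul => //; exact: LF0.
    by apply: eq_Rint => x _; rewrite mulrBl.
  by rewrite e subrr.
have [p [r [p0 pr rl]]] : exists p r, [/\ 0 < p, p < r & (r%:E < l)%E].
  case: {wd hF0 LF0 wd0 Lh mI supp orth0 h F0 Lf Lg} l l_gt0 => [s s0||//].
    by exists (s / 4), (s / 2); rewrite !lte_fin in s0 *; split; lra.
  by exists 1, 2; rewrite ltry; split => //; lra.
(* With ramps this narrow the integral of [psi0] differs from r - p by less than r - p, hence is not
   0. *)
pose e0 := (r - p) / 16; have e0_gt0 : 0 < e0 by rewrite divr_gt0//; lra.
pose psi0 := trapezoid p r e0.
have cpsi0 : continuous psi0 by exact: trapezoid_continuous.
have out0 x : ~ `[p, r]%classic x -> psi0 x = 0 by exact: trapezoid_out.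
set J0 := \int[leb]_(x in `[p, r]) psi0 x.
have J0n0 : J0 != 0.
  have := trapezoid_approx (L2_cst p r 1) e0_gt0; rewrite nsq_cst ?Rint_cst ?(ltW pr)//.
  under eq_Rint do rewrite mul1r.
  rewrite -/psi0 -/J0 expr1n !mul1r => /(_ ltac:(rewrite /e0; lra)).
  by apply: contraTneq => ->; rewrite /e0 -ltNge; nra.
pose k := (\int[leb]_(x in I) (h x * psi0 x)) / J0.
exists (fun x => F0 x + k).
  by move=> x y Ix Iy xy; rewrite -hF0//; ring.
have : {ae leb, forall x, I x -> (fun x => h x - k) x = 0}.
  apply: orthogonal_continuous_ae.
    by apply: locally_L2B => // a b _ _; exact: L2_cst.
  move=> psi c d c0 cd dl cpsi out.
  (* [m, M] contains the supports of both [psi] and [psi0]. *)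
  pose m := Num.min p c; pose M := Num.max r d.
  have m0 : 0 < m by rewrite lt_min p0.
  have mp : m <= p by rewrite ge_min lexx.
  have mc : m <= c by rewrite ge_min lexx orbT.
  have rM : r <= M by rewrite le_max lexx.
  have dM : d <= M by rewrite le_max lexx orbT.
  have Ml : (M%:E < l)%E by rewrite /M; case: (leP r d).
  have mM : m <= M by exact: le_trans (le_trans mc cd) dM.
  have IM : I M by apply: edge_itv_lt => //; exact: lt_le_trans mM.
  have Im : I m by apply: edge_itv_lt => //; apply: le_lt_trans Ml; rewrite lee_fin.
  have wide (u : R -> R) v w : m <= v -> w <= M -> (forall x, ~ `[v, w]%classic x -> u x = 0) ->
      forall x, ~ `[m, M]%classic x -> u x = 0.
    by move=> mv wM h1 x xmM; apply: h1 => xvw; apply: xmM; apply: subset_itvcc xvw.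
  have out0' := wide _ _ _ mp rM out0; have out' := wide _ _ _ mc dM out.
  have Lpsi (u : R -> R) : continuous u -> real_L2 `[m, M] u.
    by move=> cu; apply: L2_continuous; exact: continuous_subspaceT.
  set J := \int[leb]_(x in `[m, M]) psi x.
  have J0E : J0 = \int[leb]_(x in `[m, M]) psi0 x.
    by apply/esym/Rint_support => //; [exact: subset_itvcc|move=> x _; exact: out0].
  have shp (u : R -> R) : continuous u -> Rintegrable `[m, M] (fun x => h x * u x).
    by move=> cu; apply: Rintegrable_mul => //; [exact: Lh|exact: Lpsi].
  have cpsi1 : continuous (fun x => psi x - J / J0 * psi0 x).
    move=> x; apply: cvgB; first exact: cpsi.
    by apply: cvgMr; exact: cpsi0.
  have := orth0 _ m M m0 mM Ml cpsi1; rewrite RintB//; last 2 first.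
  - exact: continuous_Rintegrable.
  - by apply: RintegrableZ => //; exact: continuous_Rintegrable.
  rewrite RintZ//; last exact: continuous_Rintegrable.
  rewrite -/J -J0E divfK// subrr => /(_ _ erefl) orth1.
  have {}orth1 : \int[leb]_(x in `[m, M]) (h x * (psi x - J / J0 * psi0 x)) = 0.
    by apply: orth1 => x xmM; rewrite out'// out0'// mulr0 subrr.
  rewrite (supp psi _ m M)//.
  transitivity (\int[leb]_(x in `[m, M]) (h x * psi x) - k * J).
    rewrite -RintZ//; last exact: continuous_Rintegrable.
    rewrite -RintB//; last by apply: RintegrableZ => //; exact: continuous_Rintegrable.
      by apply: eq_Rint => x _; rewrite mulrBl.
    exact: shp.
  rewrite -[RHS]orth1 /k (supp psi0 h m M)//.
  transitivity (\int[leb]_(x in `[m, M]) (h x * psi x) -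
     J / J0 * \int[leb]_(x in `[m, M]) (h x * psi0 x)); first by field.
  rewrite -RintZ//; last exact: shp.
  rewrite -RintB//; [|exact: shp|by apply: RintegrableZ => //; exact: shp].
  by apply: eq_Rint => x _; ring.
by apply: aeS => x hx Ix; have := hx Ix; rewrite /h; lra.
Qed.

End Weak_derivative.
End Edge_interval.

(** * Continuous representatives and chains of derivatives *)

Section Continuous_representative.
Context {R : realType}.
Local Notation leb := (@lebesgue_measure R).
Implicit Types (f g h F H : R -> R) (a b c x y z : R).

Lemma primitive_holder a b F f x y : real_L2 `[a, b] f -> primitive a b F f ->
  `[a, b]%classic x -> `[a, b]%classic y ->
  (F x - F y) ^+ 2 <= `|x - y| * nsq `[a, b] f.
Proof.
move=> Lf hF /=; rewrite !in_itv/= => /andP[ax xb] /andP[ay yb].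
wlog xy : x y ax xb ay yb / y <= x.
  move=> h; have [xy|/ltW xy] := leP y x; first exact: h.
  by rewrite distrC -sqrrN opprB; exact: h.
rewrite hF// ger0_norm ?subr_ge0//.
apply: (le_trans (sqr_Rint_le xy _)); first exact: (@L2_sub _ a b).
by apply: ler_wpM2l; [rewrite subr_ge0|apply: nsqS => //; exact: subset_itvcc].
Qed.

Variable l : \bar R.
Hypothesis l_gt0 : (0 < l)%E.
Local Notation I := (edge_itv l).

Lemma edge_itv_nbhs x : I x -> exists b,
  [/\ I b, x <= b & forall y, I y -> `|x - y| < 1 -> `[0, b]%classic y].
Proof.
move=> [x0 xl]; case: l xl l_gt0 => [r xr r0|_ _|//].
  exists r; split; rewrite /edge_itv/= ?lexx//; first by split => //; exact: ltW.
  by move=> y [y0 yr] _; rewrite in_itv/= y0.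
exists (x + 1); rewrite /edge_itv/= leey; split; [split => //; lra|lra|].
by move=> y [y0 _]; rewrite in_itv/= y0/= ltr_norml => /andP[h _]; lra.
Qed.

Lemma primitive_on_continuous F f : locally_L2 l f -> primitive_on l F f ->
  {within I, continuous F}.
Proof.
move=> Lf hF; apply/subspace_continuousP => x Ix.
have [b [Ib xb nb]] := edge_itv_nbhs Ix.
have I0 : I 0 := edge_itv0 l_gt0.
have L0b : real_L2 `[0, b] f := Lf 0 b I0 Ib.
have hFb : primitive 0 b F f := primitive_on_itv hF I0 Ib.
set N := nsq `[0, b] f.
apply/cvgrPdist_lt => e e0.
pose d := Num.min 1 (e ^+ 2 / (N + 1)).
have N0 : 0 <= N by exact: nsq_ge0.
have d0 : 0 < d by rewrite lt_min ltr01 divr_gt0 ?exprn_gt0//; lra.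
have : nbhs x (ball x d) by exact: nbhsx_ballx.
rewrite /within/=; apply: filterS => y; rewrite /ball/= => xyd Iy.
have xab : `[0, b]%classic x by rewrite /= in_itv/= xb; case: Ix => ->.
have yab : `[0, b]%classic y.
  by apply: nb => //; apply: (lt_le_trans xyd); rewrite ge_min lexx.
have h := primitive_holder L0b hFb xab yab.
have h2 : `|x - y| * N < e ^+ 2.
  have : `|x - y| < e ^+ 2 / (N + 1).
    by apply: (lt_le_trans xyd); rewrite ge_min lexx orbT.
  rewrite ltr_pdivlMr; last lra.
  by have := normr_ge0 (x - y); nra.
have : `|F x - F y| ^+ 2 < e ^+ 2 by rewrite real_normK ?num_real// (le_lt_trans h).
by rewrite ltr_pXn2r// ?nnegrE ?(ltW e0).
Qed.

(** At a point where they differ, the functions differ on a one-sided neighbourhood, which has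
    positive measure; [x] may be an end of the edge, so the side is chosen inside it. *)
Lemma continuous_ae_eq f g : {within I, continuous f} -> {within I, continuous g} ->
  {ae leb, forall x, I x -> f x = g x} -> forall x, I x -> f x = g x.
Proof.
move=> cf cg fg x Ix; apply/eqP/contraT => ne.
have ch : {within I, continuous (fun x => f x - g x)}.
  by move=> t; apply: (@continuousB _ R^o (subspace I) f g); [exact: cf|exact: cg].
have /subspace_continuousP/(_ x Ix)/cvgrPdist_lt/(_ `|f x - g x|) := ch.
rewrite normr_gt0 subr_eq0 => /(_ ne) /nbhs_ballP [d /= d0 hd].
have [c [e [ce sub]]] : exists c e, c < e /\ forall t, c < t -> t < e -> I t /\ `|x - t| < d.
  have [x0 xl] := Ix; move: x0; rewrite le_eqVlt => /predU1P[x0|x0].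
    have [r [r0 rl]] : exists r, 0 < r /\ (r%:E <= l)%E.
      case: l l_gt0 => [r r0|_|//]; first by exists r.
      by exists 1; rewrite leey.
    exists 0, (Num.min d r); split; first by rewrite lt_min d0.
    move=> t t0; rewrite lt_min => /andP[td tr]; split.
      split; first exact: ltW.
      by apply: le_trans rl; rewrite lee_fin ltW.
    by rewrite -x0 sub0r normrN gtr0_norm.
  exists (Num.max 0 (x - d)), x; split; first by rewrite gt_max x0/=; lra.
  move=> t; rewrite gt_max => /andP[t0 xd] tx; split; last by rewrite gtr0_norm; lra.
  split; first exact: ltW.
  by apply: le_trans xl; rewrite lee_fin ltW.
have [N [mN N0 hN]] := fg.
have : (leb `]c, e[%classic <= leb N)%E.
  apply: le_measure; rewrite ?inE//.
  move=> t /=; rewrite in_itv/= => /andP[ct te]; apply/hN => h.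
  have [It xt] := sub t ct te; have hlt : `|(f x - g x) - (f t - g t)| < `|f x - g x| := hd t xt It.
  by move: hlt; rewrite (h It) subrr subr0 ltxx.
by rewrite N0 lebesgue_measure_itv/= lte_fin ce -EFinD lee_fin; lra.
Qed.

Lemma within_measurable f : {within I, continuous f} -> measurable_fun I f.
Proof. by move=> cf; apply: subspace_continuous_measurable_fun => //; exact: measurable_edge_itv. Qed.

(** The entries below order [m] are continuous functions with meaningful values at the ends of the
    edge; only the top entry is determined merely up to null sets. *)
Definition chain m (d : nat -> R -> R) : Prop :=
  (forall j, (j <= m)%N -> real_L2 I (d j)) /\
  (forall j, (j < m)%N -> primitive_on l (d j) (d j.+1)).

Lemma chain_L2 m d j : chain m d -> (j <= m)%N -> real_L2 I (d j).
Proof. by move=> [h _] /h. Qed.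

Lemma chain_locally_L2 m d j : chain m d -> (j <= m)%N -> locally_L2 l (d j).
Proof. by move=> h jm; apply: L2_locally; exact: chain_L2 h jm. Qed.

Lemma chain_primitive m d j : chain m d -> (j < m)%N -> primitive_on l (d j) (d j.+1).
Proof. by move=> [_ h] /h. Qed.

Lemma chain_continuous m d j : chain m d -> (j < m)%N -> {within I, continuous (d j)}.
Proof.
move=> h jm; apply: primitive_on_continuous (chain_primitive h jm).
exact: chain_locally_L2 h jm.
Qed.

Lemma chain_leq n m d : (n <= m)%N -> chain m d -> chain n d.
Proof.
move=> nm [h1 h2]; split => j hj; [exact/h1/(leq_trans hj)|exact/h2/(leq_trans hj)].
Qed.

Lemma chainD m d d' : chain m d -> chain m d' -> chain m (fun j x => d j x + d' j x).
Proof.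
have mI := measurable_edge_itv l.
move=> hd hd'; split => j jm; first by apply: L2D => //; exact: chain_L2 jm.
move=> x y Ix Iy xy; rewrite RintD//; last 2 first.
- by apply: locally_L2_Rintegrable Ix Iy; apply: chain_locally_L2 hd _.
- by apply: locally_L2_Rintegrable Ix Iy; apply: chain_locally_L2 hd' _.
by rewrite -(chain_primitive hd jm)// -(chain_primitive hd' jm)//; ring.
Qed.

Lemma chainZ m c d : chain m d -> chain m (fun j x => c * d j x).
Proof.
have mI := measurable_edge_itv l.
move=> hd; split => j jm; first by apply: L2Z => //; exact: chain_L2 jm.
move=> x y Ix Iy xy; rewrite RintZ//; last first.
  by apply: locally_L2_Rintegrable Ix Iy; apply: chain_locally_L2 hd _.
by rewrite -(chain_primitive hd jm)//; ring.
Qed.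

Lemma eq_primitive_on F f G g : locally_L2 l f -> locally_L2 l g ->
  (forall x, I x -> F x = G x) -> {ae leb, forall x, I x -> f x = g x} ->
  primitive_on l F f -> primitive_on l G g.
Proof.
move=> Lf Lg FG fg hF x y Ix Iy xy; rewrite -!FG// hF//; apply: ae_Rint => //.
- by apply: Rintegrable_measurable; exact: locally_L2_Rintegrable Lf Ix Iy.
- by apply: Rintegrable_measurable; exact: locally_L2_Rintegrable Lg Ix Iy.
by apply: aeS fg => t h txy; apply: h; exact: (edge_itv_sub Ix Iy).
Qed.

Lemma ae_L2 f g : measurable_fun I g -> {ae leb, forall x, I x -> f x = g x} ->
  real_L2 I f -> real_L2 I g.
Proof.
have mI := measurable_edge_itv l.
move=> mg fg /(real_L2P mI)[mf sf]; apply/(real_L2P mI); split => //.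
apply: (ae_Rintegrable mI _ _ sf); first exact: measurable_funX.
by apply: aeS fg => x h /h ->.
Qed.

End Continuous_representative.

(** * Real and imaginary parts; Sobolev functions as chains *)

Section Complex_parts.
Context {R : realType}.
Local Notation leb := (@lebesgue_measure R).
Implicit Types (f g : R -> R[i]).

Definition cpart (s : bool) (z : R[i]) : R := if s then complex.Im z else complex.Re z.

Lemma cpart_inj (z w : R[i]) : (forall s, cpart s z = cpart s w) -> z = w.
Proof.
by case: z w => [a b] [a' b'] h; have /= -> := h false; have /= -> := h true.
Qed.

Lemma normc_sqr (z : R[i]) : normc z ^+ 2 = cpart false z ^+ 2 + cpart true z ^+ 2.
Proof. by case: z => [a b] /=; rewrite sqr_sqrtr// addr_ge0 ?sqr_ge0. Qed.

Lemma ae_boolP (P : bool -> R -> Prop) :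
  {ae leb, forall x, forall s, P s x} <-> forall s, {ae leb, forall x, P s x}.
Proof.
split=> [h s|h]; first by apply: aeS h.
by move: (h false) (h true); apply: aeS2 => x h0 h1 [].
Qed.

Variable l : \bar R.
Hypothesis l_gt0 : (0 < l)%E.
Local Notation I := (edge_itv l).

Lemma ae_eq_onP f g : ae_eq_on I f g <->
  forall s, {ae leb, forall x, I x -> cpart s (f x) = cpart s (g x)}.
Proof.
split=> [h s|h]; first by apply: aeS h => x h /h ->.
have /ae_boolP := h; apply: aeS => x hx Ix; apply: cpart_inj => s; exact: hx.
Qed.

Lemma L2P f : L2 I f <-> forall s, real_L2 I (fun x => cpart s (f x)).
Proof.
have mI := measurable_edge_itv l.
have E : normsq I f = (\int[leb]_(x in I)
    ((cpart false (f x) ^+ 2)%:E + (cpart true (f x) ^+ 2)%:E))%E.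
  by apply: eq_integral => x _; rewrite normc_sqr EFinD.
split=> [[mr mi fin]|h].
  have mc s : measurable_fun I (fun x => cpart s (f x)) by case: s.
  move=> s; split => //; apply: le_lt_trans fin; rewrite E.
  apply: ge0_le_integral => //.
  - by move=> x _; rewrite lee_fin sqr_ge0.
  - by apply/measurable_EFinP/measurable_funX; exact: mc.
  - by apply: emeasurable_funD; apply/measurable_EFinP/measurable_funX; exact: mc.
  by move=> x _; rewrite -EFinD lee_fin; case: s; rewrite ?lerDl ?lerDr sqr_ge0.
have [mr sr] := h false; have [mi si] := h true.
split => //; rewrite E ge0_integralD//.
- exact: lte_add_pinfty.
- by move=> x _; rewrite lee_fin sqr_ge0.
- by apply/measurable_EFinP/measurable_funX.
- by move=> x _; rewrite lee_fin sqr_ge0.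
- by apply/measurable_EFinP/measurable_funX.
Qed.

Lemma normsqE f : L2 I f -> normsq I f =
  (nsq I (fun x => cpart false (f x)) + nsq I (fun x => cpart true (f x)))%:E.
Proof.
have mI := measurable_edge_itv l.
move=> /L2P h; have s0 := L2_sqr mI (h false); have s1 := L2_sqr mI (h true).
rewrite /nsq -(RintD mI)// -(integral_Rintegrable mI); last exact: RintegrableD.
by apply: eq_integral => x _; rewrite normc_sqr.
Qed.

Lemma is_wderivP f g : is_wderiv I f g <->
  forall s, weak_derivative l (fun x => cpart s (f x)) (fun x => cpart s (g x)).
Proof.
split=> h; last by move=> phi tphi; split; [exact: (h false)|exact: (h true)].
by move=> s phi tphi; have [h0 h1] := h phi tphi; case: s.
Qed.

Lemma cont_onP f : cont_on I f <-> forall s, {within I, continuous (fun x => cpart s (f x))}.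
Proof. by split=> [[h0 h1] []//|h]; split; [exact: (h false)|exact: (h true)]. Qed.

Lemma cont_on_ae_eq f g : cont_on I f -> cont_on I g -> ae_eq_on I f g ->
  forall x, I x -> f x = g x.
Proof.
move=> /cont_onP cf /cont_onP cg /ae_eq_onP fg x Ix; apply: cpart_inj => s.
by apply: (continuous_ae_eq l_gt0 (cf s) (cg s) (fg s)).
Qed.

Lemma cont_repP f g : cont_on I g -> ae_eq_on I g f ->
  forall x, I x -> cont_rep I f x = g x.
Proof.
move=> cg gf; have [cr rf] : cont_on I (cont_rep I f) /\ ae_eq_on I (cont_rep I f) f.
  exact: (@xgetPex _ (fun=> 0) [set g | cont_on I g /\ ae_eq_on I g f] (ex_intro _ g (conj cg gf))).
apply: cont_on_ae_eq => //.
by move: rf gf; apply: aeS2 => x h1 h2 Ix; rewrite h1// h2.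
Qed.

(** Both weak derivatives have primitives equal to [f] almost everywhere; continuity makes these
    primitives equal everywhere, and their densities then agree. *)
Lemma is_wderiv_unique f g g' : L2 I f -> L2 I g -> L2 I g' ->
  is_wderiv I f g -> is_wderiv I f g' -> ae_eq_on I g g'.
Proof.
move=> /L2P Lf /L2P Lg /L2P Lg' /is_wderivP wg /is_wderivP wg'; apply/ae_eq_onP => s.
have [F hF fF] := weak_derivativeP l_gt0 (L2_locally (Lf s)) (L2_locally (Lg s)) (wg s).
have [F' hF' fF'] := weak_derivativeP l_gt0 (L2_locally (Lf s)) (L2_locally (Lg' s)) (wg' s).
have FF' : forall x, I x -> F x = F' x.
  apply: continuous_ae_eq => //.
  - exact: (primitive_on_continuous l_gt0 (L2_locally (Lg s))).
  - exact: (primitive_on_continuous l_gt0 (L2_locally (Lg' s))).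
  - by move: fF fF'; apply: aeS2 => x h1 h2 Ix; rewrite -h1// h2.
apply: (@primitive_on_unique _ l l_gt0 F) => //; try exact: L2_locally.
by move=> x y Ix Iy xy; rewrite !FF'// hF'.
Qed.

Lemma wderivP f g : L2 I g -> is_wderiv I f g ->
  L2 I (wderiv I f) /\ is_wderiv I f (wderiv I f).
Proof.
move=> Lg wg.
exact: (@xgetPex _ (fun=> 0) [set g | L2 I g /\ is_wderiv I f g] (ex_intro _ g (conj Lg wg))).
Qed.

Lemma ae_wderiv f f' g g' : L2 I f -> L2 I f' -> L2 I g -> L2 I g' ->
  ae_eq_on I f f' -> ae_eq_on I g g' -> is_wderiv I f g -> is_wderiv I f' g'.
Proof.
have mI := measurable_edge_itv l.
move=> /L2P Lf /L2P Lf' /L2P Lg /L2P Lg' /ae_eq_onP ff /ae_eq_onP gg /is_wderivP wd.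
apply/is_wderivP => s phi tphi; have := wd s phi tphi.
have [dphi cphi' _] := tphi.
have cphi : continuous phi.
  by move=> z; apply: differentiable_continuous; exact/derivable1_diffP.
have mphi : measurable_fun I phi by apply: measurable_funTS; exact: continuous_measurable_fun.
have mphi' : measurable_fun I (derive1 phi).
  by apply: measurable_funTS; exact: continuous_measurable_fun.
have [mf _] := Lf s; have [mf' _] := Lf' s; have [mg _] := Lg s; have [mg' _] := Lg' s.
rewrite (@ae_Rint _ I mI (fun x => cpart s (f x) * derive1 phi x) (fun x => cpart s (f' x) * derive1 phi x)); last first.
- by apply: aeS (ff s) => x h /h ->.
- exact: measurable_funM.
- exact: measurable_funM.
rewrite (@ae_Rint _ I mI (fun x => cpart s (g x) * phi x) (fun x => cpart s (g' x) * phi x))//.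
- exact: measurable_funM.
- exact: measurable_funM.
- by apply: aeS (gg s) => x h /h ->.
Qed.

Lemma Sobolev_L2 m f : Sobolev I m f -> L2 I f.
Proof. by case: m => // m []. Qed.

Lemma ae_Sobolev m f f' : L2 I f' -> ae_eq_on I f f' -> Sobolev I m f -> Sobolev I m f'.
Proof.
case: m => [|m] //= Lf' ff [Lf [g [wg Sg]]]; split => //; exists g; split => //.
have Lg := Sobolev_L2 Sg.
by apply: (ae_wderiv Lf Lf' Lg Lg ff _ wg); apply: aeW.
Qed.

Lemma wderivnS j f : wderivn I j.+1 f = wderivn I j (wderiv I f).
Proof. by rewrite /wderivn iterSr. Qed.

(** [wderiv] is a chosen representative and may differ on a null set from the witness inside
    [Sobolev]; uniqueness of weak derivatives carries membership over. *)
Lemma Sobolev_wderivn m f j : Sobolev I m f -> (j <= m)%N ->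
  L2 I (wderivn I j f) /\ ((j < m)%N -> is_wderiv I (wderivn I j f) (wderivn I j.+1 f)).
Proof.
elim: m f j => [|m IH] f j; first by case: j.
move=> [Lf [g [wg Sg]]]; have Lg := Sobolev_L2 Sg.
have [Lw ww] := wderivP Lg wg.
case: j => [_|j jm]; first by [].
have Sw : Sobolev I m (wderiv I f).
  by apply: (ae_Sobolev Lw _ Sg); exact: (is_wderiv_unique Lf Lg Lw wg ww).
by have := IH _ j Sw jm; rewrite -!wderivnS.
Qed.

(** Below order [m] the entry is the primitive provided by [weak_derivativeP], at order [m] the weak
    derivative itself; replacing the densities by almost everywhere equal ones preserves the
    integral relations. *)
Lemma Sobolev_chain m f : Sobolev I m f ->
  exists d : bool -> nat -> R -> R, forall s, chain l m (d s) /\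
    forall j, (j <= m)%N ->
      {ae leb, forall x, I x -> cpart s (wderivn I j f x) = d s j x}.
Proof.
move=> Sf; have hf j := Sobolev_wderivn Sf (j := j).
have : forall s, forall j, exists F : R -> R, (j < m)%N ->
    primitive_on l F (fun x => cpart s (wderivn I j.+1 f x)) /\
    {ae leb, forall x, I x -> cpart s (wderivn I j f x) = F x}.
  move=> s j; have [jm|_] := boolP (j < m)%N; last by exists (fun=> 0).
  have [/L2P h1 /(_ jm) /is_wderivP h2] := hf j (ltnW jm).
  have [/L2P h3 _] := hf j.+1 jm.
  by have [F] := weak_derivativeP l_gt0 (L2_locally (h1 s)) (L2_locally (h3 s)) (h2 s); exists F.
move=> /(_ _)/choice h; have /choice[F hF] := fun s => ex_intro _ (projT1 (h s)) (projT2 (h s)).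
pose d s j := if (j < m)%N then F s j else fun x => cpart s (wderivn I j f x).
have dE s j : (j <= m)%N -> {ae leb, forall x, I x -> cpart s (wderivn I j f x) = d s j x}.
  rewrite /d => jm; case: ifP => [jm'|_]; last exact: aeW.
  by have [] := hF s j jm'.
have dL s j : (j <= m)%N -> real_L2 I (d s j).
  move=> jm; have [/L2P h1 _] := hf j jm.
  apply: (ae_L2 _ (dE s j jm)) => //.
  rewrite /d; case: ifP => [jm'|_]; last by have [] := h1 s.
  apply: within_measurable; have [h2 _] := hF s j jm'.
  apply: (primitive_on_continuous l_gt0 _ h2); apply: L2_locally.
  by have [/L2P] := hf j.+1 jm'.
exists d => s; split; last exact: dE.
split; first exact: dL.
move=> j jm; have [h2 _] := hF s j jm.
apply: (eq_primitive_on _ _ _ (dE s j.+1 jm) h2).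
- by apply: L2_locally; have [/L2P] := hf j.+1 jm.
- by apply: L2_locally; exact: dL.
- by move=> x Ix; rewrite /d jm.
Qed.

Lemma chain_wderiv m (d : bool -> nat -> R -> R) f g : (forall s, chain l m.+1 (d s)) ->
  L2 I f -> L2 I g ->
  (forall s, {ae leb, forall x, I x -> d s 0%N x = cpart s (f x)}) ->
  (forall s, {ae leb, forall x, I x -> d s 1%N x = cpart s (g x)}) ->
  is_wderiv I f g.
Proof.
have mI := measurable_edge_itv l.
move=> hd /L2P Lf /L2P Lg df dg; apply/is_wderivP => s phi tphi.
have := weak_derivative_primitive l_gt0 (chain_locally_L2 (hd s) (ltn0Sn _))
   (chain_primitive (hd s) (ltn0Sn _)) tphi.
have [dphi cphi' _] := tphi.
have cphi : continuous phi.
  by move=> z; apply: differentiable_continuous; exact/derivable1_diffP.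
have mphi : measurable_fun I phi by apply: measurable_funTS; exact: continuous_measurable_fun.
have mphi' : measurable_fun I (derive1 phi).
  by apply: measurable_funTS; exact: continuous_measurable_fun.
have [mf _] := Lf s; have [mg _] := Lg s.
have [md0 _] := chain_L2 (hd s) (leq0n m.+1).
have [md1 _] := chain_L2 (hd s) (ltn0Sn m).
rewrite (@ae_Rint _ I mI (fun x => d s 0%N x * derive1 phi x) (fun x => cpart s (f x) * derive1 phi x)); last first.
- by apply: aeS (df s) => x h /h ->.
- exact: measurable_funM.
- exact: measurable_funM.
rewrite (@ae_Rint _ I mI (fun x => d s 1%N x * phi x) (fun x => cpart s (g x) * phi x))//.
- exact: measurable_funM.
- exact: measurable_funM.
- by apply: aeS (dg s) => x h /h ->.
Qed.

Definition pack (d : bool -> R -> R) (x : R) : R[i] := Complex (d false x) (d true x).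

Lemma cpart_pack d s x : cpart s (pack d x) = d s x.
Proof. by case: s. Qed.

Lemma L2_pack d : (forall s, real_L2 I (d s)) -> L2 I (pack d).
Proof. by move=> h; apply/L2P => s; apply: eq_L2 (h s) => //; [exact: measurable_edge_itv|move=> x _; rewrite cpart_pack]. Qed.

Lemma chain_Sobolev m (d : bool -> nat -> R -> R) f : (forall s, chain l m (d s)) ->
  L2 I f -> (forall s, {ae leb, forall x, I x -> d s 0%N x = cpart s (f x)}) ->
  Sobolev I m f /\ forall j, (j <= m)%N -> forall s,
    {ae leb, forall x, I x -> d s j x = cpart s (wderivn I j f x)}.
Proof.
elim: m d f => [|m IH] d f hd Lf df.
  by split => // j; rewrite leqn0 => /eqP ->.
pose g := pack (fun s => d s 1%N).
have Lg : L2 I g by apply: L2_pack => s; exact: chain_L2 (hd s) _.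
have wg : is_wderiv I f g.
  apply: (chain_wderiv hd Lf Lg df) => s; apply: aeW => x _; by rewrite cpart_pack.
have hd' s : chain l m (fun j => d s j.+1).
  have [h1 h2] := hd s; split => j jm; [exact: h1|exact: h2].
have [Lw ww] := wderivP Lg wg.
have gw := is_wderiv_unique Lf Lg Lw wg ww.
split.
  split => //; exists g; split => //.
  have [|Sg _] := IH (fun s j => d s j.+1) g hd' Lg => //.
  by move=> s; apply: aeW => x _; rewrite cpart_pack.
have [|_ hw] := IH (fun s j => d s j.+1) (wderiv I f) hd' Lw.
  by move=> s; apply: aeS gw => x h /h <-; rewrite cpart_pack.
by case=> [_|j jm] //; rewrite wderivnS; exact: hw.
Qed.

End Complex_parts.

(** * Interpolation inequalities *)

Section Interpolation.
Context {R : realType}.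
Local Notation leb := (@lebesgue_measure R).
Implicit Types (f g F : R -> R) (a b c h x y z : R).

Lemma primitive_horner a b (p : {poly R}) : primitive a b (horner p) (horner p^`()%R).
Proof.
apply: primitive_C1; first by move=> x; exact: derivable_horner.
  exact: continuous_horner.
by move=> x; rewrite derivE.
Qed.

Lemma sqrD_le (u v : R) : (u + v) ^+ 2 <= 2 * u ^+ 2 + 2 * v ^+ 2.
Proof. by have := sqr_ge0 (u - v); rewrite sqrrB sqrrD; lra. Qed.

(** F(x)^2 <= 2 F(y)^2 + 2 (F(x) - F(y))^2, integrated over [y]. *)
Lemma sup_bound_itv a b F f x : a < b -> real_L2 `[a, b] F -> real_L2 `[a, b] f ->
  primitive a b F f -> `[a, b]%classic x ->
  F x ^+ 2 * (b - a) <= 2 * nsq `[a, b] F + 2 * (b - a) ^+ 2 * nsq `[a, b] f.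
Proof.
move=> ab LF Lf hF xab; have mab := @measurable_itvcc R a b; set N := nsq _ f.
rewrite -Rint_cst ?(ltW ab)//.
have -> : 2 * nsq `[a, b] F + 2 * (b - a) ^+ 2 * N =
    \int[leb]_(y in `[a, b]) (2 * F y ^+ 2 + 2 * (b - a) * N).
  rewrite RintD//; [|by apply: RintegrableZ => //; exact: L2_sqr|exact: Rintegrable_cst].
  rewrite RintZ//; last exact: L2_sqr.
  by rewrite Rint_cst ?(ltW ab)//; rewrite -/(nsq _ _); ring.
apply: Rint_le => //; first exact: Rintegrable_cst.
  apply: RintegrableD => //; last exact: Rintegrable_cst.
  by apply: RintegrableZ => //; exact: L2_sqr.
move=> y yab; have := primitive_holder Lf hF xab yab; rewrite -/N => h.
have : `|x - y| * N <= (b - a) * N.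
  apply: ler_wpM2r; first exact: nsq_ge0.
  by move: xab yab; rewrite /= !in_itv/= => /andP[? ?] /andP[? ?]; rewrite ler_norml; lra.
by have := sqrD_le (F y) (F x - F y); rewrite (addrC (F y)) subrK; lra.
Qed.

(* Weigh [f] with the parabola vanishing at both ends of the interval and
   integrate by parts. *)
Lemma derivative_bound_itv a b F f g : a < b -> real_L2 `[a, b] F -> real_L2 `[a, b] f ->
  real_L2 `[a, b] g -> primitive a b F f -> primitive a b f g ->
  nsq `[a, b] f * (b - a) ^+ 2 <=
    72 * nsq `[a, b] F + 2 * (b - a) ^+ 4 * nsq `[a, b] g.
Proof.
move=> ab LF Lf Lg hF hf; have mab := @measurable_itvcc R a b.
set L := b - a; have L0 : 0 < L by rewrite subr_gt0.
set NF := nsq _ F; set Ng := nsq _ g.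
have NF0 : 0 <= NF by exact: nsq_ge0.
have Ng0 : 0 <= Ng by exact: nsq_ge0.
pose p : {poly R} := ('X - a%:P) * (b%:P - 'X).
(* [P] is a primitive of the parabola [p]; it gives the total weight L^3 / 6. *)
pose P : {poly R} := (L / 2) *: ('X - a%:P) ^+ 2 - 3^-1 *: ('X - a%:P) ^+ 3.
have dP : horner P^`()%R = horner p.
  apply/funext => t; by rewrite /P /p /L !poly.derivE !hornerE /=; field.
have dp : horner p^`()%R = fun t => a + b - 2 * t.
  by apply/funext => t; rewrite /p !poly.derivE !hornerE; ring.
have Lcont (q : {poly R}) : real_L2 `[a, b] (horner q).
  by apply: L2_continuous; apply: continuous_subspaceT; exact: continuous_horner.
have hp : primitive a b (horner p) (horner p^`()%R) := @primitive_horner a b p.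
have W : \int[leb]_(t in `[a, b]) p.[t] = L ^+ 3 / 6.
  have := @primitive_horner a b P; rewrite dP => /(_ a b (lexx _) (ltW ab) (lexx _)) <-.
  by rewrite /P !hornerE/= -/L; field.
have p0 t : `[a, b]%classic t -> 0 <= p.[t].
  by rewrite /= in_itv/= /p !hornerE => /andP[? ?]; apply: mulr_ge0; lra.
have ibp : ip `[a, b] (horner p) f = - ip `[a, b] (horner p^`()%R) F.
  have := primitive_mul (L2_Rintegrable (Lcont p^`()%R)) (L2_Rintegrable Lf) hp hF.
  move=> /(_ a b (lexx _) (ltW ab) (lexx _)); rewrite RintD//; [|exact: Rintegrable_mul|exact: Rintegrable_mul].
  have pa : p.[a] = 0 by rewrite /p !hornerE subrr mul0r.
  have pb : p.[b] = 0 by rewrite /p !hornerE subrr mulr0.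
  rewrite pa pb !mul0r subrr => /eqP.
  by rewrite eq_sym addrC addr_eq0 => /eqP.
have bound_ip : (ip `[a, b] (horner p) f) ^+ 2 <= L ^+ 3 * NF.
  rewrite ibp sqrrN; apply: (le_trans (cauchy_schwarz mab (Lcont _) LF)).
  apply: ler_wpM2r => //.
  have -> : L ^+ 3 = L ^+ 2 * (b - a) by rewrite -/L; ring.
  rewrite -nsq_cst ?(ltW ab)//; apply: nsq_le => //; first exact: L2_cst.
  move=> t; rewrite /= in_itv/= dp => /andP[? ?].
  by rewrite (gtr0_norm L0) ler_norml /L; lra.
(* Bound for the oscillation of [f]: the values of [f] differ from its weighted mean by at most
   [kap], and that mean is controlled by [F] through the integration by parts. *)
pose kap := Num.sqrt (L * Ng).
have kap2 : kap ^+ 2 = L * Ng by rewrite sqr_sqrtr// mulr_ge0// ltW.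
have pointwise x : `[a, b]%classic x ->
    f x ^+ 2 * (L ^+ 3 / 6) ^+ 2 <= 2 * (kap * (L ^+ 3 / 6)) ^+ 2 + 2 * (L ^+ 3 * NF).
  move=> xab; set w := L ^+ 3 / 6.
  have w0 : 0 < w by rewrite divr_gt0 ?exprn_gt0.
  have sp : Rintegrable `[a, b] (horner p) := L2_Rintegrable (Lcont p).
  have spf : Rintegrable `[a, b] (fun t => p.[t] * f t) := Rintegrable_mul mab (Lcont p) Lf.
  have h1 : `|f x * w - ip `[a, b] (horner p) f| <= kap * w.
    rewrite /w -W -!RintZ// -RintB//; last exact: RintegrableZ.
    apply: Rint_abs_le => //; [by apply: RintegrableB => //; exact: RintegrableZ|exact: RintegrableZ|].
    move=> t tab; have -> : f x * p.[t] - p.[t] * f t = (f x - f t) * p.[t] by ring.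
    rewrite normrM (ger0_norm (p0 t tab)); apply: ler_wpM2r; first exact: p0.
    rewrite -(@ler_pXn2r _ 2)// ?nnegrE ?sqrtr_ge0// real_normK ?num_real// kap2.
    apply: (le_trans (primitive_holder Lg hf xab tab)); apply: ler_wpM2r => //.
    by move: xab tab; rewrite /= !in_itv/= => /andP[? ?] /andP[? ?]; rewrite ler_norml /L; lra.
  have h2 : (f x * w - ip `[a, b] (horner p) f) ^+ 2 <= (kap * w) ^+ 2.
    rewrite -(real_normK (num_real (f x * w - _))) lerXn2r// ?nnegrE//.
    by rewrite mulr_ge0 ?sqrtr_ge0// ltW.
  have := sqrD_le (f x * w - ip `[a, b] (horner p) f) (ip `[a, b] (horner p) f).
  by rewrite subrK exprMn; lra.
have : \int[leb]_(x in `[a, b]) ((L ^+ 3 / 6) ^+ 2 * f x ^+ 2) <=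
  \int[leb]_(x in `[a, b]) (2 * (kap * (L ^+ 3 / 6)) ^+ 2 + 2 * (L ^+ 3 * NF)).
  apply: Rint_le => //; [by apply: RintegrableZ => //; exact: L2_sqr|exact: Rintegrable_cst|].
  by move=> x xab; rewrite mulrC; exact: pointwise.
rewrite RintZ//; last exact: L2_sqr.
rewrite Rint_cst ?(ltW ab)// -/(nsq _ _) -/L [(kap * _) ^+ 2]exprMn kap2 => h.
rewrite -(@ler_pM2l _ (L ^+ 4 / 36)); last by rewrite divr_gt0 ?exprn_gt0.
have e1 : (L ^+ 3 / 6) ^+ 2 * nsq `[a, b] f = L ^+ 4 / 36 * (nsq `[a, b] f * L ^+ 2) by field.
by rewrite -e1; apply: (le_trans h); rewrite le_eqVlt; apply/orP; left; apply/eqP; field.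
Qed.

(** Pieces of length [h] are cut off until less than 2 h, or exactly 2 h, remains; on pieces of
    length between [h] and 2 h the one-piece estimate holds with the constant 2 * 2^4 = 32. *)
Lemma derivative_bound_pieces a b F f g h : 0 < h -> a + h <= b -> real_L2 `[a, b] F ->
  real_L2 `[a, b] f -> real_L2 `[a, b] g -> primitive a b F f -> primitive a b f g ->
  nsq `[a, b] f * h ^+ 2 <= 72 * nsq `[a, b] F + 32 * h ^+ 4 * nsq `[a, b] g.
Proof.
move=> h0; have [n hn] : exists n : nat, b - a <= n.+2%:R * h.
  exists (Num.bound ((b - a) / h)); rewrite -ler_pdivrMr//.
  have [ab|ba] := leP 0 ((b - a) / h); last by apply: (le_trans (ltW ba)).
  apply: (le_trans (ltW (archi_boundP ab))); rewrite ler_nat; lia.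
elim: n a b hn => [|n IH] a b hn ab LF Lf Lg hF hf; last first.
  have [b2|b2] := leP (a + 2 * h) b; last first.
    apply: IH => //; rewrite -[n.+2]addn2 natrD mulrDl.
    have : 0 <= n%:R * h by rewrite mulr_ge0// ltW.
    lra.
  have [ac cb] : a <= a + h /\ a + h <= b by lra.
  rewrite (nsq_cat ac cb LF) (nsq_cat ac cb Lf) (nsq_cat ac cb Lg).
  have sub u v w : a <= v -> w <= b -> real_L2 `[a, b] u -> real_L2 `[v, w] u.
    by move=> av wb Lu; exact: (L2_sub Lu).
  have := IH a (a + h); have := IH (a + h) b.
  have e1 : b - (a + h) <= n.+2%:R * h.
    by move: hn; rewrite -[n.+3]addn1 natrD mulrDl mul1r; lra.
  have e2 : a + h - a <= n.+2%:R * h.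
    rewrite addrAC subrr add0r -[leLHS]mul1r; apply: ler_wpM2r; first exact: ltW.
    by rewrite ler1n.
  move=> /(_ e1 ltac:(lra) (sub F _ _ ac (lexx _) LF) (sub f _ _ ac (lexx _) Lf)
     (sub g _ _ ac (lexx _) Lg) (primitive_sub ac (lexx _) hF) (primitive_sub ac (lexx _) hf)) h2.
  move=> /(_ e2 ltac:(lra) (sub F _ _ (lexx _) cb LF) (sub f _ _ (lexx _) cb Lf)
     (sub g _ _ (lexx _) cb Lg) (primitive_sub (lexx _) cb hF) (primitive_sub (lexx _) cb hf)) h1.
  by rewrite mulrDl; lra.
have := derivative_bound_itv (ltac:(lra) : a < b) LF Lf Lg hF hf.
set L := b - a in hn *; have Lh : h <= L by rewrite /L; lra.
have : nsq `[a, b] f * h ^+ 2 <= nsq `[a, b] f * L ^+ 2.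
  by apply: ler_wpM2l; [exact: nsq_ge0|rewrite lerXn2r// nnegrE; lra].
have : L ^+ 4 * nsq `[a, b] g <= (2 * h) ^+ 4 * nsq `[a, b] g.
  by apply: ler_wpM2r; [exact: nsq_ge0|rewrite lerXn2r// nnegrE; lra].
by rewrite exprMn; lra.
Qed.

Section Edge.
Variables (l : \bar R) (h0 : R).
Hypotheses (h0_gt0 : 0 < h0) (h0_le : (h0%:E <= l)%E).
Local Notation I := (edge_itv l).

Let l_gt0 : (0 < l)%E.
Proof. by apply: lt_le_trans h0_le. Qed.

Lemma edge_itv_window h x : 0 < h -> h <= h0 -> I x ->
  exists a, [/\ I a, I (a + h), a <= x & x <= a + h].
Proof.
move=> hgt0 hh0 [x0 xl]; have [xh|hx] := leP x h.
  exists 0; split; rewrite ?add0r//; first exact: edge_itv0.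
  split; first exact: ltW.
  by apply: le_trans h0_le; rewrite lee_fin.
exists (x - h); split; rewrite ?subrK//; last lra.
split; first lra.
by apply: le_trans xl; rewrite lee_fin; lra.
Qed.

Lemma sup_bound F f h x : real_L2 I F -> real_L2 I f -> primitive_on l F f ->
  0 < h -> h <= h0 -> I x ->
  F x ^+ 2 * h <= 2 * nsq I F + 2 * h ^+ 2 * nsq I f.
Proof.
move=> LF Lf hF hgt0 hh0 Ix; have mI := measurable_edge_itv l.
have [a [Ia Iah ax xa]] := edge_itv_window hgt0 hh0 Ix.
have sub := edge_itv_sub Ia Iah.
have e : a + h - a = h by rewrite addrAC subrr add0r.
have := @sup_bound_itv a (a + h) F f x.
rewrite e ltrDl => /(_ hgt0 (L2_locally LF Ia Iah) (L2_locally Lf Ia Iah)).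
move=> /(_ (primitive_on_itv hF Ia Iah)) /=; rewrite in_itv/= ax xa => /(_ isT).
have := nsqS mI (measurable_itvcc a (a + h)) sub LF.
have := nsqS mI (measurable_itvcc a (a + h)) sub Lf.
have : 0 <= h ^+ 2 by exact: sqr_ge0.
by move=> u1 u2 u3 u4; apply: (le_trans u4); nra.
Qed.

(** Monotone convergence on a ray; on a bounded edge the full interval is already one of the [0, b].
    Only lengths from [h0] on are considered because the estimates on intervals need room for the
    scale. *)
Lemma nsq_exhaust f B : measurable_fun I f ->
  (forall b, I b -> h0 <= b -> real_L2 `[0, b] f /\ nsq `[0, b] f <= B) ->
  real_L2 I f /\ nsq I f <= B.
Proof.
move=> mf hb; have mI := measurable_edge_itv l.
have B0 : 0 <= B.
  have Ih0 : I h0 by split => //; exact: ltW.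
  by have [_] := hb h0 Ih0 (lexx _); apply: le_trans; exact: nsq_ge0.
suff h : ((\int[leb]_(x in I) ((f x ^+ 2)%:E)) <= B%:E)%E.
  have Lf : real_L2 I f by split => //; exact: le_lt_trans h (ltry _).
  split => //; rewrite -lee_fin /nsq -(integral_Rintegrable mI (L2_sqr mI Lf)). exact: h.
have [[r rl]|ly] : (exists r, l = r%:E) \/ l = +oo%E.
  by case: l l_gt0 => [r _|_|//]; [left; exists r|right].
  have IE : I = `[0, r]%classic.
    by apply/seteqP; split => x; rewrite /edge_itv rl/= in_itv/= lee_fin; [case=> -> ->|move=> /andP[]].
  have Ir : I r by split; rewrite ?rl//; move: l_gt0; rewrite rl lte_fin; exact: ltW.
  have h0r : h0 <= r by move: h0_le; rewrite rl lee_fin.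
  have [Lr Nr] := hb r Ir h0r.
  by rewrite IE integral_Rintegrable//; exact: L2_sqr.
pose J (n : nat) : set R := `[0, n%:R]%classic.
have IE : I = \bigcup_n J n.
  apply/seteqP; split => x; rewrite /edge_itv ly /J/=.
    move=> [x0 _]; exists (Num.bound x) => //=; rewrite in_itv/= x0/=.
    by apply: ltW; exact: archi_boundP.
  by move=> [n _] /=; rewrite in_itv/= => /andP[-> _]; rewrite leey.
have nd : nondecreasing_seq J.
  by move=> n m nm; apply/subsetPset; apply: subset_itvcc => //; rewrite ler_nat.
have mfn n : measurable_fun (J n) (fun x => (f x ^+ 2)%:E).
  apply/measurable_EFinP/measurable_funX; apply: measurable_funS mf => //.
  by rewrite IE; exact: bigcup_sup.
have cv : ((\int[leb]_(x in J i) ((f x ^+ 2)%:E)) @[i --> \oo] -->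
    \int[leb]_(x in \bigcup_i J i) ((f x ^+ 2)%:E))%E.
  apply: ge0_nondecreasing_set_cvg_integral => //.
    by move=> n; exact: measurable_itvcc.
  by move=> n x _; rewrite lee_fin sqr_ge0.
rewrite IE; apply: cvge_le cv; exists (Num.bound h0) => // n /= nb.
have h0n : h0 <= n%:R.
  apply: ltW; apply: (lt_le_trans (archi_boundP (ltW h0_gt0))).
  by rewrite ler_nat.
have In : I n%:R by split; rewrite ?ly ?leey.
have [Ln Nn] := hb _ In h0n.
by rewrite (integral_Rintegrable (measurable_itvcc _ _) (L2_sqr (measurable_itvcc _ _) Ln)) lee_fin.
Qed.

Lemma derivative_bound F f g h : real_L2 I F -> real_L2 I f -> real_L2 I g ->
  primitive_on l F f -> primitive_on l f g -> 0 < h -> h <= h0 ->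
  nsq I f * h ^+ 2 <= 72 * nsq I F + 32 * h ^+ 4 * nsq I g.
Proof.
move=> LF Lf Lg hF hf hgt0 hh0; have mI := measurable_edge_itv l.
have [mf _] := Lf; have I0 : I 0 := edge_itv0 l_gt0.
suff : nsq I f <= (72 * nsq I F + 32 * h ^+ 4 * nsq I g) / h ^+ 2.
  by rewrite ler_pdivlMr// exprn_gt0.
apply: (proj2 (nsq_exhaust mf _)) => b Ib hb.
have sub := edge_itv_sub I0 Ib.
have hFb := primitive_on_itv hF I0 Ib; have hfb := primitive_on_itv hf I0 Ib.
split; first exact: (L2_locally Lf I0 Ib).
rewrite ler_pdivlMr ?exprn_gt0//.
apply: (le_trans (derivative_bound_pieces hgt0 _ (L2_locally LF I0 Ib)
  (L2_locally Lf I0 Ib) (L2_locally Lg I0 Ib) hFb hfb)); first by rewrite add0r; lra.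
have := nsqS mI (measurable_itvcc 0 b) sub LF.
have := nsqS mI (measurable_itvcc 0 b) sub Lg.
have : 0 <= h ^+ 4 by rewrite exprn_ge0// ltW.
by nra.
Qed.

(* The scaled squared norms satisfy a discrete convexity inequality at every
   scale [h]; the two top terms are compared at scale [theta * h] to absorb. *)
Lemma interpolation k : exists2 C : R, 0 <= C & forall d h, chain l k d ->
  0 < h -> h <= h0 -> forall j, (j <= k)%N ->
  h ^+ (2 * j) * nsq I (d j) <= C * (h ^+ (2 * k) * nsq I (d k) + nsq I (d 0%N)).
Proof.
elim: k => [|k [C C0 IH]].
  exists 1 => // d h hd hgt0 hh0 j; rewrite leqn0 => /eqP ->.
  by rewrite mul1r muln0 expr0 mul1r lerDl nsq_ge0.
case: k C C0 IH => [|k] C C0 IH.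
  exists 1 => // d h hd hgt0 hh0 j.
  have u0 : 0 <= h ^+ (2 * 1) * nsq I (d 1%N) by rewrite mulr_ge0 ?nsq_ge0// exprn_ge0// ltW.
  rewrite leq_eqVlt ltnS leqn0 mul1r => /orP[/eqP->|/eqP->]; first by rewrite lerDl nsq_ge0.
  by rewrite muln0 expr0 mul1r lerDr.
(* Makes 72 C th^2 at most 1/2, so that the term in [B] produced by the induction hypothesis is
   absorbed; [K] collects twice what remains. *)
pose th : R := (1 + 144 * C)^-1.
have th0 : 0 < th by rewrite invr_gt0; nra.
have th1 : th <= 1 by rewrite invf_le1; nra.
have thC : th * (1 + 144 * C) = 1 by rewrite /th mulVf//; nra.
pose K := 64 + 144 * C * th ^- (2 * k.+1).
have K0 : 0 <= K.
  have : 0 <= th ^- (2 * k.+1) by rewrite invr_ge0 exprn_ge0// ltW.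
  by rewrite /K => ?; nra.
pose C' := 1 + C * (K + 1).
have C'1 : 1 <= C' by rewrite /C'; nra.
exists C'; first by apply: le_trans C'1.
move=> d h hd hgt0 hh0.
have hk : chain l k.+1 d := chain_leq (leqnSn _) hd.
set A := h ^+ (2 * k.+2) * nsq I (d k.+2); set Z := nsq I (d 0%N).
have A0 : 0 <= A by rewrite mulr_ge0 ?nsq_ge0// exprn_ge0// ltW.
have Z0 : 0 <= Z by exact: nsq_ge0.
set B := h ^+ (2 * k.+1) * nsq I (d k.+1).
have B0 : 0 <= B by rewrite mulr_ge0 ?nsq_ge0// exprn_ge0// ltW.
have BK : B <= K * (A + Z).
  set D := h ^+ (2 * k) * nsq I (d k).
  have step : B <= 72 * D + 32 * A.
    have := derivative_bound (chain_L2 hd (leqW (leqnSn k))) (chain_L2 hd (leqnSn k.+1))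
      (chain_L2 hd (leqnn _)) (chain_primitive hd (leqW (ltnSn k)))
      (chain_primitive hd (ltnSn k.+1)) hgt0 hh0.
    move=> /(ler_wpM2l (exprn_ge0 (2 * k) (ltW hgt0))).
    by rewrite /A /B /D !mulnS !exprD; lra.
  have IHD : D * th ^+ (2 * k) <= C * (B * th ^+ (2 * k.+1) + Z).
    have thh : 0 < th * h by rewrite mulr_gt0.
    have thh0 : th * h <= h0 by nra.
    have := IH d (th * h) hk thh thh0 k (leqnSn k).
    by rewrite !exprMn /D /B -/Z; lra.
  have {}IHD : D <= C * th ^+ 2 * B + C * th ^- (2 * k.+1) * Z.
    have t0 : 0 < th ^+ (2 * k) by rewrite exprn_gt0.
    rewrite -(ler_pM2r t0); apply: (le_trans IHD).
    have t2 : 0 < th ^+ 2 by rewrite exprn_gt0.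
    rewrite mulnS exprD invfM mulrDr mulrDl lerD//.
      by rewrite le_eqVlt; apply/orP; left; apply/eqP; ring.
    have -> : C * ((th ^+ 2)^-1 * (th ^+ (2 * k))^-1) * Z * th ^+ (2 * k) = C * Z * (th ^+ 2)^-1.
      by field; rewrite !gt_eqF.
    apply: ler_peMr; first by rewrite mulr_ge0.
    by rewrite invf_ge1// exprn_ile1// ltW.
  have th2 : C * th ^+ 2 <= 144^-1.
    have : th ^+ 2 <= th by rewrite expr2; nra.
    nra.
  have {th2}th2 : C * th ^+ 2 * B <= 144^-1 * B by apply: ler_wpM2r.
  rewrite /K; pose q := th ^- (2 * k.+1); rewrite -/q in IHD *.
  have q0 : 0 <= C * q by rewrite mulr_ge0// invr_ge0 exprn_ge0// ltW.
  have : 0 <= C * q * A by rewrite mulr_ge0.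
  lra.
have AZ : 0 <= A + Z by rewrite addr_ge0.
move=> j; rewrite leq_eqVlt => /predU1P[->|].
  apply: (@le_trans _ _ (A + Z)); first by rewrite /A lerDl.
  by rewrite ler_peMl.
rewrite ltnS => jk; apply: (le_trans (IH d h hk hgt0 hh0 j jk)).
have : C * (B + Z) <= C * (K * (A + Z) + (A + Z)).
  by apply: ler_wpM2l => //; apply: lerD => //; rewrite lerDr.
by rewrite -/A -/B -/Z /C'; lra.
Qed.

Lemma sup_bound_chain k : (0 < k)%N -> exists2 C : R, 0 < C & forall d h x, chain l k d ->
  0 < h -> h <= h0 -> I x ->
  d 0%N x ^+ 2 * h <= C * (h ^+ (2 * k) * nsq I (d k) + nsq I (d 0%N)).
Proof.
move=> k0; have [C C0 hC] := interpolation k.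
exists (2 + 2 * C); first lra.
move=> d h x hd hgt0 hh0 Ix.
have := sup_bound (chain_L2 hd (leq0n k)) (chain_L2 hd k0) (chain_primitive hd k0) hgt0 hh0 Ix.
have := hC d h hd hgt0 hh0 1%N k0; rewrite muln1.
have : 0 <= h ^+ (2 * k) * nsq I (d k) by rewrite mulr_ge0 ?nsq_ge0// exprn_ge0// ltW.
lra.
Qed.

End Edge.
End Interpolation.

(** * Jets on a metric graph *)

Section Jets.
Context {R : realType} (G : metric_graph R).
Local Notation leb := (@lebesgue_measure R).
Local Notation I c := (edge_itv (len c.1)).

Definition family : Type := (edge G * bool)%type -> R -> R.
Implicit Types (f g w : family) (a b h x y z : R).

Definition family_L2 f : Prop := forall c, real_L2 (I c) (f c).

(** As the index runs over real and imaginary parts, this is the real part of the complex scalar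
    product of L^2(G). *)
Definition bil f g : R := \sum_c ip (I c) (f c) (g c).

Definition comb a f b g : family := fun c x => a * f c x + b * g c x.

Let mI (c : edge G * bool) : measurable (I c).
Proof. exact: measurable_edge_itv. Qed.
Hint Resolve mI : core.

Lemma family_L2_comb a f b g : family_L2 f -> family_L2 g -> family_L2 (comb a f b g).
Proof. by move=> Lf Lg c; apply: L2D => //; apply: L2Z. Qed.

Lemma bilC f g : bil f g = bil g f.
Proof. by apply: eq_bigr => c _; exact: ipC. Qed.

Lemma bil_ge0 f : 0 <= bil f f.
Proof. by apply: sumr_ge0 => c _; rewrite ip_nsq nsq_ge0. Qed.
Hint Resolve bil_ge0 : core.

Lemma bil_combl a f b g w : family_L2 f -> family_L2 g -> family_L2 w ->
  bil (comb a f b g) w = a * bil f w + b * bil g w.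
Proof.
move=> Lf Lg Lw; rewrite /bil !mulr_sumr -big_split; apply: eq_bigr => c _ /=.
by rewrite ipDl ?ipZl//; apply: L2Z.
Qed.

Lemma bil_combr a f b g w : family_L2 f -> family_L2 g -> family_L2 w ->
  bil w (comb a f b g) = a * bil w f + b * bil w g.
Proof. by move=> Lf Lg Lw; rewrite bilC bil_combl// !(bilC w). Qed.

Lemma bil_comb a f b g : family_L2 f -> family_L2 g ->
  bil (comb a f b g) (comb a f b g) = a ^+ 2 * bil f f + 2 * a * b * bil f g + b ^+ 2 * bil g g.
Proof.
move=> Lf Lg; have Lc := family_L2_comb a b Lf Lg.
by rewrite bil_combl// !bil_combr// (bilC g f); ring.
Qed.

Lemma bil_cauchy_schwarz f g : family_L2 f -> family_L2 g ->
  bil f g ^+ 2 <= bil f f * bil g g.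
Proof.
move=> Lf Lg; apply: quadratic_ge0 => // t.
by have := bil_ge0 (comb 1 f t g); rewrite bil_comb//; lra.
Qed.

Lemma nsq_le_bil f c : nsq (I c) (f c) <= bil f f.
Proof.
rewrite /bil (bigD1 c)//= ip_nsq lerDl.
by apply: sumr_ge0 => i _; rewrite ip_nsq nsq_ge0.
Qed.

Lemma eq_bil f g f' g' :
  (forall c x, I c x -> f c x * g c x = f' c x * g' c x) -> bil f g = bil f' g'.
Proof. by move=> h; apply: eq_bigr => c _; apply: eq_Rint => x /h. Qed.

Lemma sum_pairs (F : edge G * bool -> R) :
  \sum_c F c = \sum_e (F (e, true) + F (e, false)).
Proof.
rewrite (eq_bigr (fun c => F (c.1, c.2))); last by case.
rewrite -(pair_bigA _ (fun e s => F (e, s)))/=; apply: eq_bigr => e _.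
by rewrite big_bool.
Qed.

(* The index [(e, false)] or [(e, true)] is the real or imaginary part on the edge [e]; the
   functions of a jet are the successive derivatives. *)
Definition jet : Type := (edge G * bool)%type -> nat -> R -> R.
Implicit Types d : jet.

Definition level (j : nat) d : family := fun c => d c j.

Definition jcomb a d b d' : jet := fun c j x => a * d c j x + b * d' c j x.

Lemma level_jcomb j a d b d' : level j (jcomb a d b d') = comb a (level j d) b (level j d').
Proof. by []. Qed.

Definition jet_chain (m : nat) d : Prop := forall c, chain (len c.1) m (d c).

(** The conditions are real linear, so they are imposed on real and imaginary parts separately; for
    odd [j] the sign (-1)^j at a far end is -1, whatever [j]. *)
Definition vertex_conditions (m : nat) d : Prop :=
  (forall j, (j < m)%N -> ~~ odd j -> forall (e e' : edge G) (p p' : bool) (v : vertex G),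
     end_vertex e p = Some v -> end_vertex e' p' = Some v ->
     forall s, d (e, s) j (end_coord e p) = d (e', s) j (end_coord e' p')) /\
  (forall j, (j < m)%N -> odd j -> forall (v : vertex G) s,
     \sum_(c : edge G * bool | end_vertex c.1 c.2 == Some v)
       (-1) ^+ c.2 * d (c.1, s) j (end_coord c.1 c.2) = 0).

Definition jet_space (m : nat) d : Prop := jet_chain m d /\ vertex_conditions m d.

Lemma jet_space_comb m a d b d' : jet_space m d -> jet_space m d' ->
  jet_space m (jcomb a d b d').
Proof.
move=> [hd [v1 v2]] [hd' [v1' v2']]; split.
  by move=> c; apply: chainD; apply: chainZ.
split=> [j jm oj e e' p p' v ev ev' s|j jm oj v s].
  by rewrite /jcomb (v1 j jm oj e e' p p' v)// (v1' j jm oj e e' p p' v).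
rewrite (eq_bigr (fun c : edge G * bool =>
   a * ((-1) ^+ c.2 * d (c.1, s) j (end_coord c.1 c.2)) +
   b * ((-1) ^+ c.2 * d' (c.1, s) j (end_coord c.1 c.2)))); last first.
  by move=> c _; rewrite /jcomb; ring.
by rewrite big_split/= -!mulr_sumr v2// v2'// !mulr0 addr0.
Qed.

Lemma jet_space_leq n m d : (n <= m)%N -> jet_space m d -> jet_space n d.
Proof.
move=> nm [h1 [h2 h3]]; split; first by move=> c; exact: chain_leq (h1 c).
by split=> j jn; [exact/h2/(leq_trans jn)|exact/h3/(leq_trans jn)].
Qed.

Lemma jet_L2 m d j : jet_space m d -> (j <= m)%N -> family_L2 (level j d).
Proof. by move=> [h _] jm c; exact: chain_L2 (h c) jm. Qed.

Definition energy_sq (j : nat) d : R := bil (level j d) (level j d).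

Lemma energy_sq_ge0 j d : 0 <= energy_sq j d.
Proof. exact: bil_ge0. Qed.

Lemma min_length : exists h0 : R, [/\ 0 < h0, h0 <= 1 & forall e : edge G, (h0%:E <= len e)%E].
Proof.
have : forall e : edge G, exists2 r : R, 0 < r & (r%:E <= len e)%E.
  move=> e; have := len_gt0 e; case: (len e) => [r r0|_|//]; first by exists r.
  by exists 1; rewrite ?leey.
move=> /fin_all_exists2[r r0 rl]; exists (\big[Num.min/1]_e r e); split.
- by apply/bigmin_gtP; split.
- by apply: bigmin_le_id.
- by move=> e; apply: le_trans (rl e); rewrite lee_fin; exact: bigmin_le_cond.
Qed.

Lemma jet_interpolation k : (0 < k)%N -> exists hm C, [/\ 0 < hm, 0 < C &
  forall h d, jet_chain k d -> 0 < h -> h <= hm ->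
    (forall j, (j <= k)%N ->
      h ^+ (2 * j) * energy_sq j d <= C * (h ^+ (2 * k) * energy_sq k d + energy_sq 0 d)) /\
    (forall c x, I c x ->
      d c 0%N x ^+ 2 * h <= C * (h ^+ (2 * k) * energy_sq k d + energy_sq 0 d))].
Proof.
move=> k0; have [hm [hm_gt0 hm_le1 hm_len]] := min_length.
have : forall e : edge G, exists2 C : R, 0 <= C & forall (d : nat -> R -> R) h, chain (len e) k d ->
  0 < h -> h <= hm ->
  (forall j, (j <= k)%N ->
  h ^+ (2 * j) * nsq (edge_itv (len e)) (d j) <=
    C * (h ^+ (2 * k) * nsq (edge_itv (len e)) (d k) + nsq (edge_itv (len e)) (d 0%N))) /\
  (forall x, edge_itv (len e) x -> d 0%N x ^+ 2 * h <=
    C * (h ^+ (2 * k) * nsq (edge_itv (len e)) (d k) + nsq (edge_itv (len e)) (d 0%N))).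
  move=> e; have [C1 C10 h1] := interpolation hm_gt0 (hm_len e) k.
  have [C2 C20 h2] := sup_bound_chain hm_gt0 (hm_len e) k0.
  exists (C1 + C2); first by rewrite addr_ge0// ltW.
  move=> d h hd hgt0 hh; set A := h ^+ (2 * k) * _ + _.
  have A0 : 0 <= A by rewrite addr_ge0 ?nsq_ge0// mulr_ge0 ?nsq_ge0// exprn_ge0// ltW.
  split=> [j jk|x Ix].
    by apply: (le_trans (h1 d h hd hgt0 hh j jk)); apply: ler_wpM2r => //; lra.
  by apply: (le_trans (h2 d h x hd hgt0 hh Ix)); apply: ler_wpM2r => //; lra.
move=> /fin_all_exists2[C C0 hC].
have C1 e : C e <= 1 + \sum_e C e.
  rewrite (bigD1 e)//= addrCA lerDl addr_ge0//; exact: sumr_ge0.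
exists hm, (1 + \sum_e C e); split => //; first by rewrite ltr_pwDl// sumr_ge0.
move=> h d hd hgt0 hh; set CC := 1 + _ in C1 *.
have CC0 : 0 <= CC by rewrite addr_ge0// sumr_ge0.
have hk : 0 <= h ^+ (2 * k) by rewrite exprn_ge0// ltW.
pose A c := h ^+ (2 * k) * nsq (I c) (d c k) + nsq (I c) (d c 0%N).
have A0 c : 0 <= A c by rewrite addr_ge0 ?nsq_ge0// mulr_ge0 ?nsq_ge0.
have AE : \sum_c A c = h ^+ (2 * k) * energy_sq k d + energy_sq 0 d.
  rewrite big_split/= -mulr_sumr; congr (_ * _ + _); apply: eq_bigr => c _; exact/esym/ip_nsq.
split=> [j jk|c x Ix].
  rewrite -AE !mulr_sumr; apply: ler_sum => c _.
  have [h1 _] := hC c.1 (d c) h (hd c) hgt0 hh.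
  by rewrite ip_nsq; apply: (le_trans (h1 j jk)); apply: ler_wpM2r; [exact: A0|exact: C1].
have [_ h2] := hC c.1 (d c) h (hd c) hgt0 hh.
apply: (le_trans (h2 x Ix)); rewrite -AE; apply: ler_pM => //; first exact: A0.
by rewrite (bigD1 c)//= lerDl; exact: sumr_ge0.
Qed.

Definition modulus d (e : edge G) (x : R) : R :=
  Num.sqrt (d (e, false) 0%N x ^+ 2 + d (e, true) 0%N x ^+ 2).

Lemma modulus_sqr d e x : modulus d e x ^+ 2 = d (e, false) 0%N x ^+ 2 + d (e, true) 0%N x ^+ 2.
Proof. by rewrite sqr_sqrtr// addr_ge0 ?sqr_ge0. Qed.

Lemma modulus_ge0 d e x : 0 <= modulus d e x.
Proof. exact: sqrtr_ge0. Qed.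

Lemma modulus_L2 m d e : jet_space m d -> real_L2 (edge_itv (len e)) (modulus d e).
Proof.
move=> hd; have L s := jet_L2 hd (leq0n m) (e, s).
have m0 s := L2_measurable (L s).
have me := measurable_edge_itv (len e).
apply/(real_L2P me); split.
  apply: measurableT_comp; first by apply: continuous_measurable_fun; exact: sqrt_continuous.
  apply: measurable_funD; apply: measurable_funX; exact: m0.
have := RintegrableD me (L2_sqr me (L false)) (L2_sqr me (L true)).
by apply: (eq_Rintegrable me) => x _; rewrite modulus_sqr.
Qed.

Definition potential (V : edge G -> R -> R) d : family := fun c x => V c.1 x * d c 0%N x.

Definition pot V d d' : R := bil (potential V d) (level 0 d').

Definition power_integral (q : R) d : R :=
  \sum_(e : edge G) \int[leb]_(x in edge_itv (len e)) (modulus d e x `^ q).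

Definition jet_energy k V mu q d : R :=
  2^-1 * (energy_sq k d + pot V d d) - mu / q * power_integral q d.

Definition gpack d : gfun G := fun e => pack (fun s => d (e, s) 0%N).

(** Functions of H^m are continuous by definition, so their values are matched everywhere; the
    derivatives are representatives picked by choice and can be matched only almost everywhere. *)
Definition represents (m : nat) (u : gfun G) d : Prop :=
  (forall c x, I c x -> cpart c.2 (u c.1 x) = d c 0%N x) /\
  (forall j, (j <= m)%N -> forall c,
     {ae leb, forall x, I c x -> cpart c.2 (graph_deriv j u c.1 x) = d c j x}).

Lemma end_coord_dom (e : edge G) (p : bool) (v : vertex G) :
  end_vertex e p = Some v -> edge_itv (len e) (end_coord e p).
Proof.
case: p => [/= ev|_]; last exact: edge_itv0 (len_gt0 e).
have : len e <> +oo%E by move=> /trg_ray; rewrite ev.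
have := len_gt0 e; case: (len e) => [r /= r0 _|//|//]; split; last exact: lexx.
by move: r0; rewrite lte_fin => /ltW.
Qed.

Lemma cpartD s (z w : R[i]) : cpart s (z + w) = cpart s z + cpart s w.
Proof. by case: s z w => -[a b] [a' b']. Qed.

Lemma cpart_sum s (T : Type) (r : seq T) (P : pred T) (F : T -> R[i]) :
  cpart s (\sum_(i <- r | P i) F i) = \sum_(i <- r | P i) cpart s (F i).
Proof.
apply: (big_morph (cpart s)); first by move=> z w; exact: cpartD.
by case: s.
Qed.

Lemma cpart_sign s (p : bool) j (z : R[i]) : odd j ->
  cpart s ((if p then -1 else 1) ^+ j * z) = (-1) ^+ p * cpart s z.
Proof.
move=> oj; case: p; last by rewrite /= expr1n !mul1r.
rewrite -signr_odd oj !expr1 !mulN1r.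
by case: s z => -[a b].
Qed.

Lemma cont_on_chain m (d : bool -> nat -> R -> R) (l : \bar R) j : (0 < l)%E ->
  (forall s, chain l m (d s)) -> (j < m)%N ->
  cont_on (edge_itv l) (pack (fun s => d s j)).
Proof.
move=> l0 hd jm; apply/cont_onP => s.
have := chain_continuous l0 (hd s) jm.
by rewrite (_ : (fun x => cpart s (pack _ x)) = d s j)//; apply/funext => x; rewrite cpart_pack.
Qed.

(** [cont_rep] is picked by choice, but two continuous representatives agree at every point of the
    edge, its ends included; this is what carries the vertex conditions between jets and H^m. *)
Lemma graph_deriv_contE m u d j e x : jet_chain m d -> represents m u d -> (j < m)%N ->
  edge_itv (len e) x ->
  graph_deriv_cont j u e x = pack (fun s => d (e, s) j) x.
Proof.
move=> hd [_ hu] jm Ix; apply: (cont_repP (len_gt0 e)) => //.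
  by apply: (@cont_on_chain m (fun s => d (e, s)) _ j (len_gt0 e)) => // s; exact: (hd (e, s)).
apply/ae_eq_onP => s; apply: aeS (hu j (ltnW jm) (e, s)) => y h Iy.
by rewrite cpart_pack -h.
Qed.

Lemma jet_of_Sobolev m u : (0 < m)%N -> graph_Sobolev m u ->
  exists d, jet_space m d /\ represents m u d.
Proof.
move=> m0 [[[ucont uglue] uS] ueven uodd].
have /choice[D hD] := fun e => Sobolev_chain (len_gt0 e) (uS e).
pose d : jet := fun c => D c.1 c.2.
have hd : jet_chain m d by move=> c; have [] := hD c.1 c.2.
have hr : represents m u d.
  split; last by move=> j jm c; have [_ /(_ j jm)] := hD c.1 c.2.
  move=> c; apply: (continuous_ae_eq (len_gt0 c.1)).
  - by have /cont_onP := ucont c.1; apply.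
  - exact: (chain_continuous (len_gt0 _) (hd c) m0).
  - by have [_ /(_ 0%N (leq0n m))] := hD c.1 c.2.
exists d; split => //; split => //; split=> [j jm oj e e' p p' v ev ev' s|j jm oj v s].
  have [_ /(_ (e, end_coord e p) (e', end_coord e' p') v)] := ueven j jm oj.
  move=> /(_ ltac:(by exists p) ltac:(by exists p')) /=.
  rewrite !(graph_deriv_contE hd hr jm); [|exact: end_coord_dom ev'|exact: end_coord_dom ev].
  by move=> /(congr1 (cpart s)); rewrite !cpart_pack.
have := uodd j jm oj v; move=> /(congr1 (cpart s)); rewrite cpart_sum => h.
transitivity (cpart s (0 : R[i])); last by case: s {h}.
rewrite -h; apply: eq_bigr => c /eqP cv.
rewrite /inward_deriv cpart_sign// (graph_deriv_contE hd hr jm); last exact: end_coord_dom cv.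
by rewrite cpart_pack.
Qed.

Lemma Sobolev_of_jet m d : (0 < m)%N -> jet_space m d ->
  graph_Sobolev m (gpack d) /\ represents m (gpack d) d.
Proof.
move=> m0 hd; have [hc [veven vodd]] := hd.
have hS e : Sobolev (edge_itv (len e)) m (gpack d e) /\ forall j, (j <= m)%N -> forall s,
    {ae leb, forall x, edge_itv (len e) x ->
      d (e, s) j x = cpart s (wderivn (edge_itv (len e)) j (gpack d e) x)}.
  apply: (chain_Sobolev (len_gt0 e) (d := fun s => d (e, s))).
  - by move=> s; exact: (hc (e, s)).
  - by apply: L2_pack => s; exact: jet_L2 hd (leq0n m) (e, s).
  - by move=> s; apply: aeW => x _; rewrite cpart_pack.
have hr : represents m (gpack d) d.
  split=> [[e s] x Ix|j jm [e s]]; first by rewrite cpart_pack.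
  by have [_ /(_ j jm s)] := hS e; apply: aeS => x h /h ->.
have gc j : (j < m)%N -> forall e, cont_on (edge_itv (len e)) (pack (fun s => d (e, s) j)).
  move=> jm e.
  exact: (@cont_on_chain m (fun s => d (e, s)) _ j (len_gt0 e) (fun s => hc (e, s)) jm).
split => //; split.
- split; last by move=> e; have [] := hS e.
  split; first exact: gc.
  move=> [e x] [e' x'] v [p [/= ev ->]] [p' [/= ev' ->]]; apply: cpart_inj => s.
  by rewrite !cpart_pack; apply: (veven 0%N m0 isT e e' p p' v).
- move=> j jm oj; split.
    move=> e; have /cont_onP h := gc j jm e; apply/cont_onP => s.
    apply: (subspace_eq_continuous _ (h s)) => x /set_mem Ix.
    by rewrite /from_subspace/= (graph_deriv_contE hc hr jm Ix).
  move=> [e x] [e' x'] v [p [/= ev ->]] [p' [/= ev' ->]]; apply: cpart_inj => s.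
  rewrite !(graph_deriv_contE hc hr jm); [|exact: end_coord_dom ev'|exact: end_coord_dom ev].
  by rewrite !cpart_pack; apply: (veven j jm oj e e' p p' v).
- move=> j jm oj v; apply: cpart_inj => s; rewrite cpart_sum.
  transitivity (0 : R); last by case: s.
  apply: etrans (vodd j jm oj v s); apply: eq_bigr => c /eqP cv.
  rewrite /inward_deriv cpart_sign// (graph_deriv_contE hc hr jm); last exact: end_coord_dom cv.
  by rewrite cpart_pack.
Qed.

End Jets.

(** * Energy estimates *)

Section Powers.
Context {R : realType}.
Implicit Types (a b p q S : R).

Lemma le_powR r a b : 0 <= r -> 0 <= a -> a <= b -> a `^ r <= b `^ r.
Proof.
move=> r0 a0 ab; apply: (ge0_ler_powR r0) => //; rewrite nnegrE//.
exact: le_trans ab.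
Qed.

(** From [b1] on, b^(N - p) is at least 1 / delta and the power of order [N] dominates; below [b1]
    the constant does. *)
Lemma powR_young p N delta : 0 <= p -> p < N%:R -> 0 < delta ->
  exists C, 0 <= C /\ forall b, 0 <= b -> b `^ p <= delta * b ^+ N + C.
Proof.
move=> p0 pN d0; have r0 : 0 < N%:R - p by rewrite subr_gt0.
pose b1 := Num.max 1 (delta^-1 `^ ((N%:R - p)^-1)).
have b1_ge1 : 1 <= b1 by rewrite le_max lexx.
exists (b1 `^ p); split; first exact: powR_ge0.
move=> b b0; have dN : 0 <= delta * b ^+ N by rewrite mulr_ge0 ?exprn_ge0// ltW.
have [bb1|b1b] := leP b b1.
  by apply: (@le_trans _ _ (b1 `^ p)); [exact: le_powR|rewrite lerDr].
apply: (@le_trans _ _ (delta * b ^+ N)); last by rewrite lerDl powR_ge0.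
have bgt0 : 0 < b by apply: lt_trans b1b; exact: lt_le_trans b1_ge1.
rewrite -powR_mulrn// -[N%:R](subrK p) powRD; last by rewrite (gt_eqF bgt0) implybT.
rewrite mulrA -[leLHS]mul1r ler_wpM2r ?powR_ge0//.
have : delta^-1 <= b `^ (N%:R - p).
  have {1}-> : delta^-1 = (delta^-1 `^ ((N%:R - p)^-1)) `^ (N%:R - p).
    by rewrite -powRrM mulVf ?gt_eqF// powRr1// invr_ge0 ltW.
  apply: le_powR; [exact: ltW|exact: powR_ge0|].
  by apply: (le_trans _ (ltW b1b)); rewrite le_max lexx orbT.
by rewrite -(@ler_pM2l _ delta)// divff ?gt_eqF.
Qed.

Lemma bernoulli_expn (t : R) N : 0 <= t <= 1 -> 1 - t ^+ N <= N%:R * (1 - t).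
Proof.
move=> /andP[t0 t1]; elim: N => [|N IH]; first by rewrite expr0 subrr mul0r.
rewrite exprS -natr1 mulrDl mul1r.
have -> : 1 - t * t ^+ N = (1 - t) + t * (1 - t ^+ N) by ring.
have : 0 <= 1 - t ^+ N by rewrite subr_ge0 exprn_ile1.
by nra.
Qed.

Lemma powR_sqr q a : 2 <= q -> 0 <= a -> a `^ q = a `^ (q - 2) * a ^+ 2.
Proof.
move=> q2 a0; rewrite -powR_mulrn// -powRD ?subrK//.
by rewrite (_ : (q == 0) = false)//; apply/negbTE; rewrite gt_eqF//; lra.
Qed.

Lemma powR_le_sqr q a S : 2 <= q -> 0 <= a -> a <= S -> a `^ q <= S `^ (q - 2) * a ^+ 2.
Proof.
move=> q2 a0 aS; rewrite powR_sqr//; apply: ler_wpM2r; first exact: sqr_ge0.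
by apply: le_powR => //; lra.
Qed.

(** A mean value inequality by Bernoulli: with t = b / a in [0, 1] one has t^q >= t^N for an integer
    [N] at least [q], and 1 - t^N <= N (1 - t). *)
Lemma powR_dist q N S a b : 2 <= q -> q <= N%:R -> 0 <= a -> a <= S -> 0 <= b -> b <= S ->
  `|a `^ q - b `^ q| <= N%:R * S `^ (q - 2) * ((a + b) * `|a - b|).
Proof.
move=> q2 qN; wlog ab : a b / b <= a.
  move=> h a0 aS b0 bS; have [ab|/ltW ab] := leP b a; first exact: h.
  by rewrite distrC (addrC a) (distrC a); exact: h.
move=> a0 aS b0 bS.
have S0 : 0 <= S `^ (q - 2) by exact: powR_ge0.
have N0 : 0 <= N%:R :> R by [].
have [a00|an0] := eqVneq a 0.
  have b00 : b = 0 by apply/le_anti; rewrite b0 -{1}a00 ab.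
  by rewrite a00 b00 !subrr normr0 !mulr0.
have {}an0 : 0 < a by rewrite lt_neqAle eq_sym an0.
have q0 : 0 <= q by lra.
rewrite !ger0_norm ?subr_ge0//; last exact: le_powR.
pose t := b / a; have bt : b = a * t by rewrite /t mulrC divfK// gt_eqF.
have t01 : 0 <= t <= 1 by rewrite divr_ge0//= ler_pdivrMr// mul1r.
have /andP[t0 t1] := t01.
have tN : t ^+ N <= t `^ q.
  have [t00|tn0] := eqVneq t 0.
    rewrite t00 powR0 ?expr0n; last by rewrite gt_eqF//; lra.
    by case: (N) qN => // h; exfalso; rewrite /= in h; lra.
  have tgt0 : 0 < t by rewrite lt_neqAle eq_sym tn0.
  by rewrite -powR_mulrn//; apply: ger_powR => //; rewrite tgt0.
have h1 : a `^ q - b `^ q <= a `^ q * (N%:R * (1 - t)).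
  rewrite {1}bt powRM// -[X in X - _]mulr1 -mulrBr ler_wpM2l ?powR_ge0//.
  by apply: le_trans (bernoulli_expn N t01); lra.
apply: (le_trans h1).
have h2 := powR_le_sqr q2 a0 aS.
have -> : (a + b) * (a - b) = a ^+ 2 * ((1 + t) * (1 - t)) by rewrite {1 2}bt; ring.
have u0 : 0 <= N%:R * (1 - t) by rewrite mulr_ge0//; lra.
apply: (le_trans (ler_wpM2r u0 h2)).
have -> : N%:R * S `^ (q - 2) * (a ^+ 2 * ((1 + t) * (1 - t))) =
  S `^ (q - 2) * a ^+ 2 * (N%:R * (1 - t)) * (1 + t) by ring.
by apply: ler_peMr; [rewrite !mulr_ge0// ?sqr_ge0//; lra|lra].
Qed.

End Powers.

(** * Bounds for the potential and power terms; coercivity *)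

Section Energy_bounds.
Context {R : realType} (G : metric_graph R).
Local Notation leb := (@lebesgue_measure R).
Local Notation I c := (edge_itv (len c.1)).
Implicit Types (d : jet G) (V : edge G -> R -> R).

Let mI (e : edge G) : measurable (edge_itv (len e)).
Proof. exact: measurable_edge_itv. Qed.
Hint Resolve mI : core.

Definition bounded_split V (V2 Vinf : edge G -> R -> R) (M : R) : Prop := 0 <= M /\
  forall e, [/\ real_L2 (edge_itv (len e)) (V2 e), measurable_fun (edge_itv (len e)) (Vinf e),
    forall x, edge_itv (len e) x -> `|Vinf e x| <= M &
    forall x, edge_itv (len e) x -> V e x = V2 e x + Vinf e x].

(** Truncation at an essential bound makes [Vinf] bounded at every point; the correction vanishes
    almost everywhere and is moved into the L^2 part. Truncation does not increase absolute values,
    so decay at infinity survives. *)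
Lemma L2_plus_Linfty_bounded V V2 Vinf : L2_plus_Linfty V V2 Vinf ->
  exists V2' Vinf' M, bounded_split V V2' Vinf' M /\ forall e x, `|Vinf' e x| <= `|Vinf e x|.
Proof.
move=> hV; have /fin_all_exists[B hB] : forall e, exists B : R, 0 <= B /\
    {ae leb, forall x, edge_itv (len e) x -> `|Vinf e x| <= B}.
  move=> e; have [_ [_ [B hB]] _] := hV e; exists (Num.max 0 B); split; first by rewrite le_max lexx.
  by apply: aeS hB => x h /h {}h; rewrite le_max h orbT.
pose M := \sum_e B e.
have BM e : B e <= M.
  by rewrite /M (bigD1 e)//= lerDl; apply: sumr_ge0 => i _; have [] := hB i.
have M0 : 0 <= M by apply: sumr_ge0 => i _; have [] := hB i.
pose W e x := Num.max (- M) (Num.min M (Vinf e x)).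
have WM e x : `|W e x| <= M.
  by rewrite ler_norml /W le_max lexx/= ge_max ge_min lexx/=; lra.
have WV e x : `|W e x| <= `|Vinf e x|.
  rewrite /W; case: (leP M (Vinf e x)) => h1.
    by case: (leP (- M) M) => h2; [rewrite !ger0_norm//; lra|lra].
  case: (leP (- M) (Vinf e x)) => h2 //.
  by rewrite normrN ger0_norm// ler0_norm; lra.
exists (fun e x => V2 e x + (Vinf e x - W e x)), W, M; split; last exact: WV.
split=> // e; have [L2 [mVinf _] VE] := hV e.
have mW : measurable_fun (edge_itv (len e)) (W e).
  apply: (measurable_maxr (f := fun=> - M)); first exact: measurable_cst.
  by apply: (measurable_minr (f := fun=> M)) => //; exact: measurable_cst.
split => //.
- apply: (ae_L2 _ _ L2).
    apply: measurable_funD; first by case: L2.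
    exact: measurable_funB.
  have [_ hBe] := hB e; apply: aeS hBe => x h /h {}h.
  rewrite (_ : W e x = Vinf e x) ?subrr ?addr0// /W.
  have /andP[h1 h2] : - M <= Vinf e x <= M by rewrite -ler_norml (le_trans h).
  by rewrite (_ : Num.min _ _ = Vinf e x); [exact/max_idPr|exact/min_idPr].
- by move=> x Ix; rewrite VE//; ring.
Qed.

Variable k : nat.
Hypothesis k_gt0 : (0 < k)%N.

(** At scale [h] the top energy comes with the factor C h^(2k) / h, which is at most C h for h <= 1
    since [k] is positive. *)
Lemma jet_sup_small eta : 0 < eta -> exists2 C, 0 <= C & forall d, jet_space k d ->
  forall c x, I c x -> d c 0%N x ^+ 2 <= eta * energy_sq k d + C * energy_sq 0 d.
Proof.
move=> eta0; have [hm [C [hm0 C0 hC]]] := jet_interpolation G k_gt0.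
pose h := Num.min hm (Num.min 1 (eta / C)).
have h0 : 0 < h by rewrite !lt_min hm0 ltr01 divr_gt0.
have hhm : h <= hm by rewrite ge_min lexx.
have h1 : h <= 1 by rewrite !ge_min lexx orbT.
have heta : h * C <= eta by rewrite -ler_pdivlMr// !ge_min lexx !orbT.
exists (C / h); first by rewrite divr_ge0 ?ltW.
move=> d hd c x Ix; have [hd' _] := hd.
have [_ /(_ c x Ix)] := hC h d hd' h0 hhm.
rewrite -ler_pdivlMr// => /le_trans; apply.
have -> : C * (h ^+ (2 * k) * energy_sq k d + energy_sq 0 d) / h =
   C * h ^+ (2 * k) / h * energy_sq k d + C / h * energy_sq 0 d by ring.
rewrite lerD2r; apply: ler_wpM2r; first exact: energy_sq_ge0.
rewrite ler_pdivrMr//; apply: (@le_trans _ _ (C * (h ^+ 2))).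
  rewrite ler_wpM2l ?(ltW C0)//; apply: ler_wiXn2l => //; [exact: ltW|lia].
by rewrite expr2; nra.
Qed.

Lemma jet_sup : exists2 C, 0 <= C & forall d, jet_space k d ->
  forall c x, I c x -> d c 0%N x ^+ 2 <= C * (energy_sq k d + energy_sq 0 d).
Proof.
have [C C0 hC] := jet_sup_small ltr01; exists (1 + C); first lra.
move=> d hd c x Ix; apply: (le_trans (hC d hd c x Ix)).
have := energy_sq_ge0 k d; have := energy_sq_ge0 0 d; nra.
Qed.

Lemma jet_bounded d : jet_space k d -> exists2 S, 0 <= S &
  forall c x, I c x -> `|d c 0%N x| <= S.
Proof.
move=> hd; have [C C0 hC] := jet_sup.
set B := C * (energy_sq k d + energy_sq 0 d).
have B0 : 0 <= B by rewrite mulr_ge0// addr_ge0 ?energy_sq_ge0.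
exists (Num.sqrt B); first exact: sqrtr_ge0.
move=> c x Ix; rewrite -(@ler_pXn2r _ 2)// ?nnegrE ?sqrtr_ge0//.
by rewrite real_normK ?num_real// sqr_sqrtr//; exact: hC.
Qed.

(** The splitting is asked only of the products with [f], so that [W2] may be altered wherever [f]
    vanishes; [potential_far] relies on this. The L^2 part v contributes by |v| f^2 <= eta S v^2 +
    f^2 / eta. *)
Lemma ip_potential_bound (D : set R) (W W2 Wi f : R -> R) S eta M : measurable D ->
  real_L2 D (fun x => W x * f x) -> real_L2 D f -> real_L2 D W2 ->
  (forall x, D x -> W x * f x = W2 x * f x + Wi x * f x) ->
  (forall x, D x -> `|Wi x| <= M) -> (forall x, D x -> f x ^+ 2 <= S) -> 0 < eta ->
  `|ip D (fun x => W x * f x) f| <= eta * S * nsq D W2 + (eta^-1 + M) * nsq D f.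
Proof.
move=> mD LW Lf L2 WE Wib fS eta0; have s1 := L2_sqr mD L2; have s2 := L2_sqr mD Lf.
rewrite /nsq -(RintZ mD _ s1) -(RintZ mD _ s2).
rewrite -(RintD mD); [|exact: (RintegrableZ mD)|exact: (RintegrableZ mD)].
apply: (Rint_abs_le mD); first exact: (Rintegrable_mul mD LW Lf).
  by apply: (RintegrableD mD); exact: (RintegrableZ mD).
move=> x Dx; rewrite WE//; have f2 := fS x Dx; have hw := Wib x Dx.
move: f2 hw; set g := f x; set v := W2 x; set w := Wi x => f2 hw.
have -> : (v * g + w * g) * g = v * g * g + w * g ^+ 2 by ring.
apply: (le_trans (ler_normD _ _)); rewrite (mulrDl eta^-1) addrA; apply: lerD; last first.
  by rewrite normrM (ger0_norm (sqr_ge0 g)) ler_wpM2r ?sqr_ge0.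
have e1 : eta * S * v ^+ 2 + eta^-1 * g ^+ 2 = (eta ^+ 2 * S * v ^+ 2 + g ^+ 2) / eta.
  by field; rewrite gt_eqF.
rewrite e1 ler_pdivlMr// -[X in _ * X](gtr0_norm eta0) -normrM.
have : eta ^+ 2 * (g ^+ 2 * v ^+ 2) <= eta ^+ 2 * (S * v ^+ 2).
  by rewrite ler_wpM2l ?sqr_ge0// ler_wpM2r ?sqr_ge0.
move=> h; rewrite ler_norml.
have := sqr_ge0 (eta * g * v - g); have := sqr_ge0 (eta * g * v + g).
rewrite sqrrB sqrrD !exprMn => h1 h2; have := sqr_ge0 g; nra.
Qed.

Section Potential.
Variables (V V2 Vinf : edge G -> R -> R) (M : R).
Hypothesis VE : bounded_split V V2 Vinf M.

Lemma potential_L2 d : jet_space k d -> family_L2 (potential V d).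
Proof.
move=> hd c; have [M0 /(_ c.1)[L2 mVi Vib VEc]] := VE.
have [S S0 hS] := jet_bounded hd.
have L0 := jet_L2 hd (leq0n k) c.
have md := L2_measurable L0.
apply: (@eq_L2 _ _ (mI c.1) (fun x => V2 c.1 x * d c 0%N x + Vinf c.1 x * d c 0%N x)).
  by move=> x Ix; rewrite /potential VEc// mulrDl.
apply: L2D => //.
  apply: (@L2_le _ _ (mI c.1) _ (V2 c.1) S) => //.
    by apply: measurable_funM => //; case: L2.
  by move=> x Ix; rewrite normrM mulrC; apply: ler_wpM2r => //; exact: hS.
apply: (@L2_le _ _ (mI c.1) _ (level 0 d c) M) => //.
  exact: measurable_funM.
by move=> x Ix; rewrite normrM; apply: ler_wpM2r => //; exact: Vib.
Qed.

(** Each edge is counted once for either part, so this is twice the squared norm of [V2]. *)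
Definition V2_sq : R := \sum_(c : edge G * bool) nsq (I c) (V2 c.1).

Lemma V2_sq_ge0 : 0 <= V2_sq.
Proof. by apply: sumr_ge0 => c _; exact: nsq_ge0. Qed.

Lemma pot_bound d S eta : jet_space k d -> 0 < eta -> 0 <= S ->
  (forall c x, I c x -> d c 0%N x ^+ 2 <= S) ->
  `|pot V d d| <= eta * S * V2_sq + (eta^-1 + M) * energy_sq 0 d.
Proof.
move=> hd eta0 S0 hS; have LV := potential_L2 hd; have L0 := jet_L2 hd (leq0n k).
apply: (le_trans (ler_norm_sum _ _ _)).
rewrite /V2_sq /energy_sq /bil !mulr_sumr -big_split/=; apply: ler_sum => c _.
have [M0 /(_ c.1)[L2 mVi Vib VEc]] := VE; rewrite ip_nsq.
apply: (ip_potential_bound (mI c.1) (LV c) (L0 c) L2 _ Vib (hS c) eta0) => x Ix.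
by rewrite VEc// mulrDl.
Qed.

(** Infinitesimal form-boundedness: the L^2 part is tested against the supremum of the square of the
    function, which costs as little top energy as desired. *)
Lemma pot_relative_bound eta : 0 < eta -> exists2 K, 0 <= K & forall d, jet_space k d ->
  `|pot V d d| <= eta * energy_sq k d + K * energy_sq 0 d.
Proof.
move=> eta0; have [M0 _] := VE; have N0 := V2_sq_ge0.
pose e1 := eta / (V2_sq + 1).
have e10 : 0 < e1 by rewrite divr_gt0//; lra.
have e1N : e1 * V2_sq <= eta.
  rewrite /e1 mulrAC ler_pdivrMr; last lra.
  by rewrite ler_pM2l//; lra.
have [C C0 hC] := jet_sup_small e10.
exists (C * V2_sq + (1 + M)); first by rewrite addr_ge0 ?mulr_ge0//; lra.
move=> d hd; have Ek := energy_sq_ge0 k d; have E0 := energy_sq_ge0 0 d.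
set S := e1 * energy_sq k d + C * energy_sq 0 d.
have S0 : 0 <= S by apply: addr_ge0; apply: mulr_ge0 => //; exact: ltW.
apply: (le_trans (pot_bound hd ltr01 S0 _)).
  by move=> c x Ix; exact: hC.
rewrite invr1 mul1r /S.
have := ler_wpM2r Ek e1N; lra.
Qed.

End Potential.

Section Power.
Variable q : R.
Hypotheses (q_gt2 : 2 < q) (q_lt : q < 4 * k%:R + 2).

Lemma modulus_measurable d e : jet_space k d ->
  measurable_fun (edge_itv (len e)) (modulus d e).
Proof. by move=> hd; case: (modulus_L2 e hd). Qed.

Lemma energy_sq_modulus d : jet_space k d ->
  energy_sq 0 d = \sum_(e : edge G) nsq (edge_itv (len e)) (modulus d e).
Proof.
move=> hd; have L0 := jet_L2 hd (leq0n k).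
rewrite /energy_sq /bil sum_pairs.
apply: eq_bigr => e _; rewrite !ip_nsq /nsq addrC.
rewrite -RintD//; [|exact: (L2_sqr (mI e) (L0 (e, false)))|exact: (L2_sqr (mI e) (L0 (e, true)))].
by apply: eq_Rint => x _; rewrite modulus_sqr.
Qed.

Lemma modulus_le d S e x : (forall c x, I c x -> d c 0%N x ^+ 2 <= S) ->
  edge_itv (len e) x -> modulus d e x ^+ 2 <= 2 * S.
Proof.
move=> hS Ix; rewrite modulus_sqr.
by have := hS (e, false) x Ix; have := hS (e, true) x Ix; lra.
Qed.

Lemma modulus_sup T : 0 <= T -> exists2 S, 0 <= S & forall d, jet_space k d ->
  energy_sq 0 d <= T -> energy_sq k d <= T ->
  forall e x, edge_itv (len e) x -> modulus d e x <= S.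
Proof.
move=> T0; have [C C0 hC] := jet_sup.
pose B := C * (T + T).
have B0 : 0 <= B by rewrite mulr_ge0// addr_ge0.
exists (Num.sqrt (2 * B)); first exact: sqrtr_ge0.
move=> g hg g0 gk a x Ix; have B20 : 0 <= 2 * B by rewrite mulr_ge0.
rewrite -[leLHS]ger0_norm ?modulus_ge0// -sqrtr_sqr ler_sqrt//.
apply: modulus_le Ix => c y Iy; apply: (le_trans (hC g hg c y Iy)).
by apply: ler_wpM2l => //; exact: lerD.
Qed.

Lemma power_measurable d e : jet_space k d ->
  measurable_fun (edge_itv (len e)) (fun x => modulus d e x `^ q).
Proof.
move=> hd; apply: (measurableT_comp (measurable_powR q)).
exact: modulus_measurable.
Qed.

Lemma modulus_bounded d : jet_space k d -> exists2 S, 0 <= S &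
  forall e x, edge_itv (len e) x -> modulus d e x <= S.
Proof.
move=> hd; have [S S0 hS] := jet_bounded hd.
exists (Num.sqrt (2 * S ^+ 2)); first exact: sqrtr_ge0.
move=> e x Ix; rewrite ler_sqrt ?mulr_ge0 ?sqr_ge0// -modulus_sqr.
apply: modulus_le Ix => c y Iy; rewrite -real_normK ?num_real//.
by apply: lerXn2r; rewrite ?nnegrE//; exact: hS.
Qed.

Lemma power_Rintegrable d e : jet_space k d ->
  Rintegrable (edge_itv (len e)) (fun x => modulus d e x `^ q).
Proof.
move=> hd; have [S S0 hS] := modulus_bounded hd.
have sg := RintegrableZ (mI e) (S `^ (q - 2)) (L2_sqr (mI e) (modulus_L2 e hd)).
apply: (Rintegrable_le (mI e) (power_measurable hd) _ sg) => x Ix.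
by rewrite ger0_norm ?powR_ge0//; apply: powR_le_sqr; [exact: ltW|exact: modulus_ge0|exact: hS].
Qed.

Lemma power_integral_ge0 d : 0 <= power_integral q d.
Proof. by apply: sumr_ge0 => e _; apply: Rintegral_ge0 => x _; exact: powR_ge0. Qed.

Lemma power_integral_le d B : jet_space k d ->
  (forall e x, edge_itv (len e) x -> modulus d e x `^ (q - 2) <= B) ->
  power_integral q d <= B * energy_sq 0 d.
Proof.
move=> hd hB; rewrite energy_sq_modulus// mulr_sumr; apply: ler_sum => e _.
have s2 := L2_sqr (mI e) (modulus_L2 e hd).
rewrite /nsq -RintZ//; apply: Rint_le => //; [exact: power_Rintegrable|exact: RintegrableZ|].
move=> x Ix; rewrite powR_sqr ?modulus_ge0 ?(ltW q_gt2)//.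
by apply: ler_wpM2r; [exact: sqr_ge0|exact: hB].
Qed.

(** A Gagliardo-Nirenberg inequality, with the scale chosen from the value b = |u(x)|^2 itself: at h
    = w / b the mass term of the sup bound is at most half of b h and is absorbed, which leaves
    b^(2k) <= A [energy_sq k d]. Since (q - 2) / 2 < 2k, [powR_young] concludes. *)
Lemma power_subcritical T eps : 0 < T -> 0 < eps -> exists2 K, 0 <= K &
  forall d, jet_space k d -> energy_sq 0 d <= T ->
  forall e x, edge_itv (len e) x -> modulus d e x `^ (q - 2) <= eps * energy_sq k d + K.
Proof.
have q2 := q_gt2; have q4 := q_lt.
move=> T0 eps0; have [hm [C [hm0 C0 hC]]] := jet_interpolation G k_gt0.
pose w := 4 * C * T; have w0 : 0 < w by rewrite !mulr_gt0.
pose A := 4 * C * w ^+ (2 * k) / w.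
have A0 : 0 <= A by rewrite !mulr_ge0 ?invr_ge0 ?exprn_ge0// ltW.
pose p := (q - 2) / 2.
have p0 : 0 <= p by rewrite divr_ge0//; lra.
have pk : p < (2 * k)%:R by rewrite natrM ltr_pdivrMr//; lra.
have dA : 0 < eps / (A + 1) by rewrite divr_gt0//; lra.
have [K1 [K10 hK1]] := powR_young p0 pk dA.
(* Below this value of b the scale w / b would exceed [hm]; there the power is simply bounded. *)
pose B0 := w / hm.
exists (B0 `^ p + K1); first by rewrite addr_ge0// powR_ge0.
move=> d hd dT e x Ix; set b := modulus d e x ^+ 2.
have b0 : 0 <= b by exact: sqr_ge0.
have -> : modulus d e x `^ (q - 2) = b `^ p.
  by rewrite /b -powR_mulrn ?modulus_ge0// -powRrM /p mulrC divfK.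
have Ek := energy_sq_ge0 k d.
have [bB|Bb] := leP b B0.
  have := le_powR p0 b0 bB; have := mulr_ge0 (ltW eps0) Ek; lra.
have bgt0 : 0 < b by apply: le_lt_trans Bb; rewrite divr_ge0 ?ltW.
pose h := w / b; have h0 : 0 < h by rewrite divr_gt0.
have hh : h <= hm by move: Bb; rewrite /h /B0 ltr_pdivrMr// ler_pdivrMr// mulrC => /ltW.
have bh : b * h = w by rewrite /h mulrC divfK// gt_eqF.
have [_ hsup] := hC h d (hd.1) h0 hh.
have hb : b * h <= 2 * (C * (h ^+ (2 * k) * energy_sq k d + T)).
  rewrite /b -ler_pdivlMr//.
  have -> : 2 * (C * (h ^+ (2 * k) * energy_sq k d + T)) / h =
     2 * (C * (h ^+ (2 * k) * energy_sq k d + T) / h) by ring.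
  apply: modulus_le Ix => c y Iy; rewrite ler_pdivlMr//.
  apply: (le_trans (hsup c y Iy)); rewrite ler_wpM2l ?(ltW C0)//.
  by rewrite lerD2l.
have hb2 : w <= 4 * C * (h ^+ (2 * k) * energy_sq k d).
  by move: hb; rewrite bh /w; lra.
have bA : b ^+ (2 * k) <= A * energy_sq k d.
  rewrite /A mulrAC ler_pdivlMr//.
  have := ler_wpM2l (exprn_ge0 (2 * k) b0) hb2.
  have gen (x1 x2 x3 x4 : R) : x1 * (4 * x2 * (x3 * x4)) = 4 * x2 * (x1 * x3) * x4 by ring.
  by rewrite gen -exprMn bh mulrC.
have := hK1 b b0.
have h1 : eps / (A + 1) * b ^+ (2 * k) <= eps * energy_sq k d.
  apply: (@le_trans _ _ (eps / (A + 1) * (A * energy_sq k d))).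
    by rewrite ler_wpM2l// ltW.
  rewrite mulrAC ler_pdivrMr; last lra.
  by have := mulr_ge0 (ltW eps0) Ek; lra.
have := powR_ge0 B0 p; lra.
Qed.

Section Coercive.
Variables (mu : R) (V V2 Vinf : edge G -> R -> R) (M : R).
Hypothesis mu_gt0 : 0 < mu.
Hypothesis VE : bounded_split V V2 Vinf M.

(** Of the coefficient 1/2 of the top energy, the potential consumes 1/8 and the power term 1/8,
    which leaves 1/4. *)
Lemma energy_coercive T : 0 < T -> exists2 K, 0 <= K & forall d, jet_space k d ->
  energy_sq 0 d <= T -> 4^-1 * energy_sq k d - K <= jet_energy k V mu q d.
Proof.
move=> T0; have [K1 K10 hK1] := pot_relative_bound VE (eta := 4^-1) ltac:(lra).
have q0 : 0 < q by apply: lt_trans q_gt2.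
pose eps := q / (8 * mu * T).
have eps0 : 0 < eps by rewrite divr_gt0// !mulr_gt0.
have [K2 K20 hK2] := power_subcritical T0 eps0.
exists (K1 * T + mu / q * (K2 * T)).
  have mq : 0 <= mu / q by rewrite divr_ge0 ?ltW.
  apply: addr_ge0; first by apply: mulr_ge0 => //; exact: ltW.
  by apply: mulr_ge0 => //; apply: mulr_ge0 => //; exact: ltW.
move=> d hd dT; have Ek := energy_sq_ge0 k d; have E0 := energy_sq_ge0 0 d.
have hp := hK1 d hd.
have hn : power_integral q d <= (eps * energy_sq k d + K2) * T.
  apply: (le_trans (power_integral_le hd (hK2 d hd dT))).
  by apply: ler_wpM2l => //; apply: addr_ge0 => //; apply: mulr_ge0 => //; exact: ltW.
have {}hn : mu / q * power_integral q d <= 8^-1 * energy_sq k d + mu / q * (K2 * T).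
  apply: (le_trans (ler_wpM2l (_ : 0 <= mu / q) hn)); first by rewrite divr_ge0 ?ltW.
  rewrite le_eqVlt; apply/orP; left; apply/eqP; rewrite /eps.
  by field; rewrite !gt_eqF.
rewrite /jet_energy.
have : - pot V d d <= 4^-1 * energy_sq k d + K1 * energy_sq 0 d.
  by apply: le_trans hp; rewrite lerNl; have := ler_norm (- pot V d d); rewrite normrN; lra.
have : K1 * energy_sq 0 d <= K1 * T by rewrite ler_wpM2l.
have : 0 <= K1 * T by rewrite mulr_ge0// ltW.
lra.
Qed.

Lemma normsq_represents u d : jet_space k d -> represents k u d ->
  graph_normsq u = (energy_sq 0 d)%:E.
Proof.
move=> hd [hu _]; have L0 := jet_L2 hd (leq0n k).
have Lu e : L2 (edge_itv (len e)) (u e).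
  apply/L2P => s; apply: (eq_L2 (mI e) _ (L0 (e, s))) => x Ix.
  by rewrite /level -(hu (e, s) x Ix).
rewrite /graph_normsq /energy_sq /bil.
rewrite sum_pairs.
rewrite -sumEFin; apply: eq_bigr => e _; rewrite (normsqE (Lu e)) !ip_nsq addrC.
congr (_ + _)%:E; apply: eq_nsq => x Ix.
  by rewrite /level -(hu (e, true) x Ix).
by rewrite /level -(hu (e, false) x Ix).
Qed.

Lemma energy_represents u d : jet_space k d -> represents k u d ->
  graph_Sobolev k u -> energy k V mu q u = jet_energy k V mu q d.
Proof.
move=> hd [hu0 huk] hS; have L0 := jet_L2 hd (leq0n k); have Lk := jet_L2 hd (leqnn k).
have LV := potential_L2 VE hd.
have normcE e x : edge_itv (len e) x -> normc (u e x) = modulus d e x.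
  move=> Ix; apply/eqP; rewrite -(@eqrXn2 _ 2)// ?modulus_ge0//; last first.
    by case: (u e x) => a b; exact: sqrtr_ge0.
  by rewrite normc_sqr modulus_sqr -(hu0 (e, false) x Ix) -(hu0 (e, true) x Ix).
rewrite /energy /jet_energy; congr (_ * _ - _ * _); last first.
  by apply: eq_bigr => e _; apply: eq_Rint => x Ix; rewrite normcE.
rewrite /energy_sq /pot /bil -big_split/=.
rewrite sum_pairs/=.
apply: eq_bigr => e _; set J := edge_itv (len e).
have sk s : Rintegrable J (fun x => level k d (e, s) x * level k d (e, s) x).
  exact: (Rintegrable_mul (mI e) (Lk (e, s)) (Lk (e, s))).
have s0 s : Rintegrable J (fun x => potential V d (e, s) x * level 0 d (e, s) x).
  exact: (Rintegrable_mul (mI e) (LV (e, s)) (L0 (e, s))).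
have mJ : measurable J := mI e.
have sks s : Rintegrable J (fun x => level k d (e, s) x * level k d (e, s) x +
    potential V d (e, s) x * level 0 d (e, s) x) by exact: RintegrableD.
have ipE s : ip J (level k d (e, s)) (level k d (e, s)) +
    ip J (potential V d (e, s)) (level 0 d (e, s)) =
    \int[leb]_(x in J) (level k d (e, s) x * level k d (e, s) x +
    potential V d (e, s) x * level 0 d (e, s) x) by rewrite RintD.
rewrite !ipE; apply: etrans (RintD mJ (sks true) (sks false)).
have := huk k (leqnn k) (e, false); have := huk k (leqnn k) (e, true).
have Lderiv s : real_L2 J (fun x => cpart s (graph_deriv k u e x)).
  have [[_ uS] _ _] := hS; have [/L2P h _] := Sobolev_wderivn (len_gt0 e) (uS e) (leqnn k).
  exact: h.
have mder s := L2_measurable (Lderiv s).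
have eqs x : J x -> cpart true (graph_deriv k u e x) = d (e, true) k x ->
   cpart false (graph_deriv k u e x) = d (e, false) k x ->
   normc (graph_deriv k u e x) ^+ 2 + V e x * normc (u e x) ^+ 2 =
  (level k d (e, true) x * level k d (e, true) x +
    potential V d (e, true) x * level 0 d (e, true) x) +
  (level k d (e, false) x * level k d (e, false) x +
    potential V d (e, false) x * level 0 d (e, false) x).
  move=> Jx h1 h2; rewrite normcE// modulus_sqr normc_sqr h1 h2 /level /potential; ring.
move=> a1 a2; rewrite /= -[edge_dom e]/J; apply: (ae_Rint mJ).
- have mF : measurable_fun J (fun x => cpart false (graph_deriv k u e x) ^+ 2 +
      cpart true (graph_deriv k u e x) ^+ 2 +
      (potential V d (e, true) x * level 0 d (e, true) x +
       potential V d (e, false) x * level 0 d (e, false) x)).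
    apply: measurable_funD.
      by apply: measurable_funD; apply: measurable_funX; exact: mder.
    by apply: measurable_funD; [exact: (Rintegrable_measurable (s0 true))|exact: (Rintegrable_measurable (s0 false))].
  apply: eq_measurable_fun mF => x /set_mem Jx.
  by rewrite normcE// modulus_sqr normc_sqr /level /potential; ring.
- by apply: Rintegrable_measurable; exact: RintegrableD.
by move: a1 a2; apply: aeS2 => x h1 h2 Jx; exact: (eqs x Jx (h1 Jx) (h2 Jx)).
Qed.

Definition jet_energies (t : R) : set R :=
  [set jet_energy k V mu q d | d in [set d | jet_space k d /\ energy_sq 0 d = t]].

Lemma ground_energyE t :
  ground_energy k V mu q t = ereal_inf [set z%:E | z in jet_energies t].
Proof.
congr ereal_inf; apply/seteqP; split => z /=.
  move=> [u [uS ut] <-]; have [d [hd hr]] := jet_of_Sobolev k_gt0 uS.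
  exists (jet_energy k V mu q d); last by rewrite (energy_represents hd hr uS).
  exists d => //; split => //; apply: EFin_inj.
  by rewrite -(normsq_represents hd hr).
move=> [_ [d [hd dt] <-] <-]; have [uS hr] := Sobolev_of_jet k_gt0 hd.
exists (gpack d); last by rewrite (energy_represents hd hr uS).
by split => //; rewrite (normsq_represents hd hr) dt.
Qed.

End Coercive.
End Power.
End Energy_bounds.

(** * Weak compactness *)

Section Completeness.
Context {R : realType}.
Local Notation leb := (@lebesgue_measure R).
Variable D : set R.
Hypothesis mD : measurable D.
Implicit Types (h f : nat -> R -> R).

Lemma sum_half_le n : \sum_(i < n) (2^-1 : R) ^+ i <= 2.
Proof.
suff : \sum_(i < n) (2^-1 : R) ^+ i = 2 - 2 * 2^-1 ^+ n.
  by move=> ->; rewrite gerBl mulr_ge0// exprn_ge0// invr_ge0.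
elim: n => [|n IH]; first by rewrite big_ord0 expr0; lra.
by rewrite big_ord_recr/= IH exprS; lra.
Qed.

(* By AM-GM the increments are dominated by [2^-n + 2^n |h n.+1 - h n|^2], whose sum
   is integrable. *)
Lemma fast_cauchy_ae_cvg h : (forall n, real_L2 D (h n)) ->
  (forall n, nsq D (fun x => h n.+1 x - h n x) <= 4^-1 ^+ n) ->
  {ae leb, forall x, D x -> cvgn (h ^~ x)}.
Proof.
move=> Lh hn; have Ld n : real_L2 D (fun x => h n.+1 x - h n x) by exact: L2B.
pose u n x := 2 ^+ n * (h n.+1 x - h n x) ^+ 2.
have u0 n x : 0 <= u n x by rewrite mulr_ge0 ?sqr_ge0 ?exprn_ge0.
have su n : Rintegrable D (u n) by apply: RintegrableZ => //; exact: L2_sqr.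
have mu n : measurable_fun D (fun x => (u n x)%:E).
  by apply/measurable_EFinP; exact: Rintegrable_measurable (su n).
pose S x := (\sum_(n <oo) (u n x)%:E)%E.
have S0 x : (0 <= S x)%E by apply: nneseries_ge0 => n _ _; rewrite lee_fin.
have mS : measurable_fun D S.
  by apply: ge0_emeasurable_sum => // n x _ _; rewrite lee_fin.
have IS : (\int[leb]_(x in D) S x <= 2%:E)%E.
  rewrite integral_nneseries//; last by move=> n x _; rewrite lee_fin.
  apply: lime_le.
    by apply: is_cvg_nneseries => n _ _; apply: integral_ge0 => x _; rewrite lee_fin.
  apply: nearW => n; rewrite big_mkord.
  apply: (@le_trans _ _ (\sum_(i < n) ((2^-1 ^+ i)%:E))%E); last by rewrite sumEFin lee_fin sum_half_le.
  apply: lee_sum => i _; rewrite integral_Rintegrable// lee_fin /u RintZ//; last exact: L2_sqr.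
  apply: (le_trans (ler_wpM2l (exprn_ge0 i (ler0n _ 2)) (hn i))).
  by rewrite -exprMn (_ : 2 * 4^-1 = 2^-1 :> R)//; field.
have : leb.-integrable D S.
  apply/integrableP; split => //; under eq_integral do rewrite gee0_abs//.
  exact: le_lt_trans IS (ltry _).
move=> intS; have := @integrable_ae _ _ _ leb D mD S intS; apply: aeS => x h1 /h1 Sfin.
have [s Ss] : exists s, S x = s%:E by move: Sfin; case: (S x) => // s _; exists s.
have bnd n : \sum_(0 <= i < n) `|h i.+1 x - h i x| <= 2 + s.
  rewrite big_mkord; apply: (@le_trans _ _ (\sum_(i < n) (2^-1 ^+ i + u i x))).
    apply: ler_sum => i _; rewrite /u -(real_normK (num_real (h i.+1 x - h i x))).
    set a := `|_|; have a0 : 0 <= a by exact: normr_ge0.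
    have t0 : 0 < (2 : R) ^+ i by exact: exprn_gt0.
    rewrite exprVn -(@ler_pM2l _ (2 ^+ i))// mulrDr divff ?gt_eqF//.
    by have := sqr_ge0 (2 ^+ i * a - 1); rewrite sqrrB exprMn; nra.
  rewrite big_split/= lerD ?sum_half_le//.
  have := @nneseries_lim_ge R (fun n => (u n x)%:E) xpredT 0 n.
  by rewrite -/(S x) Ss big_mkord sumEFin lee_fin; apply => i _ _; rewrite lee_fin.
have cs : cvgn (series (telescope (h ^~ x))).
  apply: normed_cvg; apply: nondecreasing_is_cvgn.
    by apply: nondecreasing_series => n _ _; exact: normr_ge0.
  by exists (2 + s) => _ [n _ <-]; exact: bnd.
have -> : h ^~ x = (fun n => h 0%N x + series (telescope (h ^~ x)) n).
  by apply/funext => n; exact: (eq_sum_telescope (h ^~ x)).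
by apply: is_cvgD => //; exact: is_cvg_cst.
Qed.

(** Riesz-Fischer with a rate: a fast subsequence converges almost everywhere, and Fatou's lemma
    transfers the Cauchy bound to the limit. *)
Lemma L2_complete f (eta : nat -> R) : (forall n, real_L2 D (f n)) ->
  eta @ \oo --> 0 ->
  (forall n m, (n <= m)%N -> nsq D (fun x => f m x - f n x) <= eta n) ->
  exists2 g, real_L2 D g & forall n, nsq D (fun x => g x - f n x) <= eta n.
Proof.
move=> Lf eta0 hf.
have /choice[tau htau] : forall i, exists N, forall n, (N <= n)%N -> eta n <= 4^-1 ^+ i.
  move=> i; have /cvgrPdist_le/(_ (4^-1 ^+ i)) := eta0.
  rewrite exprn_gt0 ?invr_gt0// => /(_ isT)[N _ hN]; exists N => n Nn.
  have := hN n Nn; rewrite sub0r normrN; exact/le_trans/ler_norm.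
pose sigma i := (\sum_(j < i.+1) (tau j).+1)%N.
have sigma_tau i : (tau i <= sigma i)%N by rewrite /sigma big_ord_recr/= addnS (leq_trans (leq_addl _ _) (leqnSn _)).
have sigmaS i : (sigma i <= sigma i.+1)%N by rewrite {2}/sigma big_ord_recr/= leq_addr.
pose h i := f (sigma i).
have hcv := fast_cauchy_ae_cvg (fun i => Lf (sigma i))
  (fun i => le_trans (hf _ _ (sigmaS i)) (htau i _ (sigma_tau i))).
(* The upper limit is measurable whether or not the sequence converges at the given point. *)
pose g x := fine (limn_esup (fun i => (h i x)%:E)).
have mh i : measurable_fun D (fun x => (h i x)%:E).
  by apply/measurable_EFinP; case: (Lf (sigma i)).
have mg : measurable_fun D g.
  apply: measurableT_comp => //; apply: measurable_fun_limn_esup => i; exact: mh.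
have hg : {ae leb, forall x, D x -> h ^~ x @ \oo --> g x}.
  apply: aeS hcv => x h1 /h1 cv.
  have cvE : (fun i => (h i x)%:E) @ \oo --> (lim (h ^~ x @ \oo))%:E.
    by apply: cvg_EFin => //; exact: nearW.
  by rewrite /g (cvg_limn_einf_sup cvE).2.
have key n : (\int[leb]_(x in D) ((g x - f n x) ^+ 2)%:E <= (eta n)%:E)%E.
  have mF i : measurable_fun D (fun x => ((h i x - f n x) ^+ 2)%:E).
    apply/measurable_EFinP/measurable_funX/measurable_funB.
      by apply/measurable_EFinP; exact: mh.
    by case: (Lf n).
  have -> : (\int[leb]_(x in D) ((g x - f n x) ^+ 2)%:E =
      \int[leb]_(x in D) limn_einf (fun i => ((h i x - f n x) ^+ 2)%:E))%E.
    apply: ae_eq_integral => //.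
    - apply/measurable_EFinP/measurable_funX/measurable_funB => //.
      by case: (Lf n).
    - have -> : (fun x => limn_einf (fun i => ((h i x - f n x) ^+ 2)%:E)) =
          (fun x => (- limn_esup (-%E \o (fun i => ((h i x - f n x) ^+ 2)%:E)))%E).
        by apply/funext => x; rewrite limn_esupN oppeK.
      apply: measurableT_comp => //; apply: measurable_fun_limn_esup => i.
      exact: measurableT_comp (mF i).
    apply: aeS hg => x h1 Dx.
    have : (fun i => ((h i x - f n x) ^+ 2)%:E) @ \oo --> ((g x - f n x) ^+ 2)%:E.
      apply: cvg_EFin; first exact: nearW.
      apply: (@cvg_comp _ _ _ (fun i => h i x - f n x) (fun z => z ^+ 2)).
        by apply: cvgB; [exact: h1|exact: cvg_cst].
      exact: exprn_continuous.
    by move=> /cvg_limn_einf_sup[-> _].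
  apply: (le_trans (fatou _ _ _ _)) => //; first by move=> i x _; rewrite lee_fin sqr_ge0.
  rewrite limn_einf_lim; apply: lime_le; first exact: is_cvg_einfs.
  have [N hN] : exists N, forall i, (N <= i)%N -> (n <= sigma i)%N.
    exists n => i ni; apply: (leq_trans ni); rewrite /sigma.
    elim: i {ni} => // i IH; rewrite big_ord_recr/= addnS ltnS.
    exact: (leq_trans IH (leq_addr _ _)).
  (* The index [maxn i N] puts the subsequence beyond [n], where the Cauchy bound applies. *)
  apply: nearW => i; apply: (@le_trans _ _ (\int[leb]_(x in D) ((h (maxn i N) x - f n x) ^+ 2)%:E)%E).
    by apply: ereal_inf_lbound; exists (maxn i N) => //=; rewrite leq_maxl.
  rewrite (integral_Rintegrable mD (L2_sqr mD (L2B mD (Lf (sigma (maxn i N))) (Lf n)))).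
  by rewrite lee_fin; apply: hf; apply: hN; rewrite leq_maxr.
have Lg : real_L2 D g.
  have : real_L2 D (fun x => (g x - f 0%N x) + f 0%N x).
    apply: L2D => //; split; last exact: le_lt_trans (key 0%N) (ltry _).
    by apply: measurable_funB => //; case: (Lf 0%N).
  by apply: eq_L2 => // x _; rewrite subrK.
exists g => // n.
by rewrite -lee_fin -(integral_Rintegrable mD (L2_sqr mD (L2B mD Lg (Lf n)))); exact: key.
Qed.
End Completeness.

(** * Limits along an ultrafilter *)

Section Ultrafilter_limits.
Context {R : realType} (U : set_system nat) {UU : UltraFilter U}.

(** The limit is the supremum of the numbers below a(n) for [U]-most [n]. Its sum with [e] is not
    such a number, so by maximality of [U] the opposite inequality holds for [U]-most [n]. *)
Lemma ultra_bounded_cvg (a : nat -> R) B : (forall n, `|a n| <= B) ->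
  exists l, forall e, 0 < e -> \forall n \near U, `|a n - l| <= e.
Proof.
move=> aB; pose E := [set x | \forall n \near U, x <= a n].
have EB : E (- B) by apply: nearW => n; have := aB n; rewrite ler_norml => /andP[].
have Eub : ubound E B.
  move=> x Ex; have [n xn] := filter_ex Ex.
  by apply: (le_trans xn); have := aB n; rewrite ler_norml => /andP[].
have supE : has_sup E by split; [exists (- B)|exists B].
exists (sup E) => e e0.
have h1 : \forall n \near U, sup E - e <= a n.
  have [x Ex xs] := sup_adherent e0 supE.
  by apply: filterS Ex => n; apply: le_trans; exact: ltW.
have h2 : \forall n \near U, a n <= sup E + e.
  have [h|h] := in_ultra_setVsetC [set n | sup E + e <= a n] UU.
    have : sup E + e <= sup E by apply: ub_le_sup => //; exists B.
    by rewrite gerDl leNgt e0.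
  by apply: filterS h => n /= /negP; rewrite -ltNge => /ltW.
by near=> n; rewrite ler_norml; apply/andP; split; [have : sup E - e <= a n by near: n|have : a n <= sup E + e by near: n]; lra.
Unshelve. all: by end_near. Qed.

End Ultrafilter_limits.

(** * Uniform bounds for the derivatives of a jet *)

Section Jet_estimates.
Context {R : realType} (G : metric_graph R).
Local Notation leb := (@lebesgue_measure R).
Local Notation I c := (edge_itv (len c.1)).
Implicit Types (d g h : jet G).
Variable k : nat.
Hypothesis k_gt0 : (0 < k)%N.

Lemma jet_level_bounds : exists2 C : R, 0 <= C & forall d, jet_space k d ->
  (forall j, (j <= k)%N -> energy_sq j d <= C * (energy_sq k d + energy_sq 0 d)) /\
  (forall j c x, (j < k)%N -> I c x -> d c j x ^+ 2 <= C * (energy_sq k d + energy_sq 0 d)).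
Proof.
have [hm [C [hm0 C0 hC]]] := jet_interpolation G k_gt0.
have [h0 [h0_gt0 h0_le1 h0_len]] := min_length G.
pose h := Num.min hm 1.
have hgt0 : 0 < h by rewrite lt_min hm0/=.
have hhm : h <= hm by rewrite ge_min lexx.
have h1 : h <= 1 by rewrite ge_min lexx orbT.
pose C1 := C / h ^+ (2 * k).
have C10 : 0 <= C1 by rewrite divr_ge0 ?exprn_ge0// ltW.
have energies d j : jet_space k d -> (j <= k)%N ->
    energy_sq j d <= C1 * (energy_sq k d + energy_sq 0 d).
  move=> [hd _] jk; have [/(_ j jk) hj _] := hC h d hd hgt0 hhm.
  have p0 : 0 < h ^+ (2 * k) by rewrite exprn_gt0.
  have Ek := energy_sq_ge0 k d; have E0 := energy_sq_ge0 0 d; have Ej := energy_sq_ge0 j d.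
  rewrite /C1 mulrAC ler_pdivlMr// mulrC.
  apply: (@le_trans _ _ (h ^+ (2 * j) * energy_sq j d)).
    apply: ler_wpM2r => //; apply: ler_wiXn2l => //; [exact: ltW|by rewrite leq_mul2l jk orbT].
  apply: (le_trans hj); apply: ler_wpM2l; first exact: ltW.
  have : h ^+ (2 * k) <= 1 by apply: exprn_ile1 => //; exact: ltW.
  by nra.
exists (C1 + (2 * C1 + 2 * C1) / h0).
  apply: addr_ge0 => //; apply: divr_ge0; [lra|exact: ltW].
move=> d hd; have Ek := energy_sq_ge0 k d; have E0 := energy_sq_ge0 0 d.
have S0 : 0 <= energy_sq k d + energy_sq 0 d by rewrite addr_ge0.
have r0 : 0 <= (2 * C1 + 2 * C1) / h0 by apply: divr_ge0; [lra|exact: ltW].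
split=> [j jk|j c x jk Ix].
  by apply: (le_trans (energies d j hd jk)); apply: ler_wpM2r => //; lra.
have hdc := hd.1 c.
have := sup_bound h0_gt0 (h0_len c.1) (chain_L2 hdc (ltnW jk)) (chain_L2 hdc jk)
   (chain_primitive hdc jk) h0_gt0 (lexx _) Ix.
have n1 := nsq_le_bil (level j d) c; have n2 := nsq_le_bil (level j.+1 d) c.
have e1 := energies d j hd (ltnW jk); have e2 := energies d j.+1 hd jk.
rewrite /level in n1 n2; rewrite /energy_sq /level in e1 e2.
have h02 : h0 ^+ 2 <= 1 by apply: exprn_ile1 => //; exact: ltW.
have u0 : 0 <= nsq (I c) (d c j.+1) by exact: nsq_ge0.
rewrite -ler_pdivlMr// => /le_trans; apply.
apply: (@le_trans _ _ ((2 * C1 + 2 * C1) / h0 * (energy_sq k d + energy_sq 0 d))); last first.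
  by apply: ler_wpM2r => //; lra.
rewrite [leRHS]mulrAC ler_pM2r ?invr_gt0//.
have : 2 * h0 ^+ 2 * nsq (I c) (d c j.+1) <= 2 * nsq (I c) (d c j.+1).
  by rewrite -mulrA ler_pM2l// ler_piMl.
move: n1 n2 e1 e2; rewrite /energy_sq /level; lra.
Qed.

Lemma jet_holder d j c x y : jet_space k d -> (j < k)%N -> I c x -> I c y ->
  (d c j x - d c j y) ^+ 2 <= `|x - y| * energy_sq j.+1 d.
Proof.
move=> [hd _] jk; wlog xy : x y / y <= x.
  move=> h Ix Iy; have [xy|/ltW xy] := leP y x; first exact: h.
  by rewrite distrC -sqrrN opprB; exact: h.
move=> Ix Iy; have L1 := chain_L2 (hd c) jk.
have sub := edge_itv_sub Iy Ix.
apply: (le_trans (primitive_holder (L2_locally L1 Iy Ix)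
  (primitive_on_itv (chain_primitive (hd c) jk) Iy Ix) _ _)).
- by rewrite /= in_itv/= xy lexx.
- by rewrite /= in_itv/= xy lexx.
apply: ler_wpM2l => //; apply: le_trans (nsq_le_bil (level j.+1 d) c).
by apply: nsqS => //; exact: measurable_edge_itv.
Qed.

Lemma energy_sq_convex j d d' s : family_L2 (level j d) -> family_L2 (level j d') ->
  0 <= s <= 1 ->
  energy_sq j (jcomb (1 - s) d s d') <= (1 - s) * energy_sq j d + s * energy_sq j d'.
Proof.
move=> L1 L2 /andP[s0 s1]; rewrite /energy_sq level_jcomb bil_comb//.
have := bil_ge0 (comb 1 (level j d) (-1) (level j d')).
rewrite bil_comb//; have : 0 <= s * (1 - s) by rewrite mulr_ge0//; lra.
set a := bil _ (level j d); set b := bil (level j d) (level j d').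
set c := bil (level j d') _; nra.
Qed.

(** The form in which identities pass to the limit jet: the square of the defect is at most a fixed
    multiple of [kap N]. *)
Lemma sqr_le_cvg0 (a K : R) (kap : nat -> R) N0 : kap @ \oo --> 0 ->
  (forall N, (N0 <= N)%N -> a ^+ 2 <= K * kap N) -> a = 0.
Proof.
move=> kap0 h; apply/eqP; rewrite -sqrf_eq0 eq_le sqr_ge0 andbT.
apply/ler_addgt0Pr => e e0; rewrite add0r.
have K0 : 0 < `|K| + 1 by rewrite ltr_wpDl.
have /cvgrPdist_le/(_ (e / (`|K| + 1))) := kap0.
rewrite divr_gt0// => /(_ isT)[N1 _ hN1].
apply: (le_trans (h (maxn N0 N1) (leq_maxl _ _))).
have := hN1 (maxn N0 N1) (leq_maxr _ _); rewrite sub0r normrN ler_pdivlMr// => h2.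
apply: (le_trans (ler_norm _)); rewrite normrM; apply: le_trans h2.
by rewrite mulrC; apply: ler_wpM2l => //; rewrite lerDl.
Qed.

End Jet_estimates.

Section Weak_compactness.
Context {R : realType} (G : metric_graph R).
Local Notation leb := (@lebesgue_measure R).
Local Notation I c := (edge_itv (len c.1)).
Implicit Types (d g h : jet G).
Variable k : nat.
Hypothesis k_gt0 : (0 < k)%N.
Variables (U : set_system nat) (UU : UltraFilter U).
Variables (dn : nat -> jet G) (T : R).
Hypotheses (dn_space : forall n, jet_space k (dn n))
  (dn0 : forall n, energy_sq 0 (dn n) <= T) (dnk : forall n, energy_sq k (dn n) <= T).

Lemma pointwise_limit : exists D : jet G, forall c j x, (j < k)%N -> I c x ->
  forall e, 0 < e -> \forall n \near U, `|dn n c j x - D c j x| <= e.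
Proof.
have [C C0 hC] := jet_level_bounds G k_gt0.
have : forall p : (edge G * bool) * nat * R, exists l, (p.1.2 < k)%N -> I p.1.1 p.2 ->
    forall e, 0 < e -> \forall n \near U, `|dn n p.1.1 p.1.2 p.2 - l| <= e.
  move=> [[c j] x] /=; have [jk|_] := boolP (j < k)%N; last by exists 0.
  have [Ix|nIx] := pselect (I c x); last by exists 0.
  have [|l hl] := @ultra_bounded_cvg R U UU (fun n => dn n c j x) (Num.sqrt (C * (T + T))).
    move=> n; have [_ /(_ j c x jk Ix) h] := hC (dn n) (dn_space n).
    have {}h : dn n c j x ^+ 2 <= C * (T + T).
      by apply: (le_trans h); apply: ler_wpM2l => //; exact: lerD.
    rewrite -sqrtr_sqr ler_sqrt//; exact: le_trans (sqr_ge0 _) h.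
  by exists l.
move=> /choice[D hD]; exists (fun c j x => D (c, j, x)) => c j x jk Ix.
exact: (hD (c, j, x) jk Ix).
Qed.

(** Equicontinuity: all the jets and the limit share a Hoelder bound of exponent 1/2, so convergence
    on a finite grid of [0, X] suffices. *)
Lemma uniform_limit (D : jet G) : (forall c j x, (j < k)%N -> I c x ->
    forall e, 0 < e -> \forall n \near U, `|dn n c j x - D c j x| <= e) ->
  forall X e, 0 < e -> \forall n \near U, forall c j x, (j < k)%N -> I c x -> x <= X ->
    `|dn n c j x - D c j x| <= e.
Proof.
move=> hD X e e0.
have [C C0 hC] := jet_level_bounds G k_gt0.
pose B := C * (T + T).
have hol n c j x y : (j < k)%N -> I c x -> I c y ->
    (dn n c j x - dn n c j y) ^+ 2 <= `|x - y| * B.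
  move=> jk Ix Iy; apply: (le_trans (jet_holder (dn_space n) jk Ix Iy)).
  apply: ler_wpM2l => //; have [/(_ _ jk) h _] := hC _ (dn_space n).
  by apply: (le_trans h); apply: ler_wpM2l => //; exact: lerD.
have [cG|nG] := pselect (exists c : edge G * bool, True); last first.
  by apply: nearW => n c; exfalso; apply: nG; exists c.
have B0 : 0 <= B.
  have T0 : 0 <= T := le_trans (energy_sq_ge0 0 (dn 0)) (dn0 0).
  by rewrite mulr_ge0// addr_ge0.
have holD c j x y : (j < k)%N -> I c x -> I c y -> `|D c j x - D c j y| <= Num.sqrt (`|x - y| * B).
  move=> jk Ix Iy; apply/ler_addgt0Pr => z z0.
  have z2 : 0 < z / 2 by rewrite divr_gt0.
  have [n [n1 n2]] := filter_ex (filterI (hD c j x jk Ix _ z2) (hD c j y jk Iy _ z2)).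
  have n3 : `|dn n c j x - dn n c j y| <= Num.sqrt (`|x - y| * B).
    by rewrite -sqrtr_sqr ler_sqrt; [exact: hol|exact: mulr_ge0].
  rewrite (_ : D c j x - D c j y = - (dn n c j x - D c j x) + (dn n c j x - dn n c j y)
     + (dn n c j y - D c j y)); last by ring.
  apply: (le_trans (ler_normD _ _)); have := ler_normD (- (dn n c j x - D c j x)) (dn n c j x - dn n c j y).
  by rewrite normrN; lra.
(* A grid step over which the Hoelder bound allows an oscillation of at most e / 3. *)
pose de := (e / 3) ^+ 2 / (B + 1).
have e3 : 0 < e / 3 by rewrite divr_gt0.
have de0 : 0 < de by rewrite divr_gt0 ?exprn_gt0//; lra.
have deB t : 0 <= t -> t <= de -> Num.sqrt (t * B) <= e / 3.
  move=> t0 tde; rewrite -[leRHS]ger0_norm ?(ltW e3)// -sqrtr_sqr ler_sqrt ?sqr_ge0//.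
  apply: (@le_trans _ _ (de * (B + 1))); last by rewrite /de divfK// gt_eqF//; lra.
  by apply: ler_pM => //; lra.
pose M := Num.bound (X / de).
have : \forall n \near U, forall p : (edge G * bool) * 'I_k * 'I_M,
    I p.1.1 (p.2%:R * de) -> `|dn n p.1.1 p.1.2 (p.2%:R * de) - D p.1.1 p.1.2 (p.2%:R * de)| <= e / 3.
  apply: filter_forall => -[[c j] i] /=.
  have [Ix|nIx] := pselect (I c (i%:R * de)); last by apply: nearW.
  by apply: filterS (hD c j _ (ltn_ord j) Ix _ e3).
apply: filterS => n hn c j x jk Ix xX.
have x0 : 0 <= x by case: Ix.
pose i := Num.truncn (x / de).
have /andP[i1 i2] := Num.Theory.truncn_itv (divr_ge0 x0 (ltW de0)).
rewrite -/i ler_pdivlMr// in i1; rewrite -/i ltr_pdivrMr// -natr1 mulrDl mul1r in i2.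
have iM : (i < M)%N.
  rewrite -(@ltr_nat R); apply: le_lt_trans (archi_boundP _).
    by rewrite ler_pdivlMr//; exact: le_trans xX.
  by rewrite divr_ge0 ?(ltW de0)// (le_trans x0).
have g0 : 0 <= i%:R * de by rewrite mulr_ge0 ?(ltW de0).
have Ig : I c (i%:R * de).
  have [_ xl] := Ix; split => //; apply: le_trans xl; by rewrite lee_fin.
have := hn (c, Ordinal jk, Ordinal iM) Ig => /= h1.
have dist : `|x - i%:R * de| <= de by rewrite ger0_norm ?subr_ge0//; lra.
have h2 := holD c j x (i%:R * de) jk Ix Ig.
have h3 : `|dn n c j x - dn n c j (i%:R * de)| <= Num.sqrt (`|x - i%:R * de| * B).
  by rewrite -sqrtr_sqr ler_sqrt; [exact: hol|exact: mulr_ge0].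
have h4 := deB _ (normr_ge0 _) dist.
have e1 : dn n c j x - D c j x = (dn n c j x - dn n c j (i%:R * de))
   + (dn n c j (i%:R * de) - D c j (i%:R * de)) - (D c j x - D c j (i%:R * de)) by ring.
rewrite e1; apply: (le_trans (ler_normB _ _)).
have := ler_normD (dn n c j x - dn n c j (i%:R * de)) (dn n c j (i%:R * de) - D c j (i%:R * de)).
lra.
Qed.

(* The limit is the limit in energy of almost energy-minimising elements of the
   convex sets of jets close to the pointwise limit; minimality also yields
   the lower bound on the scalar products. *)
Theorem weak_compactness : exists d, [/\ jet_space k d,
  (forall X e, 0 < e -> \forall n \near U, forall c j x, (j < k)%N -> I c x -> x <= X ->
    `|dn n c j x - d c j x| <= e) &
  (forall e, 0 < e -> \forall n \near U,
    energy_sq k d - e <= bil (level k (dn n)) (level k d))].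
Proof.
have [D hD] := pointwise_limit; have unif := uniform_limit hD.
have T0 : 0 <= T := le_trans (energy_sq_ge0 0 (dn 0)) (dn0 0).
have mI (c : edge G * bool) : measurable (I c) by exact: measurable_edge_itv.
(* These sets are convex, shrink as [N] grows, and contain dn(n) for [U]-most [n]; the infimum [iN]
   of the top energy on them therefore increases, to a limit [L]. *)
pose C N := [set g | [/\ jet_space k g, energy_sq 0 g <= T, energy_sq k g <= T &
  forall c j x, (j < k)%N -> I c x -> x <= N%:R -> `|g c j x - D c j x| <= N.+1%:R^-1]].
have inv0 N : 0 < (N.+1%:R^-1 : R) by rewrite invr_gt0.
have CU N : \forall n \near U, C N (dn n).
  by apply: filterS (unif N%:R _ (inv0 N)) => n hn; split.
have Cconv N g h s : C N g -> C N h -> 0 <= s <= 1 -> C N (jcomb (1 - s) g s h).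
  move=> [g1 g2 g3 g4] [h1 h2 h3 h4] s01; have /andP[s0 s1] := s01.
  have s1' : 0 <= 1 - s by lra.
  split.
  - exact: jet_space_comb.
  - have := energy_sq_convex (jet_L2 g1 (leq0n k)) (jet_L2 h1 (leq0n k)) s01; nra.
  - have := energy_sq_convex (jet_L2 g1 (leqnn k)) (jet_L2 h1 (leqnn k)) s01; nra.
  move=> c j x jk Ix xN; rewrite /jcomb.
  have -> : (1 - s) * g c j x + s * h c j x - D c j x =
     (1 - s) * (g c j x - D c j x) + s * (h c j x - D c j x) by ring.
  apply: (le_trans (ler_normD _ _)); rewrite !normrM (ger0_norm s0) (ger0_norm s1').
  have := ler_wpM2l s1' (g4 c j x jk Ix xN); have := ler_wpM2l s0 (h4 c j x jk Ix xN).
  move: `|g c j x - _| `|h c j x - _| (_^-1) => a b w; lra.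
have CS N M : (N <= M)%N -> C M `<=` C N.
  move=> NM g [g1 g2 g3 g4]; split => // c j x jk Ix xN.
  apply: (le_trans (g4 c j x jk Ix _)).
    by apply: (le_trans xN); rewrite ler_nat.
  by rewrite lef_pV2 ?posrE// ler_nat.
pose E N := [set energy_sq k g | g in C N].
pose iN N := inf (E N).
have E0 N : lbound (E N) 0 by move=> _ [g _ <-]; exact: energy_sq_ge0.
have Elb N : has_lbound (E N) by exists 0; exact: E0.
have Ene N : E N !=set0.
  by have [n Cn] := filter_ex (CU N); exists (energy_sq k (dn n)); exists (dn n).
have iN_le N g : C N g -> iN N <= energy_sq k g by move=> Cg; apply: ge_inf => //; exists g.
have iNT N : iN N <= T.
  by have [z [g Cg _]] := Ene N; apply: (le_trans (iN_le N g Cg)); case: Cg.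
have iNnd : nondecreasing_seq iN.
  move=> N M NM; apply: lb_le_inf => // _ [g Cg <-]; apply: iN_le; exact: CS Cg.
have /choice[g hg] : forall N, exists g, C N g /\ energy_sq k g <= iN N + N.+1%:R^-1.
  move=> N; have [_ [g Cg <-] gi] := inf_adherent (inv0 N) (conj (Ene N) (Elb N)).
  by exists g; split => //; exact: ltW.
pose L := sup (range iN).
have iNub : has_ubound (range iN) by exists T => _ [N _ <-].
have iNL N : iN N <= L by apply: ub_le_sup => //; exists N.
have iNcv : iN @ \oo --> L by exact: nondecreasing_cvgn.
(* For N <= M the midpoint of g(N) and g(M) lies in [C N], so the parallelogram law bounds the
   squared distance at order [k] by 2 (iN(M) + iN(N)) - 4 iN(N) + 4 / (N + 1), and iN(M) <= L. *)
pose eta N := 2 * (L - iN N) + 4 * N.+1%:R^-1.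
have harm : (fun N => N.+1%:R^-1 : R) @ \oo --> 0 by exact: cvg_harmonic.
have eta_cv : eta @ \oo --> 0.
  rewrite -[0](_ : 2 * (L - L) + 4 * 0 = 0); last by rewrite subrr !mulr0 addr0.
  apply: cvgD; apply: cvgMr; last exact: harm.
  by apply: cvgB; [exact: cvg_cst|exact: iNcv].
have gsp N : jet_space k (g N) by have [[]] := hg N.
have gk N := jet_L2 (gsp N) (leqnn k).
have cauchy N M : (N <= M)%N -> energy_sq k (jcomb 1 (g M) (-1) (g N)) <= eta N.
  move=> NM; have [gN gNi] := hg N; have [gM gMi] := hg M.
  have := iN_le N _ (Cconv N _ _ 2^-1 gN (CS N M NM _ gM) ltac:(lra)).
  rewrite /energy_sq !level_jcomb !bil_comb// => h1.
  have h2 : M.+1%:R^-1 <= N.+1%:R^-1 :> R by rewrite lef_pV2 ?posrE// ler_nat ltnS.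
  move: gNi gMi h1; rewrite /energy_sq (bilC (level k (g N))).
  by have := iNL M; rewrite /eta; move: h2; move: (_^-1) (_^-1) => u v; lra.
have cauchyc c N M : (N <= M)%N ->
    nsq (I c) (fun x => g M c k x - g N c k x) <= eta N.
  move=> NM; apply: le_trans (cauchy N M NM).
  rewrite (_ : nsq _ _ = nsq (I c) (level k (jcomb 1 (g M) (-1) (g N)) c)).
    exact: nsq_le_bil.
  by apply: eq_nsq => x _; rewrite /level /jcomb; ring.
have /fin_all_exists2[top topL htop] : forall c : edge G * bool, exists2 f : R -> R,
    real_L2 (I c) f & forall N, nsq (I c) (fun x => f x - g N c k x) <= eta N.
  by move=> c; exact: (@L2_complete _ _ (mI c) (fun N => g N c k) eta (fun N => gk N c) eta_cv (cauchyc c)).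
(* Below the top order the entries are the pointwise limits along [U]; only the top entry comes from
   completeness. *)
pose d : jet G := fun c j => if (j < k)%N then D c j else top c.
have dD c j : (j < k)%N -> d c j = D c j by rewrite /d => ->.
have dtop c : d c k = top c by rewrite /d ltnn.
have gD N c j x : (j < k)%N -> I c x -> x <= N%:R -> `|g N c j x - D c j x| <= N.+1%:R^-1.
  by have [[_ _ _ h] _] := hg N; exact: h.
pose w N : R := N.+1%:R^-1.
have w0 N : 0 < w N by exact: inv0.
have w1 N : w N <= 1 by rewrite invf_le1// ler1n.
have ww N : w N ^+ 2 <= w N by rewrite expr2 ler_piMr ?(ltW (w0 N)).
have eta_ge0 N : 0 <= eta N.
  by have := iNL N; have := w0 N; rewrite /eta -/(w N); move: (w N) => u; lra.
pose kap N := eta N + w N.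
have kap_cv : kap @ \oo --> 0.
  by rewrite -[0](addr0 0); apply: cvgD; [exact: eta_cv|exact: harm].
have wkap N : w N <= kap N by rewrite lerDr.
have ekap N : eta N <= kap N by rewrite lerDl ltW.
have kap_ge0 N : 0 <= kap N by apply: le_trans (eta_ge0 N) (ekap N).
have bnd (x : R) N : (Num.bound x <= N)%N -> x <= N%:R.
  move=> xN; have [x0|/ltW x0] := leP 0 x; last exact: le_trans x0 (ler0n _ _).
  by apply: (le_trans (ltW (archi_boundP x0))); rewrite ler_nat.
have [h0 [h0_gt0 h0_le1 h0_len]] := min_length G.
have [CB CB0 hCB] := jet_level_bounds G k_gt0.
have dL2 c j : (j <= k)%N -> real_L2 (I c) (d c j).
  rewrite leq_eqVlt => /predU1P[->|jk]; first by rewrite dtop; exact: topL.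
  have gL N := jet_L2 (gsp N) (ltnW jk) c.
  have mD : measurable_fun (I c) (d c j).
    rewrite dD//; apply: (@measurable_fun_cvg _ _ _ _ (fun N => g N c j)).
      by move=> N; exact: L2_measurable (gL N).
    move=> x Ix; apply/cvgrPdist_le => e e0.
    have /cvgrPdist_le/(_ e e0)[N1 _ hN1] := harm.
    exists (maxn N1 (Num.bound x)) => // N /=; rewrite geq_max => /andP[h1 h2].
    rewrite distrC; apply: (le_trans (gD N c j x jk Ix (bnd x N h2))).
    by have := hN1 N h1; rewrite sub0r normrN; exact/le_trans/ler_norm.
  (* On [0, b] the limit is compared with g(N) for an [N] at least [b]: the difference is at most 1
     / (N + 1), so its squared norm there is at most 1. *)
  apply: (proj1 (nsq_exhaust h0_gt0 (h0_len c.1) (B := 2 * (CB * (T + T)) + 2) mD _)) => b Ib _.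
  have I0 : I c 0 := edge_itv0 (len_gt0 c.1).
  have b0 : 0 <= b by case: Ib.
  pose N := Num.bound b; have bN : b <= N%:R := bnd b N (leqnn _).
  have mb := @measurable_itvcc R 0 b.
  have sub := edge_itv_sub I0 Ib.
  have Lg : real_L2 `[0, b] (g N c j) := L2_locally (gL N) I0 Ib.
  have near_g x : `[0, b]%classic x -> `|D c j x - g N c j x| <= w N.
    move=> xb; rewrite distrC; apply: gD => //; first exact: sub.
    by move: xb; rewrite /= in_itv/= => /andP[_ xb]; exact: le_trans xb bN.
  have Ldiff : real_L2 `[0, b] (fun x => D c j x - g N c j x).
    apply: (@L2_le _ _ mb _ (fun=> 1) (w N)) => //; last exact: L2_cst.
      apply: measurable_funB; last by case: Lg.
      by rewrite -dD//; exact: measurable_funS mD.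
    by move=> x /near_g; rewrite normr1 mulr1.
  have DE x : `[0, b]%classic x -> g N c j x + (D c j x - g N c j x) = d c j x.
    by move=> _; rewrite dD// addrC subrK.
  split; first exact: (eq_L2 mb DE (L2D mb Lg Ldiff)).
  rewrite -(eq_nsq DE); apply: (le_trans (nsqD_le mb Lg Ldiff)).
  have n1 : nsq `[0, b] (g N c j) <= CB * (T + T).
    apply: (le_trans (nsqS (mI c) mb sub (gL N))).
    apply: (le_trans (nsq_le_bil (level j (g N)) c)).
    have [/(_ j (ltnW jk)) h _] := hCB _ (gsp N); apply: (le_trans h).
    by apply: ler_wpM2l => //; have [[_ u v _] _] := hg N; exact: lerD.
  have n2 : nsq `[0, b] (fun x => D c j x - g N c j x) <= 1.
    apply: (@le_trans _ _ (nsq `[0, b] (fun=> w N))).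
      apply: nsq_le => //; first exact: L2_cst.
      by move=> x /near_g h; rewrite (gtr0_norm (w0 N)).
    rewrite nsq_cst// subr0; apply: (@le_trans _ _ (w N * b)); first exact: ler_wpM2r.
    rewrite /w mulrC ler_pdivrMr// mul1r; apply: (le_trans bN).
    by rewrite ler_nat.
  lra.
have dloc c j : (j <= k)%N -> locally_L2 (len c.1) (d c j).
  by move=> jk; apply: L2_locally; exact: dL2.
(* The relation holds for each g(N). Its defect at the limit tends to 0, since g(N) converges
   uniformly on [x, y] below the top order and in L^2 at the top. *)
have prim c j : (j < k)%N -> primitive_on (len c.1) (d c j) (d c j.+1).
  move=> jk x y Ix Iy xy; have mxy := @measurable_itvcc R x y.
  apply/eqP; rewrite -subr_eq0; apply/eqP.
  pose K := 8 + 2 * (y - x) * (1 + (y - x)).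
  apply: (@sqr_le_cvg0 _ _ K kap (Num.bound y) kap_cv) => N yN.
  have {}yN := bnd y N yN; have xN := le_trans xy yN.
  have gL := jet_L2 (gsp N) jk c.
  have Lg1 : real_L2 `[x, y] (g N c j.+1) := L2_locally gL Ix Iy.
  have Ld1 : real_L2 `[x, y] (d c j.+1) := dloc c j.+1 jk x y Ix Iy.
  have Ldiff := L2B mxy Ld1 Lg1.
  have rho : nsq `[x, y] (fun t => d c j.+1 t - g N c j.+1 t) <= (1 + (y - x)) * kap N.
    have [jk1|jk1] := leqP k j.+1.
      have jE : j.+1 = k by apply/eqP; rewrite eqn_leq jk jk1.
      rewrite jE dtop in Ldiff *; have h1 := htop c N.
      apply: (@le_trans _ _ (eta N)).
        apply: le_trans h1; apply: nsqS => //; first exact: edge_itv_sub.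
        by apply: L2B => //; exact: gk.
      by have := ekap N; have := kap_ge0 N; move: (eta N) (kap N) => u v; nra.
    apply: (@le_trans _ _ (nsq `[x, y] (fun=> w N))).
      apply: nsq_le => //; first exact: L2_cst.
      move=> t txy; rewrite (gtr0_norm (w0 N)) dD// distrC; apply: gD => //.
        exact: (edge_itv_sub Ix Iy).
      by move: txy; rewrite /= in_itv/= => /andP[_ ty]; exact: le_trans ty yN.
    rewrite nsq_cst//; have := ww N; have := wkap N; have := kap_ge0 N; have := w0 N.
    by move: (w N) (kap N) => u v; nra.
  have gprim := chain_primitive ((gsp N).1 c) jk Ix Iy xy.
  have vE : d c j y - d c j x - \int[leb]_(t in `[x, y]) d c j.+1 t =
     ((d c j y - g N c j y) - (d c j x - g N c j x)) +
     - \int[leb]_(t in `[x, y]) (d c j.+1 t - g N c j.+1 t).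
    by rewrite RintB//; [rewrite -gprim; ring|exact: L2_Rintegrable|exact: L2_Rintegrable].
  rewrite vE; apply: (le_trans (sqrD_le _ _)); rewrite sqrrN.
  have i1 := sqr_Rint_le xy Ldiff.
  have i2 : (\int[leb]_(t in `[x, y]) (d c j.+1 t - g N c j.+1 t)) ^+ 2 <=
      (y - x) * ((1 + (y - x)) * kap N).
    by apply: (le_trans i1); apply: ler_wpM2l rho; rewrite subr_ge0.
  have p1 : `|d c j y - g N c j y| <= w N by rewrite dD// distrC; exact: gD.
  have p2 : `|d c j x - g N c j x| <= w N by rewrite dD// distrC; exact: gD.
  have p3 : (d c j y - g N c j y - (d c j x - g N c j x)) ^+ 2 <= 4 * kap N.
    have : `|d c j y - g N c j y - (d c j x - g N c j x)| ^+ 2 <= (2 * w N) ^+ 2.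
      apply: lerXn2r; rewrite ?nnegrE//; first by rewrite mulr_ge0 ?(ltW (w0 N)).
      by apply: (le_trans (ler_normB _ _)); lra.
    rewrite real_normK ?num_real// exprMn; have := ww N; have := wkap N.
    by move: (w N) (kap N) => u v; lra.
  rewrite /K; lra.
have dchain : jet_chain k d by move=> c; split => j jk; [exact: dL2|exact: prim].
pose XE : R := \sum_(p : edge G * bool) `|end_coord p.1 p.2|.
have XEle (e : edge G) p : end_coord e p <= XE.
  rewrite /XE (bigD1 (e, p))//=; apply: (le_trans (ler_norm _)).
  by rewrite lerDl sumr_ge0.
have near_end N (e : edge G) p (v : vertex G) s j : (Num.bound XE <= N)%N -> (j < k)%N ->
    end_vertex e p = Some v ->
    `|d (e, s) j (end_coord e p) - g N (e, s) j (end_coord e p)| <= w N.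
  move=> NX jk ev; rewrite dD// distrC; apply: gD => //; first exact: end_coord_dom ev.
  exact: le_trans (XEle e p) (bnd _ _ NX).
have dvert : vertex_conditions k d.
  split=> [j jk oj e e' p p' v ev ev' s|j jk oj v s].
    apply/eqP; rewrite -subr_eq0; apply/eqP.
    apply: (@sqr_le_cvg0 _ _ 4 kap (Num.bound XE) kap_cv) => N NX.
    have h1 := near_end N e p v s j NX jk ev; have h2 := near_end N e' p' v s j NX jk ev'.
    have [_ [/(_ j jk oj e e' p p' v ev ev' s) gE _]] := gsp N.
    have : `|d (e, s) j (end_coord e p) - d (e', s) j (end_coord e' p')| ^+ 2 <= (2 * w N) ^+ 2.
      apply: lerXn2r; rewrite ?nnegrE//; first by rewrite mulr_ge0 ?(ltW (w0 N)).
      rewrite (_ : _ - _ = (d (e, s) j (end_coord e p) - g N (e, s) j (end_coord e p)) -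
        (d (e', s) j (end_coord e' p') - g N (e', s) j (end_coord e' p'))); last first.
        by rewrite gE; ring.
      by apply: (le_trans (ler_normB _ _)); lra.
    rewrite real_normK ?num_real// exprMn; have := ww N; have := wkap N.
    by move: (w N) (kap N) => u v0; lra.
  pose K : R := \sum_(c : edge G * bool | end_vertex c.1 c.2 == Some v) 1.
  have K0 : 0 <= K by exact: sumr_ge0.
  apply: (@sqr_le_cvg0 _ _ (K ^+ 2) kap (Num.bound XE) kap_cv) => N NX.
  have [_ [_ /(_ j jk oj v s) gE]] := gsp N.
  set a := \sum_(c | _) _.
  have aK : `|a| <= K * w N.
    rewrite -[a]subr0 -gE /a -sumrB /K mulr_suml; apply: (le_trans (ler_norm_sum _ _ _)).
    apply: ler_sum => c /eqP cv; rewrite -mulrBr normrM normrX normrN1 expr1n !mul1r.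
    exact: near_end cv.
  have : `|a| ^+ 2 <= (K * w N) ^+ 2.
    by apply: lerXn2r; rewrite ?nnegrE// mulr_ge0 ?(ltW (w0 N)).
  rewrite real_normK ?num_real// exprMn => /le_trans; apply.
  by apply: ler_wpM2l; [exact: sqr_ge0|exact: le_trans (ww N) (wkap N)].
have dsp : jet_space k d by [].
exists d; split => //.
  move=> X e e0; apply: filterS (unif X e e0) => n hn c j x jk Ix xX.
  by rewrite dD//; exact: hn.
move=> e e0; have dk := jet_L2 dsp (leqnn k).
(* First variation: g(N) almost minimizes on [C N], which contains dn(n), and moving from g(N) by
   the fraction [s] towards dn(n) gives P >= A - w(N) / s - s T, with P their scalar product and A
   the top energy of g(N). Here [s] makes s T small; [N] is chosen afterwards. *)
pose s := Num.min 2^-1 (e / (4 * (T + 1))).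
have s0 : 0 < s by rewrite lt_min; apply/andP; split; [rewrite invr_gt0|apply: divr_gt0 => //; lra].
have s12 : s <= 2^-1 by rewrite ge_min lexx.
have sT : s * T <= e / 4.
  have : s * (4 * (T + 1)) <= e by rewrite -ler_pdivlMr ?ge_min ?lexx ?orbT//; lra.
  nra.
(* The weight in Young's inequality when g(N) is replaced by the limit; three such products
   occur. *)
pose th := e / (24 * (T + 1)).
have th0 : 0 < th by rewrite divr_gt0//; lra.
have thT : 3 * (th * T) <= e / 8.
  have : th * (24 * (T + 1)) = e by rewrite /th divfK// gt_eqF//; lra.
  nra.
pose K : R := \sum_(c : edge G * bool) 1.
have K0 : 0 <= K by exact: sumr_ge0.
pose tau := Num.min (s * e / 4) (e / 8 / (3 / th + 1) / (K + 1)).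
have q0 : 0 < 3 / th + 1 by rewrite ltr_wpDl// divr_ge0// ltW.
have tau0 : 0 < tau.
  rewrite lt_min; apply/andP; split; first by rewrite divr_gt0// mulr_gt0.
  by rewrite !divr_gt0//; lra.
have [N hN] : exists N, kap N <= tau.
  have /cvgrPdist_le/(_ tau tau0)[N1 _ hN1] := kap_cv.
  exists N1; have := hN1 N1 (leqnn _); rewrite /= sub0r normrN; exact/le_trans/ler_norm.
have wN : w N / s <= e / 4.
  rewrite ler_pdivrMr//; apply: (le_trans (wkap N)); apply: (le_trans hN).
  by rewrite (_ : e / 4 * s = s * e / 4) ?ge_min ?lexx//; ring.
pose del := energy_sq k (jcomb 1 d (-1) (g N)).
have del0 : 0 <= del by exact: energy_sq_ge0.
have delK : del <= K * eta N.
  rewrite /K mulr_suml; apply: ler_sum => c _; rewrite ip_nsq mul1r.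
  apply: le_trans (htop c N); rewrite le_eqVlt; apply/orP; left; apply/eqP.
  by apply: eq_nsq => x _; rewrite level_jcomb /comb /level dtop; ring.
have delq : del * (3 / th + 1) <= e / 8.
  rewrite -ler_pdivlMr//; apply: (le_trans delK).
  have : (K + 1) * kap N <= e / 8 / (3 / th + 1).
    rewrite mulrC -ler_pdivlMr; last lra.
    by apply: (le_trans hN); rewrite ge_min lexx orbT.
  by have := ekap N; have := eta_ge0 N; move: (eta N) (kap N) (e / 8 / _) => u v z; nra.
have young (f h : family G) : family_L2 f -> family_L2 h -> `|bil f h| <= th * bil f f + th^-1 * bil h h.
  move=> Lf Lh; have h1 := bil_ge0 (comb th f 1 h); have h2 := bil_ge0 (comb th f (-1) h).
  rewrite !bil_comb// in h1 h2; rewrite -(@ler_pM2l _ th)// -{1}(gtr0_norm th0) -normrM.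
  have -> : th * (th * bil f f + th^-1 * bil h h) = th ^+ 2 * bil f f + bil h h.
    by field; rewrite gt_eqF.
  by have := bil_ge0 f; have := bil_ge0 h; have := sqr_ge0 th; rewrite ler_norml; nra.
apply: filterS (CU N) => n Cn; have Ln := jet_L2 (dn_space n) (leqnn k).
have [CgN gNi] := hg N.
have s01 : 0 <= s <= 1 by lra.
have := iN_le N _ (Cconv N _ _ s CgN Cn s01).
rewrite /energy_sq level_jcomb bil_comb//; set A := bil (level k (g N)) (level k (g N)).
set P := bil (level k (g N)) (level k (dn n)); set Bq := bil (level k (dn n)) (level k (dn n)).
have BT : Bq <= T by exact: dnk.
have AT : A <= T by case: CgN.
have A0 : 0 <= A by exact: bil_ge0.
have Bq0 : 0 <= Bq by exact: bil_ge0.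
move: gNi; rewrite /energy_sq -/A -/(w N) => gNi h1.
have hP : A - w N / s - s * T <= P.
  have h2 : A * s * (2 - s) - w N - s ^+ 2 * T <= 2 * (1 - s) * s * P.
    by have := ler_wpM2l (sqr_ge0 s) BT; lra.
  have h3 : A * (2 - s) - w N / s - s * T <= 2 * (1 - s) * P.
    rewrite -(ler_pM2l s0).
    have -> : s * (A * (2 - s) - w N / s - s * T) = A * s * (2 - s) - w N - s ^+ 2 * T.
      by field; rewrite gt_eqF.
    by apply: (le_trans h2); rewrite le_eqVlt; apply/orP; left; apply/eqP; ring.
  have z0 : 0 <= w N / s + s * T.
    by apply: addr_ge0; [apply: divr_ge0; exact: ltW|apply: mulr_ge0 => //; exact: ltW].
  rewrite -(@ler_pM2l _ (2 * (1 - s))); last lra.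
  apply: le_trans h3; move: z0; set W := w N / s => z0.
  have z1 : 0 <= A * s by rewrite mulr_ge0 ?(ltW s0).
  have z2 : 0 <= (W + s * T) * (1 - 2 * s) by rewrite mulr_ge0//; lra.
  lra.
have dE : bil (level k (dn n)) (level k d) =
    P + bil (level k (dn n)) (level k (jcomb 1 d (-1) (g N))).
  by rewrite level_jcomb bil_combr// /P (bilC (level k (g N))); ring.
have dd : bil (level k d) (level k d) =
    A + 2 * bil (level k (g N)) (level k (jcomb 1 d (-1) (g N))) + del.
  by rewrite /del /energy_sq level_jcomb bil_comb// bil_combr// /A (bilC (level k d)); ring.
rewrite dE dd.
have Ldel : family_L2 (level k (jcomb 1 d (-1) (g N))) by apply: family_L2_comb; [exact: dk|exact: gk].
have := young _ _ Ln Ldel; have := young _ _ (gk N) Ldel.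
rewrite -/A -/Bq -/(energy_sq k (jcomb 1 d (-1) (g N))) -/del !ler_norml.
move=> /andP[y1 _] /andP[y2 y2'].
have y3 := young _ _ (gk N) Ldel; rewrite ler_norml -/A -/(energy_sq k (jcomb 1 d (-1) (g N))) -/del in y3.
have /andP[_ y4] := y3.
have tA : th * A <= th * T by rewrite ler_pM2l.
have tB : th * Bq <= th * T by rewrite ler_pM2l.
move: delq; rewrite mulrDr mulr1 (_ : del * (3 / th) = 3 * (th^-1 * del)); last by ring.
move=> delq.
lra.
Qed.

End Weak_compactness.

(** * Splitting of the energy *)

Section Vanishing.
Context {R : realType}.
Local Notation leb := (@lebesgue_measure R).
Implicit Types (l : \bar R) (f F w : R -> R).

(** Otherwise each [0, b] would carry at most the total minus [e], and [nsq_exhaust] would bound the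
    total by the same number. *)
Lemma nsq_tail l f e : (0 < l)%E -> real_L2 (edge_itv l) f -> 0 < e ->
  exists b, [/\ edge_itv l b & nsq (edge_itv l `\` `[0, b]) f <= e].
Proof.
move=> l0 Lf e0; have mI := measurable_edge_itv l.
have I0 := edge_itv0 l0.
have [h0 [h0_gt0 h0_le]] : exists h0 : R, 0 < h0 /\ (h0%:E <= l)%E.
  case: l l0 {Lf mI I0} => [r r0|_|//]; first by exists r.
  by exists 1; rewrite leey.
have [b [Ib hb]] : exists b, edge_itv l b /\ nsq (edge_itv l) f - e <= nsq `[0, b] f.
  apply: contrapT => /forallNP nb.
  have := @nsq_exhaust R l h0 h0_gt0 h0_le f (nsq (edge_itv l) f - e) (L2_measurable Lf).
  case=> [b Ib _|_]; last by lra.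
  split; first exact: (L2_locally Lf I0 Ib).
  by have /not_andP[//|/negP] := nb b; rewrite -ltNge => /ltW.
exists b; split => //.
have sub := edge_itv_sub I0 Ib.
have mb := @measurable_itvcc R 0 b.
have mD : measurable (edge_itv l `\` `[0, b]) by exact: measurableD.
have IE : edge_itv l = `[0, b] `|` (edge_itv l `\` `[0, b]) by rewrite setDUK.
have sf : Rintegrable (edge_itv l) (fun x => f x ^+ 2) := L2_sqr mI Lf.
have : nsq (edge_itv l) f = nsq `[0, b] f + nsq (edge_itv l `\` `[0, b]) f.
  rewrite /nsq {1}IE Rintegral_setU//.
  - by rewrite -IE.
  - by apply/disj_setPS => x [? []].
lra.
Qed.

Lemma nsq_split l f b : (0 < l)%E -> real_L2 (edge_itv l) f -> edge_itv l b ->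
  nsq (edge_itv l) f = nsq `[0, b] f + nsq (edge_itv l `\` `[0, b]) f.
Proof.
move=> l0 Lf Ib; have mI := measurable_edge_itv l.
have I0 := edge_itv0 l0.
have sub := edge_itv_sub I0 Ib.
have mb := @measurable_itvcc R 0 b.
have mD : measurable (edge_itv l `\` `[0, b]) by exact: measurableD.
have IE : edge_itv l = `[0, b] `|` (edge_itv l `\` `[0, b]) by rewrite setDUK.
have sf : Rintegrable (edge_itv l) (fun x => f x ^+ 2) := L2_sqr mI Lf.
rewrite /nsq {1}IE Rintegral_setU//.
- by rewrite -IE.
- by apply/disj_setPS => x [? []].
Qed.

Definition cap w F (x : R) : R := Num.min `|w x| `|F x|.

Lemma cap_ge0 w F x : 0 <= cap w F x.
Proof. by rewrite le_min !normr_ge0. Qed.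

Lemma cap_measurable (D : set R) w F : measurable D -> measurable_fun D w -> measurable_fun D F ->
  measurable_fun D (cap w F).
Proof.
move=> mD mw mF; apply: (@measurable_minr _ _ _ _ (fun x => `|w x|) (fun x => `|F x|)).
  by apply: measurableT_comp => //; exact: normr_measurable.
by apply: measurableT_comp => //; exact: normr_measurable.
Qed.

Lemma cap_L2 (D : set R) w F : measurable D -> measurable_fun D w -> real_L2 D F ->
  real_L2 D (cap w F).
Proof.
move=> mD mw LF; apply: (@L2_le _ _ mD _ F 1) => //.
  by apply: cap_measurable => //; case: LF.
by move=> x _; rewrite mul1r ger0_norm ?cap_ge0// ge_min lexx orbT.
Qed.

(** Up to [b] the function [w] is small, beyond [b] the fixed function [F] is: the cap tends to 0 in
    L^2 even when [w] keeps its mass far away. *)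
Lemma cap_small l F e : (0 < l)%E -> real_L2 (edge_itv l) F -> 0 < e ->
  exists b eps, [/\ edge_itv l b, 0 < eps & forall w, measurable_fun (edge_itv l) w ->
    (forall x, edge_itv l x -> x <= b -> `|w x| <= eps) ->
    nsq (edge_itv l) (cap w F) <= e].
Proof.
move=> l0 LF e0; have mI := measurable_edge_itv l.
have [b [Ib tb]] := nsq_tail l0 LF (divr_gt0 e0 (ltr0Sn R 1)).
have b0 : 0 <= b by case: Ib.
pose eps := Num.min 1 (e / (2 * (b + 1))).
have eps0 : 0 < eps by rewrite lt_min ltr01 divr_gt0//; lra.
have epsb : eps ^+ 2 * b <= e / 2.
  have h1 : eps <= 1 by rewrite ge_min lexx.
  have h2 : eps * (2 * (b + 1)) <= e by rewrite -ler_pdivlMr ?ge_min ?lexx ?orbT//; lra.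
  by nra.
exists b, eps; split => // w mw hw.
have Lc := cap_L2 mI mw LF.
have I0 := edge_itv0 l0.
have sub := edge_itv_sub I0 Ib.
have mb := @measurable_itvcc R 0 b.
have mD : measurable (edge_itv l `\` `[0, b]) by exact: measurableD.
rewrite (nsq_split l0 Lc Ib).
have n1 : nsq `[0, b] (cap w F) <= e / 2.
  apply: le_trans epsb; rewrite -{2}[b]subr0 -nsq_cst//.
  apply: nsq_le => //; [exact: (L2_locally Lc I0 Ib)|exact: L2_cst|].
  move=> x xb; rewrite ger0_norm ?cap_ge0// gtr0_norm// ge_min; apply/orP; left.
  by apply: hw; [exact: sub|move: xb; rewrite /= in_itv/= => /andP[]].
have n2 : nsq (edge_itv l `\` `[0, b]) (cap w F) <= e / 2.
  apply: le_trans tb; have sD : edge_itv l `\` `[0, b] `<=` edge_itv l by exact: subDsetl.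
  apply: nsq_le => //; [exact: (L2S mI mD sD Lc)|exact: (L2S mI mD sD LF)|].
  by move=> x _; rewrite ger0_norm ?cap_ge0// ge_min lexx orbT.
lra.
Qed.

End Vanishing.

(** * From local uniform to weak convergence *)

Section Splitting.
Context {R : realType} (G : metric_graph R).
Local Notation leb := (@lebesgue_measure R).
Local Notation I c := (edge_itv (len c.1)).
Implicit Types (d w : jet G) (f : family G).
Variable k : nat.
Hypothesis k_gt0 : (0 < k)%N.
Variables (U : set_system nat) (UU : UltraFilter U).
Variables (wn : nat -> jet G) (T : R).
Hypotheses (wn_space : forall n, jet_space k (wn n))
  (wn0 : forall n, energy_sq 0 (wn n) <= T)
  (wn_cvg : forall X e, 0 < e -> \forall n \near U, forall c x, I c x -> x <= X ->
     `|wn n c 0%N x| <= e).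

Let mI (c : edge G * bool) : measurable (I c).
Proof. exact: measurable_edge_itv. Qed.

Let wL n : family_L2 (level 0 (wn n)).
Proof. exact: (jet_L2 (wn_space n) (leq0n k)). Qed.

Lemma cap_vanish f e : family_L2 f -> 0 < e ->
  \forall n \near U, forall c, nsq (I c) (cap (wn n c 0%N) (f c)) <= e.
Proof.
move=> Lf e0; apply: filter_forall => c.
have [b [eps [Ib eps0 h]]] := cap_small (len_gt0 c.1) (Lf c) e0.
apply: filterS (wn_cvg b eps0) => n hn; apply: h; first exact: (L2_measurable (wL n c)).
by move=> x Ix xb; exact: hn.
Qed.

Lemma young_ip (D : set R) (mD : measurable D) (f1 f2 : R -> R) th :
  real_L2 D f1 -> real_L2 D f2 -> 0 < th ->
  \int[leb]_(x in D) (`|f1 x| * `|f2 x|) <= th * nsq D f1 + th^-1 * nsq D f2.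
Proof.
move=> L1 L2 th0; have s1 := L2_sqr mD L1; have s2 := L2_sqr mD L2.
rewrite /nsq -!RintZ// -RintD//; try exact: RintegrableZ.
apply: Rint_le => //.
- exact: (Rintegrable_mul mD (L2_norm mD L1) (L2_norm mD L2)).
- by apply: RintegrableD => //; exact: RintegrableZ.
move=> x _; rewrite -(real_normK (num_real (f1 x))) -(real_normK (num_real (f2 x))).
set a := `|f1 x|; set b := `|f2 x|.
have a0 : 0 <= a by exact: normr_ge0.
have b0 : 0 <= b by exact: normr_ge0.
rewrite -(@ler_pM2l _ th)// mulrDr !mulrA divff ?gt_eqF// mul1r.
have := sqr_ge0 (th * a - b); have := sqr_ge0 b; have := sqr_ge0 (th * a).
rewrite sqrrB exprMn; nra.
Qed.

(** With w the sequence: where |w| <= M |f| the product is at most |f| times the cap of w by M f,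
    which tends to 0 in L^2; elsewhere it is at most w^2 / M, small by the bound on the mass. *)
Lemma weak_bil f e : family_L2 f -> 0 < e ->
  \forall n \near U, `|bil (level 0 (wn n)) f| <= e.
Proof.
move=> Lf e0.
have T0 : 0 <= T := le_trans (energy_sq_ge0 0 (wn 0)) (wn0 0).
pose Q := bil f f; have Q0 : 0 <= Q by exact: bil_ge0.
pose K : R := \sum_(c : edge G * bool) 1.
have K0 : 0 <= K by exact: sumr_ge0.
pose M := 4 * (T + 1) / e.
have M0 : 0 < M by rewrite divr_gt0//; lra.
have MT : M^-1 * T <= e / 4.
  rewrite /M invf_div mulrAC ler_pdivrMr; last lra.
  by have := ltW e0; nra.
pose th := e / (4 * (Q + 1)).
have th0 : 0 < th by rewrite divr_gt0//; lra.
have thQ : th * Q <= e / 4.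
  have : th * (4 * (Q + 1)) = e by rewrite /th divfK// gt_eqF//; lra.
  by nra.
pose eps := e / 4 * th / (K + 1).
have eps0 : 0 < eps by apply: divr_gt0; [apply: mulr_gt0 => //; exact: divr_gt0|lra].
have epsK : th^-1 * (K * eps) <= e / 4.
  have : (K + 1) * eps = e / 4 * th by rewrite /eps mulrC divfK// gt_eqF//; lra.
  move=> h1; rewrite -(ler_pM2l th0) mulrA divff ?gt_eqF// mul1r.
  by have := ltW eps0; nra.
have Lf' : family_L2 (fun c x => M * f c x) by move=> c; exact: L2Z.
apply: filterS (cap_vanish Lf' eps0) => n hn.
apply: (le_trans (ler_norm_sum _ _ _)).
apply: (@le_trans _ _ (\sum_c (th * nsq (I c) (f c) + th^-1 * eps + M^-1 * nsq (I c) (wn n c 0%N)))).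
  apply: ler_sum => c _; set r := cap (wn n c 0%N) (fun x => M * f c x).
  have Lr : real_L2 (I c) r := cap_L2 (mI c) (L2_measurable (wL n c)) (Lf' c).
  have sw := L2_sqr (mI c) (wL n c).
  have sfr := Rintegrable_mul (mI c) (L2_norm (mI c) (Lf c)) (L2_norm (mI c) Lr).
  apply: (@le_trans _ _ (\int[leb]_(x in I c) (`|f c x| * `|r x| + M^-1 * wn n c 0%N x ^+ 2))).
    apply: (Rint_abs_le (mI c)).
    - exact: (Rintegrable_mul (mI c) (wL n c) (Lf c)).
    - by apply: (RintegrableD (mI c) sfr); exact: (RintegrableZ (mI c)).
    move=> x Ix; rewrite normrM (ger0_norm (cap_ge0 _ _ _)) /r /cap /level.
    rewrite -(real_normK (num_real (wn n c 0%N x))) normrM (gtr0_norm M0).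
    set a := `|wn n c 0%N x|; set b := `|f c x|.
    have a0 : 0 <= a by exact: normr_ge0.
    have b0 : 0 <= b by exact: normr_ge0.
    have [h|h] := leP a (M * b).
      by rewrite mulrC lerDl mulr_ge0 ?sqr_ge0// invr_ge0 ltW.
    have : a * b <= M^-1 * a ^+ 2.
      by rewrite -(ler_pM2l M0) mulVKf ?gt_eqF// expr2; nra.
    have : 0 <= b * (M * b) by apply: mulr_ge0 => //; apply: mulr_ge0 => //; exact: ltW.
    lra.
  rewrite (RintD (mI c) sfr (RintegrableZ (mI c) _ sw)) (RintZ (mI c) _ sw) lerD2r.
  apply: (le_trans (young_ip (mI c) (Lf c) Lr th0)); rewrite lerD2l.
  by apply: ler_wpM2l; [rewrite invr_ge0 ltW|exact: hn].
have e1 : \sum_c th * nsq (I c) (f c) = th * Q.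
  by rewrite /Q /bil mulr_sumr; apply: eq_bigr => c _; rewrite ip_nsq.
have e2 : \sum_c M^-1 * nsq (I c) (wn n c 0%N) = M^-1 * energy_sq 0 (wn n).
  by rewrite /energy_sq /bil mulr_sumr; apply: eq_bigr => c _; rewrite ip_nsq.
have e3 : \sum_(c : edge G * bool) th^-1 * eps = th^-1 * (K * eps).
  by rewrite /K mulr_suml mulr_sumr; apply: eq_bigr => c _; rewrite mul1r.
rewrite !big_split/= e1 e2 e3.
have : M^-1 * energy_sq 0 (wn n) <= M^-1 * T by apply: ler_wpM2l; [rewrite invr_ge0 ltW|exact: wn0].
lra.
Qed.

End Splitting.

(** * Splitting of the mass, kinetic, potential and power terms *)

Section Energy_splitting.
Context {R : realType} (G : metric_graph R).
Local Notation leb := (@lebesgue_measure R).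
Local Notation I c := (edge_itv (len c.1)).
Implicit Types (d w : jet G).
Variable k : nat.
Hypothesis k_gt0 : (0 < k)%N.
Variables (U : set_system nat) (UU : UltraFilter U).
Variables (dn : nat -> jet G) (d : jet G) (T : R).
Hypotheses (dn_space : forall n, jet_space k (dn n)) (d_space : jet_space k d)
  (dn0 : forall n, energy_sq 0 (dn n) <= T) (dnk : forall n, energy_sq k (dn n) <= T)
  (dn_cvg : forall X e, 0 < e -> \forall n \near U, forall c x, I c x -> x <= X ->
     `|dn n c 0%N x - d c 0%N x| <= e)
  (dn_weak : forall e, 0 < e -> \forall n \near U,
    energy_sq k d - e <= bil (level k (dn n)) (level k d)).

Let wn n : jet G := jcomb 1 (dn n) (-1) d.

Let wn_space n : jet_space k (wn n).
Proof. exact: jet_space_comb. Qed.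

Let T' : R := 2 * T + 2 * energy_sq 0 d + (2 * T + 2 * energy_sq k d).

Lemma energy_sq_diff j n : (j <= k)%N ->
  energy_sq j (wn n) = energy_sq j (dn n) - 2 * bil (level j (dn n)) (level j d) + energy_sq j d.
Proof.
move=> jk; rewrite /wn /energy_sq level_jcomb bil_comb; first by ring.
- exact: (jet_L2 (dn_space n) jk).
- exact: (jet_L2 d_space jk).
Qed.

Lemma energy_sq_diff_le j n : (j <= k)%N ->
  energy_sq j (wn n) <= 2 * energy_sq j (dn n) + 2 * energy_sq j d.
Proof.
move=> jk; rewrite energy_sq_diff//.
have L1 := jet_L2 (dn_space n) jk; have L2 := jet_L2 d_space jk.
have := bil_ge0 (comb 1 (level j (dn n)) 1 (level j d)).
by rewrite bil_comb// /energy_sq; lra.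
Qed.

Let wnT j n : (j == 0)%N || (j == k) -> energy_sq j (wn n) <= T'.
Proof.
have E0 := energy_sq_ge0 0 d; have Ek := energy_sq_ge0 k d.
have T0 : 0 <= T := le_trans (energy_sq_ge0 0 (dn 0)) (dn0 0).
case/orP => /eqP ->; rewrite /T'.
  by apply: (le_trans (energy_sq_diff_le n (leq0n k))); have := dn0 n; lra.
by apply: (le_trans (energy_sq_diff_le n (leqnn k))); have := dnk n; lra.
Qed.

Lemma wn_cvg X e : 0 < e -> \forall n \near U, forall c x, I c x -> x <= X ->
  `|wn n c 0%N x| <= e.
Proof.
move=> e0; apply: filterS (dn_cvg X e0) => n hn c x Ix xX.
by rewrite /wn /jcomb mul1r mulN1r; exact: hn.
Qed.

Lemma weak_diff f e : family_L2 f -> 0 < e ->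
  \forall n \near U, `|bil (level 0 (wn n)) f| <= e.
Proof.
move=> Lf e0; apply: (weak_bil UU wn_space _ wn_cvg Lf e0) => n.
by apply: wnT; rewrite eqxx.
Qed.

Lemma splitting0 e : 0 < e -> \forall n \near U,
  `|energy_sq 0 (dn n) - energy_sq 0 d - energy_sq 0 (wn n)| <= e.
Proof.
move=> e0; have Ld := jet_L2 d_space (leq0n k).
apply: filterS (weak_diff Ld (divr_gt0 e0 (ltr0Sn R 1))) => n.
have Ln := jet_L2 (dn_space n) (leq0n k).
rewrite energy_sq_diff// /wn level_jcomb bil_combl// -/(energy_sq 0 d).
by rewrite !ler_norml; lra.
Qed.

(** One-sided, because [weak_compactness] bounds the scalar products from below only; this is the
    side that a lower bound for the energy of the sequence requires. *)
Lemma splitting_k e : 0 < e -> \forall n \near U,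
  energy_sq k d + energy_sq k (wn n) - e <= energy_sq k (dn n).
Proof.
move=> e0; apply: filterS (dn_weak (divr_gt0 e0 (ltr0Sn R 1))) => n.
by rewrite energy_sq_diff//; lra.
Qed.

Section Potential.
Variables (V V2 Vinf : edge G -> R -> R) (M : R).
Hypothesis VE : bounded_split V V2 Vinf M.

(** The cross terms are scalar products of the remainder with [potential V d], a fixed L^2 family,
    and hence tend to 0. *)
Lemma splitting_pot e : 0 < e -> \forall n \near U,
  `|pot V (dn n) (dn n) - pot V d d - pot V (wn n) (wn n)| <= e.
Proof.
move=> e0; have LV := potential_L2 k_gt0 VE d_space.
apply: filterS (weak_diff LV (divr_gt0 e0 (ltr0Sn R 1))) => n.
have L0 := jet_L2 d_space (leq0n k); have Lw := jet_L2 (wn_space n) (leq0n k).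
have LVw := potential_L2 k_gt0 VE (wn_space n).
have E : pot V (dn n) (dn n) = pot V d d + 2 * bil (level 0 (wn n)) (potential V d) + pot V (wn n) (wn n).
  have e1 : pot V (dn n) (dn n) =
      bil (comb 1 (potential V (wn n)) 1 (potential V d)) (comb 1 (level 0 (wn n)) 1 (level 0 d)).
    apply: eq_bil => c x _; rewrite /potential /comb /level /wn /jcomb; ring.
  have L2c := family_L2_comb 1 1 Lw L0.
  rewrite e1 bil_combl// (bil_combr 1 1 Lw L0 LVw) (bil_combr 1 1 Lw L0 LV) /pot.
  have -> : bil (potential V (wn n)) (level 0 d) = bil (level 0 (wn n)) (potential V d).
    apply: eq_bil => c x _; rewrite /potential /level; ring.
  by rewrite (bilC (potential V d) (level 0 (wn n))); ring.
by rewrite E !ler_norml; lra.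
Qed.

End Potential.

Section Power.
Variable q : R.
Hypothesis q_gt2 : 2 < q.

Lemma modulus_triangle (d1 d2 : jet G) a b e x :
  modulus (jcomb a d1 b d2) e x <= `|a| * modulus d1 e x + `|b| * modulus d2 e x.
Proof.
set m1 := modulus d1 e x; set m2 := modulus d2 e x.
have m10 : 0 <= m1 by exact: modulus_ge0.
have m20 : 0 <= m2 by exact: modulus_ge0.
rewrite -(@ler_pXn2r _ 2)// ?nnegrE ?modulus_ge0//; last first.
  by rewrite addr_ge0// mulr_ge0.
rewrite modulus_sqr /jcomb.
have h1 := modulus_sqr d1 e x; have h2 := modulus_sqr d2 e x.
rewrite -/m1 in h1; rewrite -/m2 in h2.
move: h1 h2; set u := d1 (e, false) 0%N x; set v := d1 (e, true) 0%N x.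
set u' := d2 (e, false) 0%N x; set v' := d2 (e, true) 0%N x => h1 h2.
have cs : `|u * u' + v * v'| <= m1 * m2.
  rewrite -(@ler_pXn2r _ 2)// ?nnegrE ?mulr_ge0// real_normK ?num_real// exprMn h1 h2.
  by have := sqr_ge0 (u * v' - v * u'); lra.
rewrite !sqrrD !exprMn !real_normK ?num_real// h1 h2.
have : a * b * (u * u' + v * v') <= `|a| * `|b| * (m1 * m2).
  apply: (le_trans (ler_norm _)); rewrite normrM (normrM a); apply: ler_wpM2l cs.
  by rewrite mulr_ge0.
lra.
Qed.

(** With u an element of the sequence and w = u - d, the modulus |u| differs from the larger of |w|
    and |d| by at most the smaller. So the defect is at most a multiple of (|u| + |w| + |d|)
    min(|w|, |d|), where the minimum tends to 0 in L^2 although |w| may not. *)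
Lemma splitting_power e : 0 < e -> \forall n \near U,
  `|power_integral q (dn n) - power_integral q d - power_integral q (wn n)| <= e.
Proof.
move=> e0; have q2 := q_gt2.
have T0 : 0 <= T := le_trans (energy_sq_ge0 0 (dn 0)) (dn0 0).
have E0 := energy_sq_ge0 0 d; have Ek := energy_sq_ge0 k d.
have T'0 : 0 <= T' by rewrite /T'; lra.
have [S S0 small] := modulus_sup G k_gt0 T'0.
have dT' : energy_sq 0 d <= T' /\ energy_sq k d <= T' by rewrite /T'; split; lra.
have dnT' n : energy_sq 0 (dn n) <= T' /\ energy_sq k (dn n) <= T'.
  by have := dn0 n; have := dnk n; rewrite /T'; split; lra.
have wnT' n : energy_sq 0 (wn n) <= T' /\ energy_sq k (wn n) <= T'.
  by split; apply: wnT; rewrite eqxx ?orbT.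
have sd (a : edge G) x Ix := small d d_space dT'.1 dT'.2 a x Ix.
have sdn n (a : edge G) x Ix := small (dn n) (dn_space n) (dnT' n).1 (dnT' n).2 a x Ix.
have swn n (a : edge G) x Ix := small (wn n) (wn_space n) (wnT' n).1 (wnT' n).2 a x Ix.
pose N := Num.bound q.
have qN : q <= N%:R by apply: ltW; apply: archi_boundP; lra.
pose K := N%:R * S `^ (q - 2) + S `^ (q - 2).
have K0 : 0 <= K by rewrite addr_ge0 ?mulr_ge0 ?powR_ge0.
have diff1 a b : 0 <= a -> a <= S -> 0 <= b -> b <= S ->
    `|a `^ q - b `^ q| <= K * ((a + b) * `|a - b|).
  move=> a0 aS b0 bS; apply: (le_trans (powR_dist (ltW q2) qN a0 aS b0 bS)).
  by apply: ler_wpM2r; [rewrite mulr_ge0// addr_ge0|rewrite lerDl powR_ge0].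
have diff0 a : 0 <= a -> a <= S -> `|a `^ q| <= K * (a * a).
  move=> a0 aS; rewrite ger0_norm ?powR_ge0//.
  apply: (le_trans (powR_le_sqr (ltW q2) a0 aS)); rewrite -expr2.
  by apply: ler_wpM2r; [exact: sqr_ge0|rewrite lerDr mulr_ge0// powR_ge0].
have pointwise n (a : edge G) x : edge_itv (len a) x ->
   `|modulus (dn n) a x `^ q - modulus d a x `^ q - modulus (wn n) a x `^ q| <=
    K * ((modulus (dn n) a x + modulus (wn n) a x + modulus d a x) *
       (2 * Num.min (modulus (wn n) a x) (modulus d a x))).
  move=> Ix; have a0 := modulus_ge0 (dn n) a x; have b0 := modulus_ge0 d a x.
  have c0 := modulus_ge0 (wn n) a x.
  have aS := sdn n a x Ix; have bS := sd a x Ix; have cS := swn n a x Ix.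
  have tri1 : modulus (wn n) a x <= modulus (dn n) a x + modulus d a x.
    by have := modulus_triangle (dn n) d 1 (-1) a x; rewrite normrN normr1 !mul1r.
  have dnE : dn n = jcomb 1 (wn n) 1 d.
    by apply/funext => c; apply/funext => j; apply/funext => y; rewrite /wn /jcomb; ring.
  have dE : d = jcomb 1 (dn n) (-1) (wn n).
    by apply/funext => c; apply/funext => j; apply/funext => y; rewrite /wn /jcomb; ring.
  have tri2 : modulus (dn n) a x <= modulus (wn n) a x + modulus d a x.
    by rewrite {1}dnE; have := modulus_triangle (wn n) d 1 1 a x; rewrite normr1 !mul1r.
  have tri3 : modulus d a x <= modulus (dn n) a x + modulus (wn n) a x.
    by rewrite {1}dE; have := modulus_triangle (dn n) (wn n) 1 (-1) a x; rewrite normrN normr1 !mul1r.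
  move: a0 b0 c0 aS bS cS tri1 tri2 tri3.
  set u := modulus (dn n) a x; set v := modulus d a x; set z := modulus (wn n) a x.
  move=> a0 b0 c0 aS bS cS tri1 tri2 tri3.
  have [zv|vz] := leP z v.
    have h1 := diff1 u v a0 aS b0 bS; have h2 := diff0 z c0 cS.
    apply: (le_trans (ler_normB _ _)).
    have h3 : `|u - v| <= z by rewrite ler_norml; lra.
    have h4 : (u + v) * `|u - v| <= (u + v) * z by apply: ler_wpM2l => //; exact: addr_ge0.
    have := ler_wpM2l K0 h4 => h5.
    have h6 : K * ((u + v) * z) + K * (z * z) <= K * ((u + z + v) * (2 * z)).
      by rewrite -mulrDr; apply: ler_wpM2l => //; nra.
    lra.
  have h1 := diff1 u z a0 aS c0 cS; have h2 := diff0 v b0 bS.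
  rewrite (_ : u `^ q - v `^ q - z `^ q = u `^ q - z `^ q - v `^ q); last by ring.
  apply: (le_trans (ler_normB _ _)).
  have h3 : `|u - z| <= v by rewrite ler_norml; lra.
  have h4 : (u + z) * `|u - z| <= (u + z) * v by apply: ler_wpM2l => //; exact: addr_ge0.
  have := ler_wpM2l K0 h4 => h5.
  have h6 : K * ((u + z) * v) + K * (v * v) <= K * ((u + z + v) * (2 * v)).
    by rewrite -mulrDr; apply: ler_wpM2l => //; nra.
  lra.
pose Kc : R := \sum_(a : edge G) 1.
have Kc0 : 0 <= Kc by exact: sumr_ge0.
(* On each edge the squared norm of |u| + |w| + |d| is at most 2 (2 T' + 2 T') + 2 T' = 10 T'. *)
pose Q : R := \sum_(a : edge G) (10 * T').
have T'3 : 0 <= 10 * T' by lra.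
have Q0 : 0 <= Q by exact: sumr_ge0.
pose th := e / (4 * (K + 1) * (Q + 1)).
have th0 : 0 < th by rewrite divr_gt0// !mulr_gt0//; lra.
have thQ : K * (th * Q) <= e / 4.
  have h1 : th * (4 * (K + 1) * (Q + 1)) = e by rewrite /th divfK// gt_eqF// !mulr_gt0//; lra.
  have h2 : 0 <= K * th by rewrite mulr_ge0// ltW.
  have h3 : 0 <= th * Q by rewrite mulr_ge0// ltW.
  by have := ltW th0; nra.
pose eps := e * th / (16 * (K + 1) * (Kc + 1)).
have K10 : 0 < K + 1 by lra.
have Kc10 : 0 < Kc + 1 by lra.
have eps0 : 0 < eps by apply: divr_gt0; [exact: mulr_gt0|apply: mulr_gt0 => //; exact: mulr_gt0].
have epsK : K * (th^-1 * (4 * (Kc * eps))) <= e / 4.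
  have h1 : (16 * (K + 1) * (Kc + 1)) * eps = e * th by rewrite /eps mulrC divfK// gt_eqF// !mulr_gt0//; lra.
  have h2 : 0 <= K * eps by rewrite mulr_ge0// ltW.
  have h3 : 0 <= Kc * eps by rewrite mulr_ge0// ltW.
  rewrite -(ler_pM2l th0) (_ : th * (K * (th^-1 * (4 * (Kc * eps)))) = 4 * (K * (Kc * eps))); last first.
    by field; rewrite gt_eqF.
  by have := ltW eps0; nra.
have wm n a : measurable_fun (edge_itv (len a)) (modulus (wn n) a).
  exact: modulus_measurable (wn_space n).
have near_cap : \forall n \near U, forall a : edge G,
    nsq (edge_itv (len a)) (cap (modulus (wn n) a) (modulus d a)) <= eps.
  apply: filter_forall => a.
  have [b [ep [Ib ep0 h]]] := cap_small (len_gt0 a) (modulus_L2 a d_space) eps0.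
  have e20 : 0 < ep / 2 by rewrite divr_gt0.
  apply: filterS (wn_cvg b e20) => n hn; apply: h; first exact: wm.
  move=> x Ix xb; rewrite ger0_norm ?modulus_ge0//.
  rewrite -(@ler_pXn2r _ 2)// ?nnegrE ?modulus_ge0// ?(ltW ep0)//.
  rewrite modulus_sqr.
  have sq s : wn n (a, s) 0%N x ^+ 2 <= (ep / 2) ^+ 2.
    rewrite -real_normK ?num_real//; apply: lerXn2r; rewrite ?nnegrE ?(ltW e20)//.
    exact: (hn (a, s) x Ix xb).
  by have := sq false; have := sq true; rewrite !exprMn; have := sqr_ge0 ep; nra.
apply: filterS near_cap => n hn.
rewrite /power_integral -!sumrB.
apply: (le_trans (ler_norm_sum _ _ _)).
apply: (@le_trans _ _ (\sum_(a : edge G) K * (th * (10 * T') + th^-1 * (4 * eps)))); last first.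
  have e1 : \sum_(a : edge G) K * (th * (10 * T') + th^-1 * (4 * eps)) =
     K * (th * Q) + K * (th^-1 * (4 * (Kc * eps))).
    rewrite /Q /Kc; have gen (x y : R) : \sum_(a : edge G) K * (th * x + th^-1 * (4 * y)) =
       K * (th * \sum_(a : edge G) x) + K * (th^-1 * (4 * ((\sum_(a : edge G) 1) * y))).
      by rewrite mulr_suml !mulr_sumr -big_split/=; apply: eq_bigr => a _; rewrite mul1r mulrDr.
    exact: gen.
  by rewrite e1; lra.
apply: ler_sum => a _; set J := edge_itv (len a).
have mJ : measurable J by exact: measurable_edge_itv.
have P1 := @power_Rintegrable _ _ _ k_gt0 q q_gt2 (dn n) a (dn_space n).
have P2 := @power_Rintegrable _ _ _ k_gt0 q q_gt2 d a d_space.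
have P3 := @power_Rintegrable _ _ _ k_gt0 q q_gt2 (wn n) a (wn_space n).
rewrite -(RintB mJ P1 P2) -(RintB mJ (RintegrableB mJ P1 P2) P3).
have m1 := modulus_L2 a (dn_space n); have m2 := modulus_L2 a d_space; have m3 := modulus_L2 a (wn_space n).
pose s x := modulus (dn n) a x + modulus (wn n) a x + modulus d a x.
have Ls : real_L2 J s by apply: L2D => //; exact: L2D.
pose r x := 2 * cap (modulus (wn n) a) (modulus d a) x.
have Lr : real_L2 J r by apply: (L2Z mJ); exact: (cap_L2 mJ (wm n a) m2).
have srI := Rintegrable_mul mJ (L2_norm mJ Ls) (L2_norm mJ Lr).
apply: (@le_trans _ _ (K * \int[leb]_(x in J) (`|s x| * `|r x|))).
  rewrite -(RintZ mJ K srI); apply: (Rint_abs_le mJ).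
  - by apply: (RintegrableB mJ _ P3); exact: (RintegrableB mJ P1 P2).
  - exact: (RintegrableZ mJ).
  move=> x Jx; apply: (le_trans (pointwise n a x Jx)).
  apply: ler_wpM2l => //; rewrite /s /r /cap !ger0_norm ?modulus_ge0//.
  - by rewrite mulr_ge0// le_min !modulus_ge0.
  - by rewrite !addr_ge0 ?modulus_ge0.
apply: ler_wpM2l => //; apply: (le_trans (young_ip mJ Ls Lr th0)); apply: lerD.
  rewrite ler_pM2l//.
  have mod_le (g : jet G) : jet_space k g -> energy_sq 0 g <= T' -> nsq J (modulus g a) <= T'.
    move=> hg; apply: le_trans; rewrite (energy_sq_modulus hg) (bigD1 a)//= lerDl.
    by apply: sumr_ge0 => i _; apply: nsq_ge0.
  have b1 := mod_le _ (dn_space n) (dnT' n).1.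
  have b2 := mod_le _ d_space dT'.1.
  have b3 := mod_le _ (wn_space n) (wnT' n).1.
  have := nsqD_le mJ (L2D mJ m1 m3) m2; have := nsqD_le mJ m1 m3.
  by rewrite /s; lra.
rewrite (nsqZ mJ)//; last exact: (cap_L2 mJ (wm n a) m2).
rewrite ler_wpM2l ?invr_ge0 ?(ltW th0)//.
by have := hn a; rewrite -/J; lra.
Qed.

End Power.
End Energy_splitting.

(** * Gluing and cut-off *)

Section Glue.
Context {R : realType}.
Local Notation leb := (@lebesgue_measure R).
Variable l : \bar R.
Hypothesis l_gt0 : (0 < l)%E.
Local Notation I := (edge_itv l).

Definition glue (b : R) (F1 F2 : R -> R) (x : R) : R := if x <= b then F1 x else F2 x.

Lemma glue_L2 b f1 f2 : I b -> real_L2 `[0, b] f1 -> real_L2 I f2 -> real_L2 I (glue b f1 f2).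
Proof.
move=> Ib L1 L2; have mI := measurable_edge_itv l.
have mb := @measurable_itvcc R 0 b.
have sub := edge_itv_sub (edge_itv0 l_gt0) Ib.
have mD : measurable (I `\` `[0, b]) by exact: measurableD.
have IE : I = `[0, b] `|` (I `\` `[0, b]) by rewrite setDUK.
have LD := L2S mI mD (@subDsetl _ _ _) L2.
have e1 x : `[0, b]%classic x -> f1 x = glue b f1 f2 x.
  by rewrite /= in_itv/= /glue => /andP[_ ->].
have e2 x : (I `\` `[0, b]) x -> f2 x = glue b f1 f2 x.
  move=> [[x0 _]]; rewrite /= in_itv/= x0/= => /negP xb.
  by rewrite /glue (negPf xb).
have [m1 h1] := eq_L2 mb e1 L1; have [m2 h2] := eq_L2 mD e2 LD.
have mg : measurable_fun I (glue b f1 f2) by rewrite IE; apply/measurable_funU.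
split => //; rewrite IE ge0_integral_setU//=.
- by rewrite lte_add_pinfty.
- by rewrite -IE; apply/measurable_EFinP; exact: measurable_funX.
- by move=> x _; rewrite lee_fin sqr_ge0.
- by apply/disj_setPS => x [? []].
Qed.

(** At [b] the glued density takes the value of [f1]; this single point does not affect the
    integrals to the right of [b]. *)
Lemma glue_primitive b F1 f1 F2 f2 : I b -> real_L2 `[0, b] f1 -> real_L2 I f2 ->
  primitive 0 b F1 f1 -> primitive_on l F2 f2 -> F1 b = F2 b ->
  primitive_on l (glue b F1 F2) (glue b f1 f2).
Proof.
move=> Ib L1 L2 P1 P2 E x y Ix Iy xy; have [x0 _] := Ix; have [y0 _] := Iy.
have Lg := L2_locally (glue_L2 Ib L1 L2); have L2' := L2_locally L2.
have left u v : 0 <= u -> u <= v -> v <= b ->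
    F1 v - F1 u = \int[leb]_(t in `[u, v]) glue b f1 f2 t.
  move=> u0 uv vb; rewrite (P1 u v u0 uv vb); apply: eq_Rint => t.
  by rewrite /= in_itv/= => /andP[_ tv]; rewrite /glue (le_trans tv vb).
have right u v : I u -> I v -> u <= v -> b <= u ->
    F2 v - F2 u = \int[leb]_(t in `[u, v]) glue b f1 f2 t.
  move=> Iu Iv uv bu; rewrite (P2 u v Iu Iv uv).
  apply: (ae_Rint (@measurable_itvcc R u v)).
  - exact: (L2_measurable (L2' u v Iu Iv)).
  - exact: (L2_measurable (Lg u v Iu Iv)).
  exists [set b]; split => //; first exact: lebesgue_measure_set1.
  move=> t /= /not_implyP[]; rewrite in_itv/= => /andP[ut tv]; rewrite /glue.
  by case: (leP t b) => // tb _; apply/le_anti; rewrite tb (le_trans bu).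
rewrite {1 2}/glue; case: (leP y b) => yb.
  by rewrite (le_trans xy yb) left.
case: (leP x b) => xb; last by rewrite right// ltW.
rewrite (@Rint_itv_cat _ x b y)// ?ltW//; last first.
  exact: (L2_Rintegrable (Lg x y Ix Iy)).
rewrite -left// -right// ?ltW// E; ring.
Qed.

Lemma chain_glue m b (d1 d2 : nat -> R -> R) : I b ->
  (forall j, (j <= m)%N -> real_L2 `[0, b] (d1 j)) ->
  (forall j, (j < m)%N -> primitive 0 b (d1 j) (d1 j.+1)) ->
  chain l m d2 -> (forall j, (j < m)%N -> d1 j b = d2 j b) ->
  chain l m (fun j => glue b (d1 j) (d2 j)).
Proof.
move=> Ib L1 P1 [L2 P2] E; split=> j jm.
  exact: (glue_L2 Ib (L1 j jm) (L2 j jm)).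
exact: (glue_primitive Ib (L1 _ jm) (L2 _ jm) (P1 j jm) (P2 j jm) (E j jm)).
Qed.

Lemma nsq_local X eps f g : I X -> real_L2 I f -> real_L2 I g ->
  (forall x, I x -> x <= X -> f x ^+ 2 <= g x ^+ 2 + eps ^+ 2) ->
  (forall x, I x -> X < x -> f x ^+ 2 <= g x ^+ 2) ->
  nsq I f <= nsq I g + eps ^+ 2 * X.
Proof.
move=> IX Lf Lg h1 h2; have mI := measurable_edge_itv l; have [X0 _] := IX.
pose r := glue X (fun=> eps) (fun=> 0).
have Lr : real_L2 I r by apply: glue_L2 => //; [exact: L2_cst|exact: L2_0].
have -> : eps ^+ 2 * X = nsq I r.
  rewrite -{1}[X]subr0 -nsq_cst// /nsq (@Rint_support _ I `[0, X])//.
  - apply: eq_Rint => x; rewrite /= in_itv/= => /andP[_ xX].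
    by rewrite /r /glue xX.
  - exact: edge_itv_sub (edge_itv0 l_gt0) IX.
  - move=> x [x0 _]; rewrite /= in_itv/= x0/= => /negP xX.
    by rewrite /r /glue (negPf xX) expr0n.
rewrite /nsq -RintD//; [|exact: L2_sqr|exact: L2_sqr].
apply: Rint_le => //; [exact: L2_sqr|by apply: RintegrableD => //; exact: L2_sqr|].
move=> x Ix; rewrite /r /glue; case: (leP x X) => xX; first exact: h1.
by rewrite expr0n addr0; exact: h2.
Qed.

End Glue.

(** * Hermite interpolation by polynomials *)

Section Hermite.
Context {R : realType}.
Implicit Types (a b : R) (p r : {poly R}).

Lemma derivn_multiple_root k j a r : (j < k)%N ->
  ((('X - a%:P) ^+ k * r)^`(j)).[a] = 0.
Proof.
elim: j k r => [|j IH] [|k] r jk //.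
  by rewrite derivn0 hornerM horner_exp hornerXsubC subrr expr0n mul0r.
rewrite derivSn derivM deriv_exp derivXsubC mul1r.
have -> : ('X - a%:P) ^+ k *+ k.+1 * r + ('X - a%:P) ^+ k.+1 * r^`() =
    ('X - a%:P) ^+ k * (r *+ k.+1 + ('X - a%:P) * r^`()).
  by rewrite mulrDr mulrnAl mulrnAr exprSr mulrA.
exact: IH.
Qed.

Lemma horner_bounded a b p : exists2 C : R, 0 <= C & forall x, a <= x -> x <= b -> `|p.[x]| <= C.
Proof.
have [B hB] := primitive_bounded
  (@continuous_Rintegrable _ _ a b (@continuous_horner _ p^`())) (@primitive_horner _ a b p).
exists (Num.max 0 B); first by rewrite le_max lexx.
move=> x ax xb; rewrite le_max hB ?orbT//.
by rewrite /= in_itv/= ax.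
Qed.

Lemma derivn_comp_shift p b j : (p \Po ('X - b%:P))^`(j) = p^`(j) \Po ('X - b%:P).
Proof.
elim: j => [|j IH]; first by rewrite !derivn0.
by rewrite !derivnS IH deriv_comp derivXsubC mulr1.
Qed.

(* Bezout: [u (X - a)^k + v (X - b)^k = 1], so [u (X - a)^k t] has the jet of [t] at [b]. *)
Lemma hermite_basis k a b i : a < b -> exists p, forall j, (j < k)%N ->
  p^`(j).[a] = 0 /\ p^`(j).[b] = (i == j)%:R.
Proof.
move=> ab; have : coprimep (('X - a%:P) ^+ k) (('X - b%:P) ^+ k).
  by apply: coprimep_expl; apply: coprimep_expr; rewrite coprimep_XsubC root_XsubC gt_eqF.
move=> /Bezout_eq1_coprimepP[[u v] /= uv].
pose t : {poly R} := ((i`!%:R^-1)%:P * 'X^i) \Po ('X - b%:P).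
exists (('X - a%:P) ^+ k * (u * t)) => j jk; split; first exact: derivn_multiple_root.
have -> : ('X - a%:P) ^+ k * (u * t) = t - ('X - b%:P) ^+ k * (v * t).
  by rewrite -{2}[t]mul1r -uv; ring.
rewrite derivnB hornerD hornerN derivn_multiple_root// subr0 derivn_comp_shift.
rewrite horner_comp hornerXsubC subrr horner_coef0 coef_derivn addn0 coefCM coefXn.
rewrite eq_sym; case: eqVneq => [<-|_]; last by rewrite mulr0 mul0rn.
by rewrite mulr1 ffactnn -[LHS]mulr_natr mulVf// pnatr_eq0 -lt0n fact_gt0.
Qed.

(** The interpolant is linear in the data, so one constant serves for all of them; the bound
    includes order [k], which controls the kinetic energy of the interpolating piece. *)
Lemma hermite_interpolation k a b : a < b -> exists2 C : R, 0 <= C &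
  forall (c : nat -> R) eps, 0 <= eps -> (forall j, (j < k)%N -> `|c j| <= eps) -> exists p,
    (forall j, (j < k)%N -> p^`(j).[a] = 0 /\ p^`(j).[b] = c j) /\
    (forall j x, (j <= k)%N -> a <= x -> x <= b -> `|p^`(j).[x]| <= C * eps).
Proof.
move=> ab; have /choice[phi hphi] := fun i => @hermite_basis k a b i ab.
have /choice[B hB] : forall ij : nat * nat, exists B, 0 <= B /\
    forall x, a <= x -> x <= b -> `|(phi ij.1)^`(ij.2).[x]| <= B.
  by move=> [i j]; have [B B0 h] := horner_bounded a b (phi i)^`(j); exists B.
exists (\sum_(j < k.+1) \sum_(i < k) B (i : nat, j : nat)).
  by apply: sumr_ge0 => j _; apply: sumr_ge0 => i _; have [] := hB (i : nat, j : nat).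
move=> c eps eps0 hc; pose p := \sum_(i < k) c i *: phi i.
have pE j x : p^`(j).[x] = \sum_(i < k) c i * (phi i)^`(j).[x].
  rewrite /p linear_sum horner_sum; apply: eq_bigr => i _.
  by rewrite /= linearZ hornerZ.
exists p; split=> [j jk|j x jk ax xb].
  rewrite !pE; split.
    by apply: big1 => i _; rewrite (hphi i j jk).1 mulr0.
  rewrite (bigD1 (Ordinal jk))//= (hphi j j jk).2 eqxx mulr1 big1 ?addr0// => i ij.
  by rewrite (hphi i j jk).2 (_ : (i == j :> nat) = false) ?mulr0//; apply/negbTE.
rewrite pE; apply: (le_trans (ler_norm_sum _ _ _)).
apply: (@le_trans _ _ (\sum_(i < k) B (i : nat, j) * eps)).
  apply: ler_sum => i _; rewrite normrM mulrC.
  by apply: ler_pM => //; [exact: (hB (i : nat, j)).2|exact: hc].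
rewrite -mulr_suml.
apply: ler_wpM2r => //; rewrite (bigD1 (inord j))//= inordK// lerDl.
by apply: sumr_ge0 => j' _; apply: sumr_ge0 => i _; have [] := hB (i : nat, j' : nat).
Qed.

End Hermite.

(** * Jets that vanish near the core *)

Section Patch.
Context {R : realType} (G : metric_graph R).
Local Notation leb := (@lebesgue_measure R).
Local Notation I c := (edge_itv (len c.1)).
Implicit Types (d u v : jet G).

Lemma chain_zero l m : chain l m (fun _ _ => 0 : R).
Proof.
split=> j jm; first by apply: L2_0; exact: measurable_edge_itv.
by move=> x y _ _ xy; rewrite Rint_cst// mul0r subrr.
Qed.

Lemma zero_ends_space m d : jet_chain m d ->
  (forall (e : edge G) p (v : vertex G) s j, end_vertex e p = Some v -> d (e, s) j (end_coord e p) = 0) ->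
  jet_space m d.
Proof.
move=> hd h0; split => //; split=> [j _ _ e e' p p' v ev ev' s|j _ _ v s].
  by rewrite !(h0 _ _ v).
by apply: big1 => c /eqP cv; rewrite (h0 _ _ v)// mulr0.
Qed.

Lemma ray_coord (e : edge G) (x : R) : len e = +oo%E -> 0 <= x -> edge_itv (len e) x.
Proof. by move=> -> x0; split => //; rewrite leey. Qed.

Definition patch (a b : R) (P : edge G * bool -> {poly R}) d : jet G := fun c j =>
  if len c.1 == +oo%E then glue a (fun=> 0) (glue b (horner (P c)^`(j)) (d c j)) else fun=> 0.

(** Gluing chains asks for agreement at orders below [m] only, which polynomials can provide; all
    vertex values are 0, so the homogeneous vertex conditions hold. *)
Lemma patch_space m a b P d : 0 <= a -> a <= b -> jet_chain m d ->
  (forall c j, len c.1 = +oo%E -> (j < m)%N ->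
     (P c)^`(j).[a] = 0 /\ (P c)^`(j).[b] = d c j b) ->
  jet_space m (patch a b P d).
Proof.
move=> a0 ab hd hP; have b0 := le_trans a0 ab; apply: zero_ends_space.
  move=> c; rewrite /patch; case: eqP => lc; last exact: chain_zero.
  have Ia := ray_coord lc a0; have Ib := ray_coord lc b0.
  apply: (chain_glue (len_gt0 c.1) Ia (d1 := fun _ _ => 0)).
  - by move=> j _; apply: L2_0.
  - by move=> j _ x y _ xy _; rewrite Rint_cst// mul0r subrr.
  - apply: (chain_glue (len_gt0 c.1) Ib (d1 := fun j => horner (P c)^`(j))) => //.
    + move=> j _; apply: L2_continuous; apply: continuous_subspaceT.
      exact: continuous_horner.
    + by move=> j _; rewrite derivnS; exact: primitive_horner.
    + by move=> j jm; have [] := hP c j lc jm.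
  - by move=> j jm; rewrite /glue ab; have [->] := hP c j lc jm.
move=> e [] v s j /=; rewrite /patch/=.
  by move=> ev; case: eqP => // /trg_ray; rewrite ev.
by move=> _; case: eqP => // le; rewrite /glue a0.
Qed.

Lemma patch_left a b P d c j x : x <= a -> patch a b P d c j x = 0.
Proof. by rewrite /patch; case: eqP => // _ xa; rewrite /glue xa. Qed.

Lemma patch_bounded a b P d c j x : len c.1 <> +oo%E -> patch a b P d c j x = 0.
Proof. by rewrite /patch; case: eqP. Qed.

Lemma patch_right a b P d c j x : len c.1 = +oo%E -> a <= b -> b < x ->
  patch a b P d c j x = d c j x.
Proof.
move=> lc ab bx; rewrite /patch lc eqxx /glue !leNgt bx.
by rewrite (le_lt_trans ab bx).
Qed.

Lemma patch_mid a b P d c j x : len c.1 = +oo%E -> a < x -> x <= b ->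
  patch a b P d c j x = (P c)^`(j).[x].
Proof. by move=> lc ax xb; rewrite /patch lc eqxx /glue leNgt ax xb. Qed.

End Patch.

Lemma near_sum (F : realFieldType) (p1 p2 p3 p4 p5 p6 e : F) :
  0 <= e -> p1 - p2 <= e / 4 -> p5 <= p6 + e / 2 -> - (p4 - p3) <= e / 4 ->
  2^-1 * (p5 + p1) - p4 <= 2^-1 * (p6 + p2) - p3 + e.
Proof. lra. Qed.

(** * Scaling and continuity of the energy terms *)

Section Scaling.
Context {R : realType} (G : metric_graph R).
Local Notation leb := (@lebesgue_measure R).
Local Notation I c := (edge_itv (len c.1)).
Implicit Types (d u v : jet G).
Variable k : nat.
Hypothesis k_gt0 : (0 < k)%N.

(** Multiplication by [s], written as a combination so that the lemmas on [jcomb] apply. *)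
Definition jscale (s : R) d : jet G := jcomb s d 0 d.

Lemma jscale_space m s d : jet_space m d -> jet_space m (jscale s d).
Proof. by move=> hd; exact: jet_space_comb. Qed.

Lemma energy_sq_jscale j s d : jet_space k d -> (j <= k)%N ->
  energy_sq j (jscale s d) = s ^+ 2 * energy_sq j d.
Proof.
move=> hd jk; have L := jet_L2 hd jk.
by rewrite /energy_sq /jscale level_jcomb bil_comb//; ring.
Qed.

Lemma modulus_jscale s d e x : modulus (jscale s d) e x = `|s| * modulus d e x.
Proof.
rewrite /modulus /jscale /jcomb !mul0r !addr0 !exprMn -mulrDr.
by rewrite sqrtrM ?sqr_ge0// sqrtr_sqr.
Qed.

Lemma power_jscale q s d : 2 < q -> jet_space k d ->
  power_integral q (jscale s d) = `|s| `^ q * power_integral q d.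
Proof.
move=> q2 hd; rewrite /power_integral mulr_sumr; apply: eq_bigr => e _.
rewrite -RintZ//; last exact: (power_Rintegrable k_gt0 q2 e hd).
  by apply: eq_Rint => x _; rewrite modulus_jscale powRM ?modulus_ge0.
exact: measurable_edge_itv.
Qed.

Section Pot.
Variables (V V2 Vinf : edge G -> R -> R) (M : R).
Hypothesis VE : bounded_split V V2 Vinf M.

Lemma pot_jscale s d : jet_space k d -> pot V (jscale s d) (jscale s d) = s ^+ 2 * pot V d d.
Proof.
move=> hd; have LV := potential_L2 k_gt0 VE hd; have L0 := jet_L2 hd (leq0n k).
have e1 : pot V (jscale s d) (jscale s d) =
    bil (comb s (potential V d) 0 (potential V d)) (comb s (level 0 d) 0 (level 0 d)).
  by apply: eq_bil => c x _; rewrite /potential /comb /level /jscale /jcomb; ring.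
have Lc := family_L2_comb s 0 L0 L0.
by rewrite e1 (bil_combl s 0 LV LV Lc) (bil_combr s 0 L0 L0 LV) /pot; ring.
Qed.

Lemma potential_sq_bound d S : jet_space k d -> 0 <= S ->
  (forall c x, I c x -> d c 0%N x ^+ 2 <= S) ->
  bil (potential V d) (potential V d) <= 2 * S * V2_sq V2 + 2 * M ^+ 2 * energy_sq 0 d.
Proof.
move=> hd S0 hS; have LV := potential_L2 k_gt0 VE hd; have L0 := jet_L2 hd (leq0n k).
rewrite /V2_sq /energy_sq /bil !mulr_sumr -big_split/=; apply: ler_sum => c _.
have mI : measurable (I c) by exact: measurable_edge_itv.
have [M0 /(_ c.1)[L2 mVi Vib VEc]] := VE.
have s1 := L2_sqr mI L2; have s2 := L2_sqr mI (L0 c); have s3 := L2_sqr mI (LV c).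
rewrite !ip_nsq /nsq -(RintZ mI _ s1) -(RintZ mI _ s2).
rewrite -(RintD mI); [|exact: (RintegrableZ mI)|exact: (RintegrableZ mI)].
apply: (Rint_le mI s3).
  by apply: (RintegrableD mI); exact: (RintegrableZ mI).
move=> x Ix; rewrite /potential /level VEc//; apply: le_trans (_ : 2 * (V2 c.1 x ^+ 2 * d c 0%N x ^+ 2) + 2 * (Vinf c.1 x ^+ 2 * d c 0%N x ^+ 2) <= _).
  by rewrite mulrDl; apply: (le_trans (sqrD_le _ _)); rewrite !exprMn.
have h1 : V2 c.1 x ^+ 2 * d c 0%N x ^+ 2 <= V2 c.1 x ^+ 2 * S.
  by apply: ler_wpM2l; [exact: sqr_ge0|exact: hS].
have h2 : Vinf c.1 x ^+ 2 * d c 0%N x ^+ 2 <= M ^+ 2 * d c 0%N x ^+ 2.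
  apply: ler_wpM2r; first exact: sqr_ge0.
  rewrite -(real_normK (num_real (Vinf _ _))); apply: lerXn2r; rewrite ?nnegrE//.
  exact: Vib.
lra.
Qed.

(** The form is symmetric, so the difference of squares factors. *)
Lemma pot_difference u v : jet_space k u -> jet_space k v ->
  pot V u u - pot V v v = bil (level 0 (jcomb 1 u (-1) v)) (potential V (jcomb 1 u 1 v)).
Proof.
move=> hu hv; have Lu := jet_L2 hu (leq0n k); have Lv := jet_L2 hv (leq0n k).
have LVu := potential_L2 k_gt0 VE hu; have LVv := potential_L2 k_gt0 VE hv.
have -> : potential V (jcomb 1 u 1 v) = comb 1 (potential V u) 1 (potential V v).
  by apply/funext => c; apply/funext => x; rewrite /potential /comb /jcomb; ring.
have Lc := family_L2_comb 1 1 LVu LVv.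
rewrite level_jcomb (bil_combl _ _ Lu Lv Lc) (bil_combr _ _ LVu LVv Lu) (bil_combr _ _ LVu LVv Lv).
rewrite /pot (bilC (level 0 u) (potential V u)) (bilC (level 0 v) (potential V v)).
have -> : bil (level 0 u) (potential V v) = bil (level 0 v) (potential V u).
  by apply: eq_bil => c x _; rewrite /potential /level; ring.
ring.
Qed.

End Pot.

Lemma energy_sq_sum_le j u v : jet_space k u -> jet_space k v -> (j <= k)%N ->
  energy_sq j (jcomb 1 u 1 v) <= 2 * energy_sq j u + 2 * energy_sq j v.
Proof.
move=> hu hv jk; have Lu := jet_L2 hu jk; have Lv := jet_L2 hv jk.
have := bil_ge0 (comb 1 (level j u) (-1) (level j v)).
by rewrite /energy_sq level_jcomb !bil_comb//; lra.
Qed.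

Lemma modulus_nsq_le d e : jet_space k d ->
  nsq (edge_itv (len e)) (modulus d e) <= energy_sq 0 d.
Proof.
move=> hd; rewrite (energy_sq_modulus hd) (bigD1 e)//= lerDl.
by apply: sumr_ge0 => i _; apply: nsq_ge0.
Qed.

Lemma power_difference_bound q N S u v e x : 2 <= q -> q <= N%:R ->
  modulus u e x <= S -> modulus v e x <= S ->
  `|modulus u e x `^ q - modulus v e x `^ q| <=
    N%:R * S `^ (q - 2) * ((modulus u e x + modulus v e x) * modulus (jcomb 1 u (-1) v) e x).
Proof.
move=> q2 qN uS vS; have u0 := modulus_ge0 u e x; have v0 := modulus_ge0 v e x.
apply: (le_trans (powR_dist q2 qN u0 uS v0 vS)).
apply: ler_wpM2l; first by rewrite mulr_ge0// powR_ge0.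
apply: ler_wpM2l; first exact: addr_ge0.
have uE : u = jcomb 1 (jcomb 1 u (-1) v) 1 v.
  by apply/funext => c; apply/funext => j; apply/funext => y; rewrite /jcomb; ring.
have vE : v = jcomb 1 u (-1) (jcomb 1 u (-1) v).
  by apply/funext => c; apply/funext => j; apply/funext => y; rewrite /jcomb; ring.
have t1 := modulus_triangle (jcomb 1 u (-1) v) v 1 1 e x.
have t2 := modulus_triangle u (jcomb 1 u (-1) v) 1 (-1) e x.
move: t1 t2; rewrite -uE -vE !normrN !normr1 !mul1r ler_norml => t1 t2; lra.
Qed.

Section Continuity.
Variables (V V2 Vinf : edge G -> R -> R) (M q : R).
Hypothesis VE : bounded_split V V2 Vinf M.
Hypothesis q_gt2 : 2 < q.

(** Cauchy-Schwarz in [pot_difference]; [B] bounds the squared norm of V (u + v). *)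
Lemma pot_continuous T eps : 0 <= T -> 0 < eps -> exists2 delta, 0 < delta & forall u v,
  jet_space k u -> jet_space k v -> energy_sq 0 u <= T -> energy_sq k u <= T ->
  energy_sq 0 v <= T -> energy_sq k v <= T -> energy_sq 0 (jcomb 1 u (-1) v) <= delta ->
  `|pot V u u - pot V v v| <= eps.
Proof.
move=> T0 e0; have [C C0 hC] := jet_sup G k_gt0.
have N0 := V2_sq_ge0 V2.
pose S := C * (4 * T + 4 * T).
have S0 : 0 <= S by rewrite mulr_ge0//; lra.
pose B := 2 * S * V2_sq V2 + 2 * M ^+ 2 * (4 * T).
have B0 : 0 <= B.
  rewrite /B addr_ge0// mulr_ge0//; [lra|by rewrite mulr_ge0// sqr_ge0|lra].
exists (eps ^+ 2 / (B + 1)); first by rewrite divr_gt0 ?exprn_gt0//; lra.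
move=> u v hu hv u0 uk v0 vk.
have B1 : 0 < B + 1 by lra.
rewrite ler_pdivlMr// (pot_difference VE hu hv); set w := jcomb 1 u (-1) v => hw.
have hs : jet_space k (jcomb 1 u 1 v) := jet_space_comb 1 1 hu hv.
have s0 : energy_sq 0 (jcomb 1 u 1 v) <= 4 * T.
  by have := energy_sq_sum_le hu hv (leq0n k); lra.
have sk : energy_sq k (jcomb 1 u 1 v) <= 4 * T.
  by have := energy_sq_sum_le hu hv (leqnn k); lra.
have Lw : family_L2 (level 0 w) := jet_L2 (jet_space_comb 1 (-1) hu hv) (leq0n k).
have LV := potential_L2 k_gt0 VE hs.
have W0 := energy_sq_ge0 0 w.
have hsS c x : I c x -> jcomb 1 u 1 v c 0%N x ^+ 2 <= S.
  by move=> Ix; apply: (le_trans (hC _ hs c x Ix)); rewrite /S; apply: ler_wpM2l => //; lra.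
have hB := potential_sq_bound VE hs S0 hsS.
rewrite -(@ler_pXn2r _ 2)// ?nnegrE ?(ltW e0)// real_normK ?num_real//.
apply: (le_trans (bil_cauchy_schwarz Lw LV)); apply: le_trans hw.
apply: ler_wpM2l => //; apply: (le_trans hB).
have : 2 * M ^+ 2 * energy_sq 0 (jcomb 1 u 1 v) <= 2 * M ^+ 2 * (4 * T).
  by apply: ler_wpM2l => //; rewrite mulr_ge0// sqr_ge0.
by rewrite /B; lra.
Qed.

Lemma power_continuous T eps : 0 <= T -> 0 < eps -> exists2 delta, 0 < delta & forall u v,
  jet_space k u -> jet_space k v -> energy_sq 0 u <= T -> energy_sq k u <= T ->
  energy_sq 0 v <= T -> energy_sq k v <= T -> energy_sq 0 (jcomb 1 u (-1) v) <= delta ->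
  `|power_integral q u - power_integral q v| <= eps.
Proof.
move=> T0 e0; have q2 := q_gt2.
have [S S0 hS] := modulus_sup G k_gt0 T0.
pose N := Num.bound q.
have qN : q <= N%:R by apply: ltW; apply: archi_boundP; lra.
pose K := N%:R * S `^ (q - 2).
have K0 : 0 <= K by rewrite mulr_ge0// powR_ge0.
pose Kc : R := \sum_(a : edge G) 1.
have Kc0 : 0 <= Kc by exact: sumr_ge0.
pose Z := K * (Kc * (4 * T)).
have Z0 : 0 <= Z by do 3!apply: mulr_ge0 => //.
pose th := eps / (2 * (Z + 1)).
have th0 : 0 < th by rewrite divr_gt0//; lra.
have thZ : th * Z <= eps / 2.
  have : th * (2 * (Z + 1)) = eps by rewrite /th divfK// gt_eqF//; lra.
  by nra.
exists (eps * th / (2 * (K + 1))).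
  by rewrite divr_gt0//; [exact: mulr_gt0|lra].
move=> u v hu hv u0 uk v0 vk; set w := jcomb 1 u (-1) v => hw.
have hW : jet_space k w := jet_space_comb 1 (-1) hu hv.
have W0 := energy_sq_ge0 0 w.
have thW : K * (th^-1 * energy_sq 0 w) <= eps / 2.
  have {}hw : energy_sq 0 w * (2 * (K + 1)) <= eps * th by rewrite -ler_pdivlMr//; lra.
  rewrite -(ler_pM2l th0) (_ : th * (K * (th^-1 * energy_sq 0 w)) = K * energy_sq 0 w); last first.
    by field; rewrite gt_eqF.
  by have := mulr_ge0 K0 W0; lra.
rewrite /power_integral -sumrB.
apply: (le_trans (ler_norm_sum _ _ _)).
apply: (@le_trans _ _ (\sum_(a : edge G) K * (th * (4 * T) + th^-1 * nsq (edge_itv (len a)) (modulus w a)))); last first.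
  have s1 : \sum_(i : edge G) th * (4 * T) = th * (4 * T) * Kc.
    by rewrite /Kc mulr_sumr; apply: eq_bigr => a _; rewrite mulr1.
  have s2 : \sum_(a : edge G) th^-1 * nsq (edge_itv (len a)) (modulus w a) = th^-1 * energy_sq 0 w.
    by rewrite (energy_sq_modulus hW) mulr_sumr.
  rewrite -mulr_sumr big_split/= s1 s2.
  move: thZ thW; rewrite /Z; lra.
apply: ler_sum => a _; set J := edge_itv (len a).
have mJ : measurable J by exact: measurable_edge_itv.
have P1 := @power_Rintegrable _ _ _ k_gt0 q q_gt2 u a hu.
have P2 := @power_Rintegrable _ _ _ k_gt0 q q_gt2 v a hv.
have m1 := modulus_L2 a hu; have m2 := modulus_L2 a hv; have m3 := modulus_L2 a hW.
pose s x := modulus u a x + modulus v a x.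
have Ls : real_L2 J s by exact: L2D.
have srI := Rintegrable_mul mJ (L2_norm mJ Ls) (L2_norm mJ m3).
rewrite -(RintB mJ P1 P2).
apply: (@le_trans _ _ (K * \int[leb]_(x in J) (`|s x| * `|modulus w a x|))).
  rewrite -(RintZ mJ K srI); apply: (Rint_abs_le mJ).
  - exact: (RintegrableB mJ P1 P2).
  - exact: (RintegrableZ mJ).
  move=> x Jx; have sx0 : 0 <= s x by rewrite addr_ge0 ?modulus_ge0.
  rewrite (ger0_norm (modulus_ge0 w a x)) (ger0_norm sx0).
  exact: (power_difference_bound (ltW q2) qN (hS u hu u0 uk a x Jx) (hS v hv v0 vk a x Jx)).
apply: ler_wpM2l => //; apply: (le_trans (young_ip mJ Ls m3 th0)); rewrite lerD2r.
rewrite ler_pM2l//; have := nsqD_le mJ m1 m2; rewrite -/(s) => h.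
have := modulus_nsq_le a hu; have := modulus_nsq_le a hv; rewrite -/J => h1 h2.
by apply: (le_trans h); lra.
Qed.

(** Rescaling restores an exact mass after a cut-off or a splitting. The kinetic term changes by the
    factor s^2, close to 1, and the other terms are continuous for L^2-small changes. *)
Lemma jet_energy_near mu t T eps : 0 < mu -> 0 < t -> 0 <= T -> 0 < eps ->
  exists2 delta, 0 < delta & forall d, jet_space k d -> energy_sq 0 d <= T -> energy_sq k d <= T ->
  `|energy_sq 0 d - t| <= delta -> exists s, energy_sq 0 (jscale s d) = t /\
    jet_energy k V mu q (jscale s d) <= jet_energy k V mu q d + eps.
Proof.
move=> mu0 t0 T0 e0; have q2 := q_gt2.
(* The rescaled jet has energies up to 2 T, since s^2 = t / m <= 2 once m >= t / 2. *)
have T20 : 0 <= 2 * T by lra.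
have [d1 d10 h1] := pot_continuous T20 (divr_gt0 e0 (ltr0Sn R 3)).
have mq : 0 < mu / q by rewrite divr_gt0//; lra.
have e4 : 0 < eps / 4 / (mu / q) by rewrite !divr_gt0//; lra.
have [d2 d20 h2] := power_continuous T20 e4.
(* When s^2 > 1, this gives (s^2 - 1) T <= eps / 2, from (s^2 - 1) m <= d3 and m >= t / 2. *)
pose d3 := eps * t / (4 * (T + 1)).
have d30 : 0 < d3 by rewrite divr_gt0//; [exact: mulr_gt0|lra].
exists (Num.min (t / 2) (Num.min d1 (Num.min d2 d3))).
  by rewrite !lt_min d10 d20 d30 divr_gt0.
move=> d hd dT dkT; rewrite !le_min => /andP[h0 /andP[hd1 /andP[hd2 hd3]]].
set m := energy_sq 0 d in h0 hd1 hd2 hd3 dT *.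
have Ek := energy_sq_ge0 k d.
have mt : t / 2 <= m by move: h0; rewrite ler_norml; lra.
have m0 : 0 < m by lra.
pose s := Num.sqrt (t / m); have s0 : 0 <= s by exact: sqrtr_ge0.
have s2 : s ^+ 2 = t / m by rewrite sqr_sqrtr// divr_ge0// ltW.
have s2m : s ^+ 2 * m = t by rewrite s2 divfK// gt_eqF.
have s2le : s ^+ 2 <= 2 by rewrite s2 ler_pdivrMr//; lra.
have hsd := jscale_space s hd.
have e0E : energy_sq 0 (jscale s d) = t by rewrite (energy_sq_jscale s hd (leq0n k)).
have ekE := energy_sq_jscale s hd (leqnn k).
exists s; split => //.
have hw : energy_sq 0 (jcomb 1 (jscale s d) (-1) d) <= `|m - t|.
  have -> : jcomb 1 (jscale s d) (-1) d = jscale (s - 1) d.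
    by apply/funext => c; apply/funext => j; apply/funext => x; rewrite /jscale /jcomb; ring.
  rewrite (energy_sq_jscale _ hd (leq0n k)) -/m.
  have -> : m - t = (1 - s) * (1 + s) * m by rewrite -s2m; ring.
  rewrite normrM (gtr0_norm m0) ler_pM2r// normrM -(real_normK (num_real (s - 1))) distrC expr2.
  apply: ler_wpM2l => //; rewrite (ger0_norm (_ : 0 <= 1 + s)); last lra.
  by rewrite ler_norml; lra.
have t2 : t <= 2 * T by lra.
have b1 := h1 (jscale s d) d hsd hd; rewrite e0E ekE in b1.
have sEk : s ^+ 2 * energy_sq k d <= 2 * T.
  by have := ler_wpM2r Ek s2le; lra.
have mT : energy_sq 0 d <= 2 * T by rewrite -/m; lra.
have kT : energy_sq k d <= 2 * T by lra.
have {}b1 := b1 t2 sEk mT kT (le_trans hw hd1).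
have b2 := h2 (jscale s d) d hsd hd; rewrite e0E ekE in b2.
have {}b2 := b2 t2 sEk mT kT (le_trans hw hd2).
have b3 : s ^+ 2 * energy_sq k d <= energy_sq k d + eps / 2.
  have h4 : (s ^+ 2 - 1) * m <= d3.
    by apply: le_trans hd3; rewrite mulrBl mul1r s2m distrC; exact: ler_norm.
  have h5 : d3 * (4 * (T + 1)) = eps * t by rewrite /d3 divfK// gt_eqF//; lra.
  have [s1|s1] := leP (s ^+ 2) 1; first by have := ler_wpM2r Ek s1; lra.
  have h6 : (s ^+ 2 - 1) * (t / 2) <= d3 by apply: le_trans h4; apply: ler_wpM2l => //; lra.
  have h7 : (s ^+ 2 - 1) * (2 * (T + 1)) <= eps.
    rewrite -(ler_pM2r t0) -h5; move: h6; set z := s ^+ 2 - 1 => h6.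
    have := ler_wpM2r (_ : 0 <= 4 * (T + 1)) h6; lra.
  have h8 : (s ^+ 2 - 1) * energy_sq k d <= (s ^+ 2 - 1) * T by apply: ler_wpM2l => //; lra.
  move: h7 h8; lra.
have b4 : `|mu / q * (power_integral q (jscale s d) - power_integral q d)| <= eps / 4.
  rewrite normrM (gtr0_norm mq) mulrC -ler_pdivlMr//.
have c1 := le_trans (ler_norm _) b1.
have c2 : - (mu / q * (power_integral q (jscale s d) - power_integral q d)) <= eps / 4.
  by apply: le_trans b4; rewrite -normrN; exact: ler_norm.
rewrite mulrBr in c2.
rewrite /jet_energy ekE; exact: (near_sum (ltW e0) c1 b3 c2).
Qed.

End Continuity.
End Scaling.

(** * Rays and functions supported far away *)

Section Rays.
Context {R : realType} (G : metric_graph R).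
Implicit Types (p r : gpoint G).

Lemma graph_dist_edge (e : edge G) (x y : R) : edge_dom e x -> edge_dom e y ->
  (graph_dist (e, x) (e, y) <= `|x - y|%:E)%E.
Proof.
move=> Ix Iy; apply: ereal_inf_lbound; exists `|x - y| => //=.
rewrite -[X in graph_path _ _ X]addr0.
apply: (graph_path_move Ix Iy); apply: graph_path_nil; exact: Iy.
Qed.

(** If all edges are bounded, Heine-Borel on each of them extracts a finite subcover, because the
    distance in the graph is at most the distance along an edge. *)
Lemma noncompact_ray : ~ compact_graph G -> exists e : edge G, len e = +oo%E.
Proof.
move=> ncG; apply: contrapT => /forallNP noray; apply: ncG => F oF cF.
have : forall e : edge G, exists Fe : set (set (gpoint G)),
    [/\ finite_set Fe, Fe `<=` F & forall x, edge_dom e x -> exists U, Fe U /\ U (e, x)].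
  move=> e; have [l [l0 le]] : exists l : R, 0 < l /\ len e = l%:E.
    by have := len_gt0 e; have := noray e; case: (len e) => [l _ l0|//|//]; exists l.
  have domE x : edge_dom e x <-> `[0, l]%classic x.
    rewrite /edge_dom/= le lee_fin in_itv/=; split; first by case=> -> ->.
    by move=> /andP[].
  have /choice[Ue hUe] : forall x : R, exists Ue : set (gpoint G) * R, edge_dom e x ->
      [/\ F Ue.1, 0 < Ue.2 & forall y, edge_dom e y -> `|x - y| < Ue.2 -> Ue.1 (e, y)].
    move=> x; have [Ix|nx] := pselect (edge_dom e x); last by exists (set0, 0).
    have [U [FU Ux]] := cF (e, x) Ix; have [eps [eps0 heps]] := oF U FU (e, x) Ix Ux.
    exists (U, eps) => _; split => // y Iy xy; apply: heps => //.
    by apply: le_lt_trans (graph_dist_edge Ix Iy) _; rewrite lte_fin.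
  have := @segment_compact R 0 l; rewrite compact_cover.
  move=> /(_ R `[0, l]%classic (fun x => ball x (Ue x).2)).
  case=> [x _|x xl|D' D'D cov].
    exact: ball_open.
    exists x => //; apply: ballxx; have [] := hUe x _ => //; exact/domE.
  exists ((fun x => (Ue x).1) @` [set` D']); split.
  - exact: finite_image.
  - move=> U [x xD <-]; have := D'D x xD => /set_mem/domE Ix.
    by have [] := hUe x Ix.
  - move=> y Iy; have [x xD xy] := cov y ((domE y).1 Iy).
    have := D'D x xD => /set_mem/domE Ix; have [_ _ h] := hUe x Ix.
    exists (Ue x).1; split; first by exists x.
    exact: h.
move=> /choice[Fe hFe]; exists (\bigcup_(e in [set: edge G]) Fe e); split.
- by apply: bigcup_finite => // e _; have [] := hFe e.
- by move=> U [e _ FeU]; have [_ sub _] := hFe e; exact: sub.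
- move=> [e x] Ix; have [_ _ h] := hFe e; have [U [FU Ux]] := h x Ix.
  by exists U; split => //; exists e.
Qed.

(* The distance of a point to the core. *)
Definition height (p : gpoint G) : R := if len p.1 == +oo%E then p.2 else 0.

Lemma height_vertex v p : at_vertex v p -> height p = 0.
Proof.
move=> [b [ev ex]]; rewrite /height; case: eqP => // lp; rewrite ex.
by case: b ev ex => //= ev; have /trg_ray := lp; rewrite ev.
Qed.

(** A move along a ray changes the height by its length; moves on bounded edges and passages through
    a vertex do not change it. *)
Lemma height_lipschitz p r s : graph_path p r s -> `|height p - height r| <= s.
Proof.
elim=> {p r s} [p _|e x y r s _ _ _ IH|v p p' r s vp vp' _ IH].
- by rewrite subrr normr0.
- have : `|height (e, x) - height (e, y)| <= `|x - y|.
    by rewrite /height/=; case: eqP => //; rewrite subrr normr0.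
  rewrite (_ : height (e, x) - height r = (height (e, x) - height (e, y)) + (height (e, y) - height r)).
    by move=> h; apply: (le_trans (ler_normD _ _)); exact: lerD.
  by ring.
- by rewrite (height_vertex vp) -(height_vertex vp').
Qed.

Lemma height_core p : core p -> height p = 0.
Proof.
case: p => e x [_ /= [le|[v /height_vertex//]]].
by rewrite /height/=; case: eqP.
Qed.

Lemma height_core_nbhd n p : core_nbhd n p -> height p < n%:R.
Proof.
move=> [_ /ereal_inf_lt[_ [r rc <-]]] /ereal_inf_lt[_ [s ps <-]].
rewrite lte_fin => sn; apply: le_lt_trans sn.
have := height_lipschitz ps; rewrite (height_core rc) subr0; exact: le_trans (ler_norm _).
Qed.

End Rays.

(** * Energies outside neighbourhoods of the core *)

Section Outside.
Context {R : realType} (G : metric_graph R).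
Local Notation leb := (@lebesgue_measure R).
Local Notation I c := (edge_itv (len c.1)).
Variable k : nat.
Hypothesis k_gt0 : (0 < k)%N.
Variables (V V2 Vinf : edge G -> R -> R) (M mu q : R).
Hypothesis VE : bounded_split V V2 Vinf M.

(** A point of the support is at distance less than 1 from a point where [d] is not 0, which has
    height at least n + 1; hence its own height exceeds [n]. *)
Lemma energy_outside_le n d : jet_space k d -> energy_sq 0 d = 1 ->
  (forall c x, I c x -> d c 0%N x <> 0 -> len c.1 = +oo%E /\ n.+1%:R <= x) ->
  (energy_outside k V mu q n <= (jet_energy k V mu q d)%:E)%E.
Proof.
move=> hd d1 hs; have [uS hr] := Sobolev_of_jet k_gt0 hd.
apply: ereal_inf_lbound; exists (gpack d); last first.
  by rewrite (energy_represents k_gt0 q mu VE hd hr uS).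
split => //=; first by rewrite (normsq_represents hd hr) d1.
move=> p [Ip hp] /height_core_nbhd pn.
have [[e x] [Ix pr ux]] := hp 1 ltr01.
have [s [le nx]] : exists s : bool, len e = +oo%E /\ n.+1%:R <= x.
  apply: contrapT => /forallNP h; apply: ux; apply: cpart_inj => s.
  rewrite cpart_pack; transitivity (0 : R); last by case: s.
  by apply: contrapT => ds; apply: (h s); exact: (hs (e, s) x Ix).
move: pr => /ereal_inf_lt[_ [t pt <-]]; rewrite lte_fin => t1.
have := height_lipschitz pt; rewrite {2}/height/= le eqxx ler_norml => /andP[h _].
have : x < n%:R + 1 by lra.
by rewrite natr1; lra.
Qed.

Lemma energy_outside_nondecreasing : nondecreasing_seq (energy_outside k V mu q).
Proof.
move=> n m nm; apply: ereal_inf_le_tmp => _ [u [uS u1 su] <-].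
exists u => //; split => // p /su h hp; apply: h.
move: hp => [Ip hp]; split => //; apply: lt_le_trans hp _.
by rewrite lee_fin ler_nat.
Qed.

Lemma energy_at_infinity_le (z : \bar R) :
  (forall n, (energy_outside k V mu q n <= z)%E) -> (energy_at_infinity k V mu q <= z)%E.
Proof.
move=> h; apply: lime_le; last by apply: nearW.
exact: ereal_nondecreasing_is_cvgn energy_outside_nondecreasing.
Qed.

End Outside.

(** * Bumps on a ray and the cut-off near the core *)

Section Bump.
Context {R : realType} (G : metric_graph R).
Local Notation leb := (@lebesgue_measure R).
Local Notation I c := (edge_itv (len c.1)).
Variable k : nat.
Hypothesis k_gt0 : (0 < k)%N.

Lemma nsq_zero (D : set R) : measurable D -> nsq D (fun=> 0) = 0.
Proof.
move=> mD; have L0 : real_L2 D (fun=> 0) by apply: L2_0.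
transitivity (nsq D (fun=> 0 * 0)); first by apply: eq_nsq => x _; rewrite mul0r.
by rewrite (nsqZ mD 0 L0) expr2 !mul0r.
Qed.

Definition bump_poly : {poly R} := ('X - 0%:P) ^+ k * ('X - 1%:P) ^+ k.

Lemma bump_poly_ends j : (j < k)%N -> bump_poly^`(j).[0] = 0 /\ bump_poly^`(j).[1] = 0.
Proof.
move=> jk; split; first exact: derivn_multiple_root.
by rewrite /bump_poly mulrC; exact: derivn_multiple_root.
Qed.

Lemma bump_poly_mid (y : R) : 4^-1 <= y -> y <= 3 / 4 -> (3 / 16) ^+ k <= `|bump_poly.[y]|.
Proof.
move=> y1 y2; rewrite /bump_poly hornerM !horner_exp !hornerXsubC -exprMn normrX subr0.
have -> : `|y * (y - 1)| = y * (1 - y).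
  by rewrite -normrN -mulrN opprB ger0_norm// mulr_ge0; lra.
by apply: lerXn2r; rewrite ?nnegrE; nra.
Qed.

Definition bump_shift (a L : R) : {poly R} := bump_poly \Po (L^-1 *: ('X - a%:P)).

Lemma bump_shift_deriv a L j x :
  (bump_shift a L)^`(j).[x] = (L^-1) ^+ j * bump_poly^`(j).[(x - a) / L].
Proof.
have -> : (bump_shift a L)^`(j) = (L^-1 ^+ j) *: (bump_poly^`(j) \Po (L^-1 *: ('X - a%:P))).
  elim: j => [|j IH]; first by rewrite !derivn0 expr0 scale1r.
  rewrite !derivnS IH derivZ deriv_comp derivZ derivXsubC exprSr -scalerA.
  by rewrite -scalerAr mulr1.
by rewrite hornerZ horner_comp hornerZ hornerXsubC mulrC (mulrC L^-1) mulrC.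
Qed.

(** One profile X^k (X - 1)^k is stretched to [a, a + L] in the real part over one ray. [B] and [c0]
    depend only on the profile and [q], and the powers of [L] are those of scaling; the lower bounds
    come from the middle half, where the modulus of the profile is at least (3/16)^k. *)
Lemma exists_bump (e0 : edge G) (q : R) : len e0 = +oo%E -> 2 < q -> exists B c0,
  [/\ 0 < B, 0 < c0 & forall a L, 0 <= a -> 0 < L -> exists d : jet G,
  [/\ jet_space k d, c0 * L <= energy_sq 0 d /\ energy_sq 0 d <= B * L,
      energy_sq k d * L ^+ (2 * k) <= B * L, c0 * L <= power_integral q d
    & (forall c j x, d c j x <> 0 -> len c.1 = +oo%E /\ a < x) /\
      (forall c x, I c x -> d c 0%N x ^+ 2 <= B)]].
Proof.
move=> le0 q2; have [B0 B00 hB0] := horner_bounded 0 1 bump_poly.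
have [Bk Bk0 hBk] := horner_bounded 0 1 bump_poly^`(k).
pose B := 1 + B0 ^+ 2 + Bk ^+ 2.
have B02 := sqr_ge0 B0; have Bk2 := sqr_ge0 Bk.
pose m : R := (3 / 16) ^+ k.
have m0 : 0 < m by rewrite exprn_gt0//; lra.
pose c0 := Num.min (m ^+ 2 / 2) (m `^ q / 2).
exists B, c0; split; first by rewrite /B; lra.
  by rewrite lt_min !divr_gt0 ?exprn_gt0 ?powR_gt0.
move=> a L a0 L0; pose P (c : edge G * bool) := if c == (e0, false) then bump_shift a L else 0.
pose d : jet G := patch a (a + L) P (fun _ _ _ => 0).
have aL : a <= a + L by lra.
have hd : jet_space k d.
  apply: patch_space => //; first by move=> c; exact: chain_zero.
  move=> c j _ jk; rewrite /P; case: eqP => _; last by rewrite linear0 !horner0.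
  rewrite !bump_shift_deriv subrr mul0r [a + L]addrC addrK divff ?gt_eqF//.
  by have [-> ->] := bump_poly_ends jk; rewrite mulr0.
have mJ := @measurable_itvcc R.
have Ie x : a <= x -> edge_itv (len e0) x by move=> ax; apply: ray_coord => //; exact: le_trans ax.
have dmid j x : a < x -> x <= a + L ->
    d (e0, false) j x = (L^-1) ^+ j * bump_poly^`(j).[(x - a) / L].
  by move=> ax xb; rewrite /d patch_mid// /P eqxx bump_shift_deriv.
have dout (c : edge G * bool) j x : c != (e0, false) -> d c j x = 0.
  move=> cn; have [lc|lc] := pselect (len c.1 = +oo%E); last exact: patch_bounded.
  have [xa|ax] := leP x a; first exact: patch_left.
  have [xb|bx] := leP x (a + L); last by rewrite /d patch_right.
  by rewrite /d patch_mid// /P (negPf cn) linear0 horner0.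
have dright (c : edge G * bool) j x : a + L < x -> d c j x = 0.
  move=> bx; have [lc|lc] := pselect (len c.1 = +oo%E); last exact: patch_bounded.
  by rewrite /d patch_right.
have unit_itv x : a < x -> x <= a + L -> 0 <= (x - a) / L /\ (x - a) / L <= 1.
  by move=> ax xb; rewrite divr_ge0 ?ler_pdivrMr//; lra.
have Esq j : (j <= k)%N -> energy_sq j d = nsq `[a, a + L] (d (e0, false) j).
  move=> jk; rewrite /energy_sq /bil (bigD1 (e0, false))//= big1 ?addr0.
    rewrite ip_nsq /nsq; apply: Rint_support.
    - exact: measurable_edge_itv.
    - exact: mJ.
    - by move=> x; rewrite /= in_itv/= => /andP[ax _]; exact: Ie.
    - move=> x Ix; rewrite /= in_itv/= => /negP; rewrite negb_and -!ltNge /level => /orP[xa|bx].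
        by rewrite /d patch_left ?expr0n// ltW.
      by rewrite dright// expr0n.
  move=> c cn; rewrite ip_nsq -[RHS](nsq_zero (measurable_edge_itv (len c.1))).
  by apply: eq_nsq => x _; rewrite /level dout.
have Lj j : (j <= k)%N -> real_L2 (edge_itv (len e0)) (d (e0, false) j).
  by move=> jk; exact: (jet_L2 hd jk (e0, false)).
have Lab j : (j <= k)%N -> real_L2 `[a, a + L] (d (e0, false) j).
  by move=> jk; apply: (L2_locally (Lj j jk)); apply: Ie.
have upper j Bj : (j <= k)%N -> 0 <= Bj -> (forall y, 0 <= y -> y <= 1 -> `|bump_poly^`(j).[y]| <= Bj) ->
    energy_sq j d * L ^+ (2 * j) <= Bj ^+ 2 * L.
  move=> jk Bj0 hBj; rewrite Esq//.
  have Lpos : 0 < L ^+ (2 * j) by rewrite exprn_gt0.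
  rewrite -ler_pdivlMr//; apply: (@le_trans _ _ (nsq `[a, a + L] (fun=> (L^-1) ^+ j * Bj))).
    apply: nsq_le => //; [exact: Lab|exact: L2_cst|].
    move=> x; rewrite /= in_itv/= => /andP[ax xb].
    have c1 : 0 <= (L^-1) ^+ j by rewrite exprn_ge0// invr_ge0 ltW.
    rewrite (ger0_norm (mulr_ge0 c1 Bj0)).
    move: ax; rewrite le_eqVlt => /orP[/eqP <-|ax].
      by rewrite /d patch_left// normr0 mulr_ge0.
    rewrite dmid// normrM (ger0_norm c1); apply: ler_wpM2l => //.
    by have [] := unit_itv x ax xb; exact: hBj.
  rewrite nsq_cst// exprMn -exprM mulnC exprVn.
  have -> : a + L - a = L by ring.
  by rewrite le_eqVlt; apply/orP; left; apply/eqP; ring.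
have a1 : a <= a + L / 4 by lra.
have a2 : a + L / 4 <= a + 3 * L / 4 by lra.
have mid x : a + L / 4 <= x -> x <= a + 3 * L / 4 -> m <= `|d (e0, false) 0%N x|.
  move=> h1 h2; rewrite dmid ?expr0 ?mul1r ?derivn0; [|lra|lra].
  apply: bump_poly_mid; first by rewrite ler_pdivlMr//; lra.
  by rewrite ler_pdivrMr//; lra.
have modE x : modulus d e0 x = `|d (e0, false) 0%N x|.
  have ne : (e0, true) != (e0, false) by rewrite xpair_eqE andbF.
  by rewrite /modulus (dout (e0, true) _ _ ne) (expr0n _ 2)/= addr0 sqrtr_sqr.
exists d; split => //.
- split.
    rewrite Esq//; apply: (@le_trans _ _ (nsq `[a + L / 4, a + 3 * L / 4] (d (e0, false) 0%N))).
      apply: (@le_trans _ _ (nsq `[a + L / 4, a + 3 * L / 4] (fun=> m))).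
        rewrite nsq_cst//; apply: (@le_trans _ _ (m ^+ 2 / 2 * L)).
          by rewrite ler_wpM2r ?(ltW L0)// ge_min lexx.
        by rewrite le_eqVlt; apply/orP; left; apply/eqP; field.
      apply: nsq_le => //; [exact: L2_cst|apply: (L2_sub (Lab 0%N (leq0n k))); lra|].
      by move=> x; rewrite /= in_itv/= => /andP[h1 h2]; rewrite (gtr0_norm m0); exact: mid.
    by apply: nsqS => //; [apply: subset_itvcc; lra|exact: Lab].
  have := upper 0%N B0 (leq0n k) B00; rewrite derivn0 muln0 expr0 mulr1 => /(_ hB0) h.
  by apply: (le_trans h); rewrite ler_wpM2r ?(ltW L0)// /B; lra.
- by apply: (le_trans (upper k Bk (leqnn k) Bk0 hBk)); rewrite ler_wpM2r ?(ltW L0)// /B; lra.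
- have PI := power_Rintegrable k_gt0 q2 e0 hd.
  have mI := measurable_edge_itv (len e0).
  apply: (@le_trans _ _ (\int[leb]_(x in edge_itv (len e0)) (modulus d e0 x `^ q))); last first.
    rewrite /power_integral (bigD1 e0)//= lerDl.
    by apply: sumr_ge0 => e _; apply: Rintegral_ge0 => x _; exact: powR_ge0.
  have sJ : `[a + L / 4, a + 3 * L / 4] `<=` edge_itv (len e0).
    by move=> x; rewrite /= in_itv/= => /andP[h1 _]; apply: Ie; lra.
  apply: (@le_trans _ _ (\int[leb]_(x in `[a + L / 4, a + 3 * L / 4]) (modulus d e0 x `^ q))).
    apply: (@le_trans _ _ (\int[leb]_(x in `[a + L / 4, a + 3 * L / 4]) (m `^ q))).
      rewrite Rint_cst//; apply: (@le_trans _ _ (m `^ q / 2 * L)).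
        by rewrite ler_wpM2r ?(ltW L0)// ge_min lexx orbT.
      by rewrite le_eqVlt; apply/orP; left; apply/eqP; field.
    apply: Rint_le => //; [exact: Rintegrable_cst|exact: (RintegrableS mI (mJ _ _) sJ PI)|].
    move=> x; rewrite /= in_itv/= => /andP[h1 h2]; apply: le_powR; [lra|exact: ltW|].
    by rewrite modE; exact: mid.
  by apply: Rint_subset => // x _; exact: powR_ge0.
- split=> [c j x dx|c x Ix].
    split; first by apply: contrapT => lc; apply: dx; exact: patch_bounded.
    by rewrite ltNge; apply/negP => xa; apply: dx; exact: patch_left.
  have B0le : 0 <= B by rewrite /B; lra.
  case: (eqVneq c (e0, false)) => [->|cn]; last by rewrite dout// expr0n.
  have [xa|ax] := leP x a; first by rewrite /d patch_left// expr0n.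
  have [xb|bx] := leP x (a + L); last by rewrite dright// expr0n.
  rewrite dmid// derivn0 expr0 mul1r -(real_normK (num_real _)).
  have [u1 u2] := unit_itv x ax xb.
  apply: (@le_trans _ _ (B0 ^+ 2)); last by rewrite /B; lra.
  by apply: lerXn2r; rewrite ?nnegrE//; exact: hB0.
Qed.

(* Instead of multiplying by a cut-off function, [u] is continued to the left of [a + 1] by
   Hermite interpolation of its small jet at [a + 1] with the zero jet at [a]. *)
Lemma cutoff a eta : 0 <= a -> 0 < eta -> exists X delta, 0 < delta /\ forall u : jet G,
  jet_space k u ->
  (forall c j x, (j < k)%N -> I c x -> x <= X -> `|u c j x| <= delta) ->
  exists v : jet G, [/\ jet_space k v, forall c j x, v c j x <> 0 -> len c.1 = +oo%E /\ a <= x,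
    energy_sq 0 (jcomb 1 u (-1) v) <= eta & energy_sq k v <= energy_sq k u + eta].
Proof.
move=> a0 eta0; pose b := a + 1; have ab : a < b by rewrite /b; lra.
have [C C0 hC] := hermite_interpolation k ab.
(* Past the transition zone and past the ends of all bounded edges; [fine] turns the length of a ray
   into 0. *)
pose X := b + \sum_(e : edge G) fine (len e).
have len0 (e : edge G) : 0 <= fine (len e) by apply: fine_ge0; exact: ltW (len_gt0 e).
have bX : b <= X by rewrite lerDl; apply: sumr_ge0.
have lX (e : edge G) (l : R) : len e = l%:E -> l <= X.
  move=> le; rewrite /X (bigD1 e)//= le/=.
  have : 0 <= \sum_(i | i != e) fine (len i) by apply: sumr_ge0 => i _; exact: len0.
  by rewrite /b; lra.
have X0 : 0 <= X by rewrite /b in bX; lra.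
pose Kc : R := \sum_(c : edge G * bool) 1.
have Kc0 : 0 <= Kc by exact: sumr_ge0.
pose Z := Kc * ((1 + C) ^+ 2 * X).
have Z0 : 0 <= Z by rewrite mulr_ge0// mulr_ge0// sqr_ge0.
pose delta := Num.min 1 (eta / (Z + 1)).
have d0 : 0 < delta by rewrite lt_min ltr01 divr_gt0//; lra.
have d1 : delta <= 1 by rewrite ge_min lexx.
have dZ : delta * (Z + 1) <= eta by rewrite -ler_pdivlMr ?ge_min ?lexx ?orbT//; lra.
have d2Z : delta ^+ 2 * Z <= eta.
  by have := mulr_ge0 (ltW d0) Z0; rewrite expr2; nra.
exists X, delta; split => // u hu small.
have /choice[P hP] : forall c : edge G * bool, exists p : {poly R}, len c.1 = +oo%E ->
    (forall j, (j < k)%N -> p^`(j).[a] = 0 /\ p^`(j).[b] = u c j b) /\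
    (forall j x, (j <= k)%N -> a <= x -> x <= b -> `|p^`(j).[x]| <= C * delta).
  move=> c; have [lc|nlc] := pselect (len c.1 = +oo%E); last by exists 0.
  have [|p hp] := hC (fun j => u c j b) delta (ltW d0); last by exists p.
  move=> j jk; apply: small => //; apply: ray_coord => //; rewrite /b; lra.
pose v : jet G := patch a b P u.
have hv : jet_space k v.
  apply: patch_space => //; [exact: ltW|by case: hu|].
  by move=> c j lc jk; have [h _] := hP c lc; exact: h.
have CD : 0 <= C * delta by rewrite mulr_ge0// ltW.
(* Bounds the difference of [u] and [v]: [delta] for [u] and C delta for the interpolant. *)
pose eps := (1 + C) * delta.
have epsE : eps = delta + C * delta by rewrite /eps; ring.
have local (f g : R -> R) (c : edge G * bool) : real_L2 (I c) f -> real_L2 (I c) g ->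
    (forall x, I c x -> x <= X -> f x ^+ 2 <= g x ^+ 2 + eps ^+ 2) ->
    (forall x, I c x -> len c.1 = +oo%E -> X < x -> f x ^+ 2 <= g x ^+ 2) ->
    nsq (I c) f <= nsq (I c) g + eps ^+ 2 * X.
  move=> Lf Lg h1 h2; case El : (len c.1) => [l||].
  - have l0 : 0 < l by rewrite -lte_fin -El; exact: len_gt0.
    have Il : I c l by rewrite El; split; [exact: ltW|exact: lexx].
    rewrite -El; apply: (@le_trans _ _ (nsq (I c) g + eps ^+ 2 * l)).
      apply: (nsq_local (len_gt0 c.1) Il Lf Lg) => x Ix xl.
        by apply: h1 => //; apply: le_trans xl (lX _ _ El).
      by move: Ix; rewrite El => -[_]; rewrite lee_fin leNgt xl.
    by rewrite lerD2l; apply: ler_wpM2l; [exact: sqr_ge0|exact: lX El].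
  - rewrite -El; apply: (nsq_local (len_gt0 c.1) _ Lf Lg) => //; first exact: ray_coord.
    by move=> x Ix; exact: h2.
  - by have := len_gt0 c.1; rewrite El.
have sumK : \sum_(c : edge G * bool) eps ^+ 2 * X = delta ^+ 2 * Z.
  rewrite /Z /Kc mulr_suml mulr_sumr; apply: eq_bigr => c _.
  by rewrite /eps mul1r exprMn; ring.
have absq (y z : R) : 0 <= z -> `|y| <= z -> y ^+ 2 <= z ^+ 2.
  by move=> z0 yz; rewrite -(real_normK (num_real y)); apply: lerXn2r; rewrite ?nnegrE.
have eps0 : 0 <= eps by rewrite epsE; lra.
have hw := jet_space_comb 1 (-1) hu hv.
exists v; split => //.
- move=> c j x vx; split; first by apply: contrapT => lc; apply: vx; exact: patch_bounded.
  by rewrite leNgt; apply/negP => /ltW xa; apply: vx; exact: patch_left.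
- apply: le_trans d2Z; rewrite -sumK; apply: ler_sum => c _; rewrite ip_nsq.
  have L0 : real_L2 (I c) (fun=> 0) by apply: L2_0; exact: measurable_edge_itv.
  have n0 : nsq (I c) (fun=> 0) = 0 := nsq_zero (measurable_edge_itv _).
  rewrite -[leRHS]add0r -n0; apply: local => //; first exact: (jet_L2 hw (leq0n k) c).
    move=> x Ix xX; rewrite expr0n add0r; apply: absq => //; rewrite /level /jcomb mul1r mulN1r.
    have ux := small c 0%N x k_gt0 Ix xX.
    have [lc|lc] := pselect (len c.1 = +oo%E); last first.
      by rewrite /v patch_bounded// subr0 epsE; lra.
    have [xa|ax] := leP x a; first by rewrite /v patch_left// subr0 epsE; lra.
    have [xb|bx] := leP x b; last by rewrite /v patch_right ?subrr ?normr0// ltW.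
    rewrite /v patch_mid//; apply: (le_trans (ler_normB _ _)); rewrite epsE; apply: lerD => //.
    by have [_ h] := hP c lc; apply: h => //; exact: ltW.
  move=> x Ix lc Xx; rewrite /level /jcomb /v patch_right ?(ltW ab) ?(le_lt_trans bX)//.
  by rewrite mul1r mulN1r subrr.
- apply: (@le_trans _ _ (energy_sq k u + delta ^+ 2 * Z)); last by rewrite lerD2l.
  rewrite -sumK /energy_sq /bil -big_split/=; apply: ler_sum => c _; rewrite !ip_nsq.
  apply: local; [exact: (jet_L2 hv (leqnn k) c)|exact: (jet_L2 hu (leqnn k) c)| |].
    move=> x Ix xX; rewrite /level.
    have u2 := sqr_ge0 (u c k x); have e2 := sqr_ge0 eps.
    have [lc|lc] := pselect (len c.1 = +oo%E); last first.
      by rewrite /v patch_bounded// (expr0n _ 2)/=; lra.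
    have [xa|ax] := leP x a; first by rewrite /v patch_left// (expr0n _ 2)/=; lra.
    have [xb|bx] := leP x b; last by rewrite /v (patch_right _ _ _ lc (ltW ab) bx); lra.
    rewrite /v patch_mid//.
    have : (P c)^`(k).[x] ^+ 2 <= eps ^+ 2; last by lra.
    apply: absq => //; have [_ h] := hP c lc; have := h k x (leqnn k) (ltW ax) xb.
    by rewrite epsE; lra.
  by move=> x Ix lc Xx; rewrite /level /v patch_right ?(ltW ab) ?(le_lt_trans bX).
Qed.

End Bump.

(** * Strict subadditivity *)

Section Ground.
Context {R : realType} (G : metric_graph R).
Local Notation leb := (@lebesgue_measure R).
Local Notation I c := (edge_itv (len c.1)).
Implicit Types (d : jet G).
Variable k : nat.
Hypothesis k_gt0 : (0 < k)%N.
Variable q : R.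
Hypotheses (q_gt2 : 2 < q) (q_lt : q < 4 * k%:R + 2).
Variable mu : R.
Hypothesis mu_gt0 : 0 < mu.
Variables (V V2 Vinf : edge G -> R -> R) (M : R).
Hypothesis VE : bounded_split V V2 Vinf M.
Variable e0 : edge G.
Hypothesis ray0 : len e0 = +oo%E.

Local Notation J := (jet_energy k V mu q).

Definition is_ground (t e : R) : Prop :=
  (forall d, jet_space k d -> energy_sq 0 d = t -> e <= J d) /\
  (forall eps, 0 < eps -> exists d, [/\ jet_space k d, energy_sq 0 d = t & J d < e + eps]).

Lemma jet_energy_jscale s d : jet_space k d ->
  J (jscale s d) = 2^-1 * (s ^+ 2 * (energy_sq k d + pot V d d)) -
    mu / q * (`|s| `^ q * power_integral q d).
Proof.
move=> hd; rewrite /jet_energy (energy_sq_jscale s hd (leqnn k)) (pot_jscale k_gt0 VE s hd).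
by rewrite (power_jscale k_gt0 s q_gt2 hd) -mulrDr.
Qed.

Lemma exists_normalized t : 0 < t -> exists d, jet_space k d /\ energy_sq 0 d = t.
Proof.
move=> t0; have [B [c0 [B0 c00 h]]] := exists_bump k_gt0 ray0 q_gt2.
have [d [hd [d0 _] _ _ _]] := h 0 1 (lexx 0) ltr01.
have E0 : 0 < energy_sq 0 d by apply: lt_le_trans d0; rewrite mulr1.
exists (jscale (Num.sqrt (t / energy_sq 0 d)) d); split; first exact: jscale_space.
rewrite (energy_sq_jscale _ hd (leq0n k)) sqr_sqrtr ?divfK ?gt_eqF//.
by rewrite divr_ge0// ltW.
Qed.

Lemma ground_exists t : 0 < t -> exists2 e, ground_energy k V mu q t = e%:E & is_ground t e.
Proof.
move=> t0; rewrite (ground_energyE k_gt0 q mu VE t).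
set A := jet_energies k q mu V t.
have [K K0 hK] := energy_coercive k_gt0 q_gt2 q_lt mu_gt0 VE t0.
have lb z : A z -> - K <= z.
  move=> [d [hd dt] <-]; have := hK d hd ltac:(by rewrite dt).
  by have := energy_sq_ge0 k d; lra.
have [d1 [hd1 dt1]] := exists_normalized t0.
have [A1 hA1] : exists z, A z by exists (J d1); exists d1.
have fin : ereal_inf [set z%:E | z in A] \is a fin_num.
  rewrite fin_numE; apply/andP; split.
    apply/eqP => h; have : ((- K)%:E <= ereal_inf [set z%:E | z in A])%E.
      by apply: le_ereal_inf_tmp => _ [z Az <-]; rewrite lee_fin; exact: lb.
    by rewrite h.
  apply/eqP => h; have : (ereal_inf [set z%:E | z in A] <= A1%:E)%E.
    by apply: ereal_inf_lbound; exists A1.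
  by rewrite h.
exists (fine (ereal_inf [set z%:E | z in A])); first by rewrite fineK.
split=> [d hd dt|eps eps0].
  rewrite -lee_fin fineK//; apply: ereal_inf_lbound.
  by exists (J d) => //; exists d.
have : (ereal_inf [set z%:E | z in A] < (fine (ereal_inf [set z%:E | z in A]) + eps)%:E)%E.
  by rewrite EFinD fineK// lteDl// lte_fin.
move=> /ereal_inf_lt[_ [z [d [hd dt] <-] <-]]; rewrite lte_fin => h.
by exists d.
Qed.

(* The power term stays away from 0 along minimizing sequences: this makes the scaling
   inequality strict. *)
Definition concentrated : Prop := forall t e, 0 < t -> is_ground t e ->
  exists delta eta, [/\ 0 < delta, 0 < eta & forall d, jet_space k d -> energy_sq 0 d = t ->
    J d < e + eta -> delta <= power_integral q d].

Lemma powR_gt_sqr s : 1 < s -> s ^+ 2 < s `^ q.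
Proof.
have q2 := q_gt2.
move=> s1; have s0 : 0 < s by lra.
rewrite powR_sqr ?(ltW q_gt2) ?(ltW s0)// ltr_pMl ?exprn_gt0//.
have {1}-> : 1 = 1 `^ (q - 2) :> R by rewrite powR1.
apply: gt0_ltr_powR => //; rewrite ?nnegrE; lra.
Qed.

(** With s^2 = c the energy of [jscale s d] is c J(d) minus (s^q - c) mu / q times the power
    integral, and s^q > c. Concentration makes this gain at least [g]; starting within [eps] of the
    infimum, with c eps <= g / 2, loses at most half of it. *)
Lemma ground_scaling t e c e' : concentrated -> 0 < t -> 1 < c ->
  is_ground t e -> is_ground (c * t) e' -> e' < c * e.
Proof.
have q2 := q_gt2; have mu0 := mu_gt0.
move=> conc t0 c1 he [he' _]; have [delta [eta [de0 eta0 h]]] := conc t e t0 he.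
pose s := Num.sqrt c.
have s2 : s ^+ 2 = c by rewrite sqr_sqrtr//; lra.
have s0 : 0 <= s by exact: sqrtr_ge0.
have s1 : 1 < s by rewrite -(@ltr_pXn2r _ 2)// ?nnegrE// s2 expr1n.
have gap : 0 < s `^ q - c by rewrite subr_gt0 -s2; exact: powR_gt_sqr.
have mq : 0 < mu / q by rewrite divr_gt0//; lra.
pose g := (s `^ q - c) * (mu / q * delta).
have g0 : 0 < g by do 2!apply: mulr_gt0 => //.
pose eps := Num.min eta (g / (2 * c)).
have eps0 : 0 < eps by rewrite lt_min eta0 divr_gt0//; lra.
have epsg : eps * (2 * c) <= g by rewrite -ler_pdivlMr ?ge_min ?lexx ?orbT//; lra.
have [d [hd dt dJ]] := he.2 eps eps0.
have db : delta <= power_integral q d.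
  by apply: h => //; apply: lt_le_trans dJ _; rewrite lerD2l ge_min lexx.
have := he' (jscale s d) (jscale_space s hd).
rewrite (energy_sq_jscale s hd (leq0n k)) s2 dt => /(_ erefl).
rewrite jet_energy_jscale// s2 (ger0_norm s0) => h1.
move: dJ; rewrite /jet_energy; move: h1; set A := energy_sq k d + _; set P := power_integral q d in db *.
move=> h1 dJ.
have h2 : (s `^ q - c) * (mu / q * delta) <= (s `^ q - c) * (mu / q * P).
  by apply: ler_wpM2l; [exact: ltW|apply: ler_wpM2l => //; exact: ltW].
rewrite -/g in h2.
have h3 : c * (2^-1 * A - mu / q * P) <= c * (e + eps) by apply: ler_wpM2l; [lra|exact: ltW].
have h4 : mu / q * (s `^ q * P) = (s `^ q - c) * (mu / q * P) + c * (mu / q * P) by ring.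
rewrite h4 in h1; move: h1 h2 h3 epsg g0; rewrite !mulrDr !mulrN.
move: ((s `^ q - c) * (mu / q * P)) (c * (mu / q * P)) => x y; lra.
Qed.

(** Scaling from either mass to the sum gives t1 e < (t1 + t2) e1 and t2 e < (t1 + t2) e2; these are
    added and divided by t1 + t2. *)
Lemma strictly_subadditive t1 t2 e1 e2 e : concentrated -> 0 < t1 -> 0 < t2 ->
  is_ground t1 e1 -> is_ground t2 e2 -> is_ground (t1 + t2) e -> e < e1 + e2.
Proof.
move=> conc t10 t20 h1 h2 h.
have step t t' e' : 0 < t -> 0 < t' -> is_ground t e' -> is_ground (t + t') e -> t * e < (t + t') * e'.
  move=> t0 t'0 he' he; have c1 : 1 < (t + t') / t by rewrite ltr_pdivlMr//; lra.
  have := ground_scaling (e' := e) conc t0 c1 he'; rewrite divfK ?gt_eqF// => /(_ he).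
  by rewrite mulrAC ltr_pdivlMr// mulrC.
have s1 := step t1 t2 e1 t10 t20 h1 h.
have s2 : t2 * e < (t2 + t1) * e2 by apply: step => //; rewrite addrC.
have t0 : 0 < t1 + t2 by lra.
rewrite -(ltr_pM2l t0); lra.
Qed.

End Ground.

Lemma negative_energy_kinetic (F : realFieldType) (a K t e : F) :
  4^-1 * a - K < e + - e / 2 -> e < 0 -> 0 < t -> a <= t + 4 * K.
Proof. lra. Qed.

Lemma negative_energy_power (F : realFieldType) (a p m P K e : F) :
  2^-1 * (a + p) - m * P < e + - e / 2 -> - p <= - e / 4 + K * P -> 0 <= a -> e < 0 ->
  - e / 8 <= P * (K / 2 + m).
Proof. lra. Qed.

(** * Concentration for a decaying potential *)

Section Decaying_potential.
Context {R : realType} (G : metric_graph R).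
Local Notation leb := (@lebesgue_measure R).
Local Notation I c := (edge_itv (len c.1)).
Implicit Types (d : jet G).
Variable k : nat.
Hypothesis k_gt0 : (0 < k)%N.
Variable q : R.
Hypotheses (q_gt2 : 2 < q) (q_lt : q < 4 * k%:R + 2).
Variable mu : R.
Hypothesis mu_gt0 : 0 < mu.
Variables (V V2 Vinf : edge G -> R -> R).
Hypothesis VE : L2_plus_Linfty V V2 Vinf.
Hypothesis Vinf_cvg : forall e : edge G, len e = +oo%E -> Vinf e x @[x --> +oo] --> (0 : R).
Variable e0 : edge G.
Hypothesis ray0 : len e0 = +oo%E.

Local Notation J := (jet_energy k V mu q).

(** On a bounded edge, and on a ray up to the point beyond which it is at most [theta], the bounded
    part is square integrable and can join the L^2 part. *)
Lemma decaying_split theta : 0 < theta -> exists V2' Vinf', bounded_split V V2' Vinf' theta.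
Proof.
move=> th0; have [Va [W [M [[M0 hM] WV]]]] := L2_plus_Linfty_bounded VE.
have /choice[X hX] : forall e : edge G, exists X, edge_itv (len e) X /\
    forall x, edge_itv (len e) x -> X < x -> `|W e x| <= theta.
  move=> e; case El : (len e) => [l||]; last by have := len_gt0 e; rewrite El.
    exists l; have := len_gt0 e; rewrite El lte_fin => l0.
    split; first by split; [exact: ltW|exact: lexx].
    by move=> x [_]; rewrite lee_fin => xl lx; move: (lt_le_trans lx xl); rewrite ltxx.
  have /cvgrPdist_le/(_ theta th0)[A [Ar hA]] := Vinf_cvg El.
  exists (Num.max 0 A); rewrite -El; split; first by apply: ray_coord; rewrite // le_max lexx.
  move=> x _; rewrite gt_max => /andP[_ Ax]; apply: (le_trans (WV e x)).
  by have := hA x Ax; rewrite sub0r normrN.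
pose W1 e := glue (X e) (W e) (fun=> 0).
exists (fun e x => Va e x + W1 e x), (fun e x => W e x - W1 e x).
split; first exact: ltW.
move=> e; have [La mW Wb VEe] := hM e; have [IX hXe] := hX e.
have mI := measurable_edge_itv (len e).
have LW1 : real_L2 (edge_itv (len e)) (W1 e).
  apply: (glue_L2 (len_gt0 e) IX); last by apply: L2_0.
  have sub := edge_itv_sub (edge_itv0 (len_gt0 e)) IX.
  apply: (@L2_le _ _ (@measurable_itvcc R 0 (X e)) _ (fun=> M) 1).
  - exact: (measurable_funS mI sub mW).
  - move=> x /sub Ix; rewrite mul1r (ger0_norm M0); exact: Wb.
  - exact: L2_cst.
split.
- exact: L2D.
- by apply: measurable_funB => //; case: LW1.
- move=> x Ix; rewrite /W1 /glue; case: (leP x (X e)) => xX; first by rewrite subrr normr0 ltW.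
  by rewrite subr0; exact: hXe.
- by move=> x Ix; rewrite VEe//; ring.
Qed.

(** The L^2 part is replaced by 0 up to its own cut point on each edge, where [d] vanishes anyway,
    so that only its small tail enters [ip_potential_bound]. *)
Lemma potential_far S T eps : 0 <= S -> 0 <= T -> 0 < eps -> exists2 X, 0 <= X &
  forall d, jet_space k d -> (forall c x, I c x -> d c 0%N x ^+ 2 <= S) -> energy_sq 0 d <= T ->
  (forall c x, d c 0%N x <> 0 -> len c.1 = +oo%E /\ X < x) -> `|pot V d d| <= eps.
Proof.
move=> S0 T0 eps0; pose th := eps / (4 * (T + 1)).
have th0 : 0 < th by rewrite divr_gt0//; lra.
have thE : th * (4 * (T + 1)) = eps by rewrite /th divfK// gt_eqF//; lra.
have [W2 [Wi WE]] := decaying_split th0; have [_ hW] := WE.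
pose Kc : R := \sum_(c : edge G * bool) 1.
have Kc0 : 0 <= Kc by exact: sumr_ge0.
pose Z := th^-1 * S * Kc.
have thi : 0 < th^-1 by rewrite invr_gt0.
have Z0 : 0 <= Z by rewrite mulr_ge0// mulr_ge0// ltW.
pose ep := eps / (4 * (Z + 1)).
have ep0 : 0 < ep by rewrite divr_gt0//; lra.
have epE : ep * (4 * (Z + 1)) = eps by rewrite /ep divfK// gt_eqF//; lra.
have /choice[X hX] : forall e : edge G, exists X, edge_itv (len e) X /\
    nsq (edge_itv (len e) `\` `[0, X]) (W2 e) <= ep.
  by move=> e; have [L _ _ _] := hW e; have [b []] := nsq_tail (len_gt0 e) L ep0; exists b.
have X0 e : 0 <= X e by have [[]] := hX e.
have XX e : X e <= \sum_e X e.
  by rewrite (bigD1 e)//= lerDl; apply: sumr_ge0.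
exists (\sum_e X e); first exact: sumr_ge0.
move=> d hd dS dT ds; have LV := potential_L2 k_gt0 WE hd; have L0 := jet_L2 hd (leq0n k).
apply: (le_trans (ler_norm_sum _ _ _)).
apply: (@le_trans _ _ (\sum_c (th^-1 * S * ep + (th^-1^-1 + th) * nsq (I c) (d c 0%N)))).
  apply: ler_sum => c _; have [LW2 mWi Wib WEc] := hW c.1; have [IX hXc] := hX c.1.
  have mI := measurable_edge_itv (len c.1).
  pose W2c := glue (X c.1) (fun=> 0) (W2 c.1).
  have LW2c : real_L2 (I c) W2c by apply: (glue_L2 (len_gt0 c.1) IX) => //; apply: L2_0.
  have nW2c : nsq (I c) W2c <= ep.
    apply: le_trans hXc; rewrite /nsq (@Rint_support _ (I c) (I c `\` `[0, X c.1]))//.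
    - rewrite le_eqVlt; apply/orP; left; apply/eqP; apply: eq_Rint => x [[x0 _]].
      rewrite /= in_itv/= x0/= => /negP xX.
      by rewrite /W2c /glue (negPf xX).
    - by apply: measurableD => //; exact: measurable_itvcc.
    - move=> x Ix h; rewrite /W2c /glue; case: (leP x (X c.1)) => xX; first by rewrite (expr0n _ 2).
      exfalso; apply: h; split => //; rewrite /= in_itv/= => /andP[_].
      by rewrite leNgt xX.
  apply: (le_trans (ip_potential_bound mI (LV c) (L0 c) LW2c _ Wib (dS c) thi)).
    move=> x Ix; have [->|dn] := eqVneq (d c 0%N x) 0; first by rewrite !mulr0 addr0.
    have [lc Xx] := ds c x (elimN eqP dn).
    by rewrite WEc// /W2c /glue leNgt (le_lt_trans (XX c.1) Xx) mulrDl.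
  by rewrite lerD2r; apply: ler_wpM2l => //; rewrite mulr_ge0// ltW.
have e1 : \sum_c nsq (I c) (d c 0%N) = energy_sq 0 d.
  by apply: eq_bigr => c _; exact/esym/ip_nsq.
have e2 : \sum_(c : edge G * bool) th^-1 * S * ep = Z * ep.
  by rewrite /Z /Kc mulr_sumr mulr_suml; apply: eq_bigr => c _; rewrite mulr1.
rewrite big_split/= e2 -mulr_sumr e1 invrK.
have h1 : th * energy_sq 0 d <= th * T by apply: ler_wpM2l => //; exact: ltW.
have := ltW ep0; have := mulr_ge0 Z0 (ltW ep0); have := mulr_ge0 (ltW th0) T0; lra.
Qed.

(** With v the L^2 part, |v| f^2 <= eta v^2 + f^4 / eta. Where the squared modulus is at most [r],
    the quartic term is at most th f^2; elsewhere f^4 <= S^4 is at most a multiple of the power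
    density. So a small power term forces a small potential term. *)
Lemma potential_power_bound T eps : 0 <= T -> 0 < eps -> exists2 K, 0 <= K &
  forall d, jet_space k d -> energy_sq 0 d <= T -> energy_sq k d <= T ->
  `|pot V d d| <= eps + K * power_integral q d.
Proof.
move=> T0 eps0; have q2 := q_gt2; pose th := eps / (4 * (T + 1)).
have th0 : 0 < th by rewrite divr_gt0//; lra.
have thE : th * (4 * (T + 1)) = eps by rewrite /th divfK// gt_eqF//; lra.
have [W2 [Wi WE]] := decaying_split th0; have [_ hW] := WE.
have N0 := V2_sq_ge0 W2.
pose eta := eps / (4 * (V2_sq W2 + 1)).
have eta0 : 0 < eta by rewrite divr_gt0//; lra.
have etaE : eta * (4 * (V2_sq W2 + 1)) = eps by rewrite /eta divfK// gt_eqF//; lra.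
have etai : 0 < eta^-1 by rewrite invr_gt0.
pose r := eta * th.
have r0 : 0 < r by exact: mulr_gt0.
have [S S0 hS] := modulus_sup G k_gt0 T0.
pose rq := Num.sqrt r `^ q.
have rq0 : 0 < rq by rewrite powR_gt0// sqrtr_gt0.
pose K := eta^-1 * (S ^+ 4 / rq).
have K0 : 0 <= K by rewrite mulr_ge0 ?(ltW etai)// divr_ge0 ?exprn_ge0// ltW.
exists (2 * K); first by rewrite mulr_ge0.
move=> d hd dT dkT; have LV := potential_L2 k_gt0 WE hd; have L0 := jet_L2 hd (leq0n k).
apply: (le_trans (ler_norm_sum _ _ _)).
pose Pw (e : edge G) := \int[leb]_(x in edge_itv (len e)) (modulus d e x `^ q).
apply: (@le_trans _ _ (\sum_c ((eta * nsq (I c) (W2 c.1) + 2 * th * nsq (I c) (d c 0%N)) + K * Pw c.1))).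
  apply: ler_sum => c _; have [LW2 mWi Wib WEc] := hW c.1.
  have mI := measurable_edge_itv (len c.1).
  have s1 := L2_sqr mI LW2; have s2 := L2_sqr mI (L0 c).
  have s3 := power_Rintegrable k_gt0 q2 c.1 hd.
  have z1 := RintegrableZ mI eta s1; have z2 := RintegrableZ mI (2 * th) s2.
  have z3 := RintegrableZ mI K s3.
  rewrite /nsq /Pw -(RintZ mI _ s1) -(RintZ mI _ s2) -(RintZ mI _ s3).
  rewrite -(RintD mI z1 z2) -(RintD mI (RintegrableD mI z1 z2) z3).
  apply: (Rint_abs_le mI); first exact: (Rintegrable_mul mI (LV c) (L0 c)).
    by apply: (RintegrableD mI) => //; exact: (RintegrableD mI).
  move=> x Ix; rewrite /potential /level WEc//.
  have wi := Wib x Ix; have ms := hS d hd dT dkT c.1 x Ix.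
  have m0 := modulus_ge0 d c.1 x.
  have fm : d c 0%N x ^+ 2 <= modulus d c.1 x ^+ 2.
    rewrite modulus_sqr; case: (c) => e [] /=.
      by have := sqr_ge0 (d (e, false) 0%N x); lra.
    by have := sqr_ge0 (d (e, true) 0%N x); lra.
  move: wi ms m0 fm; set f := d c 0%N x; set v := W2 c.1 x; set w := Wi c.1 x.
  set m := modulus d c.1 x => wi ms m0 fm.
  have f0 := sqr_ge0 f.
  have quart : eta^-1 * (f ^+ 2 * f ^+ 2) <= th * f ^+ 2 + K * m `^ q.
    have [mr|rm] := leP (m ^+ 2) r.
      have h1 : f ^+ 2 * f ^+ 2 <= r * f ^+ 2 by apply: ler_wpM2r => //; lra.
      have h2 := ler_wpM2l (ltW etai) h1.
      have h3 : eta^-1 * (r * f ^+ 2) = th * f ^+ 2 by rewrite /r; field; rewrite gt_eqF.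
      have : 0 <= K * m `^ q by rewrite mulr_ge0// powR_ge0.
      lra.
    have h1 : rq <= m `^ q.
      apply: le_powR; [lra|exact: sqrtr_ge0|].
      by rewrite -[leRHS]ger0_norm// -sqrtr_sqr ler_sqrt ?sqr_ge0// ltW.
    have h2 : f ^+ 2 * f ^+ 2 <= S ^+ 4.
      have h3 : f ^+ 2 <= S ^+ 2 by apply: (le_trans fm); apply: lerXn2r; rewrite ?nnegrE.
      by rewrite (exprD S 2 2); apply: ler_pM.
    have h3 : S ^+ 4 <= S ^+ 4 / rq * m `^ q.
      by rewrite mulrAC ler_pdivlMr// ler_wpM2l// exprn_ge0.
    have := ler_wpM2l (ltW etai) (le_trans h2 h3).
    have := mulr_ge0 (ltW th0) f0; rewrite /K mulrA; lra.
  have -> : (v + w) * f * f = v * f ^+ 2 + w * f ^+ 2 by ring.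
  apply: (le_trans (ler_normD _ _)); rewrite (normrM v) (normrM w) (ger0_norm f0).
  have h1 : `|w| * f ^+ 2 <= th * f ^+ 2 by apply: ler_wpM2r.
  have h2 : `|v| * f ^+ 2 <= eta * v ^+ 2 + eta^-1 * (f ^+ 2 * f ^+ 2).
    rewrite -(real_normK (num_real v)); set a := `|v|.
    have a0 : 0 <= a by exact: normr_ge0.
    rewrite -(ler_pM2l eta0) mulrDr [X in _ <= _ + X]mulrA divff ?gt_eqF// mul1r.
    have := sqr_ge0 (eta * a - f ^+ 2); have := sqr_ge0 (eta * a); have := mulr_ge0 f0 f0.
    rewrite sqrrB exprMn; nra.
  lra.
rewrite !big_split/= -!mulr_sumr.
have -> : \sum_c nsq (I c) (d c 0%N) = energy_sq 0 d.
  by apply: eq_bigr => c _; exact/esym/ip_nsq.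
rewrite -/(V2_sq W2).
have -> : \sum_(c : edge G * bool) Pw c.1 = 2 * power_integral q d.
  by rewrite sum_pairs mulr_sumr; apply: eq_bigr => e _ /=; rewrite -/(Pw e); ring.
have h1 : th * energy_sq 0 d <= th * T by apply: ler_wpM2l => //; exact: ltW.
have := mulr_ge0 (ltW th0) T0; lra.
Qed.

(** At fixed mass and width [L], the kinetic energy is of order L^(-2k) at most and the power term
    of order L^(-p) at least, with p = (q - 2) / 2 < 2k. [L] is fixed first; the bump is then moved
    so far out that the potential term falls below the threshold [tau]. *)
Lemma decaying_ground_lt0 t : 0 < t -> exists d, [/\ jet_space k d, energy_sq 0 d = t & J d < 0].
Proof.
move=> t0; have q2 := q_gt2; have q4 := q_lt; have mu0 := mu_gt0.
have [V2' [Vinf' VE']] := decaying_split ltr01.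
have [B [c0 [B0 c00 h]]] := exists_bump k_gt0 ray0 q_gt2.
pose p := (q - 2) / 2.
have p0 : 0 <= p by rewrite divr_ge0//; lra.
pose r := (2 * k)%:R - p.
have r0 : 0 < r by rewrite /r natrM subr_gt0 ltr_pdivrMr//; lra.
have mq : 0 < mu / q by rewrite divr_gt0//; lra.
pose kap := mu / q * ((t / B) `^ p * c0).
have kap0 : 0 < kap by rewrite mulr_gt0// mulr_gt0// powR_gt0// divr_gt0.
(* Solves kap L^r = B + kap, so that B < kap L^r. *)
pose L := (B / kap + 1) `^ (r^-1).
have Bk0 : 0 < B / kap by rewrite divr_gt0.
have L0 : 0 < L by rewrite powR_gt0//; lra.
have Lr : L `^ r = B / kap + 1 by rewrite /L -powRrM mulVf ?gt_eqF// powRr1//; lra.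
have LrB : B < kap * L `^ r.
  by rewrite Lr mulrDr mulrC divfK ?gt_eqF//; lra.
(* After division of the energy by s^2, the kinetic term is below [tau] and the potential term at
   most [tau], both with the factor 1/2, while the power term is at least [tau]. *)
pose tau := kap * (L / L `^ p).
have Lp0 : 0 < L `^ p by exact: powR_gt0.
have tau0 : 0 < tau by rewrite mulr_gt0// divr_gt0.
have B1 : 0 <= B := ltW B0.
have BL : 0 <= B * L by rewrite mulr_ge0// ltW.
have [X X0 far] := potential_far B1 BL tau0.
have [d [hd [d1 d2] dk dp [ds dS]]] := h X L X0 L0.
have dpot : `|pot V d d| <= tau by apply: far => // c x; exact: ds.
set A := energy_sq 0 d in d1 d2.
have A0 : 0 < A by apply: lt_le_trans d1; exact: mulr_gt0.
pose s := Num.sqrt (t / A).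
have s0 : 0 < s by rewrite sqrtr_gt0 divr_gt0.
have s2 : s ^+ 2 = t / A by rewrite sqr_sqrtr// ltW// divr_gt0.
exists (jscale s d); split; first exact: jscale_space.
  by rewrite (energy_sq_jscale s hd (leq0n k)) s2 divfK ?gt_eqF.
rewrite (jet_energy_jscale k_gt0 q_gt2 mu VE' s hd) (gtr0_norm s0).
have kin : energy_sq k d < tau.
  have h1 : B * L < tau * L ^+ (2 * k).
    have -> : L ^+ (2 * k) = L `^ r * L `^ p.
      by rewrite -powRD ?subrK ?powR_mulrn ?(ltW L0)//; rewrite (gt_eqF L0) implybT.
    have -> : tau * (L `^ r * L `^ p) = kap * L `^ r * L by rewrite /tau; field; rewrite gt_eqF.
    by rewrite ltr_pM2r.
  by rewrite -(@ltr_pM2r _ (L ^+ (2 * k))) ?exprn_gt0//; exact: le_lt_trans dk h1.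
have pw : tau <= mu / q * (s `^ (q - 2) * power_integral q d).
  have h1 : (t / B) `^ p / L `^ p <= s `^ (q - 2).
    have -> : s `^ (q - 2) = (s ^+ 2) `^ p.
      by rewrite -powR_mulrn ?(ltW s0)// -powRrM /p mulrC divfK.
    rewrite ler_pdivrMr// -powRM ?sqr_ge0 ?(ltW L0)//.
    apply: le_powR => //; first by rewrite divr_ge0// ltW.
    rewrite s2 ler_pdivrMr// (_ : t / A * L * B = t * (B * L) / A); last by ring.
    by rewrite ler_pdivlMr// ler_pM2l.
  rewrite /tau /kap.
  have -> : mu / q * ((t / B) `^ p * c0) * (L / L `^ p) =
     mu / q * ((t / B) `^ p / L `^ p * (c0 * L)) by ring.
  rewrite ler_pM2l//; apply: ler_pM => //.
    by rewrite divr_ge0 ?powR_ge0.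
  by rewrite mulr_ge0// ltW.
have -> : s `^ q = s ^+ 2 * s `^ (q - 2) by rewrite powR_sqr ?(ltW s0) ?(ltW q2)// mulrC.
have sq0 : 0 < s ^+ 2 by rewrite exprn_gt0.
have -> : 2^-1 * (s ^+ 2 * (energy_sq k d + pot V d d)) -
    mu / q * (s ^+ 2 * s `^ (q - 2) * power_integral q d) =
  s ^+ 2 * (2^-1 * (energy_sq k d + pot V d d) - mu / q * (s `^ (q - 2) * power_integral q d)) by ring.
rewrite pmulr_rlt0//.
have := le_trans (ler_norm _) dpot; lra.
Qed.

(** Within -e / 2 of the negative infimum [e] the energy stays below e / 2 and the kinetic energy is
    bounded; by [potential_power_bound] the potential can account for such a value only together
    with the power term. *)
Lemma decaying_concentrated : concentrated k q mu V.
Proof.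
move=> t e t0 [he1 he2]; have mu0 := mu_gt0; have q2 := q_gt2.
have [V2' [Vinf' VE']] := decaying_split ltr01.
have [d1 [hd1 dt1 J1]] := decaying_ground_lt0 t0.
have eneg : e < 0 by apply: le_lt_trans J1; exact: he1.
have [K K0 hK] := energy_coercive k_gt0 q_gt2 q_lt mu_gt0 VE' t0.
pose T := t + 4 * K.
have T0 : 0 <= T by rewrite /T; lra.
have eps0 : 0 < - e / 4 by lra.
have [K1 K10 hK1] := potential_power_bound T0 eps0.
have mq : 0 < mu / q by rewrite divr_gt0//; lra.
pose D := K1 / 2 + mu / q.
have D0 : 0 < D by rewrite /D; lra.
exists (- e / 8 / D), (- e / 2); split; [by rewrite divr_gt0//; lra|lra|].
move=> d hd dt dJ.
have dk : energy_sq k d <= T.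
  have h1 : 4^-1 * energy_sq k d - K <= J d by apply: hK => //; rewrite dt.
  exact: (negative_energy_kinetic (le_lt_trans h1 dJ) eneg t0).
have dT : energy_sq 0 d <= T by rewrite dt lerDl mulr_ge0.
have pb' : - pot V d d <= - e / 4 + K1 * power_integral q d.
  by apply: le_trans (hK1 d hd dT dk); rewrite -normrN; exact: ler_norm.
rewrite ler_pdivrMr//.
exact: (negative_energy_power dJ pb' (energy_sq_ge0 k d) eneg).
Qed.

End Decaying_potential.

(** * Green's formula and ground states *)

Section Green.
Context {R : realType}.
Local Notation leb := (@lebesgue_measure R).

Lemma norm_mul_le (F : realFieldType) (x y : F) : `|x * y| <= x ^+ 2 + y ^+ 2.
Proof.
have h1 := sqr_ge0 (x - y); have h2 := sqr_ge0 (x + y); have h3 := sqr_ge0 x.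
have h4 := sqr_ge0 y; rewrite sqrrB in h1; rewrite sqrrD in h2; rewrite ler_norml; lra.
Qed.

Lemma seven_tenths (F : realFieldType) (x : F) : x <= 3 * (x / 10) + 4 * (x / 10) -> x <= 0.
Proof. lra. Qed.

(** Otherwise the sum of squares would exceed 3 e throughout an interval of length 1, against an
    integral of at most 2 e. *)
Lemma small_point b e (F1 F2 : R -> R) : 0 < e -> real_L2 `[b, b + 1] F1 -> real_L2 `[b, b + 1] F2 ->
  nsq `[b, b + 1] F1 <= e -> nsq `[b, b + 1] F2 <= e ->
  exists y, [/\ b <= y, y <= b + 1 & F1 y ^+ 2 + F2 y ^+ 2 <= 3 * e].
Proof.
move=> e0 L1 L2 n1 n2; apply: contrapT => /forallNP h.
have mb := @measurable_itvcc R b (b + 1).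
have s1 := L2_sqr mb L1; have s2 := L2_sqr mb L2.
have : \int[leb]_(x in `[b, b + 1]) (3 * e) <= \int[leb]_(x in `[b, b + 1]) (F1 x ^+ 2 + F2 x ^+ 2).
  apply: Rint_le => //; [exact: Rintegrable_cst|exact: (RintegrableD mb s1 s2)|].
  move=> x; rewrite /= in_itv/= => /andP[bx xb]; rewrite leNgt; apply/negP => /ltW hx.
  by apply: (h x).
rewrite Rint_cst; last lra.
rewrite (RintD mb s1 s2); move: n1 n2; rewrite /nsq; lra.
Qed.

(* The boundary term at infinity vanishes along points where both functions are small. *)
Lemma ray_parts (F f H h : R -> R) : real_L2 (edge_itv +oo) F -> real_L2 (edge_itv +oo) f ->
  real_L2 (edge_itv +oo) H -> real_L2 (edge_itv +oo) h ->
  primitive_on +oo F f -> primitive_on +oo H h ->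
  \int[leb]_(x in edge_itv +oo) (f x * H x + F x * h x) = - (F 0 * H 0).
Proof.
move=> LF Lf LH Lh PF PH; set I := edge_itv +oo.
have mI : measurable I by exact: measurable_edge_itv.
have I0 (x : R) : 0 <= x -> I x by split => //; rewrite leey.
have oo0 : (0 < +oo :> \bar R)%E by rewrite lt0y.
apply/eqP; rewrite -subr_eq0 opprK; apply/eqP; set D := _ + _.
apply: contrapT => /eqP Dn; have D0 : 0 < `|D| by rewrite normr_gt0.
pose e := `|D| / 10; have e0 : 0 < e by rewrite divr_gt0.
have tail w : real_L2 I w -> exists b, I b /\ forall E, measurable E -> E `<=` I `\` `[0, b] -> nsq E w <= e.
  move=> Lw; have [b [Ib hb]] := nsq_tail oo0 Lw e0; exists b; split => // E mE sE.
  apply: le_trans hb; apply: nsqS => //.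
    by apply: measurableD => //; exact: measurable_itvcc.
  by apply: (L2S mI _ _ Lw); [apply: measurableD => //; exact: measurable_itvcc|move=> x []].
have [b1 [[b10 _] h1]] := tail F LF; have [b2 [[b20 _] h2]] := tail f Lf.
have [b3 [[b30 _] h3]] := tail H LH; have [b4 [[b40 _] h4]] := tail h Lh.
pose b := b1 + b2 + b3 + b4 + 1.
have sub (y : R) E : b <= y -> E `<=` I `\` `[0, y] -> [/\ E `<=` I `\` `[0, b1], E `<=` I `\` `[0, b2],
    E `<=` I `\` `[0, b3] & E `<=` I `\` `[0, b4]].
  move=> yb sE; suff s' z : z <= y -> E `<=` I `\` `[0, z] by split; apply: s'; rewrite /b in yb; lra.
  move=> zy x /sE[Ix hx]; split => //; move: hx; rewrite /= !in_itv/= => hx /andP[x0 xz].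
  by apply: hx; rewrite x0/=; lra.
have sb : `[b, b + 1] `<=` I `\` `[0, b - 1].
  move=> x; rewrite /= in_itv/= => /andP[bx xb]; split; first by apply: I0; rewrite /b in bx; lra.
  by rewrite /= in_itv/=; apply/negP; rewrite negb_and -!ltNge; apply/orP; right; lra.
have loc w : real_L2 I w -> real_L2 `[b, b + 1] w.
  by move=> Lw; apply: (L2_locally Lw); apply: I0; rewrite /b; lra.
have sb' : [/\ `[b, b + 1] `<=` I `\` `[0, b1] & `[b, b + 1] `<=` I `\` `[0, b3]].
  by split=> x /sb[Ix hx]; split => //; move: hx; rewrite /= !in_itv/= => hx /andP[x0 xz];
    apply: hx; rewrite x0/= /b; lra.
have mb := @measurable_itvcc R b (b + 1).
have [y [by1 by2 Fy]] := small_point e0 (loc F LF) (loc H LH) (h1 _ mb sb'.1) (h3 _ mb sb'.2).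
have y0 : 0 <= y by rewrite /b in by1; lra.
have my := @measurable_itvcc R 0 y.
have mE : measurable (I `\` `[0, y]) by exact: measurableD.
have sfH := Rintegrable_mul mI Lf LH; have sFh := Rintegrable_mul mI LF Lh.
have sI := RintegrableD mI sfH sFh.
have subI : `[0, y] `<=` I by move=> x; rewrite /= in_itv/= => /andP[x0 _]; exact: I0.
have IE : I = `[0, y] `|` (I `\` `[0, y]) by rewrite setDUK.
have split : \int[leb]_(x in I) (f x * H x + F x * h x) =
  \int[leb]_(x in `[0, y]) (f x * H x + F x * h x) +
  \int[leb]_(x in I `\` `[0, y]) (f x * H x + F x * h x).
  rewrite {1}IE Rintegral_setU//.
  - by rewrite -IE.
  - by apply/disj_setPS => x [? []].
have L0y w : real_L2 I w -> Rintegrable `[0, y] w.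
  by move=> Lw; apply: L2_Rintegrable; apply: (L2_locally Lw); apply: I0.
have ibp := primitive_mul (L0y f Lf) (L0y h Lh) (primitive_on_itv PF (I0 0 (lexx 0)) (I0 y y0))
  (primitive_on_itv PH (I0 0 (lexx 0)) (I0 y y0)) (lexx 0) y0 (lexx y).
have [s1 s2 s3 s4] := sub y (I `\` `[0, y]) by1 (fun x h => h).
have n1 := h1 _ mE s1; have n2 := h2 _ mE s2; have n3 := h3 _ mE s3; have n4 := h4 _ mE s4.
have LE w : real_L2 I w -> real_L2 (I `\` `[0, y]) w by move=> Lw; apply: (L2S mI _ _ Lw) => // x [].
have q1 := L2_sqr mE (LE _ LF); have q2 := L2_sqr mE (LE _ Lf).
have q3 := L2_sqr mE (LE _ LH); have q4 := L2_sqr mE (LE _ Lh).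
have q23 := RintegrableD mE q2 q3; have q14 := RintegrableD mE q1 q4.
have bnd : `|\int[leb]_(x in I `\` `[0, y]) (f x * H x + F x * h x)| <= 4 * e.
  apply: (@le_trans _ _ (\int[leb]_(x in I `\` `[0, y]) ((f x ^+ 2 + H x ^+ 2) + (F x ^+ 2 + h x ^+ 2)))).
    apply: (Rint_abs_le mE).
    - apply: (RintegrableD mE).
        exact: (Rintegrable_mul mE (LE _ Lf) (LE _ LH)).
      exact: (Rintegrable_mul mE (LE _ LF) (LE _ Lh)).
    - exact: (RintegrableD mE).
    move=> x _; apply: (le_trans (ler_normD _ _)); apply: lerD; exact: norm_mul_le.
  rewrite (RintD mE q23 q14) (RintD mE q2 q3) (RintD mE q1 q4).
  have -> : 4 * e = (e + e) + (e + e) by ring.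
  exact: (lerD (lerD n2 n3) (lerD n1 n4)).
have FHy : `|F y * H y| <= 3 * e.
  exact: le_trans (norm_mul_le _ _) Fy.
have DE : D = F y * H y + \int[leb]_(x in I `\` `[0, y]) (f x * H x + F x * h x).
  by rewrite /D split -ibp; ring.
have De : `|D| <= 3 * e + 4 * e by rewrite DE; apply: (le_trans (ler_normD _ _)); exact: lerD.
by move: D0; rewrite ltNge (seven_tenths De).
Qed.

Variable G : metric_graph R.
Local Notation I c := (edge_itv (len c.1)).
Implicit Types (d g : jet G).

Definition inner_end (c : edge G * bool) : bool := end_vertex c.1 c.2 != None.

Lemma edge_parts (e : edge G) (F f H h : R -> R) : real_L2 (edge_itv (len e)) F ->
  real_L2 (edge_itv (len e)) f -> real_L2 (edge_itv (len e)) H -> real_L2 (edge_itv (len e)) h ->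
  primitive_on (len e) F f -> primitive_on (len e) H h ->
  \int[leb]_(x in edge_itv (len e)) (f x * H x + F x * h x) =
  - \sum_(p : bool | inner_end (e, p)) (-1) ^+ p * (F (end_coord e p) * H (end_coord e p)).
Proof.
move=> LF Lf LH Lh PF PH; rewrite big_mkcond big_bool /= /inner_end/= /end_coord.
case El : (len e) => [l||]; last by have := len_gt0 e; rewrite El.
  have l0 : 0 <= l by have := len_gt0 e; rewrite El lte_fin => /ltW.
  have -> : trg e != None.
    by apply/eqP => /trg_ray; rewrite El.
  have IE : edge_itv l%:E = `[0, l]%classic.
    apply/seteqP; split=> x; rewrite /edge_itv /= in_itv/= lee_fin; first by case=> -> ->.
    by move=> /andP[].
  have I0 : edge_itv (len e) 0 by exact: edge_itv0 (len_gt0 e).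
  have Il : edge_itv (len e) l by rewrite El IE /= in_itv/= l0 lexx.
  have L0l w : real_L2 (edge_itv (len e)) w -> Rintegrable `[0, l] w.
    by move=> Lw; apply: L2_Rintegrable; exact: (L2_locally Lw).
  have ibp := primitive_mul (L0l f Lf) (L0l h Lh) (primitive_on_itv PF I0 Il)
    (primitive_on_itv PH I0 Il) (lexx 0) l0 (lexx l).
  by rewrite IE -ibp /= expr1 expr0; ring.
have -> : trg e = None by apply/trg_ray.
rewrite El in LF Lf LH Lh PF PH.
by rewrite (ray_parts LF Lf LH Lh PF PH) /= expr0; ring.
Qed.

Lemma vertex_sum_zero (X : edge G * bool -> R) :
  (forall v, \sum_(c | end_vertex c.1 c.2 == Some v) X c = 0) -> \sum_(c | inner_end c) X c = 0.
Proof.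
move=> h; rewrite (partition_big (fun c : edge G * bool => end_vertex c.1 c.2) (fun o => o != None))//.
apply: big1 => -[v|//] _; rewrite -[RHS](h v); apply: eq_bigl => c.
by rewrite /inner_end; case: eqP => [->|]; rewrite ?andbF.
Qed.

(** One of the orders [a] and [b] is even, the other odd. At a vertex the even one has a common
    value, which factors out of the boundary sum and leaves the Kirchhoff sum of the odd one, equal
    to 0. *)
Lemma jet_parts m n a b d g : jet_space m d -> jet_space n g -> (a < m)%N -> (b < n)%N ->
  odd (a + b) -> bil (level a.+1 d) (level b g) = - bil (level a d) (level b.+1 g).
Proof.
move=> hd hg am bn ab; apply/eqP; rewrite -addr_eq0; apply/eqP.
have Ld1 := jet_L2 hd am; have Ld := jet_L2 hd (ltnW am).
have Lg1 := jet_L2 hg bn; have Lg := jet_L2 hg (ltnW bn).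
pose X s (c : edge G * bool) : R := (-1) ^+ c.2 *
  (d (c.1, s) a (end_coord c.1 c.2) * g (c.1, s) b (end_coord c.1 c.2)).
have ipE (e : edge G) s : ip (edge_itv (len e)) (level a.+1 d (e, s)) (level b g (e, s)) +
    ip (edge_itv (len e)) (level a d (e, s)) (level b.+1 g (e, s)) =
    - \sum_(p : bool | inner_end (e, p)) X s (e, p).
  have mI : measurable (edge_itv (len e)) by exact: measurable_edge_itv.
  have s1 := Rintegrable_mul mI (Ld1 (e, s)) (Lg (e, s)).
  have s2 := Rintegrable_mul mI (Ld (e, s)) (Lg1 (e, s)).
  rewrite /ip -(RintD mI s1 s2).
  apply: (edge_parts (Ld (e, s)) (Ld1 (e, s)) (Lg (e, s)) (Lg1 (e, s))).
    exact: (chain_primitive (hd.1 (e, s)) am).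
  exact: (chain_primitive (hg.1 (e, s)) bn).
have zero s : \sum_(c | inner_end c) X s c = 0.
  apply: vertex_sum_zero => v; have [e0 he0] := degree_gt0 v.
  have [p0 hp0] : exists p, end_vertex e0 p = Some v.
    by case: he0 => h; [exists false; rewrite /= h|exists true].
  case oa : (odd a).
    have ob : ~~ odd b by move: ab; rewrite oddD oa; case: (odd b).
    transitivity (g (e0, s) b (end_coord e0 p0) *
       \sum_(c : edge G * bool | end_vertex c.1 c.2 == Some v) (-1) ^+ c.2 * d (c.1, s) a (end_coord c.1 c.2)).
      rewrite mulr_sumr; apply: eq_bigr => c /eqP cv; rewrite /X.
      by rewrite (hg.2.1 b bn ob c.1 e0 c.2 p0 v cv hp0 s); ring.
    by rewrite (hd.2.2 a am oa v s) mulr0.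
  have ob : odd b by move: ab; rewrite oddD oa.
  transitivity (d (e0, s) a (end_coord e0 p0) *
     \sum_(c : edge G * bool | end_vertex c.1 c.2 == Some v) (-1) ^+ c.2 * g (c.1, s) b (end_coord c.1 c.2)).
    rewrite mulr_sumr; apply: eq_bigr => c /eqP cv; rewrite /X.
    by rewrite (hd.2.1 a am (negbT oa) c.1 e0 c.2 p0 v cv hp0 s); ring.
  by rewrite (hg.2.2 b bn ob v s) mulr0.
rewrite /bil -big_split/= sum_pairs.
rewrite (eq_bigr (fun e => - \sum_(p : bool | inner_end (e, p)) X true (e, p) -
   \sum_(p : bool | inner_end (e, p)) X false (e, p))); last by move=> e _; rewrite !ipE.
rewrite big_split/= !sumrN.
have flat s : \sum_(e : edge G) \sum_(p : bool | inner_end (e, p)) X s (e, p) = 0.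
  rewrite pair_big_dep/= -[RHS](zero s); apply: eq_big; first by case.
  by case.
by rewrite !flat oppr0 addr0.
Qed.

(** Each of the [k] integrations by parts involves boundary values of orders k + i and k - i - 1,
    whose sum 2k - 1 is odd, as [jet_parts] requires. *)
Lemma green k d g : jet_space (2 * k) d -> jet_space k g ->
  bil (level k d) (level k g) = (-1) ^+ k * bil (level (2 * k) d) (level 0 g).
Proof.
move=> hd hg; suff h i : (i <= k)%N -> bil (level k d) (level k g) =
    (-1) ^+ i * bil (level (k + i) d) (level (k - i) g).
  by rewrite (h k (leqnn k)) addnn mul2n subnn.
elim: i => [_|i IH ik]; first by rewrite addn0 subn0 expr0 mul1r.
rewrite IH; last exact: ltnW.
have E : (k - i = (k - i.+1).+1)%N by lia.
have am : (k + i < 2 * k)%N by lia.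
have bn : (k - i.+1 < k)%N by lia.
have oab : odd (k + i + (k - i.+1)).
  have -> : (k + i + (k - i.+1) = (k.-1).*2.+1)%N by lia.
  by rewrite /= odd_double.
rewrite addnS (jet_parts hd hg am bn oab) -E exprS; ring.
Qed.

End Green.

Lemma gap_power (F : realFieldType) (a m P e eta b : F) :
  2^-1 * a - m * P < e + eta -> b <= a -> eta * 2 = 2^-1 * b - e -> eta <= P * m.
Proof. lra. Qed.

(** * Concentration in the presence of a ground state *)

Section Ground_state.
Context {R : realType} (G : metric_graph R).
Local Notation leb := (@lebesgue_measure R).
Local Notation I c := (edge_itv (len c.1)).
Implicit Types (d g : jet G).
Variable k : nat.
Hypothesis k_gt0 : (0 < k)%N.
Variable q : R.
Hypotheses (q_gt2 : 2 < q) (q_lt : q < 4 * k%:R + 2).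
Variable mu : R.
Hypothesis mu_gt0 : 0 < mu.
Variables (V V2 Vinf : edge G -> R -> R) (M : R).
Hypothesis VE : bounded_split V V2 Vinf M.
Variable e0 : edge G.
Hypothesis ray0 : len e0 = +oo%E.

Local Notation J := (jet_energy k V mu q).

Definition form d g : R := bil (level k d) (level k g) + bil (potential V d) (level 0 g).

Lemma formE d : form d d = energy_sq k d + pot V d d.
Proof. by []. Qed.

Definition shifted_form (z : R) d g : R := form d g - z * bil (level 0 d) (level 0 g).

Let space2k d : jet_space (2 * k) d -> jet_space k d.
Proof. by apply: jet_space_leq; lia. Qed.

Lemma weak_form z d (F : family G) : jet_space (2 * k) d -> family_L2 F ->
  (forall c, {ae leb, forall x, I c x ->
     (-1) ^+ k * d c (2 * k)%N x + V c.1 x * d c 0%N x - z * d c 0%N x = F c x}) ->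
  forall g, jet_space k g -> shifted_form z d g = bil F (level 0 g).
Proof.
move=> hd LF hF g hg; have hd' := space2k hd.
have Ltop := jet_L2 hd (leqnn _); have L0 := jet_L2 hd' (leq0n k); have Lg := jet_L2 hg (leq0n k).
have LV := potential_L2 k_gt0 VE hd'.
have La := family_L2_comb ((-1) ^+ k) 1 Ltop LV.
have Lb := family_L2_comb 1 (- z) La L0.
rewrite /shifted_form /form (green hd hg).
have -> : (-1) ^+ k * bil (level (2 * k) d) (level 0 g) + bil (potential V d) (level 0 g) -
    z * bil (level 0 d) (level 0 g) =
    bil (comb 1 (comb ((-1) ^+ k) (level (2 * k) d) 1 (potential V d)) (- z) (level 0 d)) (level 0 g).
  by rewrite (bil_combl _ _ La L0 Lg) (bil_combl _ _ Ltop LV Lg); ring.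
apply: eq_bigr => c _; have mI : measurable (I c) by exact: measurable_edge_itv.
apply: (ae_Rint mI).
- exact: (Rintegrable_measurable (Rintegrable_mul mI (Lb c) (Lg c))).
- exact: (Rintegrable_measurable (Rintegrable_mul mI (LF c) (Lg c))).
apply: aeS (hF c) => x h Ix; rewrite -(h Ix) /comb /potential /level; ring.
Qed.

Lemma shifted_form_comb z t d g : jet_space k d -> jet_space k g ->
  shifted_form z (jcomb 1 d t g) (jcomb 1 d t g) =
  shifted_form z d d + 2 * t * shifted_form z d g + t ^+ 2 * shifted_form z g g.
Proof.
move=> hd hg; have Ld := jet_L2 hd (leqnn k); have Lg := jet_L2 hg (leqnn k).
have Ld0 := jet_L2 hd (leq0n k); have Lg0 := jet_L2 hg (leq0n k).
have LVd := potential_L2 k_gt0 VE hd; have LVg := potential_L2 k_gt0 VE hg.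
rewrite /shifted_form /form.
have -> : potential V (jcomb 1 d t g) = comb 1 (potential V d) t (potential V g).
  by apply/funext => c; apply/funext => x; rewrite /potential /comb /jcomb; ring.
rewrite !level_jcomb (bil_comb _ _ Ld Lg) (bil_comb _ _ Ld0 Lg0).
have Lc := family_L2_comb 1 t Ld0 Lg0.
rewrite (bil_combl _ _ LVd LVg Lc) (bil_combr _ _ Ld0 Lg0 LVd) (bil_combr _ _ Ld0 Lg0 LVg).
have -> : bil (potential V g) (level 0 d) = bil (potential V d) (level 0 g).
  by apply: eq_bil => c x _; rewrite /potential /level; ring.
ring.
Qed.

Lemma shifted_form_cauchy_schwarz z d g : (forall v, jet_space k v -> 0 <= shifted_form z v v) ->
  jet_space k d -> jet_space k g ->
  shifted_form z d g ^+ 2 <= shifted_form z d d * shifted_form z g g.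
Proof.
move=> h hd hg; apply: quadratic_ge0; first exact: h.
by move=> t; rewrite -shifted_form_comb//; apply: h; exact: jet_space_comb.
Qed.

Lemma cpart_real s (r : R) (z : R[i]) : cpart s (r%:C%C * z) = r * cpart s z.
Proof. by case: s; case: z => a b /=; ring. Qed.

Lemma cpartN s (z : R[i]) : cpart s (- z) = - cpart s z.
Proof. by case: s; case: z. Qed.

Lemma cpart_schrodinger_sub z (u : gfun G) e x s :
  cpart s (schrodinger_sub k V z%:C%C u e x) =
  (-1) ^+ k * cpart s (graph_deriv (2 * k) u e x) + V e x * cpart s (u e x) - z * cpart s (u e x).
Proof.
rewrite /schrodinger_sub /schrodinger.
have -> : ((-1) ^+ k : R[i]) = ((-1) ^+ k : R)%:C%C by rewrite rmorphXn rmorphN rmorph1.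
by rewrite !cpartD cpartN !cpart_real.
Qed.

Lemma schrodinger_sub_jet z (u f : gfun G) d : represents (2 * k) u d ->
  graph_ae_eq (schrodinger_sub k V z%:C%C u) f ->
  forall c, {ae leb, forall x, I c x ->
    (-1) ^+ k * d c (2 * k)%N x + V c.1 x * d c 0%N x - z * d c 0%N x = cpart c.2 (f c.1 x)}.
Proof.
move=> [h0 h1] hf c; have /ae_eq_onP/(_ c.2) := hf c.1; have := h1 _ (leqnn _) c.
apply: aeS2 => x e1 e2 Ix; rewrite -e2// cpart_schrodinger_sub e1// h0//.
Qed.

Lemma schrodinger_sub_normsq z (u f : gfun G) d : graph_Sobolev (2 * k) u -> jet_space (2 * k) d ->
  represents (2 * k) u d -> graph_L2 f -> graph_ae_eq (schrodinger_sub k V z%:C%C u) f ->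
  graph_normsq (schrodinger_sub k V z%:C%C u) = graph_normsq f.
Proof.
move=> uS hd [h0 _] Lf hf; apply: eq_bigr => e _.
have mI : measurable (edge_itv (len e)) by exact: measurable_edge_itv.
have hfe s : {ae leb, forall x, edge_itv (len e) x ->
    cpart s (f e x) = cpart s (schrodinger_sub k V z%:C%C u e x)}.
  by have /ae_eq_onP/(_ s) := hf e; apply: aeS => x h Ix; rewrite h.
have Lfe s : real_L2 (edge_itv (len e)) (fun x => cpart s (f e x)).
  by have /L2P := Lf e; exact.
have [[_ uSe] _ _] := uS.
have [/L2P Ld _] := Sobolev_wderivn (len_gt0 e) (uSe e) (leqnn (2 * k)).
have Lu s : real_L2 (edge_itv (len e)) (fun x => cpart s (u e x)).
  apply: (eq_L2 mI _ (jet_L2 hd (leq0n _) (e, s))) => x Ix.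
  by rewrite /level -(h0 (e, s) x Ix).
have mV : measurable_fun (edge_itv (len e)) (V e).
  have [_ /(_ e)[L2 mVi _ VEe]] := VE.
  apply: (@eq_measurable_fun _ _ _ _ _ (fun x => V2 e x + Vinf e x)).
    by move=> x /set_mem Ix; rewrite VEe.
  by apply: measurable_funD => //; case: L2.
have mS s : measurable_fun (edge_itv (len e)) (fun x => cpart s (schrodinger_sub k V z%:C%C u e x)).
  apply: (@eq_measurable_fun _ _ _ _ _ (fun x => (-1) ^+ k * cpart s (graph_deriv (2 * k) u e x) +
     V e x * cpart s (u e x) - z * cpart s (u e x))).
    by move=> x _; rewrite cpart_schrodinger_sub.
  have m1 := L2_measurable (Ld s); have m2 := L2_measurable (Lu s).
  apply: measurable_funB; last by apply: measurable_funM => //; exact: measurable_cst.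
  by apply: measurable_funD; apply: measurable_funM => //; exact: measurable_cst.
have LS s : real_L2 (edge_itv (len e)) (fun x => cpart s (schrodinger_sub k V z%:C%C u e x)).
  exact: (ae_L2 (mS s) (hfe s) (Lfe s)).
have L2S : L2 (edge_itv (len e)) (schrodinger_sub k V z%:C%C u e) by apply/L2P.
rewrite (normsqE L2S) (normsqE (Lf e)); congr (_ + _)%:E; apply: (ae_Rint mI).
- by apply: measurable_funX; exact: mS.
- by apply: measurable_funX; exact: (L2_measurable (Lfe false)).
- by apply: aeS (hfe false) => x h Ix; rewrite h.
- by apply: measurable_funX; exact: mS.
- by apply: measurable_funX; exact: (L2_measurable (Lfe true)).
- by apply: aeS (hfe true) => x h Ix; rewrite h.
Qed.

Definition form_bottom (z : R) : Prop :=
  (forall g, jet_space k g -> z * energy_sq 0 g <= form g g) /\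
  (forall eps, 0 < eps -> exists g, [/\ jet_space k g, energy_sq 0 g = 1 & form g g < z + eps]).

Lemma form_jscale s g : jet_space k g -> form (jscale s g) (jscale s g) = s ^+ 2 * form g g.
Proof.
by move=> hg; rewrite !formE (energy_sq_jscale s hg (leqnn k)) (pot_jscale k_gt0 VE s hg) mulrDr.
Qed.

(** The relative bound makes the form bounded below on unit mass, and homogeneity extends the
    inequality to other masses; mass 0 cannot be rescaled and is treated by the relative bound
    directly. *)
Lemma form_bottom_exists : exists z, form_bottom z.
Proof.
have [K K0 hK] := pot_relative_bound k_gt0 VE ltr01.
pose A := [set form g g | g in [set g | jet_space k g /\ energy_sq 0 g = 1]].
have lb : lbound A (- K).
  move=> _ [g [hg g1] <-]; rewrite formE.
  have := hK g hg; rewrite g1 mul1r mulr1 ler_norml => /andP[h _]; lra.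
have [g1 [hg1 n1]] := exists_normalized k_gt0 q_gt2 ray0 ltr01.
have hA : has_inf A by split; [exists (form g1 g1); exists g1|exists (- K)].
exists (inf A); split=> [g hg|eps eps0].
  have := energy_sq_ge0 0 g; rewrite le_eqVlt => /orP[/eqP g0|g0].
    rewrite -g0 mulr0 formE.
    have := hK g hg; rewrite -g0 mulr0 addr0 mul1r ler_norml => /andP[h _]; lra.
  pose s := Num.sqrt ((energy_sq 0 g)^-1).
  have s2 : s ^+ 2 = (energy_sq 0 g)^-1 by rewrite sqr_sqrtr// invr_ge0 ltW.
  have : inf A <= form (jscale s g) (jscale s g).
    apply: (ge_inf hA.2); exists (jscale s g) => //; split; first exact: jscale_space.
    by rewrite (energy_sq_jscale s hg (leq0n k)) s2 mulVf ?gt_eqF.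
  by rewrite form_jscale// s2 mulrC ler_pdivlMr.
have [_ [g [hg gn] <-] h] := inf_adherent eps0 hA.
by exists g.
Qed.

(* If [z] were in the resolvent set, solve [(A - z) d = g] for an almost minimizing [g]: then
   [1 = bil g g] is the shifted form at [(d, g)], so Cauchy-Schwarz for this form bounds it by
   the product of a bounded and an arbitrarily small quantity. *)
Lemma form_bottom_spectrum z : form_bottom z -> spectrum k V z%:C%C.
Proof.
move=> [lower approx] [solve [c bound]].
(* With b the scalar product of [g] and the solution, Cauchy-Schwarz gives 1 <= b eps, while b^2 <=
   |c| gives b <= |c| + 1: a contradiction for this [eps]. *)
pose eps := (`|c| + 2)^-1.
have c0 : 0 <= `|c| by exact: normr_ge0.
have eps0 : 0 < eps by rewrite invr_gt0; lra.
have [g [hg g1 gz]] := approx eps eps0.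
have [_ rg] := Sobolev_of_jet k_gt0 hg.
have Lg0 := jet_L2 hg (leq0n k).
have Lu : graph_L2 (gpack g) by move=> e; apply: L2_pack => s; exact: (Lg0 (e, s)).
have [v [vS vu]] := solve (gpack g) Lu.
have k2 : (0 < 2 * k)%N by lia.
have [d [hd rd]] := jet_of_Sobolev k2 vS; have hd' := space2k hd.
have ae := schrodinger_sub_jet rd vu.
have {}ae : forall c, {ae leb, forall x, I c x ->
    (-1) ^+ k * d c (2 * k)%N x + V c.1 x * d c 0%N x - z * d c 0%N x = level 0 g c x}.
  by move=> c'; apply: aeS (ae c') => x h Ix; rewrite h// /level cpart_pack; case: (c').
have wf := weak_form hd Lg0 ae.
have nd : energy_sq 0 d <= c.
  have := bound v vS; rewrite (schrodinger_sub_normsq vS hd rd Lu vu).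
  have rd' : represents k v d by case: rd => r1 r2; split => // j jk; apply: r2; lia.
  by rewrite (normsq_represents hd' rd') (normsq_represents hg rg) g1 mule1 lee_fin.
have pos w : jet_space k w -> 0 <= shifted_form z w w.
  by move=> hw; rewrite /shifted_form subr_ge0; exact: lower.
have := shifted_form_cauchy_schwarz pos hd' hg.
have Ld0 := jet_L2 hd' (leq0n k).
have := bil_cauchy_schwarz Lg0 Ld0; rewrite -/(energy_sq 0 g) -/(energy_sq 0 d) g1 mul1r.
rewrite !wf// -/(energy_sq 0 g) g1.
have Bg0 := pos g hg.
have Bg : shifted_form z g g <= eps by rewrite /shifted_form -/(energy_sq 0 g) g1; lra.
move: (bil (level 0 g) (level 0 d)) => b b2.
have epsc : eps * (`|c| + 2) = 1 by rewrite /eps mulVf// gt_eqF//; lra.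
have cc := ler_norm c.
have e2 := energy_sq_ge0 0 d.
move: (shifted_form z g g) (energy_sq 0 d) nd Bg0 Bg b2 e2 => B E nd Bg0 Bg b2 e2.
rewrite expr1n => h.
have bc : b ^+ 2 <= `|c| by lra.
have b1 : b <= `|c| + 1 by nra.
nra.
Qed.

(** At mass t the eigenfunction has form exactly lam t and a positive power term, so e < lam t / 2.
    Every jet of mass t has form at least z t >= lam t, so an energy close to [e] can be reached
    only through a power term of the order of the gap. *)
Lemma ground_state_concentrated : has_ground_state k V -> concentrated k q mu V.
Proof.
move=> [lam [infE [u [uS unz uE]]]].
have [z hz] := form_bottom_exists.
have lz : lam <= z.
  rewrite -lee_fin -infE; apply: ereal_inf_lbound; exists z => //.
  exact: form_bottom_spectrum.
have k2 : (0 < 2 * k)%N by lia.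
have [d0 [hd0 rd0]] := jet_of_Sobolev k2 uS; have hd0' := space2k hd0.
have zero_L2 : family_L2 ((fun _ _ => 0) : family G).
  by move=> c; exact: (L2_0 (I c)).
have ae : forall c, {ae leb, forall x, I c x ->
    (-1) ^+ k * d0 c (2 * k)%N x + V c.1 x * d0 c 0%N x - lam * d0 c 0%N x = 0}.
  have uE0 : graph_ae_eq (schrodinger_sub k V lam%:C%C u) (fun _ _ => 0).
    by move=> e; apply: aeS (uE e) => x h Ix; rewrite /schrodinger_sub h// subrr.
  by move=> c; apply: aeS (schrodinger_sub_jet rd0 uE0 c) => x h Ix; rewrite h//; case: (c.2).
have form0 : form d0 d0 = lam * energy_sq 0 d0.
  have := weak_form hd0 zero_L2 ae hd0'; rewrite /shifted_form.
  have -> : bil (fun _ _ => 0) (level 0 d0) = 0.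
    apply: big1 => c _; rewrite /ip -[RHS](nsq_zero (measurable_edge_itv (len c.1))).
    by apply: eq_Rint => x _; rewrite mul0r expr2 mul0r.
  by move/eqP; rewrite subr_eq0 => /eqP.
have E0 : 0 < energy_sq 0 d0.
  rewrite lt_neqAle energy_sq_ge0 andbT eq_sym; apply/eqP => h; apply: unz.
  have rd' : represents k u d0 by case: rd0 => r1 r2; split => // j jk; apply: r2; lia.
  by rewrite (normsq_represents hd0' rd') h.
(* A vanishing power integral would make the modulus 0 almost everywhere, against the nonzero
   mass. *)
have P0 : 0 < power_integral q d0.
  rewrite lt_neqAle power_integral_ge0 andbT eq_sym; apply/eqP => h.
  have hp e : \int[leb]_(x in edge_itv (len e)) (modulus d0 e x `^ q) = 0.
    apply/eqP; move/eqP: h; rewrite /power_integral psumr_eq0.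
      by move=> /allP/(_ e (mem_index_enum e)).
    by move=> i _; apply: Rintegral_ge0 => x _; exact: powR_ge0.
  move: E0; rewrite (energy_sq_modulus hd0') big1 ?ltxx// => e _.
  have mI : measurable (edge_itv (len e)) by exact: measurable_edge_itv.
  have PI := power_Rintegrable k_gt0 q_gt2 e hd0'.
  have Lm := modulus_L2 e hd0'.
  rewrite -(nsq_zero mI); apply: (ae_Rint mI).
  - exact: (Rintegrable_measurable (L2_sqr mI Lm)).
  - exact: measurable_cst.
  have mP : measurable_fun (edge_itv (len e)) (EFin \o (fun x => modulus d0 e x `^ q)).
    exact: (measurable_int _ PI).
  have /(ae_eq_integral_abs leb mI mP).1 :
      (\int[leb]_(x in edge_itv (len e)) `|(powR (modulus d0 e x) q)%:E| = 0)%E.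
    transitivity (\int[leb]_(x in edge_itv (len e)) (modulus d0 e x `^ q))%:E; last by rewrite hp.
    rewrite -(integral_Rintegrable mI PI); apply: eq_integral => x _ /=.
    by rewrite ger0_norm// powR_ge0.
  apply: aeS => x h' Ix; have [] := h' Ix.
  by move/powR_eq0_eq0 => ->.
move=> t e t0 [he1 _].
pose s := Num.sqrt (t / energy_sq 0 d0).
have s0 : 0 < s by rewrite sqrtr_gt0 divr_gt0.
have s2 : s ^+ 2 = t / energy_sq 0 d0 by rewrite sqr_sqrtr// ltW// divr_gt0.
have mq : 0 < mu / q by rewrite divr_gt0//; apply: lt_trans q_gt2.
have := he1 (jscale s d0) (jscale_space s hd0').
rewrite (energy_sq_jscale s hd0' (leq0n k)) s2 divfK ?gt_eqF// => /(_ erefl).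
rewrite (jet_energy_jscale k_gt0 q_gt2 mu VE s hd0') -formE form0 s2 (gtr0_norm s0).
have -> : t / energy_sq 0 d0 * (lam * energy_sq 0 d0) = t * lam by field; rewrite gt_eqF.
have gap : 0 < mu / q * (s `^ q * power_integral q d0).
  by apply: mulr_gt0 => //; apply: mulr_gt0 => //; exact: powR_gt0.
move: (mu / q * (s `^ q * _)) gap => gap gap0 he.
have eta0 : 0 < 2^-1 * (t * lam) - e by lra.
pose eta := (2^-1 * (t * lam) - e) / 2.
have eta0' : 0 < eta by rewrite divr_gt0.
exists (eta / (mu / q)), eta; split; [by rewrite divr_gt0|by []|].
move=> d hd dt dJ; rewrite ler_pdivrMr//.
have low := hz.1 d hd; rewrite dt in low.
have ltz : t * lam <= z * t by rewrite mulrC ler_pM2r.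
have := le_trans ltz low; rewrite formE => low'.
move: dJ; rewrite /jet_energy; move: low'.
move: (energy_sq k d + pot V d d) (power_integral q d) => a P low' dJ.
have etaE : eta * 2 = 2^-1 * (t * lam) - e by rewrite /eta divfK.
exact: (gap_power dJ low' etaE).
Qed.

End Ground_state.

(** * Minimizers *)

Section Minimizer.
Context {R : realType} (G : metric_graph R).
Local Notation leb := (@lebesgue_measure R).
Local Notation I c := (edge_itv (len c.1)).
Implicit Types (d u v w : jet G).
Variable k : nat.
Hypothesis k_gt0 : (0 < k)%N.
Variable q : R.
Hypotheses (q_gt2 : 2 < q) (q_lt : q < 4 * k%:R + 2).
Variable mu : R.
Hypothesis mu_gt0 : 0 < mu.
Variables (V V2 Vinf : edge G -> R -> R) (M : R).
Hypothesis VE : bounded_split V V2 Vinf M.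
Variable e0 : edge G.
Hypothesis ray0 : len e0 = +oo%E.

Local Notation J := (jet_energy k V mu q).

Let muq_gt0 : 0 < mu / q.
Proof. by rewrite divr_gt0//; apply: lt_trans q_gt2. Qed.

Lemma perturbation_sum (F : realFieldType) (kv ku pv pu m Pv Pu e : F) :
  pu - pv >= - e -> m * (Pu - Pv) <= e / 2 ->
  2^-1 * (kv + pv) - m * Pv <= 2^-1 * (ku + pu) - m * Pu + 2^-1 * (kv - ku) + e.
Proof. lra. Qed.

(** The kinetic terms are kept explicit: they are not continuous for L^2-small changes, and each use
    controls their difference from one side by other means. *)
Lemma jet_energy_perturbation T eps : 0 <= T -> 0 < eps -> exists2 delta, 0 < delta & forall u v,
  jet_space k u -> jet_space k v -> energy_sq 0 u <= T -> energy_sq k u <= T ->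
  energy_sq 0 v <= T -> energy_sq k v <= T -> energy_sq 0 (jcomb 1 u (-1) v) <= delta ->
  J v <= J u + 2^-1 * (energy_sq k v - energy_sq k u) + eps.
Proof.
move=> T0 eps0; have [d1 d10 h1] := pot_continuous k_gt0 VE T0 eps0.
have eps1 : 0 < eps / 2 / (mu / q) by apply: divr_gt0 => //; exact: divr_gt0.
have [d2 d20 h2] := power_continuous G k_gt0 q_gt2 T0 eps1.
exists (Num.min d1 d2); first by rewrite lt_min d10.
move=> u v hu hv u0 uk v0 vk; rewrite le_min => /andP[w1 w2].
have := h1 u v hu hv u0 uk v0 vk w1; rewrite ler_norml => /andP[p1 _].
have p2 : mu / q * (power_integral q u - power_integral q v) <= eps / 2.
  rewrite mulrC -ler_pdivlMr//; exact: (le_trans (ler_norm _) (h2 u v hu hv u0 uk v0 vk w2)).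
rewrite /jet_energy; exact: (perturbation_sum _ _ p1 p2).
Qed.

(** The sup bound, with arbitrarily little weight on the top energy, settles order 0, and uniqueness
    of densities the higher orders. The convergence to [d] then makes all derivatives below order
    [k] small near the core, as [cutoff] demands. *)
Lemma jet_zero d : jet_space k d -> energy_sq 0 d = 0 ->
  forall c j x, (j < k)%N -> I c x -> d c j x = 0.
Proof.
move=> hd d0 c; have hc : chain (len c.1) k (d c) := hd.1 c.
have l0 := len_gt0 c.1.
elim=> [|j IH] x jk Ix.
  have : d c 0%N x ^+ 2 <= 0.
    apply/ler_addgt0Pl => e e_gt0; rewrite addr0.
    have Ek := energy_sq_ge0 k d.
    have e1 : 0 < e / (energy_sq k d + 1) by rewrite divr_gt0//; lra.
    have [C _ hC] := jet_sup_small G k_gt0 e1.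
    apply: (le_trans (hC d hd c x Ix)); rewrite d0 mulr0 addr0 mulrAC ler_pdivrMr; last lra.
    by rewrite ler_pM2l//; lra.
  by rewrite le_eqVlt ltNge sqr_ge0 orbF sqrf_eq0 => /eqP.
have IH' y : I c y -> d c j y = 0 by apply: IH; exact: ltnW.
have Lj1 : locally_L2 (len c.1) (d c j.+1) := chain_locally_L2 hc (ltnW jk).
have L0 : locally_L2 (len c.1) (fun=> 0) by move=> a b _ _; apply: (L2_0 _).
have P1 := chain_primitive hc (ltnW jk).
have P0 : primitive_on (len c.1) (d c j) (fun=> 0).
  by move=> y z Iy Iz yz; rewrite !IH'// Rint_cst// mul0r subrr.
have ae := primitive_on_unique l0 Lj1 L0 P1 P0.
have C1 := chain_continuous l0 hc jk.
have C0 : {within I c, continuous (fun=> 0 : R)} by apply: continuous_subspaceT => y; exact: cvg_cst.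
exact: (continuous_ae_eq l0 C1 C0 ae Ix).
Qed.

Variable e : R.
Hypothesis ground1 : is_ground k q mu V 1 e.
Variables (U : set_system nat) (UU : UltraFilter U).
Variables (dn : nat -> jet G) (d : jet G) (T : R).
Hypotheses (dn_space : forall n, jet_space k (dn n)) (d_space : jet_space k d)
  (dn1 : forall n, energy_sq 0 (dn n) = 1)
  (dn0 : forall n, energy_sq 0 (dn n) <= T) (dnk : forall n, energy_sq k (dn n) <= T)
  (dnJ : forall eps, 0 < eps -> \forall n \near U, J (dn n) <= e + eps)
  (dn_cvg : forall X eps, 0 < eps -> \forall n \near U, forall c j x, (j < k)%N -> I c x -> x <= X ->
     `|dn n c j x - d c j x| <= eps)
  (dn_weak : forall eps, 0 < eps -> \forall n \near U,
    energy_sq k d - eps <= bil (level k (dn n)) (level k d)).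

Let dn_cvg0 X eps : 0 < eps -> \forall n \near U, forall c x, I c x -> x <= X ->
  `|dn n c 0%N x - d c 0%N x| <= eps.
Proof. by move=> eps0; apply: filterS (dn_cvg X eps0) => n h c x; exact: h. Qed.

Let wn n : jet G := jcomb 1 (dn n) (-1) d.

Let T_ge0 : 0 <= T.
Proof. exact: le_trans (energy_sq_ge0 0 (dn 0)) (dn0 0). Qed.

Let remainder eps : 0 < eps -> \forall n \near U, `|1 - energy_sq 0 d - energy_sq 0 (wn n)| <= eps.
Proof.
move=> eps0; have := splitting0 UU dn_space d_space dn0 dnk dn_cvg0 eps0.
by apply: filterS => n; rewrite dn1.
Qed.

Lemma limit_mass_le1 : energy_sq 0 d <= 1.
Proof.
apply/ler_addgt0Pr => eps eps0.
have [n] := filter_ex (remainder eps0); rewrite ler_norml => /andP[h _].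
by have := energy_sq_ge0 0 (wn n); lra.
Qed.

Lemma splitting_sum (F : realFieldType) (kd kw kn pd pw pn m Pd Pw Pn eps : F) :
  kd + kw - eps / 2 <= kn -> - (eps / 2) <= pn - pd - pw -> m * (Pn - Pd - Pw) <= eps / 2 -> 0 < eps ->
  2^-1 * (kd + pd) - m * Pd + (2^-1 * (kw + pw) - m * Pw) <= 2^-1 * (kn + pn) - m * Pn + eps.
Proof. lra. Qed.

Lemma energy_splitting eps : 0 < eps -> \forall n \near U, J d + J (wn n) <= J (dn n) + eps.
Proof.
move=> eps0; have e2 : 0 < eps / 2 by rewrite divr_gt0.
have h1 := splitting_k UU dn_space d_space dn_weak e2.
have h2 := splitting_pot k_gt0 UU dn_space d_space dn0 dnk dn_cvg0 VE e2.
have e3 : 0 < eps / 2 / (mu / q) by exact: divr_gt0.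
have h3 := splitting_power k_gt0 UU dn_space d_space dn0 dnk dn_cvg0 q_gt2 e3.
apply: filterS3 h1 h2 h3 => n s1; rewrite ler_norml => /andP[s2 _] s3.
have {}s3 : mu / q * (power_integral q (dn n) - power_integral q d - power_integral q (wn n)) <= eps / 2.
  by rewrite mulrC -ler_pdivlMr//; exact: (le_trans (ler_norm _) s3).
rewrite /jet_energy; exact: (splitting_sum s1 s2 s3 eps0).
Qed.

Lemma compact_sum (F : realFieldType) (Jd Jn kd kw kn eps e1 : F) :
  Jd <= Jn + 2^-1 * (kd - kn) + eps / 4 -> kd + kw - eps / 4 <= kn -> 0 <= kw ->
  Jn <= e1 + eps / 4 -> 0 < eps -> Jd <= e1 + eps.
Proof. lra. Qed.

(** The kinetic energies of the sequence may fail to converge to that of [d], but [splitting_k]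
    shows that the latter does not exceed them in the limit. *)
Lemma compact_minimizer : energy_sq 0 d = 1 -> J d = e.
Proof.
move=> d1; apply/le_anti/andP; split; last exact: ground1.1.
apply/ler_addgt0Pr => eps eps0; have e4 : 0 < eps / 4 by rewrite divr_gt0.
pose T' := T + energy_sq 0 d + energy_sq k d.
have E0 := energy_sq_ge0 0 d; have Ek := energy_sq_ge0 k d.
have T'0 : 0 <= T' by rewrite /T' !addr_ge0.
have TT : T <= T' by rewrite /T' -addrA lerDl addr_ge0.
have b0 : energy_sq 0 d <= T' by rewrite /T' addrAC lerDr addr_ge0.
have bk : energy_sq k d <= T' by rewrite /T' lerDr addr_ge0.
have [delta de0 h] := jet_energy_perturbation T'0 e4.
have [n [[r1 s1] J1]] := filter_ex (filterI (filterI (remainder de0)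
  (splitting_k UU dn_space d_space dn_weak e4)) (dnJ e4)).
have w0 : energy_sq 0 (jcomb 1 (dn n) (-1) d) <= delta.
  by move: r1; rewrite d1 subrr sub0r normrN; exact: le_trans (ler_norm _).
have h1 := h (dn n) d (dn_space n) d_space (le_trans (dn0 n) TT) (le_trans (dnk n) TT) b0 bk w0.
exact: (compact_sum h1 s1 (energy_sq_ge0 k (wn n)) J1 eps0).
Qed.

Lemma dichotomy_sum (F : realFieldType) (Jd Jw Js Jn em e2 e1 g : F) :
  em <= Jd -> e2 <= Js -> Js <= Jw + g / 4 -> Jd + Jw <= Jn + g / 4 -> Jn <= e1 + g / 4 ->
  g = em + e2 - e1 -> g <= 0.
Proof. lra. Qed.

(** The strict inequality leaves a gap [g] that absorbs three errors of g / 4: the remainder has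
    mass only close to 1 - m and is rescaled, the energy splits approximately, and dn(n) only nearly
    minimizes. *)
Lemma no_dichotomy : concentrated k q mu V -> energy_sq 0 d = 0 \/ energy_sq 0 d = 1.
Proof.
move=> conc; have E0 := energy_sq_ge0 0 d; have Ek := energy_sq_ge0 k d.
have := limit_mass_le1; rewrite le_eqVlt => /orP[/eqP ->|m1]; first by right.
have := E0; rewrite le_eqVlt => /orP[/eqP <-|m0]; first by left.
exfalso; set m := energy_sq 0 d in m0 m1 E0.
have m2 : 0 < 1 - m by rewrite subr_gt0.
have [em _ gm] := ground_exists k_gt0 q_gt2 q_lt mu_gt0 VE ray0 m0.
have [e2 _ g2] := ground_exists k_gt0 q_gt2 q_lt mu_gt0 VE ray0 m2.
have sub : e < em + e2.
  apply: (strictly_subadditive k_gt0 q_gt2 mu_gt0 VE conc m0 m2 gm g2).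
  by rewrite addrC subrK.
pose g := em + e2 - e.
have g0 : 0 < g by rewrite subr_gt0.
have g4 : 0 < g / 4 by rewrite divr_gt0.
pose T' := 2 * T + 2 * m + 2 * energy_sq k d.
have T'0 : 0 <= T' by rewrite /T' !addr_ge0 ?mulr_ge0.
have [delta de0 h] := jet_energy_near k_gt0 VE q_gt2 mu_gt0 m2 T'0 g4.
have [n [[r1 s1] J1]] := filter_ex (filterI (filterI (remainder de0) (energy_splitting g4)) (dnJ g4)).
have hw : jet_space k (wn n) := jet_space_comb 1 (-1) (dn_space n) d_space.
have w0 : energy_sq 0 (wn n) <= T'.
  apply: (le_trans (energy_sq_diff_le dn_space d_space n (leq0n k))); rewrite -/m.
  rewrite /T' -addrA; apply: lerD; first by rewrite ler_pM2l.
  by rewrite lerDl mulr_ge0.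
have wk : energy_sq k (wn n) <= T'.
  apply: (le_trans (energy_sq_diff_le dn_space d_space n (leqnn k))).
  rewrite /T'; apply: lerD => //; rewrite -[leLHS]addr0; apply: lerD; first by rewrite ler_pM2l.
  by rewrite mulr_ge0.
have [s [es Js]] := h (wn n) hw w0 wk ltac:(by rewrite distrC).
have em_le := gm.1 d d_space erefl.
have e2_le := g2.1 (jscale s (wn n)) (jscale_space s hw) es.
have := dichotomy_sum em_le e2_le Js s1 J1 (erefl _).
by rewrite leNgt -/g g0.
Qed.

Lemma vanishing_sum (F : realFieldType) (Js Jv Jn kv kn eps e1 : F) :
  Js <= Jv + eps / 4 -> Jv <= Jn + 2^-1 * (kv - kn) + eps / 4 -> kv <= kn + eps / 4 ->
  Jn <= e1 + eps / 4 -> 0 < eps -> Js <= e1 + eps.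
Proof. lra. Qed.

Lemma near_one (F : realFieldType) (b w delta : F) : `|b| <= delta / 3 -> 0 <= w ->
  w <= (delta / 3) ^+ 2 -> 0 < delta -> delta <= 1 -> `|1 - 2 * b + w - 1| <= delta.
Proof.
rewrite !ler_norml => /andP[b1 b2] w0 w1 d0 d1; apply/andP; split; first by lra.
have : (delta / 3) ^+ 2 <= delta / 3 by rewrite expr2; nra.
lra.
Qed.

(** With w = u - v the mass of [v] is 1 - 2 b + |w|^2, where b is the scalar product of u and w; |b|
    <= delta / 3 by Cauchy-Schwarz. *)
Lemma energy_sq_near u v delta : jet_space k u -> jet_space k v -> energy_sq 0 u = 1 ->
  0 < delta -> energy_sq 0 (jcomb 1 u (-1) v) <= Num.min 1 ((delta / 3) ^+ 2) ->
  delta <= 1 -> `|energy_sq 0 v - 1| <= delta.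
Proof.
move=> hu hv u1 de0 hw de1; have L1 := jet_L2 hu (leq0n k); have L2 := jet_L2 hv (leq0n k).
pose w := jcomb 1 u (-1) v.
have hW : jet_space k w := jet_space_comb 1 (-1) hu hv.
have Lw := jet_L2 hW (leq0n k).
have vE : level 0 v = comb 1 (level 0 u) (-1) (level 0 w).
  by apply/funext => c; apply/funext => x; rewrite /level /comb /w /jcomb; ring.
have := bil_cauchy_schwarz L1 Lw; rewrite -/(energy_sq 0 u) u1 mul1r => cs.
have E : energy_sq 0 v = 1 - 2 * bil (level 0 u) (level 0 w) + energy_sq 0 w.
  by rewrite /energy_sq vE (bil_comb _ _ L1 Lw) -/(energy_sq 0 u) u1; ring.
have W0 := energy_sq_ge0 0 w.
move: hw; rewrite -/w le_min => /andP[w1 w2].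
have cs' : `|bil (level 0 u) (level 0 w)| <= delta / 3.
  have d3 : 0 <= delta / 3 by rewrite divr_ge0// ltW.
  rewrite -(@ler_pXn2r _ 2)// ?nnegrE// real_normK ?num_real//.
  exact: le_trans w2.
by rewrite E; exact: near_one cs' W0 w2 de0 de1.
Qed.

Lemma vanishing : energy_sq 0 d = 0 -> (energy_at_infinity k V mu q <= e%:E)%E.
Proof.
move=> dz; have zero := jet_zero d_space dz.
apply: (energy_at_infinity_le) => N; apply/lee_addgt0Pr => eps eps0.
have e4 : 0 < eps / 4 by rewrite divr_gt0.
pose T' := 2 * T + 2 + eps.
have T'0 : 0 <= T' by rewrite !addr_ge0 ?mulr_ge0 ?(ltW eps0).
have [d1 d10 h1] := jet_energy_perturbation T'0 e4.
have [d2 d20 h2] := jet_energy_near k_gt0 VE q_gt2 mu_gt0 ltr01 T'0 e4.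
pose d3 := Num.min 1 d2.
have d30 : 0 < d3 by rewrite lt_min ltr01.
have d31 : d3 <= 1 by rewrite ge_min lexx.
have d32 : d3 <= d2 by rewrite ge_min lexx orbT.
(* Serves three ends: the kinetic cost of the cut, the perturbation of the energy, and a mass within
   [d3] of 1. *)
pose eta := Num.min (eps / 4) (Num.min d1 (Num.min 1 ((d3 / 3) ^+ 2))).
have eta0 : 0 < eta by rewrite !lt_min e4 d10 ltr01 exprn_gt0// divr_gt0.
have [eta1 [eta2 eta3]] : eta <= eps / 4 /\ eta <= d1 /\ eta <= Num.min 1 ((d3 / 3) ^+ 2).
  by have := lexx eta; rewrite {2}/eta le_min => /andP[z1]; rewrite le_min => /andP[z2 z3].
have N0 : 0 <= N.+1%:R :> R by [].
(* The cut is made at N + 1, the position that [energy_outside_le] requires for index [N]. *)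
have [X [delta [de0 hcut]]] := cutoff G k_gt0 N0 eta0.
have [n [c1 J1]] := filter_ex (filterI (dn_cvg X de0) (dnJ e4)).
have small c j x : (j < k)%N -> I c x -> x <= X -> `|dn n c j x| <= delta.
  by move=> jk Ix xX; have := c1 c j x jk Ix xX; rewrite zero// subr0.
have [v [hv vs vw vk]] := hcut (dn n) (dn_space n) small.
have dT : T <= T'.
  by rewrite /T' mulr2n mulrDl mul1r -!addrA lerDl !addr_ge0// ltW.
have vkT : energy_sq k v <= T'.
  apply: (le_trans vk); have := dnk n; have := T_ge0; move: eta1 eps0; rewrite /T'.
  by move: (energy_sq k (dn n)) => a; lra.
have v1 := energy_sq_near (dn_space n) hv (dn1 n) d30 (le_trans vw eta3) d31.
have v0T : energy_sq 0 v <= T'.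
  have := le_trans (ler_norm _) v1; have := T_ge0; move: d31 eps0; rewrite /T'.
  by move: (energy_sq 0 v) => a; lra.
have b1 := h1 (dn n) v (dn_space n) hv (le_trans (dn0 n) dT) (le_trans (dnk n) dT) v0T vkT
  (le_trans vw eta2).
have [s [es Js]] := h2 v hv v0T vkT (le_trans v1 d32).
have vk' : energy_sq k v <= energy_sq k (dn n) + eps / 4 by apply: (le_trans vk); rewrite lerD2l.
apply: (@le_trans _ _ (J (jscale s v))%:E).
  apply: (energy_outside_le k_gt0 mu q VE (jscale_space s hv) es) => c x Ix sv.
  apply: (vs c 0%N) => v00; apply: sv; rewrite /jscale /jcomb v00; ring.
by rewrite -EFinD lee_fin; exact: (vanishing_sum Js b1 vk' J1 eps0).
Qed.

End Minimizer.

Lemma kinetic_bound (F : realFieldType) (a K e e1 x : F) :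
  4^-1 * a - K < e + x -> x <= 1 -> e <= e1 -> a <= 1 + 4 * (K + e1 + 1).
Proof. lra. Qed.

Theorem theorem1p4 (R : realType) (G : metric_graph R)
    (connG : connected_graph G) (noncompactG : ~ compact_graph G)
    (k : nat) (k_gt0 : (0 < k)%N)
    (q : R) (q_gt2 : 2 < q) (q_lt : q < 4 * k%:R + 2)
    (mu : R) (mu_gt0 : 0 < mu)
    (V : edge G -> R -> R)
    (hV : exists V2 Vinf, L2_plus_Linfty V V2 Vinf)
    (hyp : (exists V2 Vinf, L2_plus_Linfty V V2 Vinf /\
              forall e : edge G, len e = +oo%E ->
                Vinf e x @[x --> +oo] --> (0 : R))
           \/ has_ground_state k V) :
  (forall t1 t2 : R, 0 < t1 -> 0 < t2 ->
     (ground_energy k V mu q (t1 + t2)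
        < ground_energy k V mu q t1 + ground_energy k V mu q t2)%E) /\
  ((ground_energy k V mu q 1 < energy_at_infinity k V mu q)%E ->
   exists u : gfun G, [/\ graph_Sobolev k u, graph_normsq u = 1%E
     & (energy k V mu q u)%:E = ground_energy k V mu q 1]).
Proof.
have [V2 [Vinf0 hV2]] := hV.
have [V2' [Vinf [M [VE _]]]] := L2_plus_Linfty_bounded hV2.
have [e0 ray0] := noncompact_ray noncompactG.
have conc : concentrated k q mu V.
  case: hyp => [[W2 [Winf [WE W0]]]|gs].
    exact: (decaying_concentrated k_gt0 q_gt2 q_lt mu_gt0 WE W0 ray0).
  exact: (ground_state_concentrated k_gt0 q_gt2 q_lt mu_gt0 VE ray0 gs).
have ground t (t0 : 0 < t) := ground_exists k_gt0 q_gt2 q_lt mu_gt0 VE ray0 t0.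
split=> [t1 t2 t10 t20|].
  have [e1 -> g1] := ground t1 t10; have [e2 -> g2] := ground t2 t20.
  have [e -> g] := ground (t1 + t2) (addr_gt0 t10 t20).
  rewrite -EFinD lte_fin.
  exact: (strictly_subadditive k_gt0 q_gt2 mu_gt0 VE conc t10 t20 g1 g2 g).
have [e -> g] := ground 1 ltr01 => below.
have /choice[dn hdn] : forall n : nat, exists d : jet G, [/\ jet_space k d, energy_sq 0 d = 1 &
    jet_energy k V mu q d < e + n.+1%:R^-1].
  by move=> n; apply: g.2; rewrite invr_gt0.
have dn_space n : jet_space k (dn n) by have [] := hdn n.
have dn1 n : energy_sq 0 (dn n) = 1 by have [] := hdn n.
have [K K0 hK] := energy_coercive k_gt0 q_gt2 q_lt mu_gt0 VE ltr01.
(* Large enough for the unit mass and, by coercivity, for the kinetic energy of every dn(n), whose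
   energy is below e + 1 or at most that. *)
pose T := 1 + 4 * (K + `|e| + 1).
have T0 : 1 <= T by rewrite /T; have := normr_ge0 e; lra.
have dn0 n : energy_sq 0 (dn n) <= T by rewrite dn1.
have dnk n : energy_sq k (dn n) <= T.
  have h1 := hK (dn n) (dn_space n) ltac:(by rewrite dn1).
  have [_ _ h2] := hdn n; have h3 := le_lt_trans h1 h2.
  have h4 : n.+1%:R^-1 <= 1 :> R by rewrite invf_le1// ler1n.
  by apply: (kinetic_bound h3 h4); exact: ler_norm.
(* [U] refines the filter of large [n], so the energies still tend to [e] along it. *)
have [U [UU Uoo]] := ultraFilterLemma (@eventually_filter).
have dnJ eps : 0 < eps -> \forall n \near U, jet_energy k V mu q (dn n) <= e + eps.
  move=> eps0; apply: Uoo; have := near_infty_natSinv_lt (PosNum eps0).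
  apply: filterS => n /= h; have [_ _ h2] := hdn n.
  by apply: (le_trans (ltW h2)); rewrite lerD2l ltW.
have [d [d_space d_cvg d_weak]] := weak_compactness k_gt0 UU dn_space dn0 dnk.
have [d0|d1] := no_dichotomy k_gt0 q_gt2 q_lt mu_gt0 VE ray0 g UU dn_space d_space dn1 dn0 dnk
  dnJ d_cvg d_weak conc.
  have := vanishing k_gt0 q_gt2 mu_gt0 VE UU dn_space d_space dn1 dn0 dnk dnJ d_cvg d0.
  by rewrite leNgt below.
have Jd := compact_minimizer k_gt0 q_gt2 mu_gt0 VE g UU dn_space d_space dn1 dn0 dnk
  dnJ d_cvg d_weak d1.
have [uS ru] := Sobolev_of_jet k_gt0 d_space.
exists (gpack d); split => //; first by rewrite (normsq_represents d_space ru) d1.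
by rewrite (energy_represents k_gt0 q mu VE d_space ru uS) Jd.
Qed.
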